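(* Let $E_0\in BV(\Omega,\{0,1\})$ be nonempty and bounded, and let $\beta\in L^\infty(\partial\Omega)$ be such that $-1\le\beta\le1-2\kappa$ $\mathcal H^n$-a.e. on $\partial\Omega$ for some $\kappa\in(0,\frac12]$. Then the constrained minimum problem $$\inf_{E\in\mathcal E(E_0)}\mathcal C_\beta(E,\Omega)$$ has a solution. In addition, any minimizer $E^+$ satisfies $E^+\subseteq C_{R_0}^H=\hat B_{R_0}\times(0,H)$, and $E^+$ is also a solution of $$\inf_{E\in\mathcal E(E^+)}\mathcal C_\beta(E,\Omega).$$
   Context: Let $n\ge1$, $\Omega=\mathbb R^n\times(0,+\infty)\subset\mathbb R^{n+1}$, and identify $\partial\Omega$ with $\mathbb R^n$. $BV(\Omega,\{0,1\})$ is the collection of measurable $E\subseteq\Omega$ with $\chi_E\in BV(\Omega)$, $P(E,\Omega)=\int_\Omega|D\chi_E|$, $P(E)=P(E,\mathbb R^{n+1})$. Each set is identified with its set of points of Lebesgue density one. On $\partial\Omega$, $\chi_E$ denotes the trace of $E$. $\mathcal C_\beta(E,\Omega)=P(E,\Omega)-\int_{\partial\Omega}\beta\chi_E\,d\mathcal H^n$. For $G\in BV(\Omega,\{0,1\})$, $\mathcal E(G)=\{E\in BV(\Omega,\{0,1\}):G\subseteq E\}$. $\hat B_\rho\subset\mathbb R^n$ is the open ball of radius $\rho$ centered at the origin. $H=1+\max\{x_{n+1}:x\in\overline{E_0}\}$, and $D>0$ is such that $E_0\subseteq\hat B_D\times(0,H)$. Finally $$R_0=D+1+\max\Big\{8^{n^2+n+1}\Big(\frac{P(E_0)}\kappa\Big)^{\frac{n+1}n},\,4\mu(\kappa,n)\Big\},\qquad\mu(\kappa,n)=\Big(\frac1\kappa+2\Big)^{\frac{n+1}n}.$$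 *)

(* Defs.v *)
From HB Require Import structures.
From mathcomp Require Import all_boot all_order all_algebra.
From mathcomp Require Import all_classical all_reals all_analysis.

Set Implicit Arguments.
Unset Strict Implicit.
Unset Printing Implicit Defensive.
Import Order.TTheory GRing.Theory Num.Theory.
Import numFieldNormedType.Exports.

Local Open Scope classical_set_scope.
Local Open Scope ring_scope.

(* Points of R^n are row vectors ['rV[R]_n].  MathComp-Analysis gives them the
   usual topology but the sup norm (hence [enorm] below), and no sigma-algebra.
   The sigma-algebra generated by the coordinates is the Borel one. *)
Section borel_rV.
Variables (R : realType) (n : nat).

Definition rV_coord (i : 'I_n) (x : 'rV[R]_n) : measurableTypeR R := x 0 i.

HB.instance Definition _ :=
  @isMeasurable.Build
    (measure_tuple_display (R.-ocitv.-measurable).-sigma)%mdisp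
    'rV[R]_n (g_sigma_preimage rV_coord)
    (@sigma_algebra0 _ setT _) (@sigma_algebraC _ _)
    (@sigma_algebra_bigcup _ setT _).

End borel_rV.

Section coordinates.
Variables (R : realType) (n : nat).

(* The splitting R^(n+1) = R^n x R, the last coordinate being the vertical one. *)
Definition snoc (p : 'rV[R]_n * measurableTypeR R) : 'rV[R]_n.+1 :=
  \row_i (if unlift ord_max i is Some j then p.1 0 j else p.2).

Definition horizontal (x : 'rV[R]_n.+1) : 'rV[R]_n :=
  \row_j x 0 (lift ord_max j).

Definition height (x : 'rV[R]_n.+1) : R := x 0 ord_max.

Definition unsnoc (x : 'rV[R]_n.+1) : 'rV[R]_n * measurableTypeR R :=
  (horizontal x, height x).

Lemma snocK : cancel snoc unsnoc.
Proof.
move=> [y t]; rewrite /unsnoc /horizontal /height /snoc /=; congr (_, _).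
  by apply/rowP => j; rewrite !mxE liftK.
by rewrite !mxE unlift_none.
Qed.

Lemma unsnocK : cancel unsnoc snoc.
Proof.
move=> x; apply/rowP => i; rewrite !mxE /=.
by case: unliftP => [j ->|->] //; rewrite mxE.
Qed.

End coordinates.

Section measurable_rV.
Variable R : realType.

Lemma measurable_coord n (i : 'I_n) : measurable_fun setT (@rV_coord R n i).
Proof.
move=> _ Y mY; rewrite setTI; apply: sub_sigma_algebra => /=.
rewrite -bigcup_seq/=; exists i => /=; first by rewrite mem_index_enum.
by exists Y => //; rewrite setTI.
Qed.

Lemma measurable_to_rV d (T : measurableType d) n (f : T -> 'rV[R]_n) :
  (forall i, measurable_fun setT (@rV_coord R n i \o f)) ->
  measurable_fun setT f.
Proof.
move=> mf; have : g_sigma_preimage (fun i => @rV_coord R n i \o f) `<=` measurable.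
  apply: smallest_sub; first exact: sigma_algebra_measurable.
  rewrite -bigcup_seq => A [i _ [B mB <-]]; exact: mf.
rewrite g_sigma_preimage_comp => H _ A mA.
by apply: H; exists A.
Qed.

Lemma measurable_snoc n : measurable_fun setT (@snoc R n).
Proof.
apply: measurable_to_rV => i.
case: (unliftP ord_max i) => [j ->|->].
  rewrite (_ : _ \o _ = @rV_coord R n j \o fst).
    exact: measurableT_comp (@measurable_coord n j) measurable_fst.
  by apply/funext => p; rewrite /rV_coord/= /snoc mxE liftK.
rewrite (_ : _ \o _ = snd); first exact: measurable_snd.
by apply/funext => p; rewrite /rV_coord/= /snoc mxE unlift_none.
Qed.

Lemma measurable_unsnoc n : measurable_fun setT (@unsnoc R n).
Proof.
apply/measurable_fun_pairP; split.
  apply: measurable_to_rV => j.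
  rewrite (_ : _ \o _ = @rV_coord R n.+1 (lift ord_max j)); first exact: measurable_coord.
  by apply/funext => x; rewrite /rV_coord/= /horizontal mxE.
exact: (@measurable_coord n.+1 ord_max).
Qed.

End measurable_rV.

Section lebesgue_step.
Variables (R : realType) (n : nat).
Variable mu : {sigma_finite_measure set 'rV[R]_n -> \bar R}.

Definition lebesgue_step : set 'rV[R]_n.+1 -> \bar R :=
  pushforward (mu \x (@lebesgue_measure R))%E (@snoc R n).


Let step0 : lebesgue_step set0 = 0%E.
Proof. by rewrite /lebesgue_step /pushforward preimage_set0 measure0. Qed.

Let step_ge0 A : (0 <= lebesgue_step A)%E.
Proof. by rewrite /lebesgue_step /pushforward; apply: integral_ge0. Qed.

Let step_sigma_additive : semi_sigma_additive lebesgue_step.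
Proof.
move=> F mF tF mUF; rewrite /lebesgue_step /pushforward preimage_bigcup.
have mpre A : measurable A -> measurable (@snoc R n @^-1` A).
  by move=> mA; rewrite -[X in measurable X]setTI; exact: measurable_snoc.
apply: measure_semi_sigma_additive.
- by move=> k; exact: mpre.
- apply/trivIsetP => /= i j _ _ ij; rewrite -preimage_setI.
  by move/trivIsetP : tF => /(_ _ _ _ _ ij) ->//; rewrite preimage_set0.
- by rewrite -preimage_bigcup; exact: mpre.
Qed.

HB.instance Definition _ := isMeasure.Build _ _ _ lebesgue_step
  step0 step_ge0 step_sigma_additive.

Let step_sigma_finite : sigma_finite setT lebesgue_step.
Proof.
have /sigma_finiteP[F [TF ndF Foo]] := sigma_finiteT mu.
have /sigma_finiteP[G [TG ndG Goo]] := sigma_finiteT (@lebesgue_measure R).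
exists (fun k => @unsnoc R n @^-1` (F k `*` G k)).
  apply/seteqP; split=> // x _.
  have [k _ Fk] : (\bigcup_k F k) (horizontal x) by rewrite -TF.
  have [l _ Gl] : (\bigcup_k G k) (height x) by rewrite -TG.
  exists (maxn k l) => //; split => /=.
    by move: Fk; exact/subsetPset/ndF/leq_maxl.
  by move: Gl; exact/subsetPset/ndG/leq_maxr.
move=> k; have [mF Fk] := Foo k; have [mG Gk] := Goo k; split.
  rewrite -[X in measurable X]setTI; apply: measurable_unsnoc => //.
  exact: measurableX.
rewrite /lebesgue_step /pushforward -comp_preimage.
rewrite (_ : _ \o _ = id) ?preimage_id; last by apply/funext => p; exact: snocK.
by rewrite product_measure1E// lte_mul_pinfty// ge0_fin_numE.
Qed.

HB.instance Definition _ := Measure_isSigmaFinite.Build _ _ _ lebesgue_step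
  step_sigma_finite.

End lebesgue_step.

(* Lebesgue measure on R^n: point mass on R^0, and
   L^(n+1) = L^n x L^1 along the splitting [snoc]. *)
Fixpoint lebesgue (R : realType) (n : nat) :
    {sigma_finite_measure set 'rV[R]_n -> \bar R} :=
  match n with
  | 0 => \d_(0 : 'rV[R]_0)
  | n'.+1 => lebesgue_step (lebesgue R n')
  end.

Lemma lebesgue_box (R : realType) n (A : 'I_n -> set (measurableTypeR R)) :
  (forall i, measurable (A i)) ->
  measurable [set x : 'rV[R]_n | forall i, A i (x 0%R i)] /\
  (lebesgue R n [set x : 'rV[R]_n | forall i, A i (x 0%R i)] =
  \prod_(i < n) lebesgue_measure (A i))%E.
Proof.
elim: n A => [|n IH] A mA.
  rewrite big_ord0 (_ : [set _ | _] = setT); last first.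
    by apply/seteqP; split=> // x _ [].
  split => //; exact: diracT.
have [mB HB] := IH (fun i => A (lift ord_max i)) (fun i => mA _).
set B := [set x | _] in mB HB.
have E : [set x : 'rV[R]_n.+1 | forall i, A i (x 0%R i)] = @unsnoc R n @^-1` (B `*` A ord_max).
  apply/seteqP; split => x.
    by move=> H; split=> //= i; rewrite mxE; exact: H.
  case=> /= H1 H2 i; case: (unliftP ord_max i) => [j ->|->] //.
  by have := H1 j; rewrite mxE.
rewrite E; split.
  by rewrite -[X in measurable X]setTI; apply: measurable_unsnoc => //; exact: measurableX.
rewrite /= /lebesgue_step /pushforward -comp_preimage.
rewrite (_ : _ \o _ = id) ?preimage_id; last by apply/funext => p; exact: snocK.
rewrite product_measure1E// [X in (X * _)%E]HB big_ord_recr /=; congr (_ * _)%E.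
apply: eq_bigr => i _; congr (lebesgue_measure (A _)); apply: val_inj => /=.
by rewrite /bump leqNgt ltn_ord.
Qed.

Section finite_perimeter.
Variables (R : realType) (m : nat).
Implicit Types (E Om : set 'rV[R]_m) (x : 'rV[R]_m) (f : 'rV[R]_m -> R)
  (phi : 'rV[R]_m -> 'rV[R]_m).

Definition enorm x : R := Num.sqrt (\sum_i x 0 i ^+ 2).

Definition eball x (r : R) : set 'rV[R]_m := [set y | enorm (y - x) < r].

(* [C_c^1(Om; R^m)], fields being extended by zero outside [Om]. *)
Definition C1c Om phi :=
  [/\ forall j : 'I_m, (forall x, derivable phi x (delta_mx 0 j)) /\
        continuous ('D_(delta_mx 0 j) phi),
      compact (closure [set x | phi x != 0]) &
      closure [set x | phi x != 0] `<=` Om].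

Definition divergence phi x : R := \sum_j ('D_(delta_mx 0 j) phi x) 0 j.

(* The total variation [\int_Om |Df|], for [Om] open. *)
Definition tvar Om f : \bar R :=
  ereal_sup [set (\int[lebesgue R m]_(x in Om) (f x * divergence phi x)%:E)%E
            | phi in [set phi | C1c Om phi /\ forall x, enorm (phi x) <= 1]].

Definition BV Om f :=
  (lebesgue R m).-integrable Om (EFin \o f) /\ (tvar Om f < +oo)%E.

Definition perimeter E Om : \bar R := tvar Om (\1_E).

Definition density_one E : set 'rV[R]_m :=
  [set x | fine (lebesgue R m (E `&` eball x r)) /
           fine (lebesgue R m (eball x r)) @[r --> 0^'+] --> (1 : R)].

(* [BV(Om,{0,1})].  Sets being identified with their sets of points of density
   one, each class is represented by its unique member with [density_one E = E];
   inclusions between elements of [BV01 Om] are then plain inclusions. *)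
Definition BV01 Om : set (set 'rV[R]_m) :=
  [set E | [/\ measurable E, E `<=` Om, BV Om (\1_E) & density_one E = E]].

End finite_perimeter.

Section capillarity.
Variables (R : realType) (n : nat).
Implicit Types (E G : set 'rV[R]_n.+1) (beta : 'rV[R]_n -> R).

Definition halfspace : set 'rV[R]_n.+1 := [set x | 0 < height x].

Definition boundary_point (y : 'rV[R]_n) : 'rV[R]_n.+1 := snoc (y, 0).

(* The boundary trace of a BV function on [halfspace], as a function on
   R^n = R^n x {0}: the value [t], unique if it exists, such that
   [r^-(n+1) \int_(B_r(y,0) /\ halfspace) |f - t| --> 0] as [r --> 0+].  For BV
   functions it exists for almost every [y]; elsewhere it is set to 0. *)
Definition trace (f : 'rV[R]_n.+1 -> R) (y : 'rV[R]_n) : R :=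
  xget 0 [set t : R |
    ((r ^- n.+1)%:E * \int[lebesgue R n.+1]_(x in halfspace `&`
        eball (boundary_point y) r) `|f x - t|%:E)%E @[r --> 0^'+] --> 0%E].

(* On the hyperplane [R^n x {0}], H^n is Lebesgue measure. *)
Definition capillary beta E : \bar R :=
  (perimeter E halfspace - \int[lebesgue R n]_y (beta y * trace (\1_E) y)%:E)%E.

Definition supersets G : set (set 'rV[R]_n.+1) :=
  [set E | BV01 halfspace E /\ G `<=` E].

Definition minimizer beta G E :=
  supersets G E /\
  forall F, supersets G F -> (capillary beta E <= capillary beta F)%E.

Definition cylinder (rho h : R) : set 'rV[R]_n.+1 :=
  [set x | eball 0 rho (horizontal x) /\ 0 < height x < h].

(* A maximum when [E] is bounded and nonempty. *)
Definition top_height E : R := 1 + sup (@height R n @` closure E).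

Definition mu_const (kappa : R) : R :=
  (kappa^-1 + 2) `^ (n.+1%:R / n%:R).

(* [perimeter E0 setT] is finite for bounded [E0] in [BV01 halfspace]. *)
Definition R0 (kappa D : R) E0 : R :=
  D + 1 + Num.max
    (8 ^+ (n ^ 2 + n + 1) *
       (fine (perimeter E0 setT) / kappa) `^ (n.+1%:R / n%:R))
    (4 * mu_const kappa).

End capillarity.
Arguments halfspace {R n}.

(* Main.v *)
Require Import Defs.
From HB Require Import structures.
From mathcomp Require Import all_boot all_order all_algebra.
From mathcomp Require Import all_classical all_reals all_analysis.
From mathcomp Require Import measurable_realfun ring lra.

Set Implicit Arguments.
Unset Strict Implicit.
Unset Printing Implicit Defensive.
Import Order.TTheory GRing.Theory Num.Theory.
Import numFieldNormedType.Exports.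

Local Open Scope classical_set_scope.
Local Open Scope ring_scope.

(* The capillary energy of E is the supremum of \int_E div phi over C^1 fields
   phi with |phi| <= 1 that are close to beta in the vertical direction on the
   boundary trace of E.  This dual description gives lower semicontinuity.  It
   also gives comparison results: if phi is obtained by interpolating, across a
   thin slab {s - d < x.nu < s}, between a nearly optimal field for the part of E
   below the slab and another field T, then the Gauss-Green formula for E bounds
   the energy of the truncated set.  With T = nu a constant unit vector with
   nu.e_v >= 1 - 2 kappa >= beta, truncation does not increase the energy, so
   that minimizing sequences can be taken in a fixed box, and they are compact.
   When E has mass at most q d in the slab, the energies of the two parts of E
   add up to at most the energy of E plus 4 q; for a minimizer the outer part
   then has perimeter at most 4 q / kappa, and the isoperimetric inequality turns
   this into a differential inequality for the mass beyond a hyperplane, which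
   therefore vanishes at distance R0.  Finally T = e_v below height h, tilted above
   it so that div T > 0 on E, shows that a minimizer has no mass above height h. *)

(** * Differentiable functions of several variables *)

(** The interior of a set and its trace are linked by a one-sided Gauss-Green bound alone. This
    suffices because every comparison bounds an energy from above by a nearly optimal field and then
    tests another set with that field. The obstacle is that [beta] is merely bounded and measurable:
    a C^1 field can match it only in L^1 on a boundary set [B] of finite measure, so each comparison
    first chooses [B] to contain the traces of all sets involved. Traces are reached through
    vertical slices, where finite perimeter limits how often a column can oscillate. The factor 4 in
    4 q is 2 for the difference of two unit fields times 2 for the largest slope of the
    interpolating spline. The gap 2 [kappa] below 1 gives coercivity: the energy is at least [kappa]
    times the perimeter in the whole space. This bounds minimizing sequences and drives the decay of
    the tails. Measured by the side of the cube of equal volume, the mass beyond a hyperplane decays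
    linearly, so the distance needed is the initial side divided by [decay_rate]; that [R0] allows
    for it is pure arithmetic. *)

Section C1_functions.
Variables (R : realType) (m : nat).
Implicit Types (f g : 'rV[R]_m -> R) (x y z v : 'rV[R]_m).

Notation e_ j := (delta_mx 0 j : 'rV[R]_m).

(** The partial derivatives are part of the data: sums, products and compositions then come with
    explicit derivatives, from which the divergences of pasted fields are read off by algebra. *)
Definition C1 f (df : 'I_m -> 'rV[R]_m -> R) :=
  [/\ continuous f, forall j x, is_derive x (e_ j) f (df j x) &
      forall j, continuous (df j)].

Lemma is_derive_line f x v t (a : R) : is_derive (x + t *: v) v f a ->
  is_derive t 1 (fun s : R => f (x + s *: v)) a.
Proof.
have E : (fun h : R => h^-1 *: ((fun s : R => f (x + s *: v)) (h *: 1 + t) - f (x + t *: v))) =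
         (fun h : R => h^-1 *: (f (h *: v + (x + t *: v)) - f (x + t *: v))).
  apply/funext => h; congr (_ *: (f _ - _)).
  by rewrite scalerDl /= [h *: (1 : R)]mulr1 addrCA.
case=> d <-; split; first by rewrite /derivable E.
by rewrite /derive E.
Qed.

Lemma is_derive_line0 f x v (a : R) :
  is_derive 0 (1 : R) (fun s : R => f (x + s *: v)) a -> is_derive x v f a.
Proof.
have E : (fun h : R => h^-1 *: ((fun s : R => f (x + s *: v)) (h *: 1 + 0) - f (x + 0 *: v))) =
         (fun h : R => h^-1 *: (f (h *: v + x) - f x)).
  apply/funext => h; congr (_ *: (f _ - f _)).
    by rewrite /= [h *: (1 : R)]mulr1 addr0 addrC.
  by rewrite scale0r addr0.
case=> d <-; split; first by move: d; rewrite /derivable E.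
by rewrite /derive E.
Qed.

Lemma is_derive_outer (h : R -> R) f x v (a b : R) :
  is_derive x v f a -> is_derive (f x) (1 : R) h b ->
  is_derive x v (h \o f) (b * a).
Proof.
move=> df dh; apply: is_derive_line0.
have df0 : is_derive 0 (1 : R) (fun s : R => f (x + s *: v)) a.
  by apply: is_derive_line; rewrite scale0r addr0.
have dh0 : is_derive ((fun s : R => f (x + s *: v)) 0) (1 : R) h b.
  by rewrite /= scale0r addr0.
by have := @is_derive1_comp R h (fun s : R => f (x + s *: v)) 0 b a dh0 df0.
Qed.

(* Move one coordinate at a time and apply the mean value theorem. *)
Lemma partials_lipschitz f (df : 'I_m -> 'rV[R]_m -> R) x y (M : R) :
  (forall j z, is_derive z (e_ j) f (df j z)) ->
  (forall z, (forall i, `|z 0 i - x 0 i| <= `|y 0 i - x 0 i|) ->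
     forall j, `|df j z| <= M) ->
  `|f y - f x| <= M * \sum_i `|y 0 i - x 0 i|.
Proof.
move=> dfP dfM.
pose z (k : nat) : 'rV[R]_m := \row_i (if (i < k)%N then y 0 i else x 0 i).
have z0 : z 0%N = x by apply/rowP => i; rewrite mxE.
have zm : z m = y by apply/rowP => i; rewrite mxE ltn_ord.
have -> : f y - f x = \sum_(k < m) (f (z k.+1) - f (z k)).
  by rewrite -(big_mkord xpredT (fun k => f (z k.+1) - f (z k)))
     telescope_sumr// z0 zm.
rewrite mulr_sumr (le_trans (ler_norm_sum _ _ _))// ler_sum// => k _.
pose h := y 0 k - x 0 k.
pose g (t : R) := f (z k + t *: (e_ k)).
have zS : z k + h *: e_ k = z k.+1.
  apply/rowP => i; rewrite !mxE eqxx/= ltnS.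
  have [->|ik] := eqVneq i k; first by rewrite leqnn ltnn mulr1 /h addrC subrK.
  by rewrite mulr0 addr0 [in RHS]leq_eqVlt (negbTE (_ : val i != val k)).
have dg t : is_derive t (1 : R) g (df k (z k + t *: e_ k)).
  by apply: is_derive_line; exact: dfP.
have gc : continuous g.
  by move=> t; apply/differentiable_continuous/derivable1_diffP; case: (dg t).
have dM t : `|t| <= `|h| -> `|df k (z k + t *: e_ k)| <= M.
  move=> th; apply: dfM => i; rewrite !mxE eqxx/=.
  have [->|ik] := eqVneq i k.
    by rewrite ltnn mulr1 addrAC subrr add0r.
  by rewrite mulr0 addr0; case: ifPn => // _; rewrite subrr normr0.
have -> : f (z k.+1) - f (z k) = g h - g 0 by rewrite /g zS scale0r addr0.
have [h0|h0] := leP 0 h.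
  have [c /[!in_itv]/= /andP[c0 ch] ->] :=
    MVT_segment h0 (fun t _ => dg t) (continuous_subspaceT gc).
  rewrite subr0 normrM ler_wpM2r// dM//.
  by rewrite (ger0_norm c0) (ger0_norm h0).
have [c /[!in_itv]/= /andP[ch c0] E] :=
  MVT_segment (ltW h0) (fun t _ => dg t) (continuous_subspaceT gc).
rewrite distrC E sub0r normrM normrN ler_wpM2r// dM//.
by rewrite (ler0_norm c0) (ltr0_norm h0) lerN2.
Qed.

Lemma rV_ballP x y (r : R) : 0 < r ->
  ball x r y <-> forall i, `|x 0 i - y 0 i| < r.
Proof.
move=> r0; rewrite -ball_normE /ball_/= [`|x - y|]/Num.Def.normr/= mx_normrE; split.
  move=> xy i; apply: le_lt_trans xy.
  have := @le_bigmax _ _ _ 0 (fun ij : 'I_1 * 'I_m => `|(x - y) ij.1 ij.2|) (0, i).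
  by rewrite /= !mxE.
move=> xy; apply/bigmax_ltP; split=> //.
by move=> [i j] _; rewrite [i]ord1 /= !mxE.
Qed.

(** Continuous partials are bounded near [x], so the coordinatewise Lipschitz bound applies in a
    small box. *)
Lemma continuous_of_partials f (df : 'I_m -> 'rV[R]_m -> R) :
  (forall j z, is_derive z (e_ j) f (df j z)) ->
  (forall j, continuous (df j)) -> continuous f.
Proof.
move=> dfP dfc x; apply/(@cvgrPdist_lt _ R^o _ (nbhs x) (nbhs_filter x)) => e e0.
pose M := \sum_j (`|df j x| + 1).
have M0 : 0 <= M by rewrite sumr_ge0// => j _; rewrite addr_ge0.
have /nbhs_ballP[r /= r0 rM] : \forall z \near x, forall j, `|df j z| <= M.
  apply: (filter_forall (nbhs_filter x)) => j.
  have /(@cvgrPdist_lt _ R^o _ (nbhs x) (nbhs_filter x))/(_ 1 ltr01) := dfc j x.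
  apply: filterS => z /= H.
  have : `|df j z| <= `|df j x| + 1.
    by rewrite -lerBlDl (le_trans (lerB_dist _ _))// distrC ltW.
  move=> /le_trans; apply.
  rewrite /M (bigD1 j)//= lerDl; apply: sumr_ge0 => i _; exact: addr_ge0.
(* The added 1 keeps [C] positive when [M] or the dimension vanishes. *)
pose C := M * m%:R + 1.
have C0 : 0 < C by rewrite ltr_wpDl// mulr_ge0.
apply/nbhs_ballP; exists (Num.min r (e / C)) => /=.
  by rewrite lt_min r0 divr_gt0.
move=> y xy; rewrite distrC.
have xyi i : `|y 0 i - x 0 i| < Num.min r (e / C).
  by rewrite distrC; apply/rV_ballP: i; rewrite // lt_min r0 divr_gt0.
apply: (@le_lt_trans _ _ (M * \sum_i `|y 0 i - x 0 i|)).
  apply: (partials_lipschitz dfP) => z zx j; apply: rM; apply/rV_ballP => // i.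
  rewrite distrC (le_lt_trans (zx i))//.
  by rewrite (lt_le_trans (xyi i))// ge_min lexx.
apply: (@le_lt_trans _ _ (M * (m%:R * (e / C)))).
  rewrite ler_wpM2l// (le_trans (ler_sum _ (_ : forall i, _ -> _ <= e / C)))//.
    by move=> i _; rewrite ltW// (lt_le_trans (xyi i))// ge_min lexx orbT.
  by rewrite sumr_const card_ord -[leLHS]mulr_natl.
rewrite !mulrA ltr_pdivrMr// -!mulrA [m%:R * e]mulrC [M * _]mulrCA ltr_pM2l//.
by rewrite ltrDl.
Qed.

Lemma C1_of_partials f df : (forall j z, is_derive z (e_ j) f (df j z)) ->
  (forall j, continuous (df j)) -> C1 f df.
Proof. by move=> fP dfc; split=> //; exact: continuous_of_partials dfc. Qed.

Lemma C1_cst (a : R) : C1 (cst a) (fun _ => cst 0).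
Proof. by split=> [|j x|j]; [exact: cst_continuous|exact: is_derive_cst|exact: cst_continuous]. Qed.

Lemma C1D f df g dg : C1 f df -> C1 g dg ->
  C1 (fun x => f x + g x) (fun j x => df j x + dg j x).
Proof.
move=> [fc fd dfc] [gc gd dgc]; split.
- by move=> x; exact: (continuousD (fc x) (gc x)).
- by move=> j x; exact: is_deriveD.
- by move=> j x; exact: (continuousD (dfc j x) (dgc j x)).
Qed.

Lemma C1M f df g dg : C1 f df -> C1 g dg ->
  C1 (fun x => f x * g x) (fun j x => f x * dg j x + g x * df j x).
Proof.
move=> [fc fd dfc] [gc gd dgc]; split.
- by move=> x; exact: (continuousM (fc x) (gc x)).
- by move=> j x; exact: is_deriveM.
- move=> j x.
  exact: (continuousD (continuousM (fc x) (dgc j x)) (continuousM (gc x) (dfc j x))).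
Qed.

Lemma C1_outer (h dh : R -> R) f df : C1 f df -> continuous dh ->
  (forall t : R, is_derive t (1 : R) h (dh t)) ->
  C1 (h \o f) (fun j x => dh (f x) * df j x).
Proof.
move=> [fc fd dfc] dhc hd.
have hc : continuous h.
  by move=> t; apply/differentiable_continuous/derivable1_diffP; case: (hd t).
split.
- by move=> x; apply: continuous_comp; [exact: fc|exact: hc].
- by move=> j x; exact: is_derive_outer.
- move=> j x; apply: continuousM; last exact: dfc.
  by apply: (@continuous_comp _ _ _ f dh); [exact: fc|exact: dhc].
Qed.

Lemma C1_sum (I : Type) (r : seq I) (f : I -> 'rV[R]_m -> R) (df : I -> 'I_m -> 'rV[R]_m -> R) :
  (forall i, C1 (f i) (df i)) ->
  C1 (fun x => \sum_(i <- r) f i x) (fun j x => \sum_(i <- r) df i j x).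
Proof.
move=> fP; elim: r => [|i r ih].
  have -> : (fun x => \sum_(i <- [::]) f i x) = cst 0.
    by apply/funext => x; rewrite big_nil.
  have -> : (fun j x => \sum_(i <- [::]) df i j x) = (fun _ => cst 0).
    by apply/funext => j; apply/funext => x; rewrite big_nil.
  exact: C1_cst.
have -> : (fun x => \sum_(i <- i :: r) f i x) = (fun x => f i x + \sum_(i <- r) f i x).
  by apply/funext => x; rewrite big_cons.
have -> : (fun j x => \sum_(i <- i :: r) df i j x) =
    (fun j x => df i j x + \sum_(i <- r) df i j x).
  by apply/funext => j; apply/funext => x; rewrite big_cons.
exact: C1D.
Qed.

Definition lin (nu x : 'rV[R]_m) : R := \sum_i nu 0 i * x 0 i.

Lemma linD nu x y : lin nu (x + y) = lin nu x + lin nu y.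
Proof. by rewrite /lin -big_split/=; apply: eq_bigr => i _; rewrite mxE mulrDr. Qed.

Lemma linZ nu t x : lin nu (t *: x) = t * lin nu x.
Proof. by rewrite /lin mulr_sumr; apply: eq_bigr => i _; rewrite mxE mulrCA. Qed.

Lemma lin_delta nu j : lin nu (e_ j) = nu 0 j.
Proof.
rewrite /lin (bigD1 j)//= mxE !eqxx mulr1 big1 ?addr0// => i ij.
by rewrite mxE (negbTE ij) andbF mulr0.
Qed.

Lemma C1_coord (i : 'I_m) : C1 (fun x => x 0 i) (fun j => cst ((i == j)%:R)).
Proof.
apply: C1_of_partials => [j z|j]; last exact: cst_continuous.
apply: is_derive_line0.
have -> : (fun s : R => (z + s *: e_ j) 0 i) = (fun s => (i == j)%:R * s + z 0 i).
  by apply/funext => s; rewrite !mxE eqxx/= addrC mulrC.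
apply: is_derive_eq; rewrite /GRing.scale/=; ring.
Qed.

Lemma C1_lin nu : C1 (lin nu) (fun j => cst (nu 0 j)).
Proof.
have := @C1_sum _ (index_enum 'I_m) _ _ (fun i => C1M (C1_cst (nu 0 i)) (C1_coord i)).
congr C1; apply/funext => j; apply/funext => x /=.
rewrite (bigD1 j)//= eqxx mulr1 mulr0 addr0 big1 ?addr0// => i ij.
by rewrite (negbTE ij) mulr0 mulr0 addr0.
Qed.

End C1_functions.

(** * Integration and Lebesgue measure *)

Section real_integrals.
Context d (T : measurableType d) (R : realType) (mu : {measure set T -> \bar R}).
Implicit Types (A B : set T) (f g : T -> R).

Lemma bounded_integrable A f (M : R) : measurable A -> (mu A < +oo)%E ->
  measurable_fun setT f -> (forall x, A x -> `|f x| <= M) ->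
  mu.-integrable A (EFin \o f).
Proof.
move=> mA Aoo mf fM; apply: measurable_bounded_integrable => //.
  exact: measurable_funTS.
exists M; split; first exact: num_real.
by move=> N MN x Ax; apply: le_trans (fM x Ax) (ltW MN).
Qed.

Lemma Rintegral_cvg A (f_ : nat -> T -> R) f (M : R) : measurable A -> (mu A < +oo)%E ->
  (forall k, measurable_fun setT (f_ k)) -> measurable_fun setT f ->
  (forall k x, A x -> `|f_ k x| <= M) ->
  (forall x, A x -> f_ k x @[k --> \oo] --> f x) ->
  \int[mu]_(x in A) f_ k x @[k --> \oo] --> \int[mu]_(x in A) f x.
Proof.
move=> mA Aoo mf_ mf fM ff.
have [] := @dominated_convergence _ T R mu A mA (fun k => EFin \o f_ k) (EFin \o f) (cst M%:E).
- by move=> k; apply/measurable_EFinP; exact: measurable_funTS.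
- by apply/measurable_EFinP; exact: measurable_funTS.
- by apply: aeW => x Ax; apply: cvg_EFin; [exact: nearW|exact: ff].
- by apply: (@bounded_integrable A (cst M) `|M|) => // x _.
- by apply: aeW => x k Ax /=; rewrite lee_fin fM.
move=> fi _ H; apply: fine_cvg; rewrite fineK//; exact: integrable_fin_num.
Qed.

Lemma Rintegral_setD A B f : measurable A -> measurable B ->
  mu.-integrable A (EFin \o f) ->
  \int[mu]_(x in A) f x = \int[mu]_(x in A `&` B) f x + \int[mu]_(x in A `\` B) f x.
Proof.
move=> mA mB fi; rewrite -Rintegral_setU ?setUIDK//.
- exact: measurableI.
- exact: measurableD.
- by apply/disj_setPRL => x [Ax nBx] [_ Bx].
Qed.

Lemma Rintegral_indic A B : measurable A -> measurable B ->
  \int[mu]_(x in A) \1_B x = fine (mu (A `&` B)).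
Proof. by move=> mA mB; rewrite /Rintegral/= integral_indic// setIC. Qed.

Lemma Rintegral_indicM A B f : measurable A -> measurable B ->
  \int[mu]_(x in A) (\1_B x * f x) = \int[mu]_(x in A `&` B) f x.
Proof.
move=> mA mB; rewrite Rintegral_mkcondr; apply: eq_Rintegral => x _.
by rewrite patchE indicE; case: ifPn => _; rewrite ?mul1r ?mul0r.
Qed.

Lemma Rintegral_bound A f (M : R) : measurable A -> (mu A < +oo)%E ->
  measurable_fun setT f -> (forall x, A x -> `|f x| <= M) ->
  `|\int[mu]_(x in A) f x| <= M * fine (mu A).
Proof.
move=> mA Aoo mf fM.
have fi := bounded_integrable mA Aoo mf fM.
rewrite (le_trans (le_normr_Rintegral mA fi))// -Rintegral_cst//.
have mnf : measurable_fun setT (fun x => `|f x|) by exact: measurableT_comp.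
apply: le_Rintegral => //.
- by apply: (@bounded_integrable A _ M) => // x Ax; rewrite normr_id fM.
- by apply: (@bounded_integrable A (cst M) `|M|) => // x _.
Qed.

Lemma ae_eq_Rintegral_set A B f : measurable A -> measurable B ->
  measurable_fun setT f -> mu (A `\` B) = 0%E -> mu (B `\` A) = 0%E ->
  \int[mu]_(x in A) f x = \int[mu]_(x in B) f x.
Proof.
move=> mA mB mf AB BA; rewrite 2!(Rintegral_mkcond mu _ f) /Rintegral; congr fine.
apply: ae_eq_integral => //.
- by apply/measurable_EFinP; apply/(measurable_restrictT _ mA).1; exact: measurable_funTS.
- by apply/measurable_EFinP; apply/(measurable_restrictT _ mB).1; exact: measurable_funTS.
exists ((A `\` B) `|` (B `\` A)); split.
- by apply: measurableU; exact: measurableD.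
- apply/eqP; rewrite eq_le measure_ge0 andbT.
  rewrite (le_trans (measureU2 _ _ _))//; [exact: measurableD..|].
  by rewrite [X in (X + _)%E]AB [X in (_ + X)%E]BA adde0.
- move=> x /= /not_implyP[_]; rewrite !patchE.
  by have [/set_mem Ax|/negP nAx] := boolP (x \in A);
     have [/set_mem Bx|/negP nBx] := boolP (x \in B) => // H;
     [left|right]; split=> // /mem_set.
Qed.

End real_integrals.

Section rV_measure.
Variable R : realType.

Lemma ball_rVE m (x : 'rV[R]_m) (r : R) : 0 < r ->
  ball x r = [set y | forall i, y 0 i \in `](x 0 i - r), (x 0 i + r)[ ].
Proof.
move=> r0; apply/seteqP; split => y.
  by move/(rV_ballP _ _ r0) => /= H i; rewrite in_itv/=; move: (H i); rewrite ltr_norml; lra.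
by move=> /= H; apply/(rV_ballP _ _ r0) => i; move: (H i); rewrite in_itv/= ltr_norml; lra.
Qed.

Lemma measurable_box m (A : 'I_m -> set R) :
  (forall i, measurable (A i : set (measurableTypeR R))) ->
  measurable [set x : 'rV[R]_m | forall i, A i (x 0 i)].
Proof. by move=> mA; have [] := lebesgue_box mA. Qed.

Lemma measurable_ball_rV m (x : 'rV[R]_m) (r : R) : measurable (ball x r).
Proof.
have [r0|r0] := ltP 0 r; last by rewrite le0_ball0.
rewrite ball_rVE//; apply: (measurable_box (A := fun i => [set` _])) => i.
exact: measurable_itv.
Qed.

Definition ratrV m (q : 'rV[rat]_m) : 'rV[R]_m := map_mx ratr q.

Lemma rat_rV_near m (x : 'rV[R]_m) (e : R) : 0 < e ->
  exists q : 'rV[rat]_m, ball (ratrV q) e x.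
Proof.
move=> e0; have /choice[q qP] : forall i, exists q : rat, `|ratr q - x 0 i| < e.
  move=> i; have /rat_in_itvoo[q] : x 0 i - e < x 0 i + e by lra.
  by rewrite in_itv/= => qP; exists q; rewrite ltr_norml; lra.
by exists (\row_i q i); apply/rV_ballP => // i; rewrite !mxE.
Qed.

(** The sigma-algebra is generated by the coordinates, so open sets are reached through a countable
    basis: the sup-norm balls with rational centre and radius 1/(k+1). *)
Lemma open_measurable_rV m (U : set 'rV[R]_m) : open U -> measurable U.
Proof.
move=> oU; pose F (i : 'rV[rat]_m * nat) : set 'rV[R]_m :=
  if `[< ball (ratrV i.1) (i.2.+1%:R^-1) `<=` U >] then
    ball (ratrV i.1) (i.2.+1%:R^-1) else set0.
suff -> : U = \bigcup_i F i.
  apply: countable_bigcupT_measurable => [|i]; first exact: countableP.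
  by rewrite /F; case: ifPn => // _; exact: measurable_ball_rV.
apply/seteqP; split => [x Ux|x [i _]]; last by rewrite /F; case: ifPn => // /asboolP; exact.
have /nbhs_ballP[e /= e0 eU] : nbhs x U by exact: open_nbhs_nbhs.
have [k ke] : exists k : nat, k.+1%:R^-1 < e / 2.
  have [k _ /(_ _ (leqnn _)) H] := near_infty_natSinv_lt (PosNum (divr_gt0 e0 (@ltr0n R 2))).
  by exists k.
have k0 : 0 < k.+1%:R^-1 :> R by rewrite invr_gt0.
have [q qx] := rat_rV_near x k0.
exists (q, k) => //; rewrite /F ifT //=; apply/asboolP => y qy; apply: eU; rewrite (splitr e).
apply: (@ball_triangle _ _ (ratrV q)).
  by apply: ball_sym; exact: le_ball (ltW ke) _ qx.
exact: le_ball (ltW ke) _ qy.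
Qed.

Lemma continuous_measurable_rV m (f : 'rV[R]_m -> R) :
  continuous f -> measurable_fun setT f.
Proof.
move=> fc; apply: (measurability _ (RGenOInfty.measurableE R)) => _ [_ [r ->] <-].
rewrite setTI; apply: open_measurable_rV; apply: open_comp => //.
Qed.

Lemma measurable_fun_rVP d (T : measurableType d) m (f : T -> 'rV[R]_m) :
  (forall i, measurable_fun setT (fun x => f x 0 i)) -> measurable_fun setT f.
Proof. by move=> mf; apply: measurable_to_rV => i; exact: mf. Qed.

Lemma measurable_coordinate m (i : 'I_m) : measurable_fun setT (fun x : 'rV[R]_m => x 0 i).
Proof. exact: measurable_coord. Qed.

Lemma measurable_addr_rV m (v : 'rV[R]_m) : measurable_fun setT (+%R v).
Proof.
apply: measurable_fun_rVP => i; rewrite (_ : (fun _ => _) = (fun x : 'rV[R]_m => v 0 i + x 0 i)).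
  by apply: measurable_funD => //; exact: measurable_coordinate.
by apply/funext => x; rewrite mxE.
Qed.

Definition translate_measure d (T : measurableType d) (mu : {measure set T -> \bar R})
    (f : T -> T) (mf : measurable_fun setT f) : {measure set T -> \bar R} :=
  measure_function_pushforward__canonical__measure_function_Measure mu mf.

Lemma lebesgue1_translation (v : R) (A : set R) : measurable (A : set (measurableTypeR R)) ->
  lebesgue_measure (+%R v @^-1` A) = lebesgue_measure A.
Proof.
move=> mA; have mv : measurable_fun setT (+%R v : measurableTypeR R -> measurableTypeR R).
  exact: measurable_funD.
apply/esym; apply: (@lebesgue_measure_unique R (translate_measure lebesgue_measure mv) _ A mA) => _ [[a b] _ <-].
rewrite /= /pushforward.
rewrite (_ : _ @^-1` _ = [set` `](a - v), (b - v)]]).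
  rewrite !lebesgue_measure_itv/= !lte_fin ltrD2r; case: ifPn => // _.
  by rewrite -!EFinB opprB addrA subrK.
by apply/seteqP; split => x /=; rewrite !in_itv/=; lra.
Qed.

Definition boxes m : set (set 'rV[R]_m) :=
  [set [set x : 'rV[R]_m | forall i, A i (x 0 i)] | A in
    [set A : 'I_m -> set R | forall i, measurable (A i : set (measurableTypeR R))]].

Lemma measurable_boxesE m : @measurable _ 'rV[R]_m = <<s @boxes m >>.
Proof.
apply/seteqP; split => [|A].
  apply: smallest_sub; first exact: smallest_sigma_algebra.
  rewrite -bigcup_seq => _ [i _ [B mB <-]].
  apply: sub_sigma_algebra; exists (fun j => if j == i then B else setT).
    by move=> j /=; case: ifPn.
  apply/seteqP; split => x /=; first by move/(_ i); rewrite eqxx.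
  by case=> _ Bx j; case: eqP => // ->.
apply: smallest_sub; first exact: sigma_algebra_measurable.
by move=> _ [B mB <-]; exact: measurable_box.
Qed.

Lemma boxes_setI m : setI_closed (@boxes m).
Proof.
move=> _ _ [A mA <-] [B mB <-]; exists (fun i => A i `&` B i).
  by move=> i; exact: measurableI.
by apply/seteqP; split => x /= => [H|[HA HB] i]; split=> // i; case: (H i).
Qed.

Definition cube m (M : R) : set 'rV[R]_m := [set x | forall i, x 0 i \in `]- M, M[ ].

Lemma measurable_cube m M : measurable (@cube m M).
Proof. by apply: (measurable_box (A := fun i => [set` _])) => i; exact: measurable_itv. Qed.

Lemma lebesgue_itv_box m (c : 'I_m -> R) (s : R) :
  0 <= s ->
  forall (b1 b2 : bool), lebesgue R m [set x : 'rV[R]_m | forall i,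
    x 0 i \in Interval (BSide b1 (c i)) (BSide b2 (c i + s))] = (s ^+ m)%:E.
Proof.
move=> s0 b1 b2.
have [_ ->] := @lebesgue_box R m (fun i => [set` Interval (BSide b1 (c i)) (BSide b2 (c i + s))])
  (fun i => measurable_itv _).
rewrite (eq_bigr (fun=> s%:E)); last first.
  move=> i _; rewrite lebesgue_measure_itv/= lte_fin ltrDl.
  case: ifPn => [_|]; first by rewrite -EFinB addrAC subrr add0r.
  by rewrite -leNgt => s1; congr (_%:E); apply/eqP; rewrite eq_le s0 s1.
by rewrite prodEFin prodr_const card_ord.
Qed.

Lemma lebesgue_cube m (M : R) : 0 <= M -> lebesgue R m (@cube m M) = ((2 * M) ^+ m)%:E.
Proof.
move=> M0; rewrite -(@lebesgue_itv_box m (fun _ => - M) (2 * M) _ false true) ?mulr_ge0//.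
congr (lebesgue _ _ _); apply/seteqP; split => x /= H i; move: (H i);
  by rewrite !in_itv/=; lra.
Qed.

(** Both measures agree on boxes, by one-dimensional invariance in each factor. Boxes are stable
    under intersection and generate the sigma-algebra, and the cubes of half-side [k] exhaust the
    space with finite measure. *)
Lemma lebesgue_translation m (v : 'rV[R]_m) (A : set 'rV[R]_m) : measurable A ->
  lebesgue R m (+%R v @^-1` A) = lebesgue R m A.
Proof.
move=> mA; have mv := measurable_addr_rV v.
rewrite -[LHS]/(translate_measure (lebesgue R m) mv A); apply/esym.
apply: (@measure_unique _ _ _ (@boxes m) (fun k => @cube m k%:R)) => //.
- exact: measurable_boxesE.
- exact: boxes_setI.
- by move=> k; exists (fun i => [set` `](- k%:R), k%:R[]) => // i; exact: measurable_itv.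
- apply/seteqP; split => // x _.
  have [M M0 xM] : exists2 M : R, 0 <= M & forall i, `|x 0 i| <= M.
    exists (\sum_i `|x 0 i|); first exact: sumr_ge0.
    by move=> i; rewrite (bigD1 i)//= lerDl sumr_ge0.
  exists (Num.bound M) => // i; rewrite /= in_itv/= -ltr_norml.
  exact: le_lt_trans (xM i) (archi_boundP M0).
- move=> _ [B mB <-]; rewrite /translate_measure/= /pushforward.
  have [_ ->] := lebesgue_box mB.
  have mvB i : measurable (+%R (v 0 i) @^-1` B i : set (measurableTypeR R)).
    have mvi : measurable_fun setT (+%R (v 0 i) : measurableTypeR R -> measurableTypeR R).
      exact: measurable_funD.
    by rewrite -[X in measurable X]setTI; exact: mvi.
  have := lebesgue_box mvB => -[_ H].
  rewrite (_ : _ @^-1` _ = [set x : 'rV[R]_m | forall i, (+%R (v 0 i) @^-1` B i) (x 0 i)]); last first.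
    by apply/seteqP; split => x /= K i; move: (K i); rewrite mxE.
  by rewrite H; apply: eq_bigr => i _; rewrite lebesgue1_translation.
- by move=> k; rewrite [X in (X < _)%E]lebesgue_cube// ltry.
Qed.

Lemma measurable_preimage_addr m (v : 'rV[R]_m) (A : set 'rV[R]_m) : measurable A ->
  measurable (+%R v @^-1` A).
Proof. by move=> mA; rewrite -[X in measurable X]setTI; exact: measurable_addr_rV. Qed.

Lemma continuous_measurable_lin m (nu : 'rV[R]_m) : measurable_fun setT (lin nu).
Proof. by apply: continuous_measurable_rV; case: (C1_lin nu). Qed.

Lemma lebesgueS_prod m (A : set 'rV[R]_m.+1) :
  lebesgue R m.+1 A = (lebesgue R m \x @lebesgue_measure R)%E (@snoc R m @^-1` A).
Proof. by []. Qed.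

Lemma lin_snoc m (nu : 'rV[R]_m.+1) y t :
  lin nu (snoc (y, t)) = lin (horizontal nu) y + height nu * t.
Proof.
rewrite /lin big_ord_recr /=; congr (_ + _); last by rewrite /height mxE unlift_none.
apply: eq_bigr => i _.
have -> : widen_ord (leqnSn m) i = lift ord_max i.
  by apply: val_inj; rewrite /= /bump leqNgt ltn_ord.
by rewrite !mxE liftK.
Qed.

End rV_measure.

(** * Smooth approximation of measurable sets *)

Section spline.
Variable R : realType.
Implicit Types z t a : R.

(** A quadratic remainder treats the knots of the spline on the same footing as its smooth pieces:
    for [pos2] it is checked by sign cases. *)
Lemma is_derive_quadratic (f : R -> R) (z a C : R) :
  (forall h, `|f (h + z) - f z - a * h| <= C * h ^+ 2) -> is_derive z (1 : R) f a.
Proof.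
move=> H; have C0 : 0 <= C.
  by have := le_trans (normr_ge0 _) (H 1); rewrite expr1n mulr1.
suff K : h^-1 *: (f (h *: 1 + z) - f z) @[h --> 0^'] --> a.
  split; first by apply/cvg_ex; exists a.
  exact/cvg_lim.
apply/cvgrPdist_lt => e e0.
have eC : 0 < e / (C + 1) by rewrite divr_gt0// ltr_wpDl.
near=> h.
have h0 : h != 0 by near: h; exact: nbhs_dnbhs_neq.
have hs : `|h| < e / (C + 1) by near: h; exact: dnbhs0_lt.
rewrite [h *: 1]mulr1 distrC.
rewrite (_ : _ - a = h^-1 * (f (h + z) - f z - a * h)); last first.
  by rewrite /GRing.scale/= [RHS]mulrBr (mulrC a) mulKf.
rewrite normrM normfV mulrC ltr_pdivrMr ?normr_gt0//.
rewrite (le_lt_trans (H h))// -(real_normK (num_real h)) expr2 mulrA ltr_pM2r ?normr_gt0//.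
rewrite (@le_lt_trans _ _ ((C + 1) * `|h|))//.
  by rewrite ler_wpM2r// lerDl.
by rewrite mulrC -ltr_pdivlMr// ltr_wpDl.
Unshelve. all: by end_near. Qed.

Definition pos z : R := Num.max z 0.
Definition pos2 z : R := pos z ^+ 2.

Lemma posE z : pos z = if 0 <= z then z else 0.
Proof. by rewrite /pos; case: leP => [/max_idPr|/ltW/max_idPl]. Qed.

Lemma is_derive_pos2 z : is_derive z (1 : R) pos2 (2 * pos z).
Proof.
apply: (@is_derive_quadratic _ _ _ 1) => h; rewrite /pos2 !posE ler_norml.
by case: (lerP 0 (h + z)) => ?; case: (lerP 0 z) => ?; nra.
Qed.

Lemma continuous_pos : continuous pos.
Proof.
move=> z; apply: (@continuous_max R R id (fun=> 0) z); first exact: (@cvg_id R^o).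
exact: cvg_cst.
Qed.

(* A C^1 quadratic spline: 0 for z <= 0, 1 for z >= 1, with slope at most 2. *)
Definition step z : R := 2 * pos2 z - 4 * pos2 (z - 2^-1) + 2 * pos2 (z - 1).
Definition dstep z : R := 4 * pos z - 8 * pos (z - 2^-1) + 4 * pos (z - 1).

Lemma is_derive_step z : is_derive z (1 : R) step (dstep z).
Proof.
have H a : is_derive z (1 : R) (fun t => pos2 (t - a)) (2 * pos (z - a)).
  have := @is_derive1_comp R pos2 (fun t => t - a) z _ _ (is_derive_pos2 (z - a)) (is_derive_shift z 1 (- a)).
  by rewrite mulr1.
have H0 := is_derive_pos2 z.
have Hh := H 2^-1; have H1 := H 1.
rewrite /step; apply: is_derive_eq; rewrite /GRing.scale/= /dstep; ring.
Qed.

Lemma continuous_dstep : continuous dstep.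
Proof.
move=> z; have H a : {for z, continuous (fun t => pos (t - a))}.
  apply: (@continuous_comp _ _ _ (fun t => t - a) pos); last exact: continuous_pos.
  by apply: (@continuousB R R^o R id (fun=> a)); [exact: cvg_id|exact: cvg_cst].
have C (k : R) (f : R -> R) : {for z, continuous f} -> {for z, continuous (fun t => k * f t)}.
  by move=> fc; apply: (@continuousM R R (fun=> k) f) => //; exact: cvg_cst.
have H0 : {for z, continuous pos} by exact: continuous_pos.
exact: (@continuousD R R^o R _ _ _ (@continuousB R R^o R _ _ _ (C 4 _ H0) (C 8 _ (H 2^-1))) (C 4 _ (H 1))).
Qed.

Lemma step0 z : z <= 0 -> step z = 0.
Proof.
move=> z0; rewrite /step /pos2 !posE.
by case: (lerP 0 z) => ?; case: (lerP 0 (z - 2^-1)) => ?; case: (lerP 0 (z - 1)) => ?; nra.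
Qed.

Lemma step1 z : 1 <= z -> step z = 1.
Proof.
move=> z0; rewrite /step /pos2 !posE.
by case: (lerP 0 z) => ?; case: (lerP 0 (z - 2^-1)) => ?; case: (lerP 0 (z - 1)) => ?; try nra; field.
Qed.

Lemma step_ge0 z : 0 <= step z.
Proof.
rewrite /step /pos2 !posE.
by case: (lerP 0 z) => ?; case: (lerP 0 (z - 2^-1)) => ?; case: (lerP 0 (z - 1)) => ?; nra.
Qed.

Lemma step_le1 z : step z <= 1.
Proof.
rewrite /step /pos2 !posE.
by case: (lerP 0 z) => ?; case: (lerP 0 (z - 2^-1)) => ?; case: (lerP 0 (z - 1)) => ?; nra.
Qed.

Lemma dstep_ge0 z : 0 <= dstep z.
Proof. by rewrite /dstep !posE; case: (lerP 0 z) => ?; case: (lerP 0 (z - 2^-1)) => ?; case: (lerP 0 (z - 1)) => ?; lra. Qed.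

Lemma dstep_le2 z : dstep z <= 2.
Proof. by rewrite /dstep !posE; case: (lerP 0 z) => ?; case: (lerP 0 (z - 2^-1)) => ?; case: (lerP 0 (z - 1)) => ?; lra. Qed.

Lemma dstep_out z : (z <= 0) || (1 <= z) -> dstep z = 0.
Proof. by move/orP; rewrite /dstep !posE; case: (lerP 0 z) => ?; case: (lerP 0 (z - 2^-1)) => ?; case: (lerP 0 (z - 1)) => ?; lra. Qed.

(** This lower bound on the slope is the source of the positive divergence in the height bound. *)
Lemma dstep_mid z : 4^-1 <= z <= 3 / 4 -> 1 <= dstep z.
Proof. by rewrite /dstep !posE; case: (lerP 0 z) => ?; case: (lerP 0 (z - 2^-1)) => ?; case: (lerP 0 (z - 1)) => ?; lra. Qed.

Lemma normr_dstep z : `|dstep z| <= 2.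
Proof. by rewrite ger0_norm ?dstep_le2 ?dstep_ge0. Qed.

Lemma normr_step z : `|step z| <= 1.
Proof. by rewrite ger0_norm ?step_le1 ?step_ge0. Qed.

Lemma step_gt0 z : 0 < z -> 0 < step z.
Proof.
move=> z0; rewrite /step /pos2 !posE.
by case: (lerP 0 z) => ?; case: (lerP 0 (z - 2^-1)) => ?; case: (lerP 0 (z - 1)) => ?; nra.
Qed.

Lemma C1_step m (nu : 'rV[R]_m) a b :
  C1 (fun x => step (a * lin nu x + b))
     (fun j x => dstep (a * lin nu x + b) * (a * nu 0 j)).
Proof.
have H := C1D (C1M (C1_cst _ a) (C1_lin nu)) (C1_cst _ b).
have := C1_outer H continuous_dstep is_derive_step.
congr C1; apply/funext => j; apply/funext => x /=; congr (_ * _); ring.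
Qed.

End spline.

Section approximation.
Variables (R : realType) (m : nat) (B : set 'rV[R]_m).
Hypotheses (mB : measurable B) (Boo : (lebesgue R m B < +oo)%E).
Implicit Types S : set 'rV[R]_m.
Local Notation mu := (lebesgue R m).

(** Approximation in L^1(B) by C^1 functions with values in [0,1]. The sets with this property turn
    out to form a sigma-algebra, which stands in for mollification. *)
Definition smoothable S := forall e : R, 0 < e -> exists g dg,
  [/\ @C1 R m g dg, forall x, 0 <= g x <= 1 &
      \int[mu]_(x in B) `|\1_S x - g x| <= e].

Lemma C1_measurable g dg : @C1 R m g dg -> measurable_fun setT g.
Proof. by case=> gc _ _; exact: continuous_measurable_rV. Qed.

Lemma integrable_indic_dist S (g : 'rV[R]_m -> R) : measurable S -> measurable_fun setT g ->
  (forall x, 0 <= g x <= 1) -> mu.-integrable B (EFin \o (fun x => `|\1_S x - g x|)).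
Proof.
move=> mS mg g01; apply: (@bounded_integrable _ _ _ _ _ _ 1) => //.
  by apply: measurableT_comp => //; apply: measurable_funB.
by move=> x _; rewrite normr_id ler_norml; have := g01 x; rewrite indicE; case: (x \in S) => /=; lra.
Qed.

Lemma smoothable_setC S : smoothable S -> smoothable (~` S).
Proof.
move=> H e e0; have [g [dg [g1 g01 ge]]] := H e e0.
exists (fun x => 1 + -1 * g x), (fun j x => 0 + (-1 * dg j x + g x * 0)); split.
- exact: C1D (C1_cst _ 1) (C1M (C1_cst _ (-1)) g1).
- by move=> x; have := g01 x; lra.
- apply: le_trans ge; rewrite (@eq_Rintegral _ _ _ _ _ (fun x => `|\1_S x - g x|))// => x _.
  rewrite distrC !indicE in_setC; case: (x \in S) => /=; congr `|_|; ring.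
Qed.

Lemma smoothable_setU S1 S2 : measurable S1 -> measurable S2 ->
  smoothable S1 -> smoothable S2 -> smoothable (S1 `|` S2).
Proof.
move=> mS1 mS2 H1 H2 e e0.
have e20 : 0 < e / 2 by rewrite divr_gt0.
have [g [dg [g1 g01 ge]]] := H1 _ e20; have [h [dh [h1 h01 he]]] := H2 _ e20.
(* The smooth counterpart of the union is g + h - g h = 1 - (1 - g)(1 - h), again with values in
   [0,1]. *)
have gh1 := C1D (C1D g1 h1) (C1M (C1_cst _ (-1)) (C1M g1 h1)).
eexists; eexists; split; [exact: gh1|..].
  by move=> x; have := g01 x; have := h01 x => /=; nra.
have ighg := integrable_indic_dist mS1 (C1_measurable g1) g01.
have ighh := integrable_indic_dist mS2 (C1_measurable h1) h01.
rewrite (splitr e) (le_trans _ (lerD ge he))// -RintegralD//.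
apply: le_Rintegral => //.
- apply: integrable_indic_dist; [exact: measurableU|exact: C1_measurable gh1|].
  by move=> x; have := g01 x; have := h01 x => /=; nra.
- exact: (integrableD mB ighg ighh).
move=> x _; rewrite !indicE in_setU /=.
have := g01 x; have := h01 x => /andP[h0 h1'] /andP[g0 g1'].
case: (x \in S1) => /=; case: (x \in S2) => /=; rewrite ?mulr1n ?mulr0n ?sub0r ?normrN.
- by rewrite !ger0_norm; nra.
- by rewrite !ger0_norm; nra.
- by rewrite !ger0_norm; nra.
- by rewrite !ger0_norm; nra.
Qed.

(** Dominated convergence on the finite-measure set [B] reduces a countable union to a finite one,
    at the cost of half of [e]. *)
Lemma smoothable_bigcup (S : nat -> set 'rV[R]_m) : (forall k, measurable (S k)) ->
  (forall k, smoothable (S k)) -> smoothable (\bigcup_k S k).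
Proof.
move=> mS HS e e0.
pose U N := \big[setU/set0]_(k < N) S k.
have mU N : measurable (U N) by exact: bigsetU_measurable.
have HU N : smoothable (U N).
  rewrite /U; elim: N => [|N IH]; rewrite ?big_ord0 ?big_ord_recr.
    move=> d d0; exists (cst 0), (fun _ => cst 0); split; first exact: C1_cst.
      by move=> x; rewrite lexx ler01.
    rewrite (@eq_Rintegral _ _ _ _ _ (fun x => 0)) ?Rintegral_cst ?mul0r ?ltW//.
    by move=> x _; rewrite indicE in_set0 subr0 normr0.
  by apply: smoothable_setU => //; exact: mU.
have mS' : measurable (\bigcup_k S k) by exact: bigcupT_measurable.
have : \int[mu]_(x in B) `|\1_(\bigcup_k S k) x - \1_(U N) x| @[N --> \oo] -->
    \int[mu]_(x in B) (fun=> 0) x.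
  apply: (@Rintegral_cvg _ _ _ _ _ _ _ 1) => //.
  - by move=> N; apply: measurableT_comp => //; apply: measurable_funB.
  - move=> N x _; rewrite !indicE normr_id.
    by case: (_ \in _); case: (_ \in _) => /=; rewrite ?mulr1n ?mulr0n ?subrr ?subr0 ?sub0r ?normrN ?normr0 ?normr1.
  - move=> x _; apply/cvgrPdist_lt => d d0.
    have [[k _ Sk]|nS] := pselect ((\bigcup_k S k) x); last first.
      apply: nearW => N; rewrite !indicE memNset// memNset ?subrr ?normr0//=.
        by rewrite subr0 normr0.
      by rewrite /U -bigcup_mkord => -[k _ Sk]; apply: nS; exists k.
    near=> N; rewrite !indicE mem_set; last by exists k.
    rewrite mem_set ?subrr ?normr0 ?subrr ?normr0//.
    rewrite /U -bigcup_mkord; exists k => //=; near: N; exact: nbhs_infty_gt.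
rewrite Rintegral_cst// mul0r => /cvgrPdist_lt/(_ (e / 2))[]; first by rewrite divr_gt0.
move=> N _ /(_ _ (leqnn _)); rewrite sub0r normrN ger0_norm; last by apply: Rintegral_ge0.
move=> UN; have [g [dg [g1 g01 ge]]] := HU N (e / 2) (divr_gt0 e0 (@ltr0n R 2)).
exists g, dg; split => //.
have ige := integrable_indic_dist (mU N) (C1_measurable g1) g01.
have iU : mu.-integrable B (EFin \o (fun x => `|\1_(\bigcup_k S k) x - \1_(U N) x|)).
  apply: integrable_indic_dist => //.
  by move=> x; rewrite indicE; case: (_ \in _); rewrite /= ?lexx ?ler01.
rewrite (splitr e) (le_trans _ (lerD (ltW UN) ge))// -RintegralD//.
apply: le_Rintegral => //.
- exact: integrable_indic_dist mS' (C1_measurable g1) g01.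
- exact: (integrableD mB iU ige).
- by move=> x _; rewrite (le_trans _ (ler_normD _ _))// addrA subrK.
Unshelve. all: by end_near. Qed.

Lemma smoothable_ray (i : 'I_m) (a : R) : smoothable [set x | a < x 0 i].
Proof.
move=> e e0; have mS : measurable [set x : 'rV[R]_m | a < x 0 i].
  apply: open_measurable_rV; apply: (@open_comp _ _ (fun x : 'rV[R]_m => x 0 i) [set t | a < t]); last exact: open_gt.
  by move=> x _; case: (C1_coord R i) => + _ _; exact.
pose g (N : nat) (x : 'rV[R]_m) := step (N%:R * lin (delta_mx 0 i) x + - (N%:R * a)).
have gE N x : g N x = step (N%:R * (x 0 i - a)).
  congr step; rewrite mulrBr; congr (_ * _ - _).
  rewrite /lin (bigD1 i)//= mxE !eqxx mul1r big1 ?addr0// => j ji.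
  by rewrite mxE (negbTE ji) andbF mul0r.
have g1 N := C1_step (delta_mx 0 i : 'rV[R]_m) N%:R (- (N%:R * a)).
have g01 N x : 0 <= g N x <= 1 by rewrite step_ge0 step_le1.
have : \int[mu]_(x in B) `|\1_[set x | a < x 0 i] x - g N x| @[N --> \oo] -->
    \int[mu]_(x in B) (fun=> 0) x.
  apply: (@Rintegral_cvg _ _ _ _ _ _ _ 1) => //.
  - by move=> N; apply: measurableT_comp => //; apply: measurable_funB; [exact: measurable_indic|exact: C1_measurable (g1 N)].
  - move=> N x _; rewrite normr_id indicE ler_norml; have := g01 N x.
    by case: (_ \in _) => /=; lra.
  - move=> x _; apply/cvgrPdist_lt => d d0.
    have [ax|ax] := ltP a (x 0 i); last first.
      apply: nearW => N; rewrite !indicE memNset /=; last by apply/negP; rewrite -leNgt.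
      rewrite gE step0; last by rewrite mulr_ge0_le0 ?subr_le0.
      by rewrite /= subr0 normr0 subr0 normr0.
    have xa0 : 0 < x 0 i - a by rewrite subr_gt0.
    near=> N; rewrite !indicE mem_set// gE step1 ?subrr ?normr0 ?subrr ?normr0//.
    rewrite -ler_pdivrMr// mul1r; near: N; exact: nbhs_infty_ger.
rewrite Rintegral_cst// mul0r => /cvgrPdist_lt/(_ e e0)[N _ /(_ _ (leqnn _))].
rewrite sub0r normrN ger0_norm; last by apply: Rintegral_ge0.
move=> UN; exists (g N); eexists; split; [exact: g1|exact: g01|exact: ltW].
Unshelve. all: by end_near. Qed.

(** Two nested sigma-algebra arguments: for sets of reals whose preimage under a coordinate is
    approximable, starting from rays, and for subsets of the space, starting from these preimages. A
    ray itself is reached by steepening [step]. *)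
Lemma measurable_smoothable S : measurable S -> smoothable S.
Proof.
have sig : sigma_algebra setT [set S | measurable S /\ smoothable S].
  split => /=.
  - split=> // d d0; exists (cst 0), (fun _ => cst 0); split; first exact: C1_cst.
      by move=> x; rewrite lexx ler01.
    rewrite (@eq_Rintegral _ _ _ _ _ (fun x => 0)) ?Rintegral_cst ?mul0r ?ltW//.
    by move=> x _; rewrite indicE in_set0 subr0 normr0.
  - move=> A [mA sA]; rewrite setTD; split; first exact: measurableC.
    exact: smoothable_setC.
  - move=> F HF; split; first by apply: bigcupT_measurable => k; case: (HF k).
    by apply: smoothable_bigcup => k; case: (HF k).
suff H : measurable `<=` [set S | measurable S /\ smoothable S].
  by move=> mS; case: (H S mS).
apply: smallest_sub => //; rewrite -bigcup_seq => _ [i _ [Y mY <-]] /=.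
rewrite setTI.
have sig' : sigma_algebra setT [set Y | measurable (@rV_coord R m i @^-1` Y) /\ smoothable (@rV_coord R m i @^-1` Y)].
  case: sig => s0 sC sU; split => /=.
  - by rewrite preimage_set0.
  - by move=> A /sC; rewrite !setTD preimage_setC.
  - by move=> F /sU; rewrite preimage_bigcup.
move: Y mY; rewrite (RGenOInfty.measurableE R); apply: smallest_sub => //.
move=> _ [a ->] /=.
have -> : rV_coord i @^-1` `]a, +oo[ = [set x : 'rV[R]_m | a < x 0 i].
  by apply/seteqP; split => x /=; rewrite /rV_coord in_itv/= andbT.
split; last exact: smoothable_ray.
rewrite (_ : [set _ | _] = setT `&` @rV_coord R m i @^-1` `]a, +oo[).
  by apply: measurable_coord => //; exact: measurable_itv.
by rewrite setTI; apply/seteqP; split => x /=; rewrite /rV_coord in_itv/= andbT.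
Qed.

End approximation.

(** * Perimeter and test fields *)

Section fields.
Variables (R : realType) (m : nat).
Local Notation mu := (lebesgue R m).
Local Notation e_ j := (delta_mx 0 j : 'rV[R]_m).
Implicit Types (F G : 'I_m -> 'rV[R]_m -> R) (dF dG : 'I_m -> 'I_m -> 'rV[R]_m -> R)
  (E Om : set 'rV[R]_m) (a b : 'rV[R]_m -> R) (da db : 'I_m -> 'rV[R]_m -> R).

Definition C1field F dF := forall i, C1 (F i) (dF i).

Definition dive dF (x : 'rV[R]_m) : R := \sum_i dF i i x.

Definition unit_bounded F := forall x, \sum_i F i x ^+ 2 <= 1.

(** Vanishing off some compact set, instead of a condition on the closure of the support: scaled and
    translated fields inherit it at once. *)
Definition supp_in Om F := exists2 K : set 'rV[R]_m, compact K /\ K `<=` Om &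
  forall x, ~ K x -> forall i, F i x = 0.

Definition test_field Om F dF := [/\ C1field F dF, unit_bounded F & supp_in Om F].

Lemma continuous_rV (V : topologicalType) (f : V -> 'rV[R]_m) :
  (forall i, continuous (fun x => f x 0 i)) -> continuous f.
Proof.
move=> fc x; apply/cvg_ballP => e e0.
have : \forall y \near x, forall i, `|f x 0 i - f y 0 i| < e.
  apply: (filter_forall (nbhs_filter x)) => i.
  by have /(@cvgrPdist_lt _ R^o _ (nbhs x) (nbhs_filter x))/(_ e e0) := fc i x.
by apply: filterS => y H; apply/rV_ballP.
Qed.

Lemma continuous_rV_coord (V : topologicalType) (f : V -> 'rV[R]_m) i :
  continuous f -> continuous (fun x => f x 0 i).
Proof.
move=> fc x; apply: (@continuous_comp _ _ _ f (fun y => y 0 i)); first exact: fc.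
by case: (C1_coord R i) => + _ _; exact.
Qed.

Lemma C1_supp_deriv (K : set 'rV[R]_m) a da : closed K -> C1 a da ->
  (forall x, ~ K x -> a x = 0) -> forall x, ~ K x -> forall j, da j x = 0.
Proof.
move=> cK [_ ad _] a0 x nKx j.
have [_ <-] := ad j x.
rewrite (@near_eq_derive _ _ _ a (cst 0)); first by rewrite derive_cst.
have : nbhs x (~` K) by apply: open_nbhs_nbhs; split => //; exact: closed_openC.
by apply: filterS => y; exact: a0.
Qed.

Lemma compact_bounded_fun (K : set 'rV[R]_m) a : compact K -> continuous a ->
  exists2 M : R, 0 <= M & forall x, K x -> `|a x| <= M.
Proof.
move=> cK ca; have /compact_bounded[M [_ HM]] : compact (a @` K).
  by apply: continuous_compact => //; exact: continuous_subspaceT.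
exists (Num.max 0 (M + 1)); first by rewrite le_max lexx.
by move=> x Kx; rewrite le_max; apply/orP; right; apply: HM; [rewrite ltrDl|exists x].
Qed.

Lemma test_field_bounded Om F dF : test_field Om F dF ->
  exists2 M : R, 0 <= M & forall x i j, `|dF i j x| <= M.
Proof.
move=> [F1 _ [K [cK _] F0]].
have clK : closed K by apply: compact_closed => //; exact: norm_hausdorff.
have /choice[M HM] : forall ij : 'I_m * 'I_m, exists M : R, 0 <= M /\ forall x, K x -> `|dF ij.1 ij.2 x| <= M.
  move=> [i j]; have [_ _ dc] := F1 i.
  by have [M M0 HM] := compact_bounded_fun cK (dc j); exists M.
exists (\sum_ij M ij); first by rewrite sumr_ge0// => ij _; case: (HM ij).
move=> x i j; have [Kx|nKx] := pselect (K x); last first.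
  rewrite (C1_supp_deriv clK (F1 i) (fun x nKx => F0 x nKx i) nKx) normr0.
  by rewrite sumr_ge0// => ij _; case: (HM ij).
have [_ /(_ x Kx) H] := HM (i, j); rewrite (le_trans H)// (bigD1 (i, j))//= lerDl.
by rewrite sumr_ge0// => ij _; case: (HM ij).
Qed.

Lemma dive_bounded dF (M : R) : (forall x i j, `|dF i j x| <= M) ->
  forall x, `|dive dF x| <= m%:R * M.
Proof.
move=> H x; rewrite (le_trans (ler_norm_sum _ _ _))// (le_trans (ler_sum _ (fun i _ => H x i i)))//.
by rewrite sumr_const card_ord mulr_natl.
Qed.

Lemma measurable_dive F dF : C1field F dF -> measurable_fun setT (dive dF).
Proof.
move=> F1; rewrite /dive; apply: measurable_sum => i.
by apply: continuous_measurable_rV; case: (F1 i).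
Qed.

Lemma test_dive_integrable Om F dF E : test_field Om F dF -> measurable E ->
  (mu E < +oo)%E -> mu.-integrable E (EFin \o dive dF).
Proof.
move=> tF mE Eoo; have [M M0 HM] := test_field_bounded tF.
apply: (@bounded_integrable _ _ _ _ _ _ (m%:R * M)) => //.
  by case: tF => /measurable_dive.
by move=> x _; exact: dive_bounded.
Qed.

Lemma integral_indicM_dive Om E (h : 'rV[R]_m -> R) : E `<=` Om ->
  (\int[mu]_(x in Om) (\1_E x * h x)%:E = \int[mu]_(x in E) (h x)%:E)%E.
Proof.
move=> EOm; rewrite [LHS]integral_mkcond [RHS]integral_mkcond; apply: eq_integral => x _.
rewrite !patchE indicE; have [/set_mem xE|xE] := boolP (x \in E).
  by rewrite mem_set ?mul1r//; exact: EOm.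
by case: ifPn => //; rewrite mul0r.
Qed.

Lemma perimeter_ub Om E F dF : E `<=` Om -> test_field Om F dF ->
  (\int[mu]_(x in E) (dive dF x)%:E <= perimeter E Om)%E.
Proof.
move=> EOm [F1 Fu [K [cK KOm] F0]].
pose phi (x : 'rV[R]_m) : 'rV[R]_m := \row_i F i x.
have phid x j : derivable phi x (e_ j).
  apply/derivable_mxP => i' i; rewrite (_ : (fun _ => _) = F i); last first.
    by apply/funext => y; rewrite mxE.
  by have [_ /(_ j x)[]] := F1 i.
have phiD x j i : ('D_(e_ j) phi x) 0 i = dF i j x.
  rewrite derive_mx// mxE (_ : (fun _ => _) = F i); last first.
    by apply/funext => y; rewrite mxE.
  by have [_ /(_ j x)[]] := F1 i.
have clK : closed K by apply: compact_closed => //; exact: norm_hausdorff.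
have sK : closure [set x | phi x != 0] `<=` K.
  rewrite [X in _ `<=` X](closure_id K).1//; apply: closure_subset => x /= /eqP phx.
  apply: contrapT => nKx; apply: phx; apply/rowP => i; rewrite !mxE; exact: F0.
rewrite -(@integral_indicM_dive Om)//; apply: ereal_sup_ubound => /=; exists phi.
  split; last first.
    move=> x; rewrite /enorm -sqrtr1 ler_sqrt//; apply: le_trans (Fu x).
    by apply: ler_sum => i _; rewrite mxE.
  split; last 1 first.
  - exact: subset_trans sK KOm.
  - move=> j; split=> [x|]; first exact: phid.
    apply: continuous_rV => i; rewrite (_ : (fun _ => _) = dF i j).
      by have [_ _] := F1 i; exact.
    by apply/funext => x; rewrite phiD.
  - by apply: subclosed_compact sK => //; exact: closed_closure.
by apply: eq_integral => x _; congr (_ * _)%:E; apply: eq_bigr => i _; rewrite phiD.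
Qed.

(** Together with [perimeter_ub] this trades the vector fields of the definition for families of
    components with explicit derivatives; afterwards perimeters are estimated only through these two
    bounds. *)
Lemma perimeter_le Om E (M : \bar R) : E `<=` Om ->
  (forall F dF, test_field Om F dF -> (\int[mu]_(x in E) (dive dF x)%:E <= M)%E) ->
  (perimeter E Om <= M)%E.
Proof.
move=> EOm H; apply: ge_ereal_sup => _ [phi [[phi1 cphi phiOm] phib] <-].
pose F i (x : 'rV[R]_m) := phi x 0 i.
pose dF i j (x : 'rV[R]_m) := ('D_(e_ j) phi x) 0 i.
rewrite integral_indicM_dive//.
apply: (H F dF); split.
- move=> i; apply: C1_of_partials => j.
    move=> x; have [/(_ x) d _] := phi1 j.
    have := derive_mx d; rewrite /dF => -> ; rewrite mxE.
    by apply: derivableP; move/derivable_mxP : d => /(_ 0 i).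
  by apply: continuous_rV_coord; have [] := phi1 j.
- move=> x; rewrite -(@ler_sqrt _ _ 1)// sqrtr1; exact: phib.
- exists (closure [set x | phi x != 0]) => // x nx i.
  have [ph0|ph0] := eqVneq (phi x) 0; first by rewrite /F ph0 mxE.
  by case: nx; apply: subset_closure.
Qed.

Lemma test_field0 Om : test_field Om (fun _ => cst 0) (fun _ _ => cst 0).
Proof.
split; first by move=> i; exact: C1_cst.
  by move=> x; rewrite big1// => i _; rewrite expr0n.
by exists set0 => //; split; [exact: compact0|exact: sub0set].
Qed.

Lemma perimeter_ge0 Om E : E `<=` Om -> (0 <= perimeter E Om)%E.
Proof.
move=> EOm; have := perimeter_ub EOm (test_field0 Om); apply: le_trans.
rewrite (eq_integral (fun=> 0%E)) ?integral0// => x _.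
by rewrite /dive big1.
Qed.

(** [fine] sends an infinite perimeter to 0, so the number is meaningful only under
    [finite_perimeter]. *)
Definition Per Om E : R := fine (perimeter E Om).

Definition finite_perimeter Om E :=
  [/\ measurable E, E `<=` Om, (mu E < +oo)%E & (perimeter E Om < +oo)%E].

Lemma PerK Om E : finite_perimeter Om E -> (Per Om E)%:E = perimeter E Om.
Proof.
by case=> _ EOm _ Poo; rewrite /Per fineK// ge0_fin_numE// perimeter_ge0.
Qed.

Lemma Per_ge0 Om E : finite_perimeter Om E -> 0 <= Per Om E.
Proof. by move=> fE; rewrite -lee_fin PerK//; apply: perimeter_ge0; case: fE. Qed.

Lemma Per_ub Om E F dF : finite_perimeter Om E -> test_field Om F dF ->
  \int[mu]_(x in E) dive dF x <= Per Om E.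
Proof.
move=> fE tF; have [mE EOm Eoo _] := fE.
rewrite -lee_fin PerK// /Rintegral fineK; first exact: (perimeter_ub EOm tF).
exact/integrable_fin_num/(test_dive_integrable tF).
Qed.

Lemma perimeter_le_real Om E (M : R) : measurable E -> E `<=` Om -> (mu E < +oo)%E ->
  (forall F dF, test_field Om F dF -> \int[mu]_(x in E) dive dF x <= M) ->
  (perimeter E Om <= M%:E)%E.
Proof.
move=> mE EOm Eoo H; apply: perimeter_le => // F dF tF.
rewrite -[leLHS]fineK; first by rewrite lee_fin; exact: H tF.
exact/integrable_fin_num/(test_dive_integrable tF).
Qed.

Lemma finite_perimeter_le Om E (M : R) : measurable E -> E `<=` Om -> (mu E < +oo)%E ->
  (forall F dF, test_field Om F dF -> \int[mu]_(x in E) dive dF x <= M) ->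
  finite_perimeter Om E /\ Per Om E <= M.
Proof.
move=> mE EOm Eoo H; have PM := perimeter_le_real mE EOm Eoo H.
have fE : finite_perimeter Om E by split => //; exact: le_lt_trans PM (ltry _).
by split=> //; rewrite -lee_fin PerK.
Qed.

Definition scale_field a F : 'I_m -> 'rV[R]_m -> R := fun i x => a x * F i x.
Definition dscale_field a da F dF : 'I_m -> 'I_m -> 'rV[R]_m -> R :=
  fun i j x => a x * dF i j x + F i x * da j x.
Definition add_field F G : 'I_m -> 'rV[R]_m -> R := fun i x => F i x + G i x.
Definition dadd_field dF dG : 'I_m -> 'I_m -> 'rV[R]_m -> R :=
  fun i j x => dF i j x + dG i j x.

Lemma C1field_scale a da F dF : C1 a da -> C1field F dF ->
  C1field (scale_field a F) (dscale_field a da F dF).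
Proof. by move=> a1 F1 i; exact: C1M. Qed.

Lemma C1field_add F dF G dG : C1field F dF -> C1field G dG ->
  C1field (add_field F G) (dadd_field dF dG).
Proof. by move=> F1 G1 i; exact: C1D. Qed.

Lemma dive_scale a da F dF x :
  dive (dscale_field a da F dF) x = a x * dive dF x + \sum_i F i x * da i x.
Proof. by rewrite /dive /dscale_field big_split/= -mulr_sumr. Qed.

Lemma dive_add dF dG x : dive (dadd_field dF dG) x = dive dF x + dive dG x.
Proof. by rewrite /dive big_split. Qed.

Lemma unit_bounded_scale a F : (forall x, `|a x| <= 1) -> unit_bounded F ->
  unit_bounded (scale_field a F).
Proof.
move=> a1 Fu x; apply: le_trans (Fu x); apply: ler_sum => i _.
rewrite exprMn ler_piMl ?sqr_ge0// -real_normK ?num_real//.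
by rewrite expr_le1.
Qed.

Lemma unit_bounded_convex a F G : (forall x, 0 <= a x <= 1) -> unit_bounded F ->
  unit_bounded G ->
  unit_bounded (add_field (scale_field a F) (scale_field (fun x => 1 - a x) G)).
Proof.
move=> a01 Fu Gu x; rewrite /add_field /scale_field.
rewrite (@le_trans _ _ (a x * (\sum_i F i x ^+ 2) + (1 - a x) * (\sum_i G i x ^+ 2)))//.
  rewrite !mulr_sumr -big_split/=; apply: ler_sum => i _.
  have := a01 x; set u := F i x; set v := G i x; set t := a x => t01.
  (* This product is the convexity defect of the square: t u^2 + (1 - t) v^2 - (t u + (1 - t)
     v)^2. *)
  have : 0 <= t * (1 - t) * (u - v) ^+ 2 by rewrite mulr_ge0 ?sqr_ge0// mulr_ge0; lra.
  by nra.
by have := Fu x; have := Gu x; have := a01 x; nra.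
Qed.

Lemma unit_boundedP F i x : unit_bounded F -> `|F i x| <= 1.
Proof.
move=> Fu; rewrite -(@expr_le1 _ 2)// real_normK ?num_real//.
by apply: le_trans (Fu x); rewrite (bigD1 i)//= lerDl sumr_ge0// => j _; exact: sqr_ge0.
Qed.

Lemma cauchy_schwarz_unit (u v : 'I_m -> R) : \sum_i u i ^+ 2 <= 1 -> \sum_i v i ^+ 2 <= 1 ->
  \sum_i u i * v i <= 1.
Proof.
move=> u1 v1.
rewrite (@le_trans _ _ (\sum_i (u i ^+ 2 / 2 + v i ^+ 2 / 2)))//.
  by apply: ler_sum => i _; have := sqr_ge0 (u i - v i); nra.
by rewrite big_split/= -!mulr_suml; lra.
Qed.

Lemma C1_onem a da : C1 a da -> C1 (fun x => 1 - a x) (fun j x => - da j x).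
Proof.
move=> a1; have := C1D (C1_cst _ 1) (C1M (C1_cst _ (-1)) a1).
by congr C1; [apply/funext => x|apply/funext => j; apply/funext => x] => /=; ring.
Qed.

Definition sq (x : 'rV[R]_m) : R := \sum_i x 0 i ^+ 2.

Lemma sq_ge0 x : 0 <= sq x.
Proof. by rewrite sumr_ge0// => i _; exact: sqr_ge0. Qed.

Lemma C1_sq : C1 sq (fun j x => 2 * x 0 j).
Proof.
have := @C1_sum _ _ _ (index_enum 'I_m) _ _ (fun i => C1M (C1_coord R i) (C1_coord R i)).
congr C1; apply/funext => j; apply/funext => x /=.
rewrite (bigD1 j)//= eqxx big1 ?addr0; first by rewrite mulr1; ring.
by move=> i ij; rewrite (negbTE ij) mulr0 addr0.
Qed.

(* Cutoff equal to 1 on the ball of radius M and to 0 off the ball of radius sqrt 2 M. *)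
Definition cutoff (M : R) (x : 'rV[R]_m) : R := step (2 - sq x / M ^+ 2).
Definition dcutoff (M : R) (j : 'I_m) (x : 'rV[R]_m) : R :=
  dstep (2 - sq x / M ^+ 2) * (- (2 * x 0 j) / M ^+ 2).

Lemma C1_cutoff M : C1 (cutoff M) (dcutoff M).
Proof.
have H := C1D (C1_cst _ 2) (C1M (C1_cst _ (- (M ^+ 2)^-1)) C1_sq).
have := C1_outer H (@continuous_dstep R) (@is_derive_step R).
congr C1; [apply/funext => x|apply/funext => j; apply/funext => x] => /=.
  by rewrite /cutoff; congr step; rewrite mulNr mulrC.
rewrite /dcutoff; congr (dstep _ * _); first by rewrite mulNr mulrC.
by rewrite mulr0 addr0 add0r !mulNr mulrC.
Qed.

Lemma cutoff01 M x : 0 <= cutoff M x <= 1.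
Proof. by rewrite step_ge0 step_le1. Qed.

Lemma normr_cutoff M x : `|cutoff M x| <= 1.
Proof. exact: normr_step. Qed.

Lemma normr_dcutoff M j x : 0 < M -> `|dcutoff M j x| <= 8 / M.
Proof.
move=> M0; rewrite /dcutoff; have M20 : 0 < M ^+ 2 by rewrite exprn_gt0.
have [H|H] := boolP ((2 - sq x / M ^+ 2 <= 0) || (1 <= 2 - sq x / M ^+ 2)).
  by rewrite dstep_out// mul0r normr0 divr_ge0// ltW.
move: H; rewrite negb_or -!ltNge => /andP[H _].
(* Where [dstep] does not vanish, |x|^2 < 2 M^2, so each coordinate is at most 2 M and the bound
   becomes 2 times 2 (2 M) / M^2 = 8 / M. *)
have xj : `|x 0 j| <= 2 * M.
  rewrite -(@ler_pXn2r _ 2)//; last by rewrite nnegrE mulr_ge0// ltW.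
  rewrite real_normK ?num_real// (@le_trans _ _ (sq x))//.
    by rewrite /sq (bigD1 j)//= lerDl sumr_ge0// => i _; exact: sqr_ge0.
  move: H; rewrite subr_gt0 ltr_pdivrMr// => /ltW/le_trans; apply.
  by rewrite exprMn ler_wpM2r ?(ltW M20)//; rewrite expr2; lra.
rewrite normrM (@le_trans _ _ (2 * (2 * (2 * M) / M ^+ 2)))//.
  apply: ler_pM => //; first exact: normr_dstep.
  rewrite normrM normfV normrN normrM (ger0_norm (ltW M20)) ger0_norm//.
  by rewrite ler_wpM2r ?invr_ge0 ?(ltW M20)// ler_wpM2l.
by rewrite expr2 invfM !mulrA mulfK ?gt_eqF//; lra.
Qed.

Lemma cutoff_near1 x : \forall k \near \oo, cutoff k%:R x = 1.
Proof.
near=> k; have k0 : 0 < k%:R :> R by rewrite ltr0n; near: k; exact: nbhs_infty_gt.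
suff H : sq x / k%:R ^+ 2 <= 1 by rewrite /cutoff step1//; lra.
rewrite ler_pdivrMr ?exprn_gt0// mul1r.
have k1 : 1 <= k%:R :> R by rewrite (ler_nat _ 1); near: k; exact: nbhs_infty_gt.
rewrite (@le_trans _ _ k%:R)//; last by rewrite expr2 ler_peMl// ltW.
by near: k; exact: nbhs_infty_ger.
Unshelve. all: by end_near. Qed.

Lemma compact_sq_le (c : R) : compact [set x | sq x <= c].
Proof.
apply: bounded_closed_compact.
  exists (Num.max 0 c + 1); split; first exact: num_real.
  move=> N cN x /= xc; rewrite [leLHS]/Num.Def.normr/= mx_normrE.
  have N0 : 0 <= N by rewrite (le_trans _ (ltW cN))// addr_ge0// le_max lexx.
  apply: bigmax_le => // -[i j] _ /=; rewrite [i]ord1.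
  have : x 0 j ^+ 2 <= c.
    by apply: le_trans xc; rewrite /sq (bigD1 j)//= lerDl sumr_ge0// => k _; exact: sqr_ge0.
  have cN' : c + 1 < N by apply: le_lt_trans cN; rewrite lerD2r le_max lexx orbT.
  by rewrite ler_norml => xjc; have := sqr_ge0 (x 0 j - 1); have := sqr_ge0 (x 0 j + 1); nra.
rewrite (_ : [set _ | _] = sq @^-1` [set t | t <= c])//.
apply: closed_comp; last exact: closed_le.
by move=> x _; case: C1_sq => + _ _; exact.
Qed.

Lemma cutoff_out M x : 0 < M -> ~ (sq x <= 2 * M ^+ 2) -> cutoff M x = 0.
Proof.
move=> M0 /negP; rewrite -ltNge => H; rewrite /cutoff step0//.
by rewrite subr_le0 ler_pdivlMr ?exprn_gt0// ltW.
Qed.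

Lemma supp_cutoff M F : 0 < M -> supp_in setT (scale_field (cutoff M) F).
Proof.
move=> M0; exists [set x | sq x <= 2 * M ^+ 2]; first by split => //; exact: compact_sq_le.
by move=> x nx i; rewrite /scale_field cutoff_out// mul0r.
Qed.

End fields.

(** * Translations and the isoperimetric inequality *)

Section measure_helpers.
Context d (T : measurableType d) (R : realType) (mu : {measure set T -> \bar R}).
Implicit Types A B C : set T.

Lemma le_mu A B : measurable A -> measurable B -> A `<=` B -> (mu A <= mu B)%E.
Proof. by move=> mA mB AB; apply: le_measure => //; rewrite inE. Qed.

Lemma mu_lty A B : measurable A -> measurable B -> A `<=` B -> (mu B < +oo)%E ->
  (mu A < +oo)%E.
Proof. by move=> mA mB AB; apply: le_lt_trans; exact: le_mu. Qed.

Lemma null_sub A B : measurable A -> measurable B -> A `<=` B -> mu B = 0%E -> mu A = 0%E.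
Proof. by move=> mA mB AB B0; apply/eqP; rewrite eq_le measure_ge0 -B0 andbT; exact: le_mu. Qed.

Lemma finite_muK A : (mu A < +oo)%E -> (fine (mu A))%:E = mu A.
Proof. by move=> Aoo; rewrite fineK// ge0_fin_numE// measure_ge0. Qed.

Lemma measurableY A B : measurable A -> measurable B -> measurable (A `+` B).
Proof. by move=> mA mB; apply: measurableU; exact: measurableD. Qed.

Lemma le_muU A B : measurable A -> measurable B -> (mu (A `|` B) <= mu A + mu B)%E.
Proof. by move=> mA mB; exact: measureU2. Qed.

Lemma mu_setY_trans A B C : measurable A -> measurable B -> measurable C ->
  (mu (A `+` C) <= mu (A `+` B) + mu (B `+` C))%E.
Proof.
move=> mA mB mC; apply: (@le_trans _ _ (mu ((A `+` B) `|` (B `+` C)))).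
  apply: le_mu; [exact: measurableY|by apply: measurableU; exact: measurableY|].
  move=> x [[Ax nCx]|[Cx nAx]]; have [Bx|nBx] := pselect (B x).
  - by right; left.
  - by left; left.
  - by left; right.
  - by right; right.
by apply: le_muU; exact: measurableY.
Qed.

Lemma setYC A B : A `+` B = B `+` A.
Proof. by rewrite /setY setUC. Qed.

Lemma mu_setY_half A B : measurable A -> measurable B -> (mu A < +oo)%E -> mu A = mu B ->
  mu (A `+` B) = (2%:E * mu (A `\` B))%E.
Proof.
move=> mA mB Aoo AB; have Boo : (mu B < +oo)%E by rewrite -AB.
have mAB : measurable (A `\` B) by exact: measurableD.
have mBA : measurable (B `\` A) by exact: measurableD.
rewrite /setY measureU//; last first.
  by apply/seteqP; split => // x [[Ax nBx] [Bx nAx]].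
have E : mu (B `\` A) = mu (A `\` B).
  by rewrite (measureD mB mA Boo) (measureD mA mB Aoo) setIC; congr (_ - _)%E; exact/esym.
by rewrite mule_natl mule2n; congr (_ + _)%E; exact: E.
Qed.

End measure_helpers.

Section translations.
Variables (R : realType) (m : nat).
Local Notation mu := (lebesgue R m).
Local Notation e_ j := (delta_mx 0 j : 'rV[R]_m).
Implicit Types (E Om A : set 'rV[R]_m) (v : 'rV[R]_m).

Lemma continuous_addr_rV v : continuous (fun x : 'rV[R]_m => x + v).
Proof.
apply: continuous_rV => i.
have [+ _ _] := C1D (C1_coord R i) (C1_cst m (v 0 i)).
by rewrite (_ : (fun x => (x + v) 0 i) = (fun x => x 0 i + cst (v 0 i) x))//; apply/funext => x; rewrite mxE.
Qed.

Lemma Rintegral_translation v A (f : 'rV[R]_m -> R) : measurable A ->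
  measurable_fun setT f -> mu.-integrable A (EFin \o f) ->
  \int[mu]_(x in +%R v @^-1` A) f (v + x) = \int[mu]_(x in A) f x.
Proof.
move=> mA mf fi; have mv := measurable_addr_rV v.
have mT := lebesgue_translation v.
have H B : measurable B -> B `<=` A -> translate_measure mu mv B = mu B.
  by move=> mB _; exact: mT.
rewrite /Rintegral; congr fine.
rewrite -(eq_measure_integral _ H) /translate_measure.
have mEf : measurable_fun setT (EFin \o f) by exact/measurable_EFinP.
rewrite [RHS](@integral_pushforward _ _ _ _ _ _ mv mu A _ mEf)//.
apply/integrableP; split.
  by apply: measurable_funTS; apply/measurable_EFinP; exact: measurableT_comp.
move/integrableP : fi => [_].
rewrite -(eq_measure_integral _ H) ge0_integral_pushforward//.
  by apply: measurableT_comp => //; exact: measurable_funTS.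
Qed.

(** Multiplication by these functions turns a bounded C^1 function into a legal test on [Om], so
    that the whole space and the half-space share one translation argument. *)
Definition exhaustion Om (c : nat -> 'rV[R]_m -> R) (dc : nat -> 'I_m -> 'rV[R]_m -> R) :=
  [/\ forall k, C1 (c k) (dc k), forall k x, 0 <= c k x <= 1,
      forall k, exists2 K, compact K /\ K `<=` Om & forall x, ~ K x -> c k x = 0 &
      forall x, Om x -> c k x @[k --> \oo] --> (1 : R)].

Lemma exhaustion_setT : exhaustion setT (fun k => @cutoff R m k.+1%:R) (fun k => @dcutoff R m k.+1%:R).
Proof.
split.
- by move=> k; exact: C1_cutoff.
- by move=> k x; exact: cutoff01.
- move=> k; exists [set x | sq x <= 2 * k.+1%:R ^+ 2]; first by split => //; exact: compact_sq_le.
  by move=> x; exact: cutoff_out.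
- move=> x _; have [N _ HN] := cutoff_near1 x; apply: cvg_near_cst.
  by exists N => // k Nk; apply: HN => /=; exact: leqW.
Qed.

(** The mean value theorem in the length of the translation: the derivative in t of the integral of
    g(x - t e_j) over [E] is the integral of the divergence of the field - g(x - t e_j) e_j. Its
    support is that of [g] moved along e_j, which stays in [Om] by the stability assumption. *)
Lemma translation_test Om E j (h : R) (g : 'rV[R]_m -> R) dg :
  finite_perimeter Om E -> 0 <= h ->
  (forall x t, 0 <= t -> Om x -> Om (x + t *: e_ j)) ->
  C1 g dg -> (forall x, `|g x| <= 1) ->
  (exists2 K, compact K /\ K `<=` Om & forall x, ~ K x -> g x = 0) ->
  \int[mu]_(x in E) g (- (h *: e_ j) + x) - \int[mu]_(x in E) g x <= h * Per Om E.
Proof.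
move=> fE h0 Oms g1 gb [K [cK KOm] gK].
have [mE EOm Eoo _] := fE; have [gc gd dgc] := g1.
have clK : closed K by apply: compact_closed => //; exact: norm_hausdorff.
pose f (t : R) (x : 'rV[R]_m) := g (x + (- t) *: e_ j).
pose Phi t := \int[mu]_(x in E) f t x.
have [M M0 HM0] := compact_bounded_fun cK (dgc j).
have HM x : `|dg j x| <= M.
  by have [/HM0//|nK] := pselect (K x); rewrite (C1_supp_deriv clK g1 gK nK) normr0.
have fd t x : is_derive t (1 : R) (f ^~ x) (- dg j (x + (- t) *: e_ j)).
  have H := is_derive_line (gd j (x + (- t) *: e_ j)).
  have := @is_derive1_comp R (fun s => g (x + s *: e_ j)) -%R t _ _ H (is_deriveNid t (1 : R)).
  by rewrite mulrN1.
have trc (t : 'rV[R]_m) : continuous (fun x : 'rV[R]_m => x + t).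
  exact: continuous_addr_rV.
have mf t : measurable_fun setT (f t).
  apply: continuous_measurable_rV => x.
  by apply: (@continuous_comp _ _ _ (fun x : 'rV[R]_m => x + (- t) *: e_ j) g); [exact: trc|exact: gc].
have Phid t : is_derive t (1 : R) Phi (\int[mu]_(x in E) - dg j (x + (- t) *: e_ j)).
  have Ia : `]t - 1, t + 1[%classic t by rewrite /= in_itv/=; lra.
  have d1 s x : partial1of2 f s x = - dg j (x + (- s) *: e_ j).
    by rewrite partial1of2E; case: (fd s x).
  have i1 s : `]t - 1, t + 1[%classic s -> mu.-integrable E (EFin \o f s).
    by move=> _; apply: (@bounded_integrable _ _ _ _ _ _ 1) => // x _; exact: gb.
  have i2 (s : R) (y : 'rV[R]_m) : `]t - 1, t + 1[%classic s -> E y -> derivable (f ^~ y) s 1.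
    by move=> _ _; case: (fd s y).
  have i3 : mu.-integrable E (EFin \o (cst M : 'rV[R]_m -> R)).
    by apply: (@bounded_integrable _ _ _ _ _ _ `|M|).
  have i4 s y : `]t - 1, t + 1[%classic s -> E y -> `|partial1of2 f s y| <= cst M y.
    by move=> _ _; rewrite d1 normrN.
  split; first exact: (derivable_under_integral mE Ia i1 i2 (fun=> M0) i3 i4).
  rewrite -derive1E (differentiation_under_integral mE Ia i1 i2 (fun=> M0) i3 i4).
  by apply: eq_Rintegral => x _; rewrite d1.
have Phic : continuous Phi.
  by move=> t; apply/differentiable_continuous/derivable1_diffP; case: (Phid t).
have [c cP cE] := MVT_segment h0 (fun t _ => Phid t) (continuous_subspaceT Phic).
rewrite (_ : \int[mu]_(x in E) g (- (h *: e_ j) + x) = Phi h); last first.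
  by apply: eq_Rintegral => x _; rewrite /f scaleNr addrC.
rewrite (_ : \int[mu]_(x in E) g x = Phi 0); last first.
  by apply: eq_Rintegral => x _; rewrite /f oppr0 scale0r addr0.
rewrite cE subr0 mulrC ler_wpM2l//.
have c0 : 0 <= c by move: cP; rewrite in_itv/= => /andP[].
pose F i (x : 'rV[R]_m) : R := (i == j)%:R * - f c x.
pose dF i k (x : 'rV[R]_m) : R := (i == j)%:R * - dg k (x + (- c) *: e_ j).
have fc1 : C1 (f c) (fun k x => dg k (x + (- c) *: e_ j)).
  apply: C1_of_partials => k; last first.
    by move=> x; apply: (@continuous_comp _ _ _ (fun x : 'rV[R]_m => x + (- c) *: e_ j) (dg k)); [exact: trc|exact: dgc].
  move=> z; apply: is_derive_line0.
  have H : is_derive (z + (- c) *: e_ j + 0 *: e_ k) (e_ k) g (dg k (z + (- c) *: e_ j)).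
    by rewrite scale0r addr0; exact: gd.
  have := is_derive_line H; rewrite (_ : (fun s => _) = (fun s => f c (z + s *: e_ k)))//.
  by apply/funext => s; rewrite /f addrAC.
have tF : test_field Om F dF.
  split.
  - move=> i; have := C1M (C1_cst _ (i == j)%:R) (C1M (C1_cst _ (-1)) fc1).
    by congr C1; [apply/funext => x|apply/funext => k; apply/funext => x];
       rewrite /F /dF/=; ring.
  - move=> x; rewrite (bigD1 j)//= big1 ?addr0.
      by rewrite /F eqxx mul1r sqrrN -real_normK ?num_real// expr_le1// gb.
    by move=> i ij; rewrite /F (negbTE ij) mul0r expr0n.
  - exists ((fun x => x + c *: e_ j) @` K).
      split.
        by apply: continuous_compact => //; apply: continuous_subspaceT; exact: trc.
      by move=> _ [x Kx <-]; apply: Oms => //; exact: KOm.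
    move=> x nKx i; rewrite /F /f gK ?oppr0 ?mulr0// => Kx; apply: nKx.
    by exists (x + - c *: e_ j) => //; rewrite scaleNr subrK.
apply: le_trans (Per_ub fE tF); rewrite le_eqVlt; apply/orP; left; apply/eqP.
apply: eq_Rintegral => x _; rewrite /dive (bigD1 j)//= big1 ?addr0.
  by rewrite /dF eqxx mul1r.
by move=> i ij; rewrite /dF (negbTE ij) mul0r.
Qed.

(** The measure of a symmetric difference is the integral of 1_A - 1_E against its own sign. The
    sign is approximated by a C^1 function, cut off by the exhaustion, and passed to
    [translation_test]. Intersecting with [Om] discards the part of the translate that leaves the
    domain. *)
Lemma translation_estimate Om E c dc j (h : R) :
  finite_perimeter Om E -> exhaustion Om c dc -> measurable Om -> 0 <= h ->
  (forall x t, 0 <= t -> Om x -> Om (x + t *: e_ j)) ->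
  (mu (Om `&` ((+%R (h *: e_ j) @^-1` E) `+` E)) <= (h * Per Om E)%:E)%E.
Proof.
move=> fE [c1 c01 cK cOm] mOm h0 Oms; have [mE EOm Eoo _] := fE.
set v := h *: e_ j; set A := +%R v @^-1` E.
have mA : measurable A by exact: measurable_preimage_addr.
have Aoo : (mu A < +oo)%E by rewrite /A lebesgue_translation.
pose S1 := Om `&` (A `\` E); pose S2 := E `\` A; pose B := A `|` E.
have mS1 : measurable S1 by apply: measurableI => //; exact: measurableD.
have mS2 : measurable S2 by exact: measurableD.
have mB : measurable B by exact: measurableU.
have Boo : (mu B < +oo)%E.
  by apply: (le_lt_trans (le_muU _ mA mE)); rewrite lte_add_pinfty.
have -> : Om `&` (A `+` E) = S1 `|` S2.
  apply/seteqP; split => x; first by move=> [Ox [?|?]]; [left|right].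
  by move=> [[Ox ?]|[Ex nAx]]; [split=> //; left|split; [exact: EOm|right]].
have mX : measurable (S1 `|` S2) by exact: measurableU.
have Xoo : (mu (S1 `|` S2) < +oo)%E.
  by apply: (mu_lty mX mB) => // x [[_ []]|[]]; [left|right].
rewrite -finite_muK// lee_fin.
apply/ler_addgt0Pr => eps eps0.
have e20 : 0 < eps / 2 by rewrite divr_gt0.
have [g1 [dg1 [C1g1 g101 g1e]]] := measurable_smoothable mB Boo mS1 e20.
have [g2 [dg2 [C1g2 g201 g2e]]] := measurable_smoothable mB Boo mS2 e20.
(* In L^1(B) this is close to the sign: 1 on [S1], -1 on [S2], 0 on the rest of [B]. *)
pose gm x := g1 x + -1 * g2 x.
have C1gm := C1D C1g1 (C1M (C1_cst _ (-1)) C1g2).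
have gmb x : `|gm x| <= 1 by rewrite ler_norml /gm; have := g101 x; have := g201 x; lra.
have C1u k := C1M (c1 k) C1gm.
pose u k x := c k x * gm x.
have ub k x : `|u k x| <= 1.
  rewrite normrM mulr_ile1//; have := c01 k x => /andP[? ?].
  by rewrite ger0_norm.
have mu_ k : measurable_fun setT (u k) by exact: C1_measurable (C1u k).
pose w (x : 'rV[R]_m) : R := \1_A x - \1_E x.
have mw : measurable_fun setT w by apply: measurable_funB; exact: measurable_indic.
have wb x : `|w x| <= 1.
  by rewrite /w !indicE; case: (_ \in _); case: (_ \in _); rewrite /= ?mulr1n ?mulr0n ?subrr ?subr0 ?sub0r ?normrN ?normr0 ?normr1.
have step1 k : \int[mu]_(x in B) (w x * u k x) <= h * Per Om E.
  have iu S : measurable S -> (mu S < +oo)%E -> mu.-integrable S (EFin \o u k).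
    by move=> mS Soo; apply: (@bounded_integrable _ _ _ _ _ _ 1).
  have H := translation_test fE h0 Oms (C1u k) (ub k).
  have {}H := H _; apply: le_trans (H _); last first.
    have [K KP K0] := cK k; exists K => // x /K0 ck; by rewrite /= ck mul0r.
  have -> : \int[mu]_(x in E) (c k (- v + x) * (g1 (- v + x) + cst (-1) (- v + x) * g2 (- v + x))) =
      \int[mu]_(x in A) u k x.
    rewrite -(@Rintegral_translation (- v) A)//; last exact: iu.
    congr (Rintegral _ _ _); apply/seteqP; split => x; rewrite /A/= addrA subrr add0r//.
  have EB : B `&` E = E by rewrite setIC setIidl// => x; right.
  have AB : B `&` A = A by rewrite setIC setIidl// => x; left.
  rewrite -[X in _ <= X - _](_ : \int[mu]_(x in B) (\1_A x * u k x) = _); last first.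
    by rewrite Rintegral_indicM// AB.
  rewrite -[X in _ <= _ - X](_ : \int[mu]_(x in B) (\1_E x * u k x) = _); last first.
    by rewrite Rintegral_indicM// EB.
  have ii S : measurable S -> mu.-integrable B (EFin \o (fun x => \1_S x * u k x)).
    move=> mS; apply: (@bounded_integrable _ _ _ _ _ _ 1) => //.
      by apply: measurable_funM => //; exact: measurable_indic.
    move=> x _; rewrite normrM mulr_ile1// indicE.
    by case: (_ \in _); rewrite /= ?normr0 ?normr1.
  rewrite -RintegralB//; [|exact: ii|exact: ii].
  by rewrite le_eqVlt; apply/orP; left; apply/eqP; apply: eq_Rintegral => x _; rewrite -mulrBl.
pose lim_ x := w x * (\1_Om x * gm x).
have mlim : measurable_fun setT lim_.
  apply: measurable_funM => //; apply: measurable_funM; first exact: measurable_indic.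
  exact: C1_measurable C1gm.
have limb x : `|lim_ x| <= 1.
  rewrite normrM mulr_ile1// normrM mulr_ile1// indicE.
  by case: (_ \in _); rewrite /= ?normr0 ?normr1.
have step2 : \int[mu]_(x in B) lim_ x <= h * Per Om E.
  have H : \int[mu]_(x in B) (w x * u k x) @[k --> \oo] --> \int[mu]_(x in B) lim_ x.
    apply: (@Rintegral_cvg _ _ _ _ _ _ _ 1) => //.
    - by move=> k; apply: measurable_funM.
    - by move=> k x _; rewrite normrM mulr_ile1.
    - move=> x _; rewrite /lim_ /u; apply: cvgMr; apply: cvgMl.
      rewrite indicE; have [Ox|nOx] := boolP (x \in Om); first exact: cOm (set_mem Ox).
      apply: cvg_near_cst; apply: nearW => k; have [K [_ KO] K0] := cK k.
      by apply: K0 => /KO /mem_set; rewrite (negbTE nOx).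
  by apply: (cvgr_to_le H); apply: nearW => k; exact: step1.
have i1 := integrable_indic_dist mB Boo mS1 (C1_measurable C1g1) g101.
have i2 := integrable_indic_dist mB Boo mS2 (C1_measurable C1g2) g201.
have il : mu.-integrable B (EFin \o lim_) by apply: (@bounded_integrable _ _ _ _ _ _ 1).
have iX : mu.-integrable B (EFin \o (\1_(S1 `|` S2) : 'rV[R]_m -> R)).
  apply: (@bounded_integrable _ _ _ _ _ _ 1) => // x _; rewrite indicE.
  by case: (_ \in _); rewrite /= ?normr0 ?normr1.
have -> : fine (mu (S1 `|` S2)) = \int[mu]_(x in B) \1_(S1 `|` S2) x.
  rewrite Rintegral_indic//; congr (fine (mu _)); rewrite setIC setIidl//.
  by move=> x [[_ []]|[]]; [left|right].
apply: (@le_trans _ _ (\int[mu]_(x in B) (lim_ x + (`|\1_S1 x - g1 x| + `|\1_S2 x - g2 x|)))).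
  apply: le_Rintegral => //.
    exact: (integrableD mB il (integrableD mB i1 i2)).
  move=> x _; rewrite /lim_ /w /gm !indicE.
  have a1 := g101 x; have a2 := g201 x.
  have [Ax|nAx] := pselect (A x); have [Ex|nEx] := pselect (E x).
  - rewrite (mem_set Ax) (mem_set Ex) [x \in _ `|` _]memNset; last by move=> [[_ []]|[]].
    by rewrite /= subrr mul0r add0r addr_ge0.
  - rewrite (mem_set Ax) (memNset nEx); have [Ox|nOx] := pselect (Om x).
      have S1x : S1 x by [].
      rewrite (mem_set Ox) (mem_set S1x) [x \in S2]memNset; last by move=> [].
      rewrite mem_set; last by left.
      by rewrite /= ?mulr1n ?mulr0n subr0 sub0r normrN !mul1r !ger0_norm; lra.
    rewrite (memNset nOx) [x \in _ `|` _]memNset; last by move=> [[]|[]].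
    by rewrite /= mulr0n mul0r mulr0 add0r addr_ge0.
  - have Ox : Om x by exact: EOm.
    have S2x : S2 x by [].
    rewrite (memNset nAx) (mem_set Ex) (mem_set Ox) (mem_set S2x).
    rewrite [x \in S1]memNset; last by move=> [_ []].
    rewrite mem_set; last by right.
    by rewrite /= ?mulr1n ?mulr0n !sub0r normrN !mul1r !ger0_norm; lra.
  - rewrite (memNset nAx) (memNset nEx) [x \in _ `|` _]memNset; last by move=> [[_ []]|[]].
    by rewrite /= !mulr0n subrr !mul0r add0r addr_ge0.
rewrite RintegralD//; last exact: (integrableD mB i1 i2).
rewrite RintegralD//; apply: lerD => //.
by rewrite (splitr eps); exact: lerD.
Qed.

End translations.

Section isoperimetric.
Variables (R : realType) (m : nat).
Local Notation mu := (lebesgue R m).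
Local Notation e_ j := (delta_mx 0 j : 'rV[R]_m).
Implicit Types (E Om A : set 'rV[R]_m) (v : 'rV[R]_m).

Lemma preimage_addrD v w E : +%R (v + w) @^-1` E = +%R w @^-1` (+%R v @^-1` E).
Proof. by apply/seteqP; split => x /=; rewrite addrA. Qed.

Lemma preimage_addr0 E : +%R 0 @^-1` E = E.
Proof. by apply/seteqP; split => x /=; rewrite add0r. Qed.

Lemma preimage_setY v A E : +%R v @^-1` (A `+` E) = (+%R v @^-1` A) `+` (+%R v @^-1` E).
Proof. by []. Qed.

Lemma mu_shiftY_add v w E : measurable E ->
  (mu ((+%R (v + w) @^-1` E) `+` E) <= mu ((+%R v @^-1` E) `+` E) + mu ((+%R w @^-1` E) `+` E))%E.
Proof.
move=> mE; rewrite preimage_addrD.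
have mv := measurable_preimage_addr v mE; have mw := measurable_preimage_addr w mE.
apply: (le_trans (mu_setY_trans mu (measurable_preimage_addr w mv) mw mE)).
by rewrite -preimage_setY [X in (X + _ <= _)%E]lebesgue_translation//; exact: measurableY.
Qed.

Lemma translation_coord E j (h : R) : finite_perimeter setT E ->
  (mu ((+%R (h *: e_ j) @^-1` E) `+` E) <= (`|h| * Per setT E)%:E)%E.
Proof.
move=> fE; have [mE _ _ _] := fE.
wlog h0 : h / 0 <= h => [H|].
  have [h0|h0] := leP 0 h; first exact: H.
  have Nh0 : 0 <= - h by rewrite oppr_ge0 ltW.
  have := H _ Nh0; rewrite normrN; apply: le_trans.
  have mh := measurable_preimage_addr (h *: e_ j) mE.
  rewrite -(@lebesgue_translation R m (- h *: e_ j) (_ `+` E)); last exact: measurableY.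
  rewrite preimage_setY -preimage_addrD scaleNr subrr.
  by rewrite preimage_addr0 setYC.
rewrite ger0_norm// -[X in mu X]setTI.
by apply: (translation_estimate fE (exhaustion_setT R m)) => //.
Qed.

(** Moving along one coordinate after another produces the l^1 norm of [v], the origin of the
    dimensional factor in [isoperimetric]. *)
Lemma translation_any E v : finite_perimeter setT E ->
  (mu ((+%R v @^-1` E) `+` E) <= ((\sum_i `|v 0 i|) * Per setT E)%:E)%E.
Proof.
move=> fE; have [mE _ _ _] := fE.
rewrite {1}(row_sum_delta v).
elim: (index_enum _) => [|i s IH].
  by rewrite !big_nil mul0r preimage_addr0 /setY setDv setU0 measure0.
rewrite !big_cons; apply: (le_trans (mu_shiftY_add _ _ mE)).
by rewrite mulrDl EFinD; apply: leeD => //; exact: translation_coord.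
Qed.

(** [E] and its translate have equal measure, so each one-sided difference is half of the symmetric
    one. *)
Lemma mu_shiftD E v : finite_perimeter setT E ->
  (mu (E `\` (+%R v @^-1` E)) <= ((\sum_i `|v 0 i|) * Per setT E / 2)%:E)%E.
Proof.
move=> fE; have [mE _ Eoo _] := fE; have mv := measurable_preimage_addr v mE.
have := translation_any v fE; rewrite setYC mu_setY_half//; last exact/esym/lebesgue_translation.
move=> H; rewrite -(@lee_pmul2l _ 2%:E)//; apply: (le_trans H).
by rewrite -EFinM lee_fin [leRHS]mulrC divfK.
Qed.

Lemma measurable_addr2 : measurable_fun setT (fun p : 'rV[R]_m * 'rV[R]_m => p.1 + p.2).
Proof.
apply: measurable_fun_rVP => i.
rewrite (_ : (fun _ => _) = (fun p : 'rV[R]_m * 'rV[R]_m => p.1 0 i + p.2 0 i)); last first.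
  by apply/funext => p; rewrite mxE.
apply: measurable_funD.
  by apply: (@measurableT_comp _ _ _ _ _ _ (fun x : 'rV[R]_m => x 0 i) _ fst) => //; exact: measurable_coordinate.
by apply: (@measurableT_comp _ _ _ _ _ _ (fun x : 'rV[R]_m => x 0 i) _ snd) => //; exact: measurable_coordinate.
Qed.

(* Tonelli applied to the set of pairs (h, x) with h in Q, x in E and x + h not in E. *)
Lemma double_count E (Q : set 'rV[R]_m) (K : R) : measurable E -> measurable Q -> 0 <= K ->
  (forall h, Q h -> (mu (E `\` (+%R h @^-1` E)) <= K%:E)%E) ->
  (\int[mu]_(x in E) mu (Q `\` (+%R x @^-1` E)) <= K%:E * mu Q)%E.
Proof.
move=> mE mQ K0 H.
pose Z : set ('rV[R]_m * 'rV[R]_m) := (Q `*` E) `\` ((fun p => p.1 + p.2) @^-1` E).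
have mZ : measurable Z.
  apply: measurableD; first exact: measurableX.
  by rewrite -[X in measurable X]setTI; exact: measurable_addr2.
have := @indic_fubini_tonelli _ _ _ _ R mu mu Z mZ.
rewrite indic_fubini_tonelli_FE// indic_fubini_tonelli_GE// => E12.
have E2 : (\int[mu]_(x in E) mu (Q `\` (+%R x @^-1` E)) = \int[mu]_x (mu \o ysection Z) x)%E.
  rewrite integral_mkcond; apply: eq_integral => x _; rewrite patchE /=.
  case: ifPn => xE.
    congr (mu _); apply/seteqP; split => h; rewrite /ysection/= inE /Z/=.
      by move=> [Qh nE]; split; [split=> //; exact: set_mem|rewrite addrC].
    by move=> [[Qh _]]; rewrite addrC.
  rewrite (_ : ysection Z x = set0) ?measure0//; apply/seteqP; split => // h.
  by rewrite /ysection/= inE /Z/= => -[[_ /mem_set]]; rewrite (negbTE xE).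
rewrite E2 -E12 -integral_cst//.
rewrite [leRHS]integral_mkcond; apply: ge0_le_integral => //=.
- exact: measurable_fun_xsection.
- have mK : measurable_fun Q (fun=> K%:E : \bar R) by exact: measurable_cst.
  exact: (measurable_restrictT _ mQ).1 mK.
- move=> h _; rewrite patchE; case: ifPn => hQ.
    apply: le_trans (H h (set_mem hQ)).
    rewrite (_ : xsection Z h = E `\` (+%R h @^-1` E))//.
    apply/seteqP; split => x; rewrite /xsection/= inE /Z/=.
      by move=> [[]].
    by move=> [Ex nE]; split=> //; split=> //; exact: set_mem.
  rewrite (_ : xsection Z h = set0) ?measure0//; apply/seteqP; split => // x.
  by rewrite /xsection/= inE /Z/= => -[[/mem_set]]; rewrite (negbTE hQ).
Qed.

Lemma cube_shift_bound E (W : R) : finite_perimeter setT E -> 0 <= W ->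
  (\int[mu]_(x in E) mu (@cube R m W `\` (+%R x @^-1` E)) <=
    ((m%:R * W * Per setT E / 2) * (2 * W) ^+ m)%:E)%E.
Proof.
move=> fE W0; have [mE _ _ _] := fE; have P0 := Per_ge0 fE.
rewrite EFinM -lebesgue_cube//.
apply: double_count => //; first exact: measurable_cube.
  by rewrite divr_ge0// !mulr_ge0.
move=> h hW; apply: (le_trans (mu_shiftD h fE)); rewrite lee_fin.
rewrite ler_pM2r// ler_wpM2r// (le_trans (ler_sum _ (_ : forall i, _ -> _ <= W)))//.
  by move=> i _; move: (hW i); rewrite in_itv/= -ltr_norml => /ltW.
by rewrite sumr_const card_ord -[leLHS]mulr_natl.
Qed.

(** [W] is the side of the cube with the volume of [E]. From any point of [E], at least (2 W)^m -
    W^m of the shifts in the cube of half-side [W] lead out of [E], since those that stay land in a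
    set of measure W^m. Integrating over [E] and using [cube_shift_bound] leaves W^m <= m W P. *)
Lemma isoperimetric E (W : R) : (0 < m)%N -> finite_perimeter setT E -> 0 < W ->
  mu E = (W ^+ m)%:E -> W ^+ m.-1 <= m%:R * Per setT E.
Proof.
move=> m0 fE W0 EW; have [mE _ Eoo _] := fE; have P0 := Per_ge0 fE.
have W00 : 0 <= W by exact: ltW.
have H := cube_shift_bound fE W00.
pose q : R := (2 * W) ^+ m - W ^+ m.
have q0 : 0 <= q by rewrite subr_ge0 ler_pXn2r ?nnegrE ?mulr_ge0//; lra.
have {}H : (q%:E * mu E <= (m%:R * W * Per setT E / 2 * (2 * W) ^+ m)%:E)%E.
  apply: le_trans H; rewrite -integral_cst//.
  pose f x := mu (@cube R m W `\` (+%R x @^-1` E)).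
  have mD x : measurable (@cube R m W `\` (+%R x @^-1` E)).
    by apply: measurableD; [exact: measurable_cube|exact: measurable_preimage_addr].
  apply: ge0_le_integral => //=.
  - have mZ : measurable ((setT `*` @cube R m W) `\` ((fun p : 'rV[R]_m * 'rV[R]_m => p.1 + p.2) @^-1` E)).
      apply: measurableD; first by apply: measurableX => //; exact: measurable_cube.
      by rewrite -[X in measurable X]setTI; exact: measurable_addr2.
    rewrite (_ : (fun x => _) = mu \o xsection ((setT `*` @cube R m W) `\` ((fun p : 'rV[R]_m * 'rV[R]_m => p.1 + p.2) @^-1` E))).
      exact/measurable_funTS/measurable_fun_xsection.
    apply/funext => x /=; congr (mu _); apply/seteqP; split => h; rewrite /xsection/= inE/=.
      by move=> [? ?].
    by move=> [[]].
  - move=> x _; have mx := measurable_preimage_addr x mE.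
    have cW : mu (cube W) = ((2 * W) ^+ m)%:E by rewrite lebesgue_cube.
    rewrite measureD//; [|exact: measurable_cube|by rewrite [X in (X < _)%E]cW ltry].
    rewrite [X in (_ <= X - _)%E]cW /q EFinB leeB// -EW -(@lebesgue_translation R m x E)//.
    by apply: le_mu => //; apply: measurableI => //; exact: measurable_cube.
move: H; rewrite EW -EFinM lee_fin /q exprMn => H.
have Wm0 : 0 < W ^+ m by exact: exprn_gt0.
(* Gives 2^m - 1 >= 2^m / 2, after which the powers of 2 cancel. *)
have twom : 2 <= 2 ^+ m :> R.
  by rewrite -[leLHS]expr1 ler_eXn2l// ltr1n.
have {}H : (2 ^+ m - 1) * W ^+ m <= m%:R * W * Per setT E / 2 * 2 ^+ m.
  by rewrite -(ler_pM2r Wm0) mulrBl mul1r -[leRHS]mulrA.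
have {}H : W ^+ m <= m%:R * W * Per setT E.
  have : 2 ^+ m / 2 * W ^+ m <= 2 ^+ m / 2 * (m%:R * W * Per setT E).
    apply: le_trans (le_trans H _); last by rewrite le_eqVlt; apply/orP; left; apply/eqP; ring.
    by apply: ler_wpM2r; [exact: ltW|move: twom; set p := 2 ^+ m; lra].
  by rewrite ler_pM2l// divr_gt0// exprn_gt0.
by rewrite -(ler_pM2l W0) -exprS prednK// mulrCA mulrA.
Qed.

End isoperimetric.

(** * Compactness of sets of bounded perimeter *)

Section compactness.
Variables (R : realType) (m : nat).
Local Notation mu := (lebesgue R m).
Implicit Types (E F : set 'rV[R]_m).

Section grid.
Variables (N : nat) (M : R).
Hypotheses (N0 : (0 < N)%N) (M0 : 0 < M).

Let l : R := 2 * M / N%:R.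

Let l0 : 0 < l.
Proof. by rewrite divr_gt0 ?mulr_gt0// ltr0n. Qed.

Definition cell (c : {ffun 'I_m -> 'I_N}) : set 'rV[R]_m :=
  [set x | forall i, x 0 i \in `[(- M + l * (c i)%:R), (- M + l * (c i)%:R + l)[].

Definition half_open_box : set 'rV[R]_m := [set x | forall i, x 0 i \in `[- M, M[].

Lemma measurable_cell c : measurable (cell c).
Proof. by apply: (measurable_box (A := fun i => [set` _])) => i; exact: measurable_itv. Qed.

Lemma mu_cell c : mu (cell c) = (l ^+ m)%:E.
Proof. exact: (@lebesgue_itv_box R m (fun i => - M + l * (c i)%:R) l (ltW l0) true true). Qed.

Lemma cell_cover x : half_open_box x -> exists c, cell c x.
Proof.
move=> xM; pose k (i : 'I_m) := Num.trunc ((x 0 i + M) / l).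
have kP i : (k i < N)%N /\ x 0 i \in `[(- M + l * (k i)%:R), (- M + l * (k i)%:R + l)[.
  move: (xM i); rewrite in_itv/= => /andP[x1 x2].
  have y0 : 0 <= (x 0 i + M) / l by rewrite divr_ge0 ?(ltW l0)//; lra.
  have /andP[t1 t2] := Num.Theory.truncn_itv y0.
  move: t1 t2; rewrite ler_pdivlMr// ltr_pdivrMr// -/(k i) -[(k i).+1%:R]natr1 mulrDl mul1r => t1 t2.
  split; last by rewrite in_itv/= ![l * _]mulrC; lra.
  rewrite -(@ltr_nat R) -(ltr_pM2r l0) (le_lt_trans t1)//.
  by rewrite /l mulrC divfK ?gt_eqF ?ltr0n//; lra.
exists [ffun i => Ordinal (proj1 (kP i))] => i; rewrite ffunE.
by case: (kP i).
Qed.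

Lemma cell_inj c c' x : cell c x -> cell c' x -> c = c'.
Proof.
move=> xc xc'; apply/ffunP => i; apply: val_inj => /=.
move: (xc i) (xc' i); rewrite !in_itv/= => /andP[a1 a2] /andP[b1 b2].
apply/eqP; rewrite eqn_leq; apply/andP; split; rewrite -ltnS -(@ltr_nat R);
  by rewrite -[_.+1%:R]natr1 -(ltr_pM2l l0) mulrDr mulr1; lra.
Qed.

(** If x lies in [E] and in a cell, every point of that cell outside [E] is x + h with h in the cube
    of half-side [l]. The products are thus dominated by the double count of [cube_shift_bound]: a
    Poincare inequality on the grid. *)
Lemma sum_cells E (P : R) : finite_perimeter setT E -> Per setT E <= P ->
  \sum_c fine (mu (E `&` cell c)) * fine (mu (cell c `\` E)) <=
    m%:R * l * P / 2 * (2 * l) ^+ m.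
Proof.
move=> fE EP; have [mE _ Eoo _] := fE.
have mc := measurable_cell.
have mEc c : measurable (E `&` cell c) by exact: measurableI.
have mcE c : measurable (cell c `\` E) by exact: measurableD.
have coo c : (mu (cell c) < +oo)%E by rewrite mu_cell ltry.
rewrite (@le_trans _ _ (m%:R * l * Per setT E / 2 * (2 * l) ^+ m))//; last first.
  apply: ler_wpM2r; first by rewrite exprn_ge0// mulr_ge0// ltW.
  by rewrite ler_pM2r// ler_wpM2l// mulr_ge0// ltW.
rewrite -lee_fin; apply: le_trans (cube_shift_bound fE (ltW l0)).
pose f c (x : 'rV[R]_m) : \bar R := ((fine (mu (cell c `\` E)))%:E * (\1_(cell c) x)%:E)%E.
have mf c : measurable_fun setT (f c).
  by apply: emeasurable_funM => //; apply/measurable_EFinP; exact: measurable_indic.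
have f0 c x : (0 <= f c x)%E by rewrite mule_ge0// lee_fin fine_ge0.
have -> : ((\sum_c fine (mu (E `&` cell c)) * fine (mu (cell c `\` E)))%:E =
    \int[mu]_(x in E) \sum_c f c x)%E.
  rewrite ge0_integral_sum//; last by move=> c; exact: measurable_funTS.
  rewrite -sumEFin; apply: eq_bigr => c _.
  have mi : measurable_fun E (fun x => (\1_(cell c) x)%:E : \bar R).
    by apply/measurable_EFinP; apply: measurable_funTS; exact: measurable_indic.
  rewrite ge0_integralZl//; last by rewrite lee_fin fine_ge0.
  rewrite integral_indic// setIC [RHS]muleC EFinM; congr (_ * _)%E.
  by rewrite finite_muK//; apply: mu_lty Eoo => //; apply: measurableI.
apply: ge0_le_integral => //.
- by move=> x _; apply: sume_ge0.
- apply: measurable_funTS; exact: emeasurable_sum.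
- have mZ : measurable ((setT `*` @cube R m l) `\` ((fun p : 'rV[R]_m * 'rV[R]_m => p.1 + p.2) @^-1` E)).
    apply: measurableD; first by apply: measurableX => //; exact: measurable_cube.
    by rewrite -[X in measurable X]setTI; exact: measurable_addr2.
  rewrite (_ : (fun x => _) = mu \o xsection ((setT `*` @cube R m l) `\` ((fun p : 'rV[R]_m * 'rV[R]_m => p.1 + p.2) @^-1` E))).
    exact/measurable_funTS/measurable_fun_xsection.
  apply/funext => x /=; congr (mu _); apply/seteqP; split => h; rewrite /xsection/= inE/=.
    by move=> [? ?].
  by move=> [[]].
- move=> x Ex; have [[c xc]|nc] := pselect (exists c, cell c x); last first.
    by rewrite big1// => c _; rewrite /f indicE memNset ?mule0// => xc; apply: nc; exists c.
  rewrite (bigD1 c)//= big1 ?adde0; last first.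
    move=> c' cc'; rewrite /f indicE memNset ?mule0// => xc'.
    by move: cc'; rewrite (cell_inj xc xc') eqxx.
  rewrite /f indicE mem_set// mule1 finite_muK; last by apply: mu_lty (coo c) => // y [].
  apply: (@le_trans _ _ (mu (+%R x @^-1` (cell c `\` E)))); first by rewrite lebesgue_translation.
  apply: le_mu.
  + exact: measurable_preimage_addr.
  + by apply: measurableD; [exact: measurable_cube|exact: measurable_preimage_addr].
  + move=> h [/= hc nE]; split=> // i; move: (hc i) (xc i).
    by rewrite !in_itv/= mxE; lra.
Qed.

(** A fingerprint of [E] on the grid; it takes finitely many values, which is what total boundedness
    asks for. *)
Definition majority E : {ffun {ffun 'I_m -> 'I_N} -> bool} :=
  [ffun c => l ^+ m / 2 <= fine (mu (E `&` cell c))].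

Definition minority E c := if majority E c then cell c `\` E else E `&` cell c.

(** In each cell the larger of the two parts has measure at least l^m / 2, so the smaller one is at
    most 2 / l^m times the product summed in [sum_cells]. *)
Lemma minority_bound E (P : R) : finite_perimeter setT E -> Per setT E <= P ->
  \sum_c fine (mu (minority E c)) <= 2 ^+ m * m%:R * l * P.
Proof.
move=> fE EP; have := sum_cells fE EP; have [mE _ Eoo _] := fE.
have mc := measurable_cell.
have mEc c : measurable (E `&` cell c) by exact: measurableI.
have mcE c : measurable (cell c `\` E) by exact: measurableD.
have coo c : (mu (cell c) < +oo)%E by rewrite mu_cell ltry.
have lm : 0 < l ^+ m by exact: exprn_gt0.
have a0 c : 0 <= fine (mu (E `&` cell c)) by rewrite fine_ge0.
have b0 c : 0 <= fine (mu (cell c `\` E)) by rewrite fine_ge0.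
have ab c : fine (mu (E `&` cell c)) + fine (mu (cell c `\` E)) = l ^+ m.
  apply: EFin_inj; rewrite EFinD finite_muK; last by apply: mu_lty (coo c) => // y [].
  rewrite finite_muK; last by apply: mu_lty (coo c) => // y [].
  by rewrite -(mu_cell c) [in RHS](measureDI mu (mc c) mE) addeC setIC.
move=> H; rewrite -(ler_pM2r (divr_gt0 lm (@ltr0n R 2))).
apply: le_trans (le_trans _ H) _; last first.
  rewrite exprMn le_eqVlt; apply/orP; left; apply/eqP; ring.
rewrite mulr_suml; apply: ler_sum => c _; rewrite /minority ffunE.
have := ab c; have := a0 c; have := b0 c.
case: ifPn; move: lm; move: (l ^+ m) (fine (mu (E `&` _))) (fine (mu (_ `\` _))) => L a b L0.
  by move=> *; nra.
by rewrite -ltNge => *; nra.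
Qed.

(** Inside a cell, sets with the same fingerprint can differ only within their two minority
    parts. *)
Lemma same_majority E F (P : R) : E `<=` half_open_box -> F `<=` half_open_box ->
  finite_perimeter setT E -> finite_perimeter setT F ->
  Per setT E <= P -> Per setT F <= P -> majority E = majority F ->
  (mu (E `+` F) <= (2 * (2 ^+ m * m%:R * l * P))%:E)%E.
Proof.
move=> EB FB fE fF EP FP EF; have [mE _ Eoo _] := fE; have [mF _ Foo _] := fF.
have mmin G c : measurable G -> measurable (minority G c).
  by move=> mG; rewrite /minority; case: ifP => _; [apply: measurableD|apply: measurableI] => //; exact: measurable_cell.
have coo c : (mu (cell c) < +oo)%E by rewrite mu_cell ltry.
have moo G c : measurable G -> (mu (minority G c) < +oo)%E.
  move=> mG; apply: (mu_lty (mmin G c mG) (measurable_cell c)); last exact: coo.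
  by move=> x; rewrite /minority; case: ifP => _ [].
pose U := \big[setU/set0]_c (minority E c `|` minority F c).
have mU : measurable U by apply: bigsetU_measurable => ? _; apply: measurableU; exact: mmin.
apply: (@le_trans _ _ (mu U)).
  apply: le_mu => //; first exact: measurableY.
  move=> x EFx; have [c xc] : exists c, cell c x.
    by apply: cell_cover; case: EFx => -[+ _]; [exact: EB|exact: FB].
  rewrite /U (bigD1 c)//=; left; rewrite /minority -EF.
  case: EFx => -[Gx nGx]; case: ifP => _.
  - by right; split.
  - by left; split.
  - by left; split.
  - by right; split.
apply: (@le_trans _ _ (\sum_c (mu (minority E c) + mu (minority F c)))%E).
  rewrite /U; elim: (index_enum _) => [|c s IH]; first by rewrite !big_nil measure0.
  rewrite !big_cons; apply: le_trans (leeD (le_muU _ (mmin E c mE) (mmin F c mF)) IH).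
  apply: le_muU; first by apply: measurableU; exact: mmin.
  by apply: bigsetU_measurable => ? _; apply: measurableU; exact: mmin.
rewrite big_split/= mulr_natl mulr2n EFinD.
have H G : finite_perimeter setT G -> Per setT G <= P ->
    (\sum_c mu (minority G c) <= (2 ^+ m * m%:R * l * P)%:E)%E.
  move=> fG GP; rewrite (eq_bigr (fun c => (fine (mu (minority G c)))%:E)).
    by rewrite sumEFin lee_fin; exact: minority_bound.
  by move=> c _; rewrite finite_muK//; apply: moo; case: fG.
by apply: leeD; exact: H.
Qed.

End grid.

Lemma totally_bounded_perimeter (M P e : R) : 0 < M -> 0 < e ->
  exists (X : finType) (cl : set 'rV[R]_m -> X), forall E F,
  E `<=` half_open_box M -> F `<=` half_open_box M ->
  finite_perimeter setT E -> finite_perimeter setT F ->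
  Per setT E <= P -> Per setT F <= P -> cl E = cl F -> (mu (E `+` F) <= e%:E)%E.
Proof.
move=> M0 e0; pose C : R := 2 * (2 ^+ m * m%:R * (2 * M) * `|P|) + 1.
have C0 : 0 < C by rewrite ltr_wpDl// !mulr_ge0// ?exprn_ge0// ltW.
pose N := (Num.bound (C / e)).+1.
exists {ffun {ffun 'I_m -> 'I_N} -> bool}, (@majority N M) => E F EB FB fE fF EP FP EF.
apply: (le_trans (same_majority (ltn0Sn _) M0 EB FB fE fF EP FP EF)).
rewrite lee_fin -/N.
have N0 : 0 < N%:R :> R by rewrite ltr0n.
have CN : C / e < N%:R.
  have := archi_boundP (ltW (divr_gt0 C0 e0)); move/lt_trans; apply.
  by rewrite ltr_nat.
rewrite (_ : 2 * _ = (2 * (2 ^+ m * m%:R * (2 * M) * P)) / N%:R); last by ring.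
rewrite ler_pdivrMr// (@le_trans _ _ C)//; last by move: CN; rewrite ltr_pdivrMr// mulrC => /ltW.
rewrite /C (le_trans _ (_ : 2 * (2 ^+ m * m%:R * (2 * M) * `|P|) <= _))//; last by rewrite lerDl.
by rewrite ler_pM2l// ler_wpM2l ?ler_norm// !mulr_ge0// ?exprn_ge0// ltW.
Qed.

(** An ultrafilter on the indices selects one fingerprint class at all scales 2^-i simultaneously; a
    diagonal choice makes consecutive differences summable. The limit is the upper limit of these
    sets, an explicit set that inherits inclusions exactly and not only up to null sets, which keeps
    the constraint and the box. *)
Lemma perimeter_compactness (E_ : nat -> set 'rV[R]_m) (M P : R) : 0 < M ->
  (forall k, E_ k `<=` half_open_box M) -> (forall k, finite_perimeter setT (E_ k)) ->
  (forall k, Per setT (E_ k) <= P) ->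
  exists E, [/\ measurable E, E `<=` \bigcup_k E_ k, \bigcap_k E_ k `<=` E &
    forall (e : R) (K : nat), 0 < e -> exists2 k, (K <= k)%N & (mu (E `+` E_ k) <= e%:E)%E].
Proof.
move=> M0 EB fE EP.
have mE k : measurable (E_ k) by case: (fE k).
have [U [UF Uoo]] := ultraFilterLemma eventually_filter.
have PU := @ultra_proper _ U UF.
have /choice[S HS] : forall i : nat, exists Si : set nat, U Si /\
    forall k k', Si k -> Si k' -> (mu (E_ k `+` E_ k') <= ((2 ^ i)%:R^-1)%:E)%E.
  move=> i.
  have e0 : 0 < (2 ^ i)%:R^-1 :> R by rewrite invr_gt0 ltr0n expn_gt0.
  have [X [cl clP]] := totally_bounded_perimeter P M0 e0.
  have [[x Ux]|nU] := pselect (exists x : X, U [set k | cl (E_ k) = x]).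
    by exists [set k | cl (E_ k) = x]; split => // k k' /= kx k'x; apply: clP => //; rewrite kx.
  have : U [set k | forall x : X, cl (E_ k) <> x].
    apply: (@filter_forall _ _ (fun x k => cl (E_ k) <> x) U) => x.
    by have [Ux|//] := in_ultra_setVsetC [set k | cl (E_ k) = x] UF; exfalso; apply: nU; exists x.
  by move/(@filter_ex _ U _) => [k /(_ (cl (E_ k)))].
have /choice[kk Hkk] : forall j : nat, exists k : nat, (j <= k)%N /\ forall i, (i <= j)%N -> S i k.
  move=> j.
  have : U [set k | (j <= k)%N /\ forall i : 'I_j.+1, S i k].
    apply: filterI; first by apply: Uoo; exists j.
    by apply: filter_forall => i; case: (HS i).
  move/(@filter_ex _ U _) => [k [jk Sk]]; exists k; split => // i ij.
  exact: (Sk (Ordinal (ij : (i < j.+1)%N))).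
pose F j := E_ (kk j).
have FF i : (mu (F i `+` F i.+1) <= ((2 ^ i)%:R^-1)%:E)%E.
  have [_ HSi] := HS i; apply: HSi; [exact: (Hkk i).2|exact: (Hkk i.+1).2 i (leqnSn i)].
exists (lim_sup_set F); split.
- apply: bigcapT_measurable => n; apply: bigcup_measurable => j _; exact: mE.
- by move=> x /(_ 0%N I) [j _ Fx]; exists (kk j).
- by move=> x Ex n _; exists n => //=; exact: Ex.
move=> e K e0.
have [j Kj je] : exists2 j, (K <= j)%N & 2 / (2 ^ j)%:R <= e.
  pose j := (maxn K (Num.bound (2 / e))); exists j; first exact: leq_maxl.
  rewrite ler_pdivrMr ?ltr0n ?expn_gt0// mulrC -ler_pdivrMr//.
  have := archi_boundP (ltW (divr_gt0 (@ltr0n R 2) e0)); move/ltW/le_trans; apply.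
  by rewrite ler_nat (leq_trans (leq_maxr K _))// ltnW// ltn_expl.
exists (kk j); first by apply: leq_trans (Hkk j).1.
apply: (@le_trans _ _ (2 / (2 ^ j)%:R)%:E); last by rewrite lee_fin.
pose X i := F (i + j)%N `+` F (i + j).+1.
have mX i : measurable (X i) by apply: measurableY; exact: mE.
have mlim : measurable (lim_sup_set F).
  by apply: bigcapT_measurable => n; apply: bigcup_measurable => i _; exact: mE.
apply: (le_trans (measure_sigma_subadditive mu mX (measurableY mlim (mE (kk j))) _)).
  move=> x Hx; apply: contrapT => nX.
  (* Outside all consecutive differences from [j] on, membership in [F i] no longer changes, hence
     agrees with membership in the upper limit. *)
  have const i : F (i + j)%N x <-> F j x.
    elim: i => // i IH; rewrite addSn -IH; split => H; apply: contrapT => nH; apply: nX; exists i => //.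
      by right.
    by left.
  case: Hx => -[H1 H2].
    have [i /= ji Fi] := H1 j I; apply: H2.
    by rewrite -(subnK ji) in Fi; move/const: Fi.
  apply: H2 => i _; exists (i + j)%N; first by rewrite /= leq_addr.
  exact/const.
apply: le_trans (epsilon_trick0 xpredT (_ : 0 <= 2 / (2 ^ j)%:R)); last first.
  by rewrite divr_ge0.
apply: lee_nneseries => [i _ _|i _]; first exact: measure_ge0.
apply: (le_trans (FF _)); rewrite lee_fin expnD expnS !natrM.
rewrite le_eqVlt; apply/orP; left; apply/eqP.
by field; rewrite ?pnatr_eq0 -?lt0n ?expn_gt0.
Qed.

End compactness.

(** * Density points *)

Section density.
Variables (R : realType) (m : nat).
Local Notation mu := (lebesgue R m).
Implicit Types (E F S : set 'rV[R]_m) (x y : 'rV[R]_m).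

Lemma mu_ball x (r : R) : 0 < r -> mu (ball x r) = ((2 * r) ^+ m)%:E.
Proof.
move=> r0; rewrite ball_rVE// -(@lebesgue_itv_box R m (fun i => x 0 i - r) (2 * r) _ false true).
  congr (mu _); apply/seteqP; split => y H i; move: (H i); rewrite !in_itv/=; lra.
by rewrite mulr_ge0// ltW.
Qed.

Lemma nbhs_cube x (M : R) : cube M x -> nbhs x (cube M).
Proof.
move=> xM; apply: (filter_forall (nbhs_filter x)) => i.
apply: open_nbhs_nbhs; split; last exact: xM.
apply: (@open_comp _ _ (fun y : 'rV[R]_m => y 0 i) [set t | t \in `]- M, M[]).
  by move=> y _; case: (C1_coord R i) => + _ _; exact.
exact: interval_open.
Qed.

Section covering.
Variables (u : 'rV[R]_m -> \bar R) (K : \bar R).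
Hypotheses (mu_u : measurable_fun setT u) (u0 : forall x, (0 <= u x)%E) (K0 : (0 <= K)%E).

Definition balls (s : seq ('rV[R]_m * R)) : set 'rV[R]_m :=
  \big[setU/set0]_(b <- s) ball b.1 b.2.

Lemma ballsP s x : balls s x <-> exists2 b, b \in s & ball b.1 b.2 x.
Proof.
rewrite /balls; elim: s => [|b s IH]; first by rewrite big_nil; split => // -[].
rewrite big_cons; split => [[bx|/IH[c cs cx]]|[c]].
- by exists b => //; rewrite inE eqxx.
- by exists c => //; rewrite inE cs orbT.
- by rewrite inE => /orP[/eqP -> cx|cs cx]; [left|right; apply/IH; exists c].
Qed.

Lemma measurable_balls s : measurable (balls s).
Proof. by apply: bigsetU_measurable => b _; exact: measurable_ball_rV. Qed.

Lemma max_radius (s : seq ('rV[R]_m * R)) : s != [::] ->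
  exists2 b, b \in s & forall c, c \in s -> c.2 <= b.2.
Proof.
elim: s => // b [|b' s] IH _.
  by exists b; rewrite ?inE// => c; rewrite inE => /eqP ->.
have [c cs cmax] := IH isT.
have [bc|cb] := leP b.2 c.2.
  exists c; first by rewrite inE cs orbT.
  by move=> d; rewrite inE => /orP[/eqP ->//|]; exact: cmax.
exists b; first by rewrite inE eqxx.
move=> d; rewrite inE => /orP[/eqP ->//|ds].
exact: le_trans (cmax d ds) (ltW cb).
Qed.

(* Greedy selection: a ball of largest radius absorbs, after tripling, all the balls it meets. *)
Lemma finite_covering s :
  (forall b, b \in s -> 0 < b.2 /\ (mu (ball b.1 (3 * b.2)) <= K * \int[mu]_(x in ball b.1 b.2) u x)%E) ->
  (mu (balls s) <= K * \int[mu]_(x in balls s) u x)%E.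
Proof.
have [n] := ubnP (size s); elim: n s => // n IH s sn H.
have [->|s0] := eqVneq s [::].
  by rewrite /balls big_nil measure0 integral_set0 mule0.
have [b bs bmax] := max_radius s0; have [b0 bK] := H b bs.
pose p (c : 'rV[R]_m * R) := `[< ball c.1 c.2 `&` ball b.1 b.2 = set0 >].
pose s' := [seq c <- s | p c].
have s's c : c \in s' -> c \in s by rewrite mem_filter => /andP[].
have nb : b \notin s'.
  rewrite mem_filter bs andbT; apply/asboolP; rewrite setIid => /seteqP[+ _].
  by move=> /(_ b.1 (ballxx _ b0)).
have sn' : (size s' < n)%N.
  apply: leq_trans (sn : (size s <= n)%N) => //.
  rewrite size_filter -(count_predC p s) -[ltnLHS]addn0 ltn_add2l -has_count.
  by apply/hasP; exists b => //=; move: nb; rewrite mem_filter bs andbT.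
have {}IH := IH s' sn' (fun c cs' => H c (s's c cs')).
have mb := @measurable_ball_rV R m.
have cover : balls s `<=` ball b.1 (3 * b.2) `|` balls s'.
  move=> x /ballsP[c cs cx]; have [pc|/asboolP npc] := boolP (p c).
    by right; apply/ballsP; exists c => //; rewrite mem_filter pc.
  left; have /set0P[y [cy by_]] : ball c.1 c.2 `&` ball b.1 b.2 != set0 by apply/eqP.
  have cb := bmax c cs.
  have cy' : ball c.1 b.2 y by exact: le_ball cb _ cy.
  have cx' : ball c.1 b.2 x by exact: le_ball cb _ cx.
  rewrite (_ : 3 * b.2 = b.2 + (b.2 + b.2)); last by ring.
  apply: ball_triangle by_ _; apply: ball_triangle cx'; exact: ball_sym.
have mU : measurable (ball b.1 (3 * b.2) `|` balls s') by apply: measurableU; [exact: mb|exact: measurable_balls].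
apply: (@le_trans _ _ (mu (ball b.1 (3 * b.2) `|` balls s'))).
  exact: le_mu (measurable_balls s) mU cover.
apply: (le_trans (le_muU mu (mb _ _) (measurable_balls s'))).
apply: (le_trans (leeD bK IH)).
have mB : measurable (ball b.1 b.2 : set 'rV[R]_m) by exact: mb.
have mB' : measurable (balls s') by exact: measurable_balls.
have dis : [disjoint ball b.1 b.2 & balls s'].
  apply/disj_setPRL => x /ballsP[c]; rewrite mem_filter => /andP[/asboolP pc _] cx bx.
  by have : (ball c.1 c.2 `&` ball b.1 b.2) x by []; rewrite pc.
have mS u' : measurable_fun (u' : set 'rV[R]_m) u by exact: measurable_funTS.
rewrite -ge0_muleDr; [|exact: integral_ge0|exact: integral_ge0].
rewrite -(@ge0_integral_setU _ _ _ mu _ _ mB mB' _ (mS _) (fun x _ => u0 x) dis).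
apply: lee_wpmul2l => //.
apply: (@ge0_subset_integral _ _ _ mu _ _ (measurableU _ _ mB mB') (measurable_balls s) _ (mS _) (fun x _ => u0 x)).
move=> x [bx|/ballsP[c cs cx]]; apply/ballsP; first by exists b.
by exists c => //; exact: s's.
Qed.

End covering.

(** The covering argument is applied to rational balls, of which there are countably many, so that
    [G] is an increasing union of finite unions and is measurable. The constant 12 is 2 from radius
    to side, 3 from the tripling, and 2 from a rational radius below 2 r. *)
Lemma maximal_inequality (u : 'rV[R]_m -> \bar R) (lam : R) : 0 < lam ->
  measurable_fun setT u -> (forall x, (0 <= u x)%E) ->
  exists G, [/\ measurable G,
    (forall x r, 0 < r -> ((lam * r ^+ m)%:E < \int[mu]_(y in ball x r) u y)%E -> G x) &
    (mu G <= (12 ^+ m / lam)%:E * \int[mu]_x u x)%E].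
Proof.
move=> lam0 mu_u u0; pose K : \bar R := (12 ^+ m / lam)%:E.
have K0 : (0 <= K)%E by rewrite lee_fin divr_ge0 ?exprn_ge0// ltW.
pose tob (i : 'rV[rat]_m * rat) : 'rV[R]_m * R := (ratrV R i.1, ratr i.2).
pose good (i : 'rV[rat]_m * rat) := `[< 0 < (tob i).2 /\
  (mu (ball (tob i).1 (3 * (tob i).2)) <= K * \int[mu]_(x in ball (tob i).1 (tob i).2) u x)%E >].
pose s N := [seq tob i | i <- [seq i <- pmap (@unpickle _) (iota 0 N) | good i]].
have mG N : measurable (balls (s N)) by exact: measurable_balls.
have GN N : (mu (balls (s N)) <= K * \int[mu]_x u x)%E.
  apply: (le_trans (finite_covering mu_u u0 K0 _)).
    by move=> b /mapP[i]; rewrite mem_filter => /andP[/asboolP gi _ ->].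
  apply: (lee_wpmul2l K0).
  exact: (@ge0_subset_integral _ _ _ mu _ _ (mG N) measurableT _ mu_u (fun x _ => u0 x) (@subsetT _ _)).
have sub N N' : (N <= N')%N -> balls (s N) `<=` balls (s N').
  move=> NN' x /ballsP[b /mapP[i]]; rewrite mem_filter mem_pmap => /andP[gi /mapP[k kN ki]] -> bx.
  apply/ballsP; exists (tob i) => //; apply/mapP; exists i => //.
  rewrite mem_filter gi mem_pmap; apply/mapP; exists k => //.
  by move: kN; rewrite !mem_iota/= !add0n => /leq_trans; exact.
exists (\bigcup_N balls (s N)); split.
- exact: bigcupT_measurable.
- move=> x r r0 H; have r20 : 0 < r / 2 by rewrite divr_gt0.
  have [q qx] := rat_rV_near x r20.
  (* A radius above 3 r / 2 makes the ball around [q], which is within r / 2 of x, contain the ball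
     of radius r around x. *)
  have [p pr] : exists p : rat, ratr p \in `](3 * r / 2), (2 * r)[ by apply: rat_in_itvoo; lra.
  move: pr; rewrite in_itv/= => /andP[p1 p2].
  have p0 : 0 < ratr p :> R by lra.
  have xb : ball x r `<=` ball (ratrV R q) (ratr p).
    move=> y xy; apply: (@le_ball _ _ _ (r / 2 + r)); first lra.
    exact: ball_triangle qx xy.
  have gi : good (q, p).
    have p30 : 0 < 3 * ratr p :> R by lra.
    apply/asboolP; split => //=; rewrite mu_ball//.
    apply: (@le_trans _ _ (K * (lam * r ^+ m)%:E)%E); last first.
      apply: (lee_wpmul2l K0); apply: (le_trans (ltW H)).
      exact: (@ge0_subset_integral _ _ _ mu _ _ (measurable_ball_rV _ _) (measurable_ball_rV _ _)
        _ (measurable_funTS mu_u) (fun x _ => u0 x) xb).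
    rewrite -EFinM lee_fin [leRHS]mulrA divfK ?gt_eqF// -exprMn.
    by apply: lerXn2r; rewrite ?nnegrE; lra.
  exists (pickle (q, p)).+1 => //.
  apply/ballsP; exists (tob (q, p)).
    apply/mapP; exists (q, p) => //; rewrite mem_filter gi mem_pmap; apply/mapP.
    exists (pickle (q, p)); last by rewrite pickleK.
    by rewrite mem_iota leq0n add0n ltnSn.
  by apply: xb; exact: ballxx.
- have mono : {homo (fun N => balls (s N)) : N N' / (N <= N')%N >-> (N <= N')%O}.
    by move=> N N' NN'; apply/subsetPset; exact: sub.
  apply: (cvge_to_le (nondecreasing_cvg_mu mG (bigcupT_measurable _ mG) mono)).
  by apply: nearW => N; exact: GN.
Qed.

Lemma negligible_le (Z : set 'rV[R]_m) (C : R) :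
  (forall e : R, 0 < e -> exists G, [/\ measurable G, Z `<=` G & (mu G <= (C * e)%:E)%E]) ->
  mu.-negligible Z.
Proof.
move=> H; have /choice[G HG] : forall k : nat, exists G, [/\ measurable G, Z `<=` G &
    (mu G <= (C * k.+1%:R^-1)%:E)%E] by move=> k; apply: H; rewrite invr_gt0.
have mG : measurable (\bigcap_k G k) by apply: bigcapT_measurable => k; case: (HG k).
exists (\bigcap_k G k); split => //; last by move=> x Zx k _; case: (HG k) => _ + _; exact.
apply/eqP; rewrite eq_le measure_ge0 andbT; apply/lee_addgt0Pr => e e0; rewrite add0e.
pose k := Num.bound (`|C| / e).
have := archi_boundP (divr_ge0 (normr_ge0 C) (ltW e0)); rewrite -/k => Ck.
have [mGk _ Gk] := HG k; apply: (le_trans (le_mu mu mG mGk _)); first by move=> x; exact.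
apply: (le_trans Gk); rewrite lee_fin ler_pdivrMr//.
apply: (le_trans (ler_norm C)); move: Ck; rewrite ltr_pdivrMr// mulrC => /ltW/le_trans; apply.
by rewrite ler_wpM2l ?(ltW e0)// ler_nat.
Qed.

(** Approximate the indicator of [S] in L^1 by a C^1 function g. Off the set [G1] where the maximal
    function of |1_S - g| is large and the set [G2] where |1_S - g| itself is large, a point outside
    [S] has g small around it, so [S] has little mass in small balls. Both exceptional sets have
    measure of order e, for every e. *)
Lemma density_zero S : measurable S ->
  {ae mu, forall x, ~ S x -> fine (mu (S `&` ball x r)) / r ^+ m @[r --> 0^'+] --> (0 : R)}.
Proof.
move=> mS.
pose Z (k : nat) : set 'rV[R]_m := [set x | [/\ ~ S x, cube k%:R x &
  forall d : R, 0 < d -> exists r, [/\ 0 < r, r < d & r ^+ m / k.+1%:R < fine (mu (S `&` ball x r))]]].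
suff HZ k : mu.-negligible (Z k).
  have : mu.-negligible (\bigcup_k Z k) by exact: negligible_bigcup.
  apply: negligibleS => x /=; rewrite -existsNE => -[nSx].
  have [[e e0 He]|H] := pselect (exists2 e : R, 0 < e & forall d : R, 0 < d ->
      exists r, [/\ 0 < r, r < d & e < fine (mu (S `&` ball x r)) / r ^+ m]); last first.
    case; apply/cvgrPdist_le => e e0.
    have [d d0 Hd] : exists2 d : R, 0 < d & forall r, 0 < r -> r < d -> fine (mu (S `&` ball x r)) / r ^+ m <= e.
      apply: contrapT => nd; apply: H; exists e => // d d0; apply: contrapT => nr; apply: nd.
      by exists d => // r r0 rd; rewrite leNgt; apply/negP => er; apply: nr; exists r.
    near=> r; have r0 : 0 < r by [].
    rewrite sub0r normrN ger0_norm; last by rewrite divr_ge0 ?fine_ge0// exprn_ge0// ltW.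
    by apply: Hd => //; near: r; exact: nbhs_right_lt.
  move=> _; have [M [M0 xM]] : exists M : R, 0 <= M /\ forall i, `|x 0 i| <= M.
    exists (\sum_i `|x 0 i|); split; first exact: sumr_ge0.
    by move=> i; rewrite (bigD1 i)//= lerDl sumr_ge0.
  pose k := maxn (Num.bound M) (Num.bound e^-1).
  exists k => //; split => //.
    move=> i; rewrite in_itv/= -ltr_norml (le_lt_trans (xM i))// (lt_le_trans (archi_boundP M0))//.
    by rewrite ler_nat leq_maxl.
  move=> d /He[r [r0 rd er]]; exists r; split => //; apply: le_lt_trans (_ : e * r ^+ m < _).
    rewrite mulrC ler_pM2r ?exprn_gt0// invf_ple ?posrE//.
    rewrite (le_trans (ltW (archi_boundP _)))//; first by rewrite invr_ge0 ltW.
    by rewrite ler_nat (leq_trans (leq_maxr (Num.bound M) _))// leqnSn.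
  by rewrite -ltr_pdivlMr ?exprn_gt0.
pose c : R := k.+1%:R^-1; have c0 : 0 < c by rewrite invr_gt0.
(* The two error terms lam r^m and 2 tau (2 r)^m add up to exactly c r^m. *)
pose lam := c / 2; have lam0 : 0 < lam by rewrite divr_gt0.
pose tau := c / (4 * 2 ^+ m); have tau0 : 0 < tau by rewrite divr_gt0// mulr_gt0// exprn_gt0.
apply: (@negligible_le (Z k) (12 ^+ m / lam + tau^-1)) => e e0.
have mB := @measurable_cube R m k%:R.
have Boo : (mu (@cube R m k%:R) < +oo)%E by rewrite lebesgue_cube// ltry.
have [g [dg [g1 g01 ge]]] := measurable_smoothable mB Boo mS e0.
have mg := C1_measurable g1.
pose v x : R := `|\1_S x - g x|.
have mv : measurable_fun setT v.
  by apply: measurableT_comp => //; apply: measurable_funB => //; exact: measurable_indic.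
pose u x : \bar R := (\1_(@cube R m k%:R) x * v x)%:E.
have mu_u : measurable_fun setT u.
  by apply/measurable_EFinP; apply: measurable_funM => //; exact: measurable_indic.
have u0 x : (0 <= u x)%E by rewrite /u lee_fin; apply: mulr_ge0; [rewrite indicE|exact: normr_ge0].
have ue : (\int[mu]_x u x <= e%:E)%E.
  rewrite -[leLHS]fineK.
    rewrite lee_fin; apply: le_trans ge; rewrite le_eqVlt; apply/orP; left; apply/eqP.
    by rewrite -[LHS]/(\int[mu]_(x in setT) (\1_(@cube R m k%:R) x * v x)) Rintegral_indicM// setTI.
  rewrite (_ : \int[mu]_x u x = \int[mu]_(x in @cube R m k%:R) (v x)%:E)%E.
    by apply: integrable_fin_num => //; exact: (integrable_indic_dist mB Boo mS mg g01).
  rewrite [RHS]integral_mkcond; apply: eq_integral => x _; rewrite patchE /u indicE.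
  by case: ifPn => _; rewrite ?mul1r ?mul0r.
have [G1 [mG1 G1P G1e]] := maximal_inequality lam0 mu_u u0.
pose G2 : set 'rV[R]_m := [set x | (tau%:E <= u x)%E].
have mG2 : measurable G2.
  rewrite (_ : G2 = setT `&` u @^-1` [set` `[tau%:E, +oo[]); last first.
    by rewrite setTI; apply/seteqP; split => x; rewrite /G2/= in_itv/= andbT.
  by apply: mu_u => //; exact: emeasurable_itv.
have G2e : (mu G2 <= (tau^-1 * e)%:E)%E.
  rewrite -(@lee_pmul2l _ tau%:E)// -EFinM mulrA divff ?gt_eqF// mul1r.
  apply: le_trans ue; rewrite -integral_cst// [leLHS]integral_mkcond.
  apply: ge0_le_integral => //=.
  - by move=> x _; rewrite patchE; case: ifPn => // _; rewrite lee_fin ltW.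
  - have mK : measurable_fun G2 (fun=> tau%:E : \bar R) by exact: measurable_cst.
    exact: (measurable_restrictT _ mG2).1 mK.
  - by move=> x _; rewrite patchE; case: ifPn => // /set_mem.
exists (G1 `|` G2); split; first exact: measurableU.
  move=> x [nSx xk Hx]; apply: contrapT => /not_orP[nG1 nG2].
  have ux : g x < tau.
    move: nG2; rewrite /G2/= /u /v indicE mem_set// indicE memNset//= mul1r sub0r normrN.
    have /andP[gx0 _] := g01 x.
    by rewrite ger0_norm// lee_fin => /negP; rewrite -ltNge.
  have [d1 d10 Hd1] : exists2 d : R, 0 < d & ball x d `<=` cube k%:R.
    have : nbhs x (@cube R m k%:R) by exact: nbhs_cube.
    by move=> /nbhs_ballP[d /= d0 Hd]; exists d.
  have [d2 d20 Hd2] : exists2 d : R, 0 < d & forall y, ball x d y -> g y < g x + tau.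
    have [gc _ _] := g1.
    have /(@cvgrPdist_lt _ R^o _ (nbhs x) (nbhs_filter x))/(_ tau tau0) := gc x.
    move=> /nbhs_ballP[d /= d0 Hd]; exists d => // y /Hd /=.
    by rewrite ltr_norml; lra.
  have d120 : 0 < Num.min d1 d2 by rewrite lt_min d10 d20.
  have [r [r0 rd Hr]] := Hx _ d120.
  have rd1 : r < d1 by rewrite (lt_le_trans rd)// ge_min lexx.
  have rd2 : r < d2 by rewrite (lt_le_trans rd)// ge_min lexx orbT.
  have mb := measurable_ball_rV x r.
  have boo : (mu (ball x r) < +oo)%E by rewrite mu_ball// ltry.
  have K1 : (\int[mu]_(y in ball x r) u y <= (lam * r ^+ m)%:E)%E.
    by rewrite leNgt; apply/negP => /(G1P x r r0).
  have K2 : (mu (S `&` ball x r) <= \int[mu]_(y in ball x r) (u y + (2 * tau)%:E))%E.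
    rewrite -integral_indic//; apply: ge0_le_integral => //.
    - by apply/measurable_EFinP; apply: measurable_funTS; exact: measurable_indic.
    - by apply: measurable_funTS; apply: emeasurable_funD.
    - move=> y yb; rewrite /u /v !indicE (mem_set (Hd1 _ (le_ball (ltW rd1) yb))) mul1r -EFinD lee_fin.
      have gy := Hd2 _ (le_ball (ltW rd2) yb).
      have [yS|yS] := boolP (y \in S); last by rewrite addr_ge0// mulr_ge0// ltW.
      have : g y + `|1 - g y| >= 1 by have := ler_norm (1 - g y); lra.
      by rewrite /=; lra.
  have tau2 : (0 <= (2 * tau)%:E)%E by rewrite lee_fin mulr_ge0// ltW.
  rewrite (ge0_integralD mu mb (fun y _ => u0 y) (measurable_funTS mu_u) (fun y _ => tau2) (measurable_cst _)) in K2.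
  rewrite integral_cst// [X in (_ + _ * X)%E]mu_ball// in K2.
  have : (mu (S `&` ball x r) <= (r ^+ m / k.+1%:R)%:E)%E.
    apply: (le_trans K2); apply: (le_trans (leeD K1 (lexx _))).
    rewrite -EFinM -EFinD lee_fin /lam /tau -/c exprMn.
    rewrite le_eqVlt; apply/orP; left; apply/eqP.
    by field; rewrite ?expf_neq0.
  rewrite -(@finite_muK _ _ _ mu (S `&` ball x r)); last first.
    by apply: (mu_lty (measurableI _ _ mS mb) mb _ boo) => y [].
  by rewrite lee_fin leNgt Hr.
apply: (le_trans (le_muU _ mG1 mG2)); rewrite mulrDl EFinD; apply: leeD => //.
by apply: (le_trans G1e); rewrite [leRHS]EFinM; apply: lee_wpmul2l => //; rewrite lee_fin divr_ge0 ?exprn_ge0// ltW.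
Unshelve. all: by end_near. Qed.

End density.

(** * Density-one representatives *)

Section density_one_sets.
Variables (R : realType) (m : nat).
Local Notation mu := (lebesgue R m).
Implicit Types (E F G S B : set 'rV[R]_m) (x y : 'rV[R]_m) (r : R).

Lemma enormE x : enorm x = Num.sqrt (sq x).
Proof. by []. Qed.

Lemma enorm_ge0 x : 0 <= enorm x.
Proof. exact: sqrtr_ge0. Qed.

Lemma enorm_coord x i : `|x 0 i| <= enorm x.
Proof.
rewrite -sqrtr_sqr ler_sqrt ?sq_ge0//.
by rewrite (bigD1 i)//= lerDl sumr_ge0// => j _; exact: sqr_ge0.
Qed.

Lemma enorm_le_sum x : enorm x <= \sum_i `|x 0 i|.
Proof.
have s0 (I : Type) (s : seq I) (f : I -> R) : 0 <= \sum_(i <- s) `|f i| by exact: sumr_ge0.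
rewrite -[leRHS]ger0_norm ?s0// -sqrtr_sqr ler_sqrt ?sqr_ge0//.
elim: (index_enum _) => [|i s IH]; first by rewrite !big_nil expr0n.
rewrite !big_cons -real_normK ?num_real//.
have := s0 _ s (x 0); have := normr_ge0 (x 0 i).
move: IH; move: (\sum_(j <- s) x 0 j ^+ 2) (\sum_(j <- s) `|x 0 j|) `|x 0 i| => a b c.
by nra.
Qed.

Lemma eballE x r : 0 < r -> eball x r = [set y | sq (y - x) < r ^+ 2].
Proof.
move=> r0; apply/seteqP; split => y; rewrite /eball/= enormE => H.
  rewrite -(sqr_sqrtr (sq_ge0 (y - x))).
  by rewrite ltr_pXn2r// nnegrE ?sqrtr_ge0// ltW.
by rewrite -(@ltr_pXn2r _ 2) ?nnegrE ?sqrtr_ge0 ?(ltW r0)// sqr_sqrtr// sq_ge0.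
Qed.

Lemma eball_le0 x r : r <= 0 -> eball x r = set0.
Proof.
move=> r0; apply/seteqP; split => // y; rewrite /eball/= => H.
by have := enorm_ge0 (y - x); lra.
Qed.

Lemma continuous_sq_sub x : continuous (fun y : 'rV[R]_m => sq (y - x)).
Proof.
move=> y; apply: (@continuous_comp _ _ _ (fun y => y - x) (@sq R m)).
  exact: continuous_addr_rV.
by case: (@C1_sq R m) => + _ _; exact.
Qed.

Lemma open_eball x r : open (eball x r).
Proof.
have [r0|r0] := leP r 0; first by rewrite eball_le0//; exact: open0.
rewrite eballE//; apply: (@open_comp _ _ (fun y : 'rV[R]_m => sq (y - x)) [set t | t < r ^+ 2]).
  by move=> y _; exact: continuous_sq_sub.
exact: open_lt.
Qed.

Lemma measurable_eball x r : measurable (eball x r).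
Proof. by apply: open_measurable_rV; exact: open_eball. Qed.

Lemma eball_sub_ball x r : eball x r `<=` ball x r.
Proof.
have [r0|r0] := leP r 0; first by rewrite eball_le0.
move=> y xy; apply/rV_ballP => // i.
have := enorm_coord (y - x) i; rewrite !mxE distrC => /le_lt_trans; apply; exact: xy.
Qed.

(** Dividing by m + 1 rather than m keeps the inequality strict and covers dimension 0. *)
Lemma ball_sub_eball x r : 0 < r -> ball x (r / m.+1%:R) `<=` eball x r.
Proof.
move=> r0 y /rV_ballP H; rewrite /eball/= (le_lt_trans (enorm_le_sum _))//.
have d0 : 0 < r / m.+1%:R by rewrite divr_gt0.
rewrite (@le_lt_trans _ _ (\sum_(i < m) r / m.+1%:R))//.
  by apply: ler_sum => i _; rewrite !mxE distrC ltW// H.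
rewrite sumr_const card_ord -[ltLHS]mulr_natr mulrAC ltr_pdivrMr// ltr_pM2l//.
by rewrite ltr_nat ltnSn.
Qed.

Lemma mu_eball_lty x r : (mu (eball x r) < +oo)%E.
Proof.
have [r0|r0] := leP r 0; first by rewrite eball_le0// measure0.
apply: (mu_lty (measurable_eball x r) (measurable_ball_rV x r) (@eball_sub_ball x r)).
by rewrite [X in (X < _)%E]mu_ball// ltry.
Qed.

Lemma mu_eball_ge x r : 0 < r -> (2 / m.+1%:R) ^+ m * r ^+ m <= fine (mu (eball x r)).
Proof.
move=> r0; have d0 : 0 < r / m.+1%:R by rewrite divr_gt0.
rewrite -lee_fin finite_muK ?mu_eball_lty//.
rewrite (_ : _%:E = mu (ball x (r / m.+1%:R))); last first.
  by rewrite mu_ball// -exprMn; congr (_ ^+ _)%:E; rewrite mulrA mulrAC.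
exact: le_mu (measurable_ball_rV _ _) (measurable_eball _ _) (ball_sub_eball r0).
Qed.

Lemma mu_eball_gt0 x r : 0 < r -> 0 < fine (mu (eball x r)).
Proof.
move=> r0; apply: lt_le_trans (mu_eball_ge x r0).
by rewrite mulr_gt0// exprn_gt0// divr_gt0.
Qed.

Definition ratio S x r : R := fine (mu (S `&` eball x r)) / fine (mu (eball x r)).

Lemma ratio_ge0 S x r : 0 <= ratio S x r.
Proof. by rewrite divr_ge0 ?fine_ge0. Qed.

Lemma mu_capI_lty S x r : measurable S -> (mu (S `&` eball x r) < +oo)%E.
Proof.
move=> mS; apply: (mu_lty _ (measurable_eball x r) _ (mu_eball_lty x r)).
  by apply: measurableI => //; exact: measurable_eball.
by move=> y [].
Qed.

Lemma le_ratio S F x r : measurable S -> measurable F ->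
  (mu (S `&` eball x r) <= mu (F `&` eball x r))%E -> ratio S x r <= ratio F x r.
Proof.
move=> mS mF H; rewrite ler_wpM2r ?invr_ge0 ?fine_ge0//.
by apply: fine_le => //; rewrite ge0_fin_numE// mu_capI_lty.
Qed.

Lemma ratio_le1 S x r : measurable S -> ratio S x r <= 1.
Proof.
move=> mS; have [r0|r0] := leP r 0.
  by rewrite /ratio eball_le0// setI0 measure0 mul0r.
rewrite ler_pdivrMr ?mu_eball_gt0// mul1r.
apply: fine_le; rewrite ?ge0_fin_numE ?mu_capI_lty ?mu_eball_lty//.
apply: le_mu; [|exact: measurable_eball|by move=> y []].
by apply: measurableI => //; exact: measurable_eball.
Qed.

Lemma ratioC S x r : measurable S -> 0 < r -> ratio S x r = 1 - ratio (~` S) x r.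
Proof.
move=> mS r0; have b0 := mu_eball_gt0 x r0; have mb := measurable_eball x r.
have E : fine (mu (eball x r)) = fine (mu (S `&` eball x r)) + fine (mu (~` S `&` eball x r)).
  apply: EFin_inj; rewrite EFinD !finite_muK ?mu_eball_lty ?mu_capI_lty//; last exact: measurableC.
  by rewrite [LHS](measureDI mu mb mS) addeC setIC setDE [_ `&` ~` S]setIC.
by rewrite /ratio -[in X in X - _](@divff _ (fine (mu (eball x r)))) ?gt_eqF// -mulrBl {2}E addrK.
Qed.

Lemma eq_ratio S F x r : mu (S `\` F) = 0%E -> mu (F `\` S) = 0%E ->
  measurable S -> measurable F -> ratio S x r = ratio F x r.
Proof.
move=> SF FS mS mF; have mb := measurable_eball x r.
suff H A B : measurable A -> measurable B -> mu (A `\` B) = 0%E -> ratio A x r <= ratio B x r.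
  by apply/eqP; rewrite eq_le !H.
move=> mA mB AB; apply: le_ratio => //.
have mAb : measurable (A `&` eball x r) by exact: measurableI.
have mBb : measurable (B `&` eball x r) by exact: measurableI.
have mAB : measurable (A `\` B) by exact: measurableD.
apply: (@le_trans _ _ (mu ((B `&` eball x r) `|` (A `\` B)))).
  apply: le_mu => //; first exact: measurableU.
  by move=> y [Ay by_]; have [By|nBy] := pselect (B y); [left|right].
by apply: (le_trans (le_muU _ mBb mAB)); rewrite [X in (_ + X)%E]AB adde0.
Qed.

Lemma density_oneE S x : density_one S x = (ratio S x r @[r --> 0^'+] --> (1 : R)).
Proof. by []. Qed.

Lemma eq_density_one S F : mu (S `\` F) = 0%E -> mu (F `\` S) = 0%E ->
  measurable S -> measurable F -> density_one S = density_one F.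
Proof.
move=> SF FS mS mF; apply/seteqP; split => x; rewrite !density_oneE;
  by rewrite (_ : ratio S x = ratio F x)//; apply/funext => r; exact: eq_ratio.
Qed.

(** [density_zero] speaks of sup-norm balls; a Euclidean ball lies in the one of equal radius and
    has at least a fixed multiple of r^m as measure, so the limit 0 transfers. *)
Lemma ratio_zero_ae S : measurable S ->
  {ae mu, forall x, ~ S x -> ratio S x r @[r --> 0^'+] --> (0 : R)}.
Proof.
move=> mS; have := density_zero mS; apply: filterS => x H /H {}H.
pose c : R := (2 / m.+1%:R) ^+ m.
have c0 : 0 < c by rewrite exprn_gt0// divr_gt0.
have : c^-1 * (fine (mu (S `&` ball x r)) / r ^+ m) @[r --> 0^'+] --> c^-1 * 0.
  by apply: cvgMr.
rewrite mulr0; apply: squeeze_cvgr (cvg_cst 0); near=> r.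
have r0 : 0 < r by [].
rewrite ratio_ge0/= /ratio ler_pdivrMr ?mu_eball_gt0//.
have mb := measurable_ball_rV x r.
have boo : (mu (S `&` ball x r) < +oo)%E.
  apply: (mu_lty (measurableI _ _ mS mb) mb); first by move=> y [].
  by rewrite [X in (X < _)%E]mu_ball// ltry.
apply: (@le_trans _ _ (fine (mu (S `&` ball x r)))).
  apply: fine_le; rewrite ?ge0_fin_numE ?mu_capI_lty//.
  apply: le_mu; [by apply: measurableI => //; exact: measurable_eball|exact: measurableI|].
  by move=> y [Sy /eball_sub_ball].
rewrite [leRHS](_ : _ = (c^-1 * (r ^+ m)^-1 * fine (mu (eball x r))) * fine (mu (S `&` ball x r))); last by ring.
rewrite ler_peMl ?fine_ge0// -invfM mulrC ler_pdivlMr ?mulr_gt0 ?exprn_gt0// mul1r.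
exact: mu_eball_ge.
Unshelve. all: by end_near. Qed.

Lemma ratio_one_ae S : measurable S ->
  {ae mu, forall x, S x -> ratio S x r @[r --> 0^'+] --> (1 : R)}.
Proof.
move=> mS; have := ratio_zero_ae (measurableC mS); apply: filterS => x H Sx.
have : 1 - ratio (~` S) x r @[r --> 0^'+] --> (1 - 0 : R).
  by apply: cvgB; [exact: cvg_cst|apply: H => /=; exact].
rewrite subr0; apply: cvg_trans; apply: near_eq_cvg; near=> r.
have r0 : 0 < r by [].
by rewrite /= (ratioC x mS r0).
Unshelve. all: by end_near. Qed.

(** Prepares the measurability of [density_one]: two quantifiers range over naturals, and the one
    over radii is reduced to rationals by [eball_left_continuous]. *)
Lemma density_one_near S x : measurable S -> density_one S x <->
  forall k : nat, exists j : nat, forall r, 0 < r -> r < j.+1%:R^-1 -> 1 - k.+1%:R^-1 <= ratio S x r.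
Proof.
move=> mS; rewrite density_oneE; split => [H k|H].
  have k0 : 0 < k.+1%:R^-1 :> R by rewrite invr_gt0.
  move/cvgrPdist_le : H => /(_ _ k0)[d /= d0 Hd].
  exists (Num.bound d^-1) => r r0 rd.
  have : `|1 - ratio S x r| <= k.+1%:R^-1.
    apply: Hd => //=; rewrite sub0r normrN gtr0_norm// (lt_le_trans rd)//.
    rewrite invf_ple ?posrE// (le_trans (ltW (archi_boundP _)))//; first by rewrite invr_ge0 ltW.
    by rewrite ler_nat.
  by rewrite ler_norml; move: (k.+1%:R^-1) (ratio S x r) => a b; lra.
apply/cvgrPdist_le => e e0; have [j Hj] := H (Num.bound e^-1).
near=> r; have r0 : 0 < r by [].
have rj : r < j.+1%:R^-1 by near: r; apply: nbhs_right_lt; rewrite invr_gt0.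
rewrite ger0_norm ?subr_ge0 ?ratio_le1//.
have := Hj r r0 rj; suff : (Num.bound e^-1).+1%:R^-1 <= e.
  by move: (_.+1%:R^-1) (ratio S x r) => a b; lra.
rewrite invf_ple ?posrE// (le_trans (ltW (archi_boundP _)))//; first by rewrite invr_ge0 ltW.
by rewrite ler_nat.
Unshelve. all: by end_near. Qed.

Lemma measurable_ratio S r : measurable S -> measurable_fun setT (ratio S ^~ r).
Proof.
move=> mS.
have H T : measurable T -> measurable_fun setT (fun x => fine (mu (T `&` eball x r))).
  move=> mT; have [r0|r0] := leP r 0.
    rewrite (_ : (fun _ => _) = cst 0); first exact: measurable_cst.
    by apply/funext => x; rewrite eball_le0// setI0 measure0.
  pose Z : set ('rV[R]_m * 'rV[R]_m) := (setT `*` T) `&` ((fun p => sq (p.2 - p.1)) @^-1` `]-oo, r ^+ 2[).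
  have msub : measurable_fun setT (fun p : 'rV[R]_m * 'rV[R]_m => p.2 - p.1).
    apply: measurable_fun_rVP => i.
    rewrite (_ : (fun _ => _) = (fun p : 'rV[R]_m * 'rV[R]_m => p.2 0 i - p.1 0 i)); last first.
      by apply/funext => p; rewrite !mxE.
    apply: measurable_funB.
      by apply: (@measurableT_comp _ _ _ _ _ _ (fun x : 'rV[R]_m => x 0 i) _ snd) => //; exact: measurable_coordinate.
    by apply: (@measurableT_comp _ _ _ _ _ _ (fun x : 'rV[R]_m => x 0 i) _ fst) => //; exact: measurable_coordinate.
  have msq : measurable_fun setT (@sq R m) by exact: C1_measurable (@C1_sq R m).
  have mZ : measurable Z.
    apply: measurableI; first exact: measurableX.
    rewrite -[X in measurable X]setTI.
    by apply: (measurableT_comp msq msub) => //; exact: measurable_itv.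
  apply: measurableT_comp => //.
  rewrite (_ : (fun _ => _) = mu \o xsection Z); first exact: measurable_fun_xsection.
  apply/funext => x /=; congr (mu _); rewrite eballE//.
  apply/seteqP; split => y; rewrite /xsection/= inE /Z/= in_itv/=.
    by move=> [Ty yx]; split.
  by move=> [[_ Ty] yx].
rewrite (_ : ratio S ^~ r = (fun x => fine (mu (S `&` eball x r)) * (fine (mu (eball 0 r)))^-1)).
  by apply: measurable_funM => //; exact: H.
apply/funext => x; rewrite /ratio; congr (_ / fine _).
rewrite -(lebesgue_translation (- x) (measurable_eball 0 r)); congr (mu _).
by apply/seteqP; split => y; rewrite /eball/= subr0 [- x + y]addrC.
Qed.

(** An open ball is the increasing union of smaller concentric ones, so a lower bound at rational
    radii passes to the limit from the left. *)
Lemma eball_left_continuous (c : R) S x r : measurable S -> 0 < r ->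
  (forall q : rat, 0 < ratr q :> R -> ratr q < r -> c <= ratio S x (ratr q)) -> c <= ratio S x r.
Proof.
move=> mS r0 H; have [c0|c0] := leP c 0; first exact: le_trans c0 (ratio_ge0 _ _ _).
rewrite ler_pdivlMr ?mu_eball_gt0//.
pose rr (k : nat) := r - r / k.+2%:R.
have rr0 k : 0 < rr k.
  by rewrite subr_gt0 ltr_pdivrMr// ltr_pMr// ltr1n.
have rrr k : rr k < r by rewrite ltrBlDr ltrDl divr_gt0.
have mono k k' : (k <= k')%N -> eball x (rr k) `<=` eball x (rr k').
  move=> kk' y; rewrite /eball/= => /lt_le_trans; apply.
  rewrite lerB// ler_wpM2l ?(ltW r0)// lef_pV2 ?posrE ?ltr0n//.
  by rewrite ler_nat !ltnS.
have U : \bigcup_k eball x (rr k) = eball x r.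
  apply/seteqP; split => [y [k _]|y].
    by rewrite /eball/= => /lt_trans; apply.
  rewrite {1}/eball/= => yr.
  pose k := Num.bound (r / (r - enorm (y - x))).
  have d0 : 0 < r - enorm (y - x) by rewrite subr_gt0.
  exists k => //; rewrite /eball/= ltrBrDl -ltrBrDr ltr_pdivrMr//.
  rewrite mulrC -ltr_pdivrMr// (lt_trans (archi_boundP _))//.
    by rewrite divr_ge0// ltW.
  by rewrite ltr_nat -/k ltnW.
have mrr k : measurable (eball x (rr k)) by exact: measurable_eball.
have monoO : {homo (fun k => eball x (rr k)) : k k' / (k <= k')%N >-> (k <= k')%O}.
  by move=> k k' kk'; apply/subsetPset; exact: mono.
have := nondecreasing_cvg_mu (mu := mu) mrr (bigcupT_measurable _ mrr) monoO.
rewrite U => cv; rewrite mulrC -ler_pdivlMr//.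
have : fine (mu (eball x (rr k))) @[k --> \oo] --> fine (mu (eball x r)).
  by apply: fine_cvg; rewrite finite_muK ?mu_eball_lty.
move/cvgr_to_le; apply; apply: nearW => k.
have [q] := rat_in_itvoo (rrr k); rewrite in_itv/= => /andP[q1 q2].
have q0 : 0 < ratr q :> R by exact: lt_trans (rr0 k) q1.
have := H q q0 q2; rewrite ler_pdivlMr ?mu_eball_gt0// mulrC -ler_pdivlMr// => Hq.
apply: le_trans (le_trans Hq _).
  apply: fine_le; rewrite ?ge0_fin_numE ?mu_eball_lty//.
  apply: le_mu; [exact: measurable_eball..|].
  by move=> y; rewrite /eball/= => /lt_trans; apply.
rewrite ler_pM2r ?invr_gt0//.
apply: fine_le; rewrite ?ge0_fin_numE ?mu_capI_lty//.
apply: le_mu; [by apply: measurableI => //; exact: measurable_eball..|].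
by move=> y [Sy]; split=> //; move: b; rewrite /eball/= => /lt_trans; apply.
Qed.

Lemma measurable_density_one S : measurable S -> measurable (density_one S).
Proof.
move=> mS.
pose T k j (q : rat) : set 'rV[R]_m :=
  if (0 < ratr q :> R) && (ratr q < j.+1%:R^-1 :> R) then [set x | 1 - k.+1%:R^-1 <= ratio S x (ratr q)] else setT.
rewrite (_ : density_one S = \bigcap_k \bigcup_j \bigcap_q T k j q).
  apply: bigcapT_measurable => k; apply: bigcupT_measurable => j.
  rewrite -[X in measurable X]setCK setC_bigcap; apply: measurableC.
  apply: bigcupT_measurable_rat => q; apply: measurableC; rewrite /T; case: ifP => // _.
  rewrite (_ : [set _ | _] = setT `&` (ratio S ^~ (ratr q)) @^-1` `[1 - k.+1%:R^-1, +oo[).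
    by apply: measurable_ratio => //; exact: measurable_itv.
  by rewrite setTI; apply/seteqP; split => x /=; rewrite in_itv/= andbT.
apply/seteqP; split => x.
  move/(density_one_near x mS) => H k _; have [j Hj] := H k; exists j => // q _.
  by rewrite /T; case: ifP => // /andP[q0 qj] /=; exact: Hj.
move=> H; apply/(density_one_near x mS) => k; have [j _ Hj] := H k I; exists j => r r0 rj.
apply: eball_left_continuous => // q q0 qr.
have := Hj q I; rewrite /T q0 (lt_trans qr rj) /=; exact.
Qed.

Lemma ratio_not01 S x : ratio S x r @[r --> 0^'+] --> (0 : R) ->
  ratio S x r @[r --> 0^'+] --> (1 : R) -> False.
Proof.
move=> /(cvg_lim (@norm_hausdorff _ R^o)) E0 /(cvg_lim (@norm_hausdorff _ R^o)).
by rewrite E0 => /eqP; rewrite eq_sym oner_eq0.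
Qed.

Lemma density_one_null S : measurable S ->
  mu (density_one S `\` S) = 0%E /\ mu (S `\` density_one S) = 0%E.
Proof.
move=> mS; have mD := measurable_density_one mS.
split; apply/negligibleP; try exact: measurableD.
- have := ratio_zero_ae mS; apply: negligibleS => x /= [Dx nSx] H.
  by case: (ratio_not01 (H nSx) Dx).
- by have := ratio_one_ae mS; apply: negligibleS => x /= [Sx nDx] H; apply: nDx; exact: H.
Qed.

Lemma density_one_idem S : measurable S -> density_one (density_one S) = density_one S.
Proof.
move=> mS; have [H1 H2] := density_one_null mS.
by apply: eq_density_one => //; exact: measurable_density_one.
Qed.

Lemma density_one_mono S F : measurable S -> measurable F -> mu (S `\` F) = 0%E ->
  density_one S `<=` density_one F.
Proof.
move=> mS mF SF x; rewrite !density_oneE => H.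
apply: (squeeze_cvgr _ H (cvg_cst (1 : R))); near=> r; rewrite /=; rewrite ratio_le1// andbT.
apply: le_ratio => //; have mb := measurable_eball x r.
have mFb : measurable (F `&` eball x r) by exact: measurableI.
have mSF : measurable (S `\` F) by exact: measurableD.
apply: (@le_trans _ _ (mu ((F `&` eball x r) `|` (S `\` F)))).
  apply: le_mu; [exact: measurableI|exact: measurableU|].
  by move=> y [Sy by_]; have [Fy|nFy] := pselect (F y); [left|right].
by apply: (le_trans (le_muU _ mFb mSF)); rewrite [X in (_ + X)%E]SF adde0.
Unshelve. all: by end_near. Qed.

(* Near a point of [U] the set [S] is null, so its density there is 0. *)
Lemma density_one_open S (U : set 'rV[R]_m) : measurable S -> open U -> mu (S `&` U) = 0%E ->
  density_one S `<=` ~` U.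
Proof.
move=> mS oU SU x Dx Ux.
have /nbhs_ballP[e /= e0 eU] : nbhs x U by exact: open_nbhs_nbhs.
suff H : ratio S x r @[r --> 0^'+] --> (0 : R).
  exact: ratio_not01 H Dx.
apply: cvg_near_cst; near=> r; rewrite /ratio (_ : mu _ = 0%E) ?mul0r//.
apply: (null_sub _ _ _ SU); [|by apply: measurableI => //; exact: open_measurable_rV|].
  by apply: measurableI => //; exact: measurable_eball.
move=> y [Sy /eball_sub_ball xy]; split => //; apply: eU; apply: le_ball xy.
by near: r; exact: nbhs_right_le.
Unshelve. all: by end_near. Qed.

(* A set below [height = 0] omits at least a fixed fraction of every ball centred there. *)
Lemma density_one_halfspace (i : 'I_m) S : measurable S -> S `<=` [set x | 0 < x 0 i] ->
  density_one S `<=` [set x | 0 < x 0 i].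
Proof.
move=> mS SO x Dx; rewrite /= ltNge; apply/negP => xi.
(* A corner box of side r / (m + 1) just below x misses [S] and lies in the ball, whose measure is
   at most (2 r)^m; [c] is the resulting fraction. *)
pose c : R := (m.+1%:R^-1) ^+ m / 2 ^+ m.
have c0 : 0 < c by rewrite divr_gt0 ?exprn_gt0.
have mC := measurableC mS.
have H r : 0 < r -> c <= ratio (~` S) x r.
  move=> r0; pose s := r / m.+1%:R; have s0 : 0 < s by rewrite divr_gt0.
  pose Q : set 'rV[R]_m := [set y | forall j, y 0 j \in `](x 0 j - s), (x 0 j - s + s)[].
  have mQ : measurable Q.
    by apply: (measurable_box (A := fun j => [set` _])) => j; exact: measurable_itv.
  have muQ : mu Q = (s ^+ m)%:E.
    exact: (@lebesgue_itv_box R m (fun j => x 0 j - s) s (ltW s0) false true).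
  have QS : Q `<=` ~` S `&` eball x r.
    move=> y Qy; split.
      by move=> /SO/=; move: (Qy i); rewrite in_itv/= subrK; lra.
    apply: ball_sub_eball => //; apply/rV_ballP => // j.
    by move: (Qy j); rewrite in_itv/= subrK ltr_norml -/s; lra.
  rewrite ler_pdivlMr ?mu_eball_gt0//.
  apply: (@le_trans _ _ (s ^+ m)).
    have : fine (mu (eball x r)) <= (2 * r) ^+ m.
      rewrite -lee_fin finite_muK ?mu_eball_lty// -(mu_ball x r0).
      exact: le_mu (measurable_eball _ _) (measurable_ball_rV _ _) (@eball_sub_ball _ _).
    move/(ler_wpM2l (ltW c0))/le_trans; apply.
    rewrite /c /s !exprMn le_eqVlt; apply/orP; left; apply/eqP.
    by field; rewrite expf_neq0.
  rewrite -lee_fin finite_muK ?mu_capI_lty// -muQ.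
  by apply: le_mu => //; apply: measurableI => //; exact: measurable_eball.
have : density_one S x by []; rewrite density_oneE => /cvgrPdist_lt/(_ c c0)[d /= d0 Hd].
have d20 : 0 < d / 2 by rewrite divr_gt0.
have : `|1 - ratio S x (d / 2)| < c.
  apply: Hd => //=; rewrite sub0r normrN gtr0_norm//; lra.
rewrite ratioC//; have := H _ d20; set t := ratio _ _ _ => ct.
by rewrite (_ : 1 - (1 - t) = t) ?ltNge ?(le_trans ct (ler_norm t))//; ring.
Qed.

End density_one_sets.

(** * Boundary traces *)

Section oscillation.
Variables (R : realType) (U : set R).
Hypothesis mU : measurable (U : set (measurableTypeR R)).
Local Notation lam := (@lebesgue_measure R).
Implicit Types (a b h s t p q : R).

Local Notation msb A := (measurable (A : set (measurableTypeR R))).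

Definition jumps h : set R := [set t | ~ (U (h + t) <-> U t)].

Lemma measurable_shift1 h (A : set R) : msb A -> msb (+%R h @^-1` A).
Proof.
move=> mA; have mv : measurable_fun setT (+%R h : measurableTypeR R -> measurableTypeR R).
  exact: measurable_funD.
by rewrite -[X in measurable X]setTI; exact: mv.
Qed.

Lemma measurable_jumps h : msb (jumps h).
Proof.
rewrite (_ : jumps h = (+%R h @^-1` U) `+` U); first by apply: measurableY => //; exact: measurable_shift1.
apply/seteqP; split => t /=.
  move=> H; have [Ut|nUt] := pselect (U t); have [Uh|nUh] := pselect (U (h + t)).
  - by case: H.
  - by right.
  - by left.
  - by case: H.
by move=> [[? ?]|[? ?]] [? ?]; tauto.
Qed.

Lemma lam_bounded (A : set R) a b : msb A -> A `<=` `[a, b] -> (lam A < +oo)%E.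
Proof.
move=> mA Aab; apply: (mu_lty mA (measurable_itv `[a, b]) Aab).
by rewrite [X in (X < _)%E]lebesgue_measure_itv/=; case: ifP => _; rewrite ?ltry// -EFinB ltry.
Qed.

Definition mass p q : R := fine (lam (U `&` `]p, q])).

Lemma mass_lty p q : (lam (U `&` `]p, q]) < +oo)%E.
Proof.
apply: (@lam_bounded _ p q); first exact: measurableI.
by move=> t [_] /=; rewrite !in_itv/=; lra.
Qed.

Lemma massD p q s : p <= q -> q <= s -> mass p s = mass p q + mass q s.
Proof.
move=> pq qs; apply: EFin_inj; rewrite /mass EFinD !finite_muK ?mass_lty// -measureU.
- congr (lam _); rewrite -setIUr; congr (_ `&` _).
  by apply/seteqP; split => t /=; rewrite !in_itv/=;
    [case: (leP t q) => ? ?; [left|right]; lra|case; lra].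
- exact: measurableI.
- exact: measurableI.
- by apply/seteqP; split => // t /= [[_ +] [_]]; rewrite !in_itv/=; lra.
Qed.

(** The integral over ]p, q] of 1_U(t + h) - 1_U(t) telescopes to the difference of the masses in
    the windows ]q, q + h] and ]p, p + h], and the integrand vanishes off [jumps h]. *)
Lemma mass_jumps p q h : 0 <= h -> p <= q ->
  `|mass p (p + h) - mass q (q + h)| <= fine (lam (jumps h `&` `]p, q])).
Proof.
move=> h0 pq.
have mJ : msb (jumps h `&` `]p, q]) by apply: measurableI => //; exact: measurable_jumps.
have Joo : (lam (jumps h `&` `]p, q]) < +oo)%E.
  by apply: (@lam_bounded _ p q mJ) => t [_] /=; rewrite !in_itv/=; lra.
have shift : lam (+%R h @^-1` U `&` `]p, q]) = lam (U `&` `](p + h), (q + h)]).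
  rewrite -(lebesgue1_translation h (A := U `&` `](p + h), (q + h)])); last exact: measurableI.
  by congr (lam _); apply/seteqP; split => t /= [Ut]; rewrite !in_itv/=; split=> //; lra.
have shiftm : fine (lam (+%R h @^-1` U `&` `]p, q])) = mass (p + h) (q + h) by rewrite shift.
have mS : msb (+%R h @^-1` U `&` `]p, q]) by apply: measurableI => //; exact: measurable_shift1.
have mV : msb (U `&` `]p, q]) by exact: measurableI.
have Soo : (lam (+%R h @^-1` U `&` `]p, q]) < +oo)%E.
  by apply: (@lam_bounded _ p q mS) => t [_] /=; rewrite !in_itv/=; lra.
have H1 : mass p q <= mass (p + h) (q + h) + fine (lam (jumps h `&` `]p, q])).
  rewrite -shiftm /mass -lee_fin EFinD !finite_muK ?mass_lty//.
  apply: (le_trans _ (le_muU _ mS mJ)); apply: le_mu => //; first exact: measurableU.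
  move=> t [Ut pqt]; have [Uh|nUh] := pselect (U (h + t)); first by left.
  by right; split => //; rewrite /jumps/= => -[_ /(_ Ut)].
have H2 : mass (p + h) (q + h) <= mass p q + fine (lam (jumps h `&` `]p, q])).
  rewrite -shiftm /mass -lee_fin EFinD !finite_muK ?mass_lty//.
  apply: (le_trans _ (le_muU _ mV mJ)); apply: le_mu => //; first exact: measurableU.
  move=> t [Uh pqt]; have [Ut|nUt] := pselect (U t); first by left.
  by right; split => //; rewrite /jumps/= => -[/(_ Uh)].
have pqh : p + h <= q + h by rewrite lerD2r.
have E1 := massD pq (_ : q <= q + h); have E2 := massD (_ : p <= p + h) pqh.
rewrite ler_norml; have := E1 _; have := E2 _; rewrite !lerDl h0.
by move=> /(_ isT) -> /(_ isT); lra.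
Qed.

(** [p] is a density point of [U] and [q] one of its complement. *)
Lemma density_points a b : (0 < lam (U `&` `]a, b[))%E -> (0 < lam (`]a, b[ `\` U))%E ->
  exists p q, [/\ a < p < b, a < q < b &
    \forall h \near 0^'+, 3 / 4 * h <= mass p (p + h) /\ mass q (q + h) <= h / 4].
Proof.
move=> U1 U0.
have [N [mN N0 NP]] := lebesgue_density mU.
have pick (A : set R) : msb A -> (0 < lam A)%E -> exists2 p, A p & ~ N p.
  move=> mA A0; apply: contrapT => H.
  have : A `<=` N by move=> p Ap; apply: contrapT => nNp; apply: H; exists p.
  move=> /(null_sub mA mN)/(_ N0) E; by rewrite E ltxx in A0.
have [p [Up pab] nNp] : exists2 p, (U `&` `]a, b[) p & ~ N p by apply: pick => //; exact: measurableI.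
have [q [qab nUq] nNq] : exists2 p, (`]a, b[ `\` U) p & ~ N p by apply: pick => //; exact: measurableD.
exists p, q; split; [by move: pab; rewrite /= in_itv|by move: qab; rewrite /= in_itv|].
have dens (x : R) : ~ N x -> (lam (U `&` ball x r) / lam (ball x r))%E @[r --> 0^'+] --> (\1_U x)%:E.
  by move=> nNx; apply: contrapT => H; apply: nNx; exact: NP.
have ballE (x r : R) : 0 < r -> lam (ball x r) = (2 * r)%:E.
  by move=> r0; rewrite lebesgue_measure_ball ?ltW// mulr_natl.
have mb (x r : R) : msb (ball x r) by exact: measurable_ball.
have bU (x r : R) : (lam (U `&` ball x r) < +oo)%E.
  have [r0|r0] := ltP 0 r; last by rewrite le0_ball0// setI0 measure0.
  apply: (mu_lty (measurableI _ _ mU (mb x r)) (mb x r)); first by move=> t [].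
  by rewrite [X in (X < _)%E]ballE// ltry.
have densr (x : R) : ~ N x -> fine (lam (U `&` ball x r)) / (2 * r) @[r --> 0^'+] --> (\1_U x : R).
  move=> /dens/fine_cvg; apply: cvg_trans; apply: near_eq_cvg; near=> r.
  have r0 : 0 < r by [].
  rewrite /= ballE// -(finite_muK (bU x r)) inver ifF; last by apply/negbTE; rewrite gt_eqF// mulr_gt0.
  by rewrite -EFinM.
(* A deviation of 1/8 in a window of length 2 h leaves mass at least 7/4 h around p, of which at
   most h lies to the left. *)
have := densr p nNp; rewrite indicE mem_set//= => /cvgrPdist_lt/(_ 8^-1)[|d1 /= d10 H1]; first by [].
(* At q the radius used is 2 h, because ]q, q + h] is not inside the open ball of radius h; hence
   1/16 of a window of length 4 h. *)
have := densr q nNq; rewrite indicE memNset//= => /cvgrPdist_lt/(_ 16^-1)[|d2 /= d20 H2]; first by [].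
near=> h; have h0 : 0 < h by [].
have hd1 : h < d1 by near: h; exact: nbhs_right_lt.
have hd2 : h < d2 / 2 by near: h; apply: nbhs_right_lt; rewrite divr_gt0.
have {}H1 : `|1 - fine (lam (U `&` ball p h)) / (2 * h)| < 8^-1.
  by apply: H1 => //=; rewrite sub0r normrN gtr0_norm.
have h20 : 0 < 2 * h by rewrite mulr_gt0.
have h40 : 0 < 2 * (2 * h) by rewrite mulr_gt0.
have {}H2 : `|0 - fine (lam (U `&` ball q (2 * h))) / (2 * (2 * h))| < 16^-1.
  by apply: H2 => //=; rewrite sub0r normrN gtr0_norm//; lra.
split.
  have : 7 / 8 * (2 * h) <= fine (lam (U `&` ball p h)).
    by rewrite -ler_pdivlMr//; move: H1; rewrite ltr_norml; lra.
  have : fine (lam (U `&` ball p h)) <= h + mass p (p + h).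
    rewrite /mass -lee_fin EFinD !finite_muK ?mass_lty ?bU//.
    have mL : msb (`]p - h, p]%classic : set R) by exact: measurable_itv.
    have -> : h%:E = lam `]p - h, p]%classic.
      by rewrite lebesgue_measure_itv/= lte_fin ltrBlDr ltrDl h0 -EFinB opprB addrCA subrr addr0.
    have mUp : msb (U `&` `]p, p + h]) by exact: measurableI.
    apply: (le_trans _ (le_muU _ mL mUp)); apply: le_mu; [exact: measurableI|exact: measurableU|].
    move=> t [Ut]; rewrite ball_itv/= !in_itv/= => ?.
    by have [tp|tp] := leP t p; [left|right; split => //]; rewrite /= ?in_itv/=; lra.
  by lra.
have : fine (lam (U `&` ball q (2 * h))) <= 16^-1 * (2 * (2 * h)).
  by rewrite -ler_pdivrMr//; move: H2; rewrite ltr_norml; lra.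
have : mass q (q + h) <= fine (lam (U `&` ball q (2 * h))).
  rewrite /mass -lee_fin !finite_muK ?mass_lty ?bU//.
  apply: le_mu; [exact: measurableI|exact: measurableI|].
  by move=> t [Ut]; rewrite ball_itv/= !in_itv/= => ?; split => //; rewrite /= ?in_itv/=; lra.
by lra.
Unshelve. all: by end_near. Qed.

(** The windows at p and q differ in mass by at least h / 2, whichever point comes first. This
    expresses through translations that an indicator which is not almost constant has variation
    bounded below. *)
Lemma jumps_interval a b : (0 < lam (U `&` `]a, b[))%E -> (0 < lam (`]a, b[ `\` U))%E ->
  \forall h \near 0^'+, h / 2 <= fine (lam (jumps h `&` `]a, b[)).
Proof.
move=> U1 U0; have [p [q [/andP[ap pb] /andP[aq qb] H]]] := density_points U1 U0.
near=> h; have h0 : 0 < h by [].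
have [H1 H2] : 3 / 4 * h <= mass p (p + h) /\ mass q (q + h) <= h / 4 by near: h.
have mJ p' q' : msb (jumps h `&` `]p', q']) by apply: measurableI => //; exact: measurable_jumps.
have mJab : msb (jumps h `&` `]a, b[) by apply: measurableI => //; exact: measurable_jumps.
have sub p' q' : a < p' -> q' < b -> fine (lam (jumps h `&` `]p', q'])) <= fine (lam (jumps h `&` `]a, b[)).
  move=> ap' qb'; have Joo : (lam (jumps h `&` `]a, b[) < +oo)%E.
    by apply: (@lam_bounded _ a b mJab) => t [_] /=; rewrite !in_itv/=; lra.
  have S : jumps h `&` `]p', q'] `<=` jumps h `&` `]a, b[.
    by move=> t [Jt]; rewrite /= !in_itv/= => ?; split => //; rewrite /= ?in_itv/=; lra.
  apply: fine_le; rewrite ?ge0_fin_numE ?Joo//; last exact: le_mu.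
  exact: mu_lty mJab S Joo.
have [pq|qp] := leP p q.
  have := mass_jumps (ltW h0) pq; have := sub p q ap qb; rewrite ler_norml; lra.
have := mass_jumps (ltW h0) (ltW qp); have := sub q p aq pb; rewrite ler_norml; lra.
Unshelve. all: by end_near. Qed.

Definition mixed s := ((0 < lam (U `&` `]0%R, s[))%E /\ (0 < lam (`]0%R, s[ `\` U))%E).

(** Removing ]0, a] cannot exhaust a mass larger than a. *)
Lemma mixed_gt s : 0 < s -> mixed s -> exists2 a, 0 < a < s &
  (0 < lam (U `&` `]a, s[))%E /\ (0 < lam (`]a, s[ `\` U))%E.
Proof.
move=> s0 [U1 U0].
have key (A : set R) : msb A -> (0 < lam (A `&` `]0%R, s[))%E ->
    exists2 a0 : R, 0 < a0 & forall a, 0 < a -> a < a0 -> a < s -> (0 < lam (A `&` `]a, s[))%E.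
  move=> mA A0; have mI a : msb (A `&` `]a, s[) by exact: measurableI.
  have Aoo a : 0 <= a -> (lam (A `&` `]a, s[) < +oo)%E.
    by move=> a0; apply: (@lam_bounded _ 0 s (mI a)) => t [_] /=; rewrite !in_itv/=; lra.
  exists (fine (lam (A `&` `]0%R, s[))).
    by rewrite fine_gt0// A0 Aoo.
  move=> a a0 aA as_; rewrite lt_neqAle measure_ge0 andbT eq_sym; apply/eqP => Z.
  have mL : msb (`]0%R, a]%classic : set R) by exact: measurable_itv.
  have : (lam (A `&` `]0%R, s[) <= a%:E)%E.
    have -> : a%:E = (lam `]0%R, a]%classic + lam (A `&` `]a, s[))%E.
      by rewrite Z adde0 lebesgue_measure_itv/= lte_fin a0 -EFinB subr0.
    apply: (le_trans _ (le_muU _ mL (mI a))); apply: le_mu => //; first exact: measurableU.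
    by move=> t [At]; rewrite /= !in_itv/= => ?; have [ta|ta] := leP t a; [left|right; split=> //]; rewrite /= ?in_itv/=; lra.
  rewrite -(finite_muK (Aoo 0 (lexx _))) lee_fin; lra.
have [a1 a10 H1] := key U mU U1.
have [a2 a20 H2] : exists2 a0 : R, 0 < a0 & forall a, 0 < a -> a < a0 -> a < s -> (0 < lam (~` U `&` `]a, s[))%E.
  by apply: key; [exact: measurableC|rewrite setIC -setDE].
pose a := Num.min s (Num.min a1 a2) / 2.
have m0 : 0 < Num.min s (Num.min a1 a2) by rewrite !lt_min s0 a10 a20.
have [as_ aa1 aa2] : [/\ a < s, a < a1 & a < a2].
  have : Num.min s (Num.min a1 a2) <= s by rewrite ge_min lexx.
  have : Num.min s (Num.min a1 a2) <= a1 by rewrite !ge_min lexx orbT.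
  have : Num.min s (Num.min a1 a2) <= a2 by rewrite !ge_min lexx !orbT.
  by move: m0; rewrite /a; move: (Num.min _ _) => z; split; lra.
have a0 : 0 < a by rewrite divr_gt0.
exists a; first by rewrite a0.
by split; [exact: H1|rewrite setDE setIC; exact: H2].
Qed.

(* Nested intervals accumulating at 0 each contribute jumps of total length h/2. *)
Lemma jumps_near_zero N s : 0 < s -> (forall s', 0 < s' -> mixed s') ->
  \forall h \near 0^'+, N%:R * (h / 2) <= fine (lam (jumps h `&` `]0%R, s[)).
Proof.
move=> + mix; elim: N s => [|N IH] s s0.
  by apply: nearW => h; rewrite mul0r fine_ge0.
have [a /andP[a0 as_] [U1 U0]] := mixed_gt s0 (mix s s0).
have H1 := jumps_interval U1 U0; have H2 := IH a a0.
near=> h; have h1 : h / 2 <= fine (lam (jumps h `&` `]a, s[)) by near: h.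
have h2 : N%:R * (h / 2) <= fine (lam (jumps h `&` `]0%R, a[)) by near: h.
have mJ p' q' : msb (jumps h `&` `]p', q'[) by apply: measurableI => //; exact: measurable_jumps.
have Joo p q : (lam (jumps h `&` `]p, q[) < +oo)%E.
  by apply: (@lam_bounded _ p q (mJ p q)) => t [_] /=; rewrite !in_itv/=; lra.
rewrite -natr1 mulrDl mul1r (le_trans (lerD h2 h1))//.
have E : lam ((jumps h `&` `]0%R, a[) `|` (jumps h `&` `]a, s[)) =
    (lam (jumps h `&` `]0%R, a[) + lam (jumps h `&` `]a, s[))%E.
  apply: measureU => //.
  by apply/seteqP; split => // t /= [[_ +] [_]]; rewrite !in_itv/=; lra.
rewrite -lee_fin EFinD !(finite_muK (Joo _ _)) -E.
apply: le_mu => //; first exact: measurableU.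
by move=> t [[Jt]|[Jt]]; rewrite /= !in_itv/= => ?; split => //; rewrite /= ?in_itv/=; lra.
Unshelve. all: by end_near. Qed.

End oscillation.

(** * Vertical slices and columns that oscillate near the boundary *)

Section traces.
Variables (R : realType) (n : nat).
Local Notation mu := (lebesgue R n.+1).
Local Notation l := (lebesgue R n).
Local Notation lam := (@lebesgue_measure R).
Local Notation Om := (@halfspace R n).
Local Notation e_v := (delta_mx 0 ord_max : 'rV[R]_n.+1).
Implicit Types (E F : set 'rV[R]_n.+1) (y : 'rV[R]_n) (k : nat).

Lemma lin_e m (j : 'I_m) (x : 'rV[R]_m) : lin (delta_mx 0 j) x = x 0 j.
Proof.
rewrite /lin (bigD1 j)//= mxE !eqxx mul1r big1 ?addr0// => i ij.
by rewrite mxE (negbTE ij) andbF mul0r.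
Qed.

Lemma continuous_height : continuous (@height R n).
Proof. by case: (C1_coord R (@ord_max n)) => + _ _; exact. Qed.

Lemma open_halfspace : open Om.
Proof.
apply: (@open_comp _ _ (@height R n) [set t | 0 < t]); last exact: open_gt.
by move=> x _; exact: continuous_height.
Qed.

Lemma measurable_halfspace : measurable Om.
Proof. by apply: open_measurable_rV; exact: open_halfspace. Qed.

(** Zero up to height 1/(k+1) and one from 2/(k+1) on: it pushes the support of a field off the
    boundary. *)
Definition lift_cutoff k (x : 'rV[R]_n.+1) : R := step (k.+1%:R * lin e_v x + -1).
Definition dlift_cutoff k (j : 'I_n.+1) (x : 'rV[R]_n.+1) : R :=
  dstep (k.+1%:R * lin e_v x + -1) * (k.+1%:R * e_v 0 j).

Lemma C1_lift_cutoff k : C1 (lift_cutoff k) (dlift_cutoff k).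
Proof. exact: C1_step. Qed.

Lemma lift_cutoffE k x : lift_cutoff k x = step (k.+1%:R * height x - 1).
Proof. by rewrite /lift_cutoff lin_e. Qed.

Lemma lift_cutoff_low k x : height x < k.+1%:R^-1 -> lift_cutoff k x = 0.
Proof.
move=> H; rewrite lift_cutoffE step0// subr_le0 mulrC -ler_pdivlMr//.
by rewrite mul1r ltW.
Qed.

Lemma lift_cutoff_near1 x : Om x -> lift_cutoff k x @[k --> \oo] --> (1 : R).
Proof.
move=> hx; apply: cvg_near_cst; near=> k; rewrite lift_cutoffE step1//.
suff : 2 <= k.+1%:R * height x by lra.
rewrite -ler_pdivrMr// (@le_trans _ _ k%:R)//; last by rewrite ler_nat.
by near: k; exact: nbhs_infty_ger.
Unshelve. all: by end_near. Qed.

Lemma supp_lift (F : 'I_n.+1 -> 'rV[R]_n.+1 -> R) k :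
  supp_in setT F -> supp_in Om (scale_field (lift_cutoff k) F).
Proof.
move=> [K [cK _] F0]; exists (K `&` [set x | k.+1%:R^-1 <= height x]).
  split; last by move=> x [_ /= /(lt_le_trans _)]; apply; rewrite invr_gt0.
  apply: compact_closedI => //.
  apply: (@closed_comp _ _ (@height R n) [set t | k.+1%:R^-1 <= t]); last exact: closed_ge.
  by move=> x _; exact: continuous_height.
move=> x nK i; rewrite /scale_field.
have [Kx|nKx] := pselect (K x); last by rewrite F0// mulr0.
rewrite lift_cutoff_low ?mul0r// ltNge; apply/negP => H; exact: nK.
Qed.

Lemma exhaustion_halfspace : exhaustion Om
  (fun k x => cutoff k.+1%:R x * lift_cutoff k x)
  (fun k j x => cutoff k.+1%:R x * dlift_cutoff k j x + lift_cutoff k x * dcutoff k.+1%:R j x).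
Proof.
have [_ _ _ c1] := exhaustion_setT R n.+1.
split.
- by move=> k; apply: C1M; [exact: C1_cutoff|exact: C1_lift_cutoff].
- move=> k x; have /andP[a0 a1] := cutoff01 k.+1%:R x.
  by rewrite mulr_ge0 ?mulr_ile1 ?step_ge0 ?step_le1.
- move=> k; exists ([set x | sq x <= 2 * k.+1%:R ^+ 2] `&` [set x | k.+1%:R^-1 <= height x]).
    split; last by move=> x [_ /= /(lt_le_trans _)]; apply; rewrite invr_gt0.
    apply: compact_closedI; first exact: compact_sq_le.
    apply: (@closed_comp _ _ (@height R n) [set t | k.+1%:R^-1 <= t]); last exact: closed_ge.
    by move=> x _; exact: continuous_height.
  move=> x nK; have [H|H] := pselect (sq x <= 2 * k.+1%:R ^+ 2); last by rewrite cutoff_out ?mul0r.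
  rewrite lift_cutoff_low ?mulr0// ltNge; apply/negP => H'; exact: nK.
- by move=> x Ox; have := cvgM (c1 x I) (lift_cutoff_near1 Ox); rewrite mulr1; exact.
Qed.

Lemma height_addZ x t : height (x + t *: e_v) = height x + t.
Proof. by rewrite /height !mxE !eqxx mulr1. Qed.

Lemma vertical_translation E (h : R) : finite_perimeter Om E -> 0 <= h ->
  (mu (Om `&` ((+%R (h *: e_v) @^-1` E) `+` E)) <= (h * Per Om E)%:E)%E.
Proof.
move=> fE h0; apply: (translation_estimate fE exhaustion_halfspace measurable_halfspace h0).
by move=> x t t0; rewrite /halfspace/= height_addZ => ?; rewrite ltr_wpDr.
Qed.

Definition slice E y : set R := [set t | E (snoc (y, t))].

Lemma measurable_snoc_pre E : measurable E -> measurable (@snoc R n @^-1` E).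
Proof. by move=> mE; rewrite -[X in measurable X]setTI; exact: measurable_snoc. Qed.

Lemma xsection_snoc E y : xsection (@snoc R n @^-1` E) y = slice E y.
Proof. by apply/seteqP; split => t; rewrite /xsection/= inE. Qed.

Lemma measurable_slice E y : measurable E -> measurable (slice E y : set (measurableTypeR R)).
Proof.
by move=> mE; rewrite -xsection_snoc; apply: measurable_xsection; exact: measurable_snoc_pre.
Qed.

Lemma measurable_lam_slice E : measurable E -> measurable_fun setT (fun y => lam (slice E y)).
Proof.
move=> mE; rewrite (_ : (fun y => _) = lam \o xsection (@snoc R n @^-1` E)).
  by apply: measurable_fun_xsection; exact: measurable_snoc_pre.
by apply/funext => y; rewrite /= xsection_snoc.
Qed.

Lemma mu_slices E : (mu E = \int[l]_y lam (slice E y))%E.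
Proof.
rewrite lebesgueS_prod -[LHS]/(\int[l]_y (lam \o xsection (@snoc R n @^-1` E)) y)%E.
by apply: eq_integral => y _; rewrite /= xsection_snoc.
Qed.

Lemma mu_slices_null E : (forall y, lam (slice E y) = 0%E) -> mu E = 0%E.
Proof. by move=> H; rewrite mu_slices integral0_eq. Qed.

Definition band (s : R) : set 'rV[R]_n.+1 := [set x | 0 < height x < s].

Lemma height_snoc y t : height (snoc (y, t)) = t.
Proof. by rewrite /height mxE unlift_none. Qed.

Lemma horizontal_snoc y t : horizontal (snoc (y, t)) = y.
Proof. by apply/rowP => i; rewrite !mxE liftK. Qed.

Lemma measurable_horizontal : measurable_fun setT (@horizontal R n).
Proof.
apply: measurable_fun_rVP => i.
rewrite (_ : (fun x => _) = (fun x : 'rV[R]_n.+1 => x 0 (lift ord_max i))).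
  exact: measurable_coordinate.
by apply/funext => x; rewrite mxE.
Qed.

Lemma measurable_height : measurable_fun setT (@height R n).
Proof. exact: measurable_coordinate. Qed.

Lemma measurable_horizontal_pre (B : set 'rV[R]_n) : measurable B -> measurable (@horizontal R n @^-1` B).
Proof. by move=> mB; rewrite -[X in measurable X]setTI; exact: measurable_horizontal. Qed.

Lemma measurable_band s : measurable (band s).
Proof.
rewrite (_ : band s = setT `&` @height R n @^-1` `]0, s[).
  by apply: measurable_height => //; exact: measurable_itv.
by rewrite setTI; apply/seteqP; split => x; rewrite /band/= in_itv.
Qed.

Lemma slice_band E y s : slice (E `&` band s) y = slice E y `&` `]0, s[%classic.
Proof. by apply/seteqP; split => t; rewrite /slice /band/= height_snoc in_itv. Qed.

Lemma slice_bandD E y s : slice (band s `\` E) y = `]0, s[%classic `\` slice E y.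
Proof. by apply/seteqP; split => t; rewrite /slice /band/= height_snoc in_itv. Qed.

Lemma mu_cylinder (B : set 'rV[R]_n) s : measurable B -> 0 <= s ->
  mu ((@horizontal R n @^-1` B) `&` band s) = (s%:E * l B)%E.
Proof.
move=> mB s0; rewrite mu_slices -integral_cst// [RHS]integral_mkcond.
apply: eq_integral => y _; rewrite patchE slice_band.
case: ifPn => yB.
  rewrite (_ : slice _ _ = setT) ?setTI.
    rewrite lebesgue_measure_itv/= lte_fin; case: ltP => [_|s0']; first by rewrite -EFinB subr0.
    by congr (_%:E); apply/eqP; rewrite eq_le s0 s0'.
  by apply/seteqP; split => // t _; rewrite /slice/= horizontal_snoc; exact: set_mem.
rewrite (_ : slice _ _ = set0) ?set0I ?measure0//.
apply/seteqP; split => // t; rewrite /slice/= horizontal_snoc => /mem_set.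
by rewrite (negbTE yB).
Qed.

(** A concrete trace, read off from columns: those filled almost everywhere up to some positive
    height. Being a measurable set, it replaces the pointwise limit of [trace] in all estimates. *)
Definition tr_set E : set 'rV[R]_n :=
  [set y | exists k, lam (`]0, k.+1%:R^-1[%classic `\` slice E y) = 0%E].
Definition mixed_set E k : set 'rV[R]_n := [set y | mixed (slice E y) k.+1%:R^-1].

Lemma measurable_lam_null E : measurable E -> measurable [set y | lam (slice E y) = 0%E].
Proof.
move=> mE; rewrite (_ : [set _ | _] = setT `&` (fun y => lam (slice E y)) @^-1` [set 0%E]).
  by apply: measurable_lam_slice => //; exact: measurable_set1.
by rewrite setTI.
Qed.

Lemma measurable_tr_set E : measurable E -> measurable (tr_set E).
Proof.
move=> mE; rewrite (_ : tr_set E = \bigcup_k [set y | lam (slice (band k.+1%:R^-1 `\` E) y) = 0%E]).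
  apply: bigcupT_measurable => k; apply: measurable_lam_null; apply: measurableD => //.
  exact: measurable_band.
apply/seteqP; split => y; first by move=> [k yk]; exists k => //=; rewrite slice_bandD.
by move=> [k _ /= H]; exists k; rewrite -slice_bandD.
Qed.

Lemma measurable_mixed_set E k : measurable E -> measurable (mixed_set E k).
Proof.
move=> mE; rewrite (_ : mixed_set E k = (~` [set y | lam (slice (E `&` band k.+1%:R^-1) y) = 0%E]) `&`
    (~` [set y | lam (slice (band k.+1%:R^-1 `\` E) y) = 0%E])).
  apply: measurableI; apply: measurableC; apply: measurable_lam_null.
    by apply: measurableI => //; exact: measurable_band.
  by apply: measurableD => //; exact: measurable_band.
apply/seteqP; split => y; rewrite /mixed_set /mixed/= slice_band slice_bandD.
  by move=> [a b]; split => z; [rewrite z ltxx in a|rewrite z ltxx in b].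
by move=> [a b]; split; rewrite lt_neqAle measure_ge0 andbT eq_sym; apply/eqP.
Qed.

Lemma itv0_pos (s : R) : 0 < s -> (0 < lam `]0%R, s[%classic)%E.
Proof. by move=> s0; rewrite lebesgue_measure_itv/= lte_fin s0 -EFinB subr0 lte_fin. Qed.

(** Off [mixed_set] the bottom of the column is full or empty up to a null set; an empty bottom
    excludes a full one at any other scale, which decides membership in [tr_set]. *)
Lemma not_mixedP E k y : measurable E -> ~ mixed_set E k y ->
  (tr_set E y /\ lam (`]0, k.+1%:R^-1[%classic `\` slice E y) = 0%E) \/
  (~ tr_set E y /\ lam (slice E y `&` `]0, k.+1%:R^-1[%classic) = 0%E).
Proof.
move=> mE nm; have mS := measurable_slice y mE.
have k0 : 0 < k.+1%:R^-1 :> R by rewrite invr_gt0.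
have [H1|H1] := eqVneq (lam (`]0, k.+1%:R^-1[%classic `\` slice E y)) 0%E.
  by left; split => //; exists k.
have H2 : lam (slice E y `&` `]0, k.+1%:R^-1[%classic) = 0%E.
  apply/eqP; apply: contra_notT nm => H2; split; rewrite lt_neqAle measure_ge0 andbT eq_sym.
    exact: H2.
  exact: H1.
right; split => // -[j Hj].
pose s : R := Num.min k.+1%:R^-1 j.+1%:R^-1.
have s0 : 0 < s by rewrite lt_min k0 /= invr_gt0 ltr0n.
have := itv0_pos s0; rewrite lt_neqAle => /andP[/eqP + _]; apply; apply/esym.
have mI (s' : R) : measurable (`]0, s'[%classic : set (measurableTypeR R)) by exact: measurable_itv.
have mA : measurable ((slice E y `&` `]0, k.+1%:R^-1[%classic) `|` (`]0, j.+1%:R^-1[%classic `\` slice E y) : set (measurableTypeR R)).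
  by apply: measurableU; [exact: measurableI|exact: measurableD].
apply: (null_sub (mI s) mA).
  move=> t /=; rewrite !in_itv/= lt_min => /and3P[t0 t1 t2].
  have [Et|nEt] := pselect (slice E y t); [left|right]; split => //=; rewrite ?in_itv/= ?t0 ?t1 ?t2 //.
apply/eqP; rewrite -[_ == _]measure_le0.
apply: (le_trans (le_muU lam (measurableI _ _ mS (mI _)) (measurableD (mI _) mS))).
by rewrite [X in (X + _)%E]H2 [X in (_ + X)%E]Hj adde0.
Qed.

Lemma mixed_set_mono E k k' : measurable E -> (k <= k')%N -> mixed_set E k' `<=` mixed_set E k.
Proof.
move=> mE kk' y [H1 H2]; have mS := measurable_slice y mE.
have mI (s' : R) : measurable (`]0, s'[%classic : set (measurableTypeR R)) by exact: measurable_itv.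
have sub : (`]0, k'.+1%:R^-1[%classic : set R) `<=` `]0, k.+1%:R^-1[%classic.
  move=> t; rewrite /= !in_itv/= => /andP[-> /lt_le_trans]; apply.
  by rewrite lef_pV2 ?posrE// ler_nat.
split.
  by apply: (lt_le_trans H1); apply: le_mu; [exact: measurableI|exact: measurableI|exact: setIS].
by apply: (lt_le_trans H2); apply: le_mu; [exact: measurableD|exact: measurableD|exact: setSD].
Qed.

(** For each h = 1/(j+1), [vertical_translation] and Chebyshev bound by Per / c the measure of the
    columns with jump length at least c h. A column of [Z] is among them for all large j, so [Z]
    lies in the lower limit of these sets, which keeps the bound. [Z] may be nonmeasurable, hence
    [G]. *)
Lemma jump_set_bound E (Z : set 'rV[R]_n) (c s : R) : finite_perimeter Om E -> 0 < c ->
  (forall y, Z y -> \forall h \near 0^'+, c * h <= fine (lam (jumps (slice E y) h `&` `]0, s[%classic))) ->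
  exists G, [/\ measurable G, Z `<=` G & (l G <= (Per Om E / c)%:E)%E].
Proof.
move=> fE c0 HZ; have [mE EOm Eoo _] := fE.
pose h (j : nat) : R := j.+1%:R^-1.
have h0 j : 0 < h j by rewrite invr_gt0.
pose X j := Om `&` ((+%R (h j *: e_v) @^-1` E) `+` E).
have mX j : measurable (X j).
  apply: measurableI; first exact: measurable_halfspace.
  by apply: measurableY => //; exact: measurable_preimage_addr.
pose T j := [set y | ((c * h j)%:E <= lam (slice (X j) y))%E].
have mT j : measurable (T j).
  rewrite (_ : T j = setT `&` (fun y => lam (slice (X j) y)) @^-1` [set` `[(c * h j)%:E, +oo[]).
    by apply: measurable_lam_slice => //; exact: emeasurable_itv.
  rewrite setTI; apply/seteqP; split => y; rewrite /T/= in_itv/= ?andbT //.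
have Tj j : (l (T j) <= (Per Om E / c)%:E)%E.
  have ch0 : 0 < c * h j by rewrite mulr_gt0.
  rewrite -(@lee_pmul2l _ (c * h j)%:E)// ?lte_fin// -EFinM.
  rewrite [X in (_ <= X%:E)%E](_ : _ = h j * Per Om E); last by field; rewrite gt_eqF.
  apply: le_trans (vertical_translation fE (ltW (h0 j))).
  rewrite -integral_cst// mu_slices [leLHS]integral_mkcond.
  apply: ge0_le_integral => //=.
  - by move=> y _; rewrite patchE; case: ifPn => // _; rewrite lee_fin ltW.
  - have mK : measurable_fun (T j) (fun=> (c * h j)%:E : \bar R) by exact: measurable_cst.
    exact: (measurable_restrictT _ (mT j)).1 mK.
  - exact: (measurable_lam_slice (mX j)).
  - by move=> y _; rewrite patchE; case: ifPn => [/set_mem//|_]; rewrite measure_ge0.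
pose V K := \bigcap_(j in [set j | (K <= j)%N]) T j.
have mV K : measurable (V K).
  by apply: bigcap_measurable => [|j _]; [exists K => /=|exact: mT].
have monoV : {homo V : K K' / (K <= K')%N >-> (K <= K')%O}.
  move=> K K' KK'; apply/subsetPset => y Vy j /= K'j; apply: Vy; exact: leq_trans K'j.
exists (\bigcup_K V K); split.
- exact: bigcupT_measurable.
- move=> y Zy; have mS := measurable_slice y mE.
  have [d d0 Hd] : exists2 d, 0 < d & forall r, 0 < r -> r < d ->
      c * r <= fine (lam (jumps (slice E y) r `&` `]0, s[%classic)).
    have := HZ _ Zy; rewrite near_withinE => /nbhs_ballP[d /= d0 Hd]; exists d => // r r0 rd.
    by apply: Hd => //; rewrite /ball/= sub0r normrN gtr0_norm.
  have [K] := ltr_add_invr d0; rewrite add0r => HK.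
  exists K => // j /= Kj; rewrite /T/=.
  have hd : h j < d by apply: le_lt_trans HK; rewrite /h lef_pV2 ?posrE// ler_nat.
  have mJ : measurable (jumps (slice E y) (h j) `&` `]0, s[%classic : set (measurableTypeR R)).
    by apply: measurableI; [exact: measurable_jumps|exact: measurable_itv].
  have Joo : (lam (jumps (slice E y) (h j) `&` `]0%R, s[%classic) < +oo)%E.
    apply: (@le_lt_trans _ _ (lam (`]0, s[%classic : set (measurableTypeR R)))).
      by apply: le_mu => //; exact: subIsetr.
    by rewrite lebesgue_measure_itv/=; case: ifP => _; rewrite ?ltry.
  have := Hd _ (h0 j) hd; rewrite -lee_fin fineK ?ge0_fin_numE// => /le_trans; apply.
  apply: le_mu => //; first exact: measurable_slice.
  move=> t [Jt]; rewrite /= in_itv/= => /andP[t0 _].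
  split; first by rewrite /halfspace/= height_snoc.
  have Es : (h j *: e_v + snoc (y, t) : 'rV[R]_n.+1) = snoc (y, h j + t).
    apply/rowP => i; rewrite !mxE; case: unliftP => [i' ->|->] /=.
      by rewrite lift_eqF ?andbF mulr0 add0r.
    by rewrite eqxx mulr1.
  have [Et|nEt] := pselect (E (snoc (y, t))); have [Eh|nEh] := pselect (E (snoc (y, h j + t))).
  - by case: Jt.
  - by right; split => //; rewrite /preimage/= Es.
  - by left; split => //; rewrite /preimage/= Es.
  - by case: Jt.
- apply: (cvge_to_le (nondecreasing_cvg_mu mV (bigcupT_measurable _ mV) monoV)).
  apply: nearW => K; apply: le_trans (Tj K); apply: le_mu => //.
  by move=> y; apply; rewrite /=.
Qed.

End traces.

(** * Identification of the trace *)

Section trace_of_set.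
Variables (R : realType) (n : nat).
Local Notation mu := (lebesgue R n.+1).
Local Notation l := (lebesgue R n).
Local Notation lam := (@lebesgue_measure R).
Local Notation Om := (@halfspace R n).
Implicit Types (E X : set 'rV[R]_n.+1) (B C : set 'rV[R]_n) (y : 'rV[R]_n) (k : nat).

Lemma mixed_set_le E k : finite_perimeter Om E -> (l (mixed_set E k) <= (2 * Per Om E)%:E)%E.
Proof.
move=> fE; have [mE _ _ _] := fE.
have [||G [mG ZG HG]] := @jump_set_bound R n E (mixed_set E k) (1/2) k.+1%:R^-1 fE.
- by rewrite divr_gt0.
- move=> y [H1 H2]; have := jumps_interval (measurable_slice y mE) H1 H2.
  by apply: filterS => h; rewrite div1r mulrC.
rewrite (_ : 2 * _ = Per Om E / (1 / 2)); last by field.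
by apply: le_trans HG; apply: le_mu => //; exact: measurable_mixed_set.
Qed.

(** By [jumps_near_zero] a column mixed at every scale has jumps of length N h / 2 for every N, so
    such columns have measure at most 2 Per / N and hence 0. *)
Lemma mixed_set_cvg E : finite_perimeter Om E -> l (mixed_set E k) @[k --> \oo] --> 0%E.
Proof.
move=> fE; have [mE _ _ _] := fE.
have mX k : measurable (mixed_set E k) by exact: measurable_mixed_set.
have mI : measurable (\bigcap_k mixed_set E k) by exact: bigcapT_measurable.
suff <- : l (\bigcap_k mixed_set E k) = 0%E.
  apply: nonincreasing_cvg_mu => //.
    by apply: (le_lt_trans (mixed_set_le 0 fE)); rewrite ltry.
  by move=> k k' kk'; apply/subsetPset; exact: mixed_set_mono.
have P0 := Per_ge0 fE.
have key (N : nat) : (l (\bigcap_k mixed_set E k) <= (Per Om E * 2 / N.+1%:R)%:E)%E.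
  have [||G [mG ZG HG]] := @jump_set_bound R n E (\bigcap_k mixed_set E k) (N.+1%:R / 2) 1 fE.
  - by rewrite divr_gt0.
  - move=> y Hy.
    have mix s' : 0 < s' -> mixed (slice E y) s'.
      move=> s0; have [k] := ltr_add_invr s0; rewrite add0r => /ltW ks.
      have [H1 H2] := Hy k I; have mS := measurable_slice y mE.
      have sub : (`]0, k.+1%:R^-1[%classic : set R) `<=` `]0, s'[%classic.
        by move=> t; rewrite /= !in_itv/= => /andP[-> /lt_le_trans]; exact.
      have mJ (r : R) : measurable (`]0, r[%classic : set (measurableTypeR R)) by exact: measurable_itv.
      split.
        by apply: (lt_le_trans H1); apply: le_mu; [exact: measurableI|exact: measurableI|exact: setIS].
      by apply: (lt_le_trans H2); apply: le_mu; [exact: measurableD|exact: measurableD|exact: setSD].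
    have := jumps_near_zero (measurable_slice y mE) N.+1 ltr01 mix.
    by apply: filterS => h; rewrite mulrA mulrAC.
  rewrite (_ : _ / _ = Per Om E / (N.+1%:R / 2)); last first.
    by rewrite invf_div mulrA.
  by apply: le_trans HG; exact: le_mu.
apply/eqP; rewrite -measure_le0; apply/lee_addgt0Pr => e e0; rewrite add0e.
have q : 0 < Per Om E * 2 + 1 by lra.
have [N] := ltr_add_invr (divr_gt0 e0 q); rewrite add0r ltr_pdivlMr// => HN.
apply: (le_trans (key N)); rewrite lee_fin; apply: le_trans (ltW HN).
rewrite mulrC; apply: ler_wpM2l => //; lra.
Qed.

Lemma mu_band_le X B C (s : R) : measurable X -> measurable B -> measurable C -> 0 <= s ->
  (forall y, ~ B y -> lam (slice X y `&` `]0, s[%classic) = 0%E) ->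
  (mu (X `&` (@horizontal R n @^-1` C) `&` band s) <= s%:E * l (B `&` C))%E.
Proof.
move=> mX mB mC s0 H; rewrite -mu_cylinder//; last exact: measurableI.
have mh D := @measurable_horizontal_pre R n D.
have mb := @measurable_band R n s.
have mB' := mh _ (measurableC mB).
set Y := X `&` band s `&` (@horizontal R n @^-1` (~` B)).
have mY : measurable Y by apply: measurableI => //; exact: measurableI.
have mZ : measurable ((@horizontal R n @^-1` (B `&` C)) `&` band s).
  by apply: measurableI => //; apply: mh; exact: measurableI.
have Y0 : mu Y = 0%E.
  apply: mu_slices_null => y; have [By|nBy] := pselect (B y).
    rewrite (_ : slice Y y = set0) ?measure0//; apply/seteqP; split => // t.
    by rewrite /slice /Y/= horizontal_snoc => -[].
  rewrite -(H y nBy) -slice_band; congr (lam _); apply/seteqP; split => t.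
    by move=> -[].
  by rewrite /slice /Y/= => ?; rewrite horizontal_snoc.
apply: (@le_trans _ _ (mu ((@horizontal R n @^-1` (B `&` C)) `&` band s `|` Y))).
  apply: le_mu; first by apply: measurableI => //; apply: measurableI => //; exact: mh.
    exact: measurableU.
  move=> x [[Xx Cx] bx]; have [Bx|nBx] := pselect (B (horizontal x)); first by left.
  by right.
apply: (le_trans (le_muU mu mZ mY)); by rewrite [X in (_ + X <= _)%E]Y0 adde0.
Qed.

Lemma height_boundary y : height (boundary_point y) = 0.
Proof. exact: height_snoc. Qed.

Lemma halfball_sub_band y (r : R) : 0 < r ->
  Om `&` eball (boundary_point y) r `<=` (@horizontal R n @^-1` ball y r) `&` band r.
Proof.
move=> r0 x [x0 /eball_sub_ball /rV_ballP H]; split.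
  apply/rV_ballP => // i; have := H r0 (lift ord_max i).
  by rewrite /boundary_point/snoc !mxE liftK.
rewrite /band/=; apply/andP; split => //; have := H r0 ord_max.
by rewrite !mxE unlift_none/= sub0r normrN => /ltr_normlW.
Qed.

Lemma band_sub_halfball y (r : R) : 0 < r ->
  (@horizontal R n @^-1` ball y (r / n.+2%:R)) `&` band (r / n.+2%:R) `<=`
  Om `&` eball (boundary_point y) r.
Proof.
move=> r0 x [/rV_ballP H /andP[x0 xr]]; split => //.
have d0 : 0 < r / n.+2%:R by rewrite divr_gt0.
apply: ball_sub_eball => //; apply/rV_ballP => // i; rewrite /boundary_point/snoc mxE.
case: unliftP => [j ->|->] /=; first by have := H d0 j; rewrite mxE.
by rewrite sub0r normrN gtr0_norm.
Qed.

Lemma measurable_halfball y r : measurable (Om `&` eball (boundary_point y) r).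
Proof. by apply: measurableI; [exact: measurable_halfspace|exact: measurable_eball]. Qed.

Lemma mu_halfball_ge y : exists2 c : R, 0 < c &
  forall r, 0 < r -> ((c * r ^+ n.+1)%:E <= mu (Om `&` eball (boundary_point y) r))%E.
Proof.
exists (n.+2%:R^-1 * (2 / n.+2%:R) ^+ n); first by rewrite mulr_gt0 ?exprn_gt0 ?divr_gt0 ?invr_gt0.
move=> r r0; have d0 : 0 < r / n.+2%:R by rewrite divr_gt0.
have mB := measurable_ball_rV y (r / n.+2%:R).
apply: (@le_trans _ _ (mu ((@horizontal R n @^-1` ball y (r / n.+2%:R)) `&` band (r / n.+2%:R)))).
  rewrite (mu_cylinder mB (ltW d0)) (mu_ball _ d0) -EFinM lee_fin le_eqVlt; apply/orP; left; apply/eqP.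
  rewrite exprS !exprMn; ring.
apply: le_mu; [|exact: measurable_halfball|exact: band_sub_halfball].
by apply: measurableI; [exact: measurable_horizontal_pre|exact: measurable_band].
Qed.

Lemma measurable_indic_dist E (t : R) : measurable E ->
  measurable_fun setT (fun x => `|(\1_E x : R) - t|%:E).
Proof.
move=> mE; apply/measurable_EFinP; apply: measurableT_comp => //.
by apply: measurable_funB => //; exact: measurable_indic.
Qed.

Definition trace_values E y : set R := [set t : R |
  ((r ^- n.+1)%:E * \int[mu]_(x in Om `&` eball (boundary_point y) r)
     `|(\1_E x : R) - t|%:E)%E @[r --> 0^'+] --> 0%E].

(** If t1 and t2 are both limits, the triangle inequality bounds |t1 - t2| times the volume of the
    half-ball, which is at least of order r^(n+1). *)
Lemma trace_values_unique E y : measurable E -> is_subset1 (trace_values E y).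
Proof.
move=> mE t1 t2 H1 H2; have [c c0 Hc] := mu_halfball_ge y.
have := cvgeD _ H1 H2; rewrite adde0 => /(_ _ isT) H.
suff : ((`|t1 - t2| * c)%:E <= 0)%E.
  by rewrite lee_fin pmulr_lle0// normr_le0 subr_eq0 => /eqP.
apply: (cvge_to_ge H); near=> r; have r0 : 0 < r by [].
set V := Om `&` _; have mV : measurable V by exact: measurable_halfball.
have i0 t : (0 <= \int[mu]_(x in V) `|(\1_E x : R) - t|%:E)%E by apply: integral_ge0.
rewrite -ge0_muleDr//.
have rm : 0 < r ^- n.+1 by rewrite invr_gt0 exprn_gt0.
rewrite -ge0_integralD//; last 2 first.
- by apply: measurable_funTS; exact: measurable_indic_dist.
- by apply: measurable_funTS; exact: measurable_indic_dist.
apply: (@le_trans _ _ ((r ^- n.+1)%:E * (`|t1 - t2|%:E * mu V))%E).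
  apply: (@le_trans _ _ ((r ^- n.+1)%:E * (`|t1 - t2|%:E * (c * r ^+ n.+1)%:E))%E).
    have a0 : r ^+ n.+1 != 0 by rewrite gt_eqF ?exprn_gt0.
    rewrite -!EFinM lee_fin; move: (r ^+ n.+1) a0 => a a0.
    by rewrite [leRHS](_ : _ = `|t1 - t2| * c)//; field.
  rewrite lee_pmul2l ?lte_fin//; apply: lee_wpmul2l; [by rewrite lee_fin|exact: Hc].
rewrite lee_pmul2l ?lte_fin// -integral_cst//.
apply: ge0_le_integral => //.
- by move=> x _; rewrite /cst lee_fin.
- apply: emeasurable_funD; apply: measurable_funTS; exact: measurable_indic_dist.
- move=> x _; rewrite /cst -EFinD lee_fin.
  rewrite (_ : t1 - t2 = (t1 - \1_E x) + (\1_E x - t2)); last by ring.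
  by apply: (le_trans (ler_normD _ _)); rewrite distrC.
Unshelve. all: by end_near. Qed.

Lemma trace_value E y (a : R) : measurable E -> trace_values E y a -> trace (\1_E) y = a.
Proof. by move=> mE Ha; apply: xget_subset1 => //; exact: trace_values_unique. Qed.

(** At almost every y some scale k0 is unmixed, and y has density 0 for [mixed_set E k0] and for
    whichever of [tr_set E] and its complement misses y. In a half-ball of radius r below 1/(k0+1)
    only columns over these two sparse sets contribute, each with height at most r. *)
Lemma trace_indic E : finite_perimeter Om E -> {ae l, forall y, trace (\1_E) y = \1_(tr_set E) y}.
Proof.
move=> fE; have [mE _ _ _] := fE; have mA := measurable_tr_set mE.
have mX k := measurable_mixed_set k mE.
have nmix : {ae l, forall y, exists k, ~ mixed_set E k y}.
  exists (\bigcap_k mixed_set E k); split; first exact: bigcapT_measurable.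
    apply: cvg_unique (mixed_set_cvg fE) => //.
    apply: nonincreasing_cvg_mu => //; last by move=> k k' kk'; apply/subsetPset; exact: mixed_set_mono.
    - by apply: (le_lt_trans (mixed_set_le 0 fE)); rewrite ltry.
    - exact: bigcapT_measurable.
  by move=> y /= /forallNP H k _; apply: contrapT; exact: H.
have dA := density_zero mA; have dA' := density_zero (measurableC mA).
have dX := ae_foralln (fun k => density_zero (mX k)).
have FF : Filter (almost_everywhere l) by exact: ae_filter_ringOfSetsType.
have FI := @filterI _ _ FF _ _ (@filterI _ _ FF _ _ dX nmix) (@filterI _ _ FF _ _ dA dA').
apply: (@filterS _ _ FF _ _ _ FI) => y [[Hm [k0 nk0]] [HA HA']].
apply: trace_value => //; rewrite /trace_values/=.
(* [S] collects the base points of the opposite kind to y, [X] the part of the half-space where the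
   indicator differs from its expected value at y. *)
pose S := if `[< tr_set E y >] then ~` tr_set E else tr_set E.
pose X := if `[< tr_set E y >] then Om `\` E else E.
have mS : measurable S by rewrite /S; case: ifP => _ //; exact: measurableC.
have mX' : measurable X by rewrite /X; case: ifP => _ //; apply: measurableD => //; exact: measurable_halfspace.
have HS : fine (l (S `&` ball y r)) / r ^+ n @[r --> 0^'+] --> (0 : R).
  by rewrite /S; case: asboolP => yA; [apply: HA'|apply: HA].
have HM := Hm _ nk0.
have loo (B : set 'rV[R]_n) r : 0 < r -> measurable B -> (l (B `&` ball y r) < +oo)%E.
  move=> r0 mB; apply: (@mu_lty _ _ _ _ _ (ball y r)); [|exact: measurable_ball_rV|exact: subIsetr|].
    by apply: measurableI => //; exact: measurable_ball_rV.
  by rewrite [X in (X < _)%E]mu_ball// ltry.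
pose g r := fine (l (mixed_set E k0 `&` ball y r)) / r ^+ n + fine (l (S `&` ball y r)) / r ^+ n.
have Hg : g r @[r --> 0^'+] --> (0 : R) by have := cvgD HM HS; rewrite addr0; exact.
apply: (@squeeze_cvge _ _ _ _ (cst 0%E) _ (EFin \o g)); last 2 first.
- exact: cvg_cst.
- by apply/fine_cvgP; split => //; exact: nearW.
near=> r; have r0 : 0 < r by [].
have rk : r < k0.+1%:R^-1 by near: r; apply: nbhs_right_lt; rewrite invr_gt0.
set V := Om `&` _; have mV : measurable V by exact: measurable_halfball.
have rm : 0 < r ^- n.+1 by rewrite invr_gt0 exprn_gt0.
apply/andP; split; first by rewrite mule_ge0// ?lee_fin ?(ltW rm)//; exact: integral_ge0.
have mB : measurable (mixed_set E k0 `|` S) by exact: measurableU.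
have mb := measurable_ball_rV y r.
have bound : (\int[mu]_(x in V) `|(\1_E x : R) - \1_(tr_set E) y|%:E <=
    r%:E * l ((mixed_set E k0 `|` S) `&` ball y r))%E.
  apply: (@le_trans _ _ (mu (X `&` (@horizontal R n @^-1` ball y r) `&` band r))).
    rewrite (_ : integral _ _ _ = mu (X `&` V)).
      apply: le_mu; first exact: measurableI.
        by apply: measurableI; [apply: measurableI => //; exact: measurable_horizontal_pre|exact: measurable_band].
      by move=> x [Xx /(halfball_sub_band r0)[]].
    rewrite -integral_indic//; apply: eq_integral => x /set_mem[Ox _]; congr (_%:E).
    rewrite !indicE /X; case: asboolP => yA.
      rewrite (mem_set yA) in_setD (mem_set Ox)/=.
      by case: (x \in E); rewrite /= ?subrr ?normr0// sub0r normrN normr1.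
    by rewrite (memNset yA) subr0; case: (x \in E); rewrite /= ?normr1 ?normr0.
  apply: (mu_band_le mX' mB mb (ltW r0)).
  move=> y' /not_orP[nm nS]; have mS' := measurable_slice y' mE.
  have sub : (`]0, r[%classic : set R) `<=` `]0, k0.+1%:R^-1[%classic.
    by move=> t; rewrite /= !in_itv/= => /andP[-> /lt_trans]; exact.
  have mI (s : R) : measurable (`]0, s[%classic : set (measurableTypeR R)) by exact: measurable_itv.
  move: nS; rewrite /S /X; case: asboolP => yA nS.
    have [[_ z]|[nA _]] := not_mixedP mE nm; last by case: nS.
    apply: null_sub z.
    - apply: measurableI => //; apply: measurable_slice; apply: measurableD => //.
      exact: measurable_halfspace.
    - exact: measurableD.
    - by move=> t [[_ nE] /sub]; split.
  have [[yA' _]|[_ z]] := not_mixedP mE nm; first by case: nS.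
  by apply: null_sub z; [exact: measurableI|exact: measurableI|exact: setIS].
apply: (@le_trans _ _ ((r ^- n.+1)%:E * (r%:E * (l (mixed_set E k0 `&` ball y r) + l (S `&` ball y r))))%E).
  rewrite lee_pmul2l ?lte_fin//; apply: (le_trans bound); rewrite lee_pmul2l ?lte_fin//.
  by rewrite setIUl; apply: le_muU; exact: measurableI.
rewrite -(finite_muK (loo _ _ r0 (mX k0))) -(finite_muK (loo _ _ r0 mS)) -EFinD -!EFinM lee_fin /g.
have a0 : r ^+ n != 0 by rewrite gt_eqF ?exprn_gt0.
rewrite exprS; set u := fine _; set v := fine _; move: (r ^+ n) a0 => a a0.
rewrite [leLHS](_ : _ = u / a + v / a)//; field; rewrite a0 gt_eqF.
Unshelve. all: by end_near. Qed.

End trace_of_set.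

(** * The Gauss-Green formula *)

Section gauss_green.
Variables (R : realType) (n : nat).
Local Notation mu := (lebesgue R n.+1).
Local Notation l := (lebesgue R n).
Local Notation lam := (@lebesgue_measure R).
Local Notation Om := (@halfspace R n).
Local Notation e_v := (delta_mx 0 ord_max : 'rV[R]_n.+1).
Implicit Types (E : set 'rV[R]_n.+1) (A : set 'rV[R]_n) (k : nat).

Definition cyl A (s : R) : set 'rV[R]_n.+1 := (@horizontal R n @^-1` A) `&` band s.

Lemma measurable_cyl A s : measurable A -> measurable (cyl A s).
Proof.
by move=> mA; apply: measurableI; [exact: measurable_horizontal_pre|exact: measurable_band].
Qed.

Lemma lam_itv_lty b1 b2 (a b : R) :
  (lam [set` Interval (BSide b1 a) (BSide b2 b)] < +oo)%E.
Proof. by rewrite lebesgue_measure_itv/=; case: ifP => _; rewrite ?ltry. Qed.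

Lemma integral_cylinder A (s : R) (g : 'rV[R]_n -> R) (h : R -> R) (C C' : R) :
  measurable A -> (l A < +oo)%E -> 0 <= s -> measurable_fun setT g -> measurable_fun setT h ->
  (forall y, `|g y| <= C) -> (forall t, `|h t| <= C') ->
  \int[mu]_(x in cyl A s) (h (height x) * g (horizontal x)) =
  (\int[lam]_(t in `]0, s[) h t) * \int[l]_(y in A) g y.
Proof.
move=> mA Aoo s0 mg mh gC hC.
pose f (p : 'rV[R]_n * measurableTypeR R) : R := h p.2 * g p.1.
have mI : measurable (`]0, s[%classic : set (measurableTypeR R)) by exact: measurable_itv.
have mf : measurable_fun setT f.
  apply: measurable_funM; first exact: measurableT_comp mh measurable_snd.
  exact: measurableT_comp mg measurable_fst.
pose D := A `*` (`]0, s[%classic : set (measurableTypeR R)).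
have mD : measurable D by exact: measurableX.
have preD : @snoc R n @^-1` cyl A s = D.
  apply/seteqP; split => -[y t]; rewrite /cyl /band/= horizontal_snoc height_snoc.
    by move=> [Ay ts]; split => //=; rewrite in_itv.
  by rewrite /D/= in_itv.
have fC p : `|f p| <= C' * C by rewrite normrM ler_pM.
have Doo : ((l \x lam)%E D < +oo)%E.
  by rewrite -preD -lebesgueS_prod mu_cylinder// lte_mul_pinfty ?lee_fin.
have If : (l \x lam)%E.-integrable D (EFin \o f).
  by apply: (@bounded_integrable _ _ _ _ _ _ (C' * C)) => // p _.
have mF : measurable_fun setT (fun x : 'rV[R]_n.+1 => (h (height x) * g (horizontal x))%:E).
  apply/measurable_EFinP; apply: measurable_funM.
    exact: measurableT_comp mh (@measurable_height R n).
  exact: measurableT_comp mg (@measurable_horizontal R n).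
have fE p : (h (height (snoc p)) * g (horizontal (snoc p))) = f p.
  by case: p => y t; rewrite height_snoc horizontal_snoc.
have E1 : (\int[mu]_(x in cyl A s) (h (height x) * g (horizontal x))%:E =
  \int[(l \x lam)%E]_(p in D) (f p)%:E)%E.
  rewrite -preD -[LHS]/(\int[pushforward (l \x lam)%E (@snoc R n)]_(x in cyl A s) (h (height x) * g (horizontal x))%:E)%E.
  rewrite integral_pushforward//.
  - by apply: eq_integral => p _ /=; rewrite fE.
  - exact: measurable_snoc.
  - rewrite preD; apply: eq_integrable If => // p _ /=; by rewrite fE.
  - exact: measurable_cyl.
have Ih : lam.-integrable `]0, s[ (EFin \o h).
  apply: (@bounded_integrable _ _ _ _ _ _ C') => //.
  exact: lam_itv_lty.
have IfD : (l \x lam)%E.-integrable setT ((EFin \o f) \_ D) by exact: (integrable_mkcond _ mD).1 If.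
have E2 : (\int[(l \x lam)%E]_(p in D) (f p)%:E = \int[l]_y fubini_F lam ((EFin \o f) \_ D) y)%E.
  by rewrite integral_mkcond; exact: esym (integral12_prod_meas1 IfD).
rewrite /Rintegral E1 E2.
rewrite -[RHS]RintegralZl//; last by apply: (@bounded_integrable _ _ _ _ _ _ C).
rewrite /Rintegral [in RHS]integral_mkcond; congr fine; apply: eq_integral => y _.
rewrite /fubini_F [RHS]patchE; case: ifPn => yA.
  transitivity (\int[lam]_(t in `]0%R, s[) (g y * h t)%:E)%E.
    rewrite [RHS]integral_mkcond; apply: eq_integral => t _; rewrite !patchE.
    rewrite /f/= [h t * _]mulrC /D; congr (if _ then _ else _).
    by apply/idP/idP => /set_mem H; apply/mem_set; [case: H|split => //; exact: set_mem].
  rewrite -[LHS]fineK; last first.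
    by apply: integrable_fin_num => //; apply: (eq_integrable _ _ _ _ (integrableZl _ (g y) Ih)).
  by congr (_%:E); rewrite -[LHS]/(\int[lam]_(t in _) (g y * h t)) RintegralZl// mulrC.
rewrite integral0_eq// => t _; rewrite patchE; case: ifPn => // /set_mem [/= /mem_set].
by rewrite (negbTE yA).
Qed.

(** The spline climbs from 0 at height 1 / a to 1 at height 2 / a. *)
Lemma integral_dstep (a : R) : 0 < a ->
  \int[lam]_(t in `]0, 2 / a[) (dstep (a * t - 1) * a) = 1.
Proof.
move=> a0; pose h (t : R) := dstep (a * t - 1) * a; rewrite -[LHS]/(\int[lam]_(t in `]0, 2 / a[) h t); have s0 : 0 < 2 / a by rewrite divr_gt0.
pose F (t : R) := step (a * t - 1).
have dl t : is_derive t (1 : R) (fun t => a * t - 1) a.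
  have := is_deriveD (is_deriveZ a (is_derive_id t (1 : R))) (is_derive_cst (-1 : R) t (1 : R)).
  by rewrite addr0 [_ *: _]mulr1; exact.
have dF t : is_derive t (1 : R) F (h t).
  have := @is_derive1_comp R (@step R) (fun t => a * t - 1) t _ _ (is_derive_step _) (dl t).
  exact.
have cl : continuous (fun t => a * t - 1 : R).
  by move=> t; apply: differentiable_continuous; apply/derivable1_diffP; case: (dl t).
have ch : continuous h.
  move=> t; apply: cvgM; last exact: cvg_cst.
  by have := continuous_comp (cl t) (@continuous_dstep R (a * t - 1)); exact.
have cF : continuous F.
  by move=> t; apply: differentiable_continuous; apply/derivable1_diffP; case: (dF t).
have mh : measurable_fun setT h by exact: continuous_measurable_fun.
have hb : forall t, `|h t| <= 2 * a.
  by move=> t; rewrite normrM (gtr0_norm a0); apply: ler_wpM2r; [exact: ltW|exact: normr_dstep].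
rewrite Rintegral_itv_obnd_cbnd ?Rintegral_itv_bndo_bndc; last 2 first.
- apply: (@bounded_integrable _ _ _ _ _ _ (2 * a)) => //.
  exact: lam_itv_lty.
- apply: (@bounded_integrable _ _ _ _ _ _ (2 * a)) => //.
  exact: lam_itv_lty.
rewrite /Rintegral (@continuous_FTC2 _ _ F)//.
- rewrite -EFinB/= /F step1 ?step0 ?subr0//; first by rewrite mulr0; lra.
  by rewrite mulrC divfK ?gt_eqF//; lra.
- exact: continuous_subspaceT.
- split; first by move=> t _; case: (dF t).
    by apply: cvg_at_right_filter; exact: cF.
  by apply: cvg_at_left_filter; exact: cF.
- by move=> t _; rewrite derive1E; case: (dF t) => _ ->.
Qed.

End gauss_green.

Section symmetric_difference.
Context d (T : measurableType d) (R : realType) (mu : {measure set T -> \bar R}).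
Implicit Types (A B : set T) (f : T -> R).

Lemma Rintegral_setY A B f (M : R) : measurable A -> measurable B -> (mu A < +oo)%E ->
  (mu B < +oo)%E -> measurable_fun setT f -> (forall x, `|f x| <= M) ->
  `|\int[mu]_(x in A) f x - \int[mu]_(x in B) f x| <= M * fine (mu (A `+` B)).
Proof.
move=> mA mB Aoo Boo mf fM.
have mAB := measurableD mA mB; have mBA := measurableD mB mA.
have ABoo := mu_lty mAB mA (@subDsetl _ A B) Aoo.
have BAoo := mu_lty mBA mB (@subDsetl _ B A) Boo.
rewrite (@Rintegral_setD _ _ _ mu A B)//; last exact: (@bounded_integrable _ _ _ _ _ _ M).
rewrite (@Rintegral_setD _ _ _ mu B A)//; last exact: (@bounded_integrable _ _ _ _ _ _ M).
rewrite [B `&` A]setIC opprD addrACA subrr add0r.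
have -> : fine (mu (A `+` B)) = fine (mu (A `\` B)) + fine (mu (B `\` A)).
  rewrite /setY measureU//; last by apply/seteqP; split => // x [[? ?] []].
  by rewrite fineD// ge0_fin_numE.
rewrite mulrDr; apply: (le_trans (ler_normB _ _)).
by apply: lerD; exact: Rintegral_bound.
Qed.

End symmetric_difference.

Section gauss_green.
Variables (R : realType) (n : nat).
Local Notation mu := (lebesgue R n.+1).
Local Notation l := (lebesgue R n).
Local Notation lam := (@lebesgue_measure R).
Local Notation Om := (@halfspace R n).
Local Notation e_v := (delta_mx 0 ord_max : 'rV[R]_n.+1).
Implicit Types (E : set 'rV[R]_n.+1) (A : set 'rV[R]_n) (k j : nat).

(** Over an unmixed column, [E] and the cylinder over its trace agree in the band up to a null
    set. *)
Lemma mu_cyl_diff E j : finite_perimeter Om E ->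
  (mu ((E `&` band j.+1%:R^-1) `+` cyl (tr_set E) j.+1%:R^-1) <=
   (j.+1%:R^-1)%:E * l (mixed_set E j))%E.
Proof.
move=> fE; have [mE _ _ _] := fE; have mA := measurable_tr_set mE.
have mhA := measurable_horizontal_pre mA.
have mX : measurable (E `+` (@horizontal R n @^-1` tr_set E)) by exact: measurableY.
have H := @mu_band_le R n _ (mixed_set E j) setT j.+1%:R^-1 mX (measurable_mixed_set j mE) measurableT.
rewrite setIT in H; apply: le_trans (H _ _).
- rewrite le_eqVlt; apply/orP; left; apply/eqP; congr (mu _).
  apply/seteqP; split => x; rewrite /cyl /setY/= ; tauto.
- by rewrite invr_ge0.
- move=> y nm; have mS := measurable_slice y mE.
  have mI : measurable (`]0, j.+1%:R^-1[%classic : set (measurableTypeR R)) by exact: measurable_itv.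
  have mXs := measurable_slice y mX.
  have [[Ay z]|[nAy z]] := not_mixedP mE nm.
    apply: null_sub z; [exact: measurableI|exact: measurableD|].
    move=> t [[[Et nA]|[At nE]] ts]; last by split.
    by case: nA; rewrite /preimage/= horizontal_snoc.
  apply: null_sub z; [exact: measurableI|exact: measurableI|].
  move=> t [[[Et nA]|[At nE]] ts]; first by split.
  by case: nAy; move: At; rewrite /preimage/= horizontal_snoc.
Qed.

Lemma tr_set_lty E : finite_perimeter Om E -> (l (tr_set E) < +oo)%E.
Proof.
move=> fE; have [mE _ Eoo _] := fE; have mA := measurable_tr_set mE.
have mX := measurable_mixed_set 0 mE.
have mc := @measurable_cyl R n _ 0.+1%:R^-1 mA.
have mEb : measurable (E `&` band 0.+1%:R^-1) by apply: measurableI => //; exact: measurable_band.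
have mD := measurableY mEb mc.
have Ec : mu (cyl (tr_set E) 0.+1%:R^-1) = l (tr_set E).
  by rewrite [LHS]mu_cylinder// ?invr1 ?mul1e.
rewrite -Ec.
apply: (@le_lt_trans _ _ (mu (E `|` ((E `&` band 0.+1%:R^-1) `+` cyl (tr_set E) 0.+1%:R^-1)))).
  apply: le_mu => //; first exact: measurableU.
  move=> x cx; have [Ex|nEx] := pselect (E x); [by left|right; right].
  by split => // -[].
apply: (le_lt_trans (le_muU mu mE mD)).
rewrite lte_add_pinfty//; apply: (le_lt_trans (mu_cyl_diff 0 fE)).
by rewrite invr1 mul1e; apply: (le_lt_trans (mixed_set_le 0 fE)); rewrite ltry.
Qed.

Lemma boundary_lipschitz (f : 'rV[R]_n.+1 -> R) df (M : R) x : C1 f df ->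
  (forall x (i : 'I_n.+1), `|df i x| <= M) -> 0 < height x ->
  `|f x - f (boundary_point (horizontal x))| <= M * height x.
Proof.
move=> [_ fd _] dM x0.
have := @partials_lipschitz R n.+1 f df (boundary_point (horizontal x)) x M fd (fun z _ i => dM z i).
rewrite (bigD1 ord_max)//= big1 ?addr0; last first.
  move=> i im; rewrite !mxE; case: unliftP im => [i' ->|->]; last by rewrite eqxx.
  by rewrite mxE subrr normr0.
have -> : `|x 0 ord_max - boundary_point (horizontal x) 0 ord_max| = height x.
  by rewrite /boundary_point /snoc mxE unlift_none/= subr0 gtr0_norm.
exact.
Qed.

Lemma continuous_boundary : continuous (@boundary_point R n).
Proof.
apply: continuous_rV => i; rewrite /boundary_point /snoc.
case: (unliftP ord_max i) => [j ->|->].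
  rewrite (_ : (fun _ => _) = (fun y : 'rV[R]_n => y 0 j)); last by apply/funext => y; rewrite mxE liftK.
  by case: (C1_coord R j).
rewrite (_ : (fun _ => _) = cst 0); last by apply/funext => y; rewrite mxE unlift_none.
exact: cst_continuous.
Qed.

Lemma continuous_on_boundary (f : 'rV[R]_n.+1 -> R) : continuous f ->
  continuous (fun y => f (boundary_point y)).
Proof.
by move=> cf y; apply: (@continuous_comp _ _ _ (@boundary_point R n) f);
  [exact: continuous_boundary|exact: cf].
Qed.

(** The vertical derivative of [lift_cutoff] at index 2 j + 1: an approximate identity of unit
    vertical mass, living between the heights 1/(2(j+1)) and 1/(j+1). *)
Definition boundary_layer j (x : 'rV[R]_n.+1) : R :=
  dstep (2 * j.+1%:R * height x - 1) * (2 * j.+1%:R).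

Lemma normr_boundary_layer j x : `|boundary_layer j x| <= 4 * j.+1%:R.
Proof.
rewrite /boundary_layer normrM (_ : 4 * _ = 2 * (2 * j.+1%:R)); last by rewrite mulrA; congr (_ * _); rewrite -natrM.
have a0 : 0 <= 2 * j.+1%:R :> R by rewrite mulr_ge0.
by rewrite (ger0_norm a0); apply: ler_wpM2r => //; exact: normr_dstep.
Qed.

Lemma measurable_boundary_layer j : measurable_fun setT (boundary_layer j).
Proof.
apply: measurable_funM => //.
have H : continuous (fun t : R => dstep (2 * j.+1%:R * t - 1)).
  move=> t; have c1 : {for t, continuous (fun t : R => 2 * j.+1%:R * t - 1)}.
    by apply: cvgB; [apply: cvgM; [exact: cvg_cst|exact: cvg_id]|exact: cvg_cst].
  by have := continuous_comp c1 (@continuous_dstep R (2 * j.+1%:R * t - 1)); exact.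
have mh : measurable_fun setT (fun t : R => dstep (2 * j.+1%:R * t - 1)) by exact: continuous_measurable_fun.
exact: measurableT_comp mh (@measurable_height R n).
Qed.

Lemma boundary_layer_out j x : j.+1%:R^-1 <= height x -> boundary_layer j x = 0.
Proof.
move=> H; rewrite /boundary_layer dstep_out ?mul0r//; apply/orP; right.
suff : 1 <= j.+1%:R * height x by move: (j.+1%:R) => a; nra.
by rewrite mulrC -ler_pdivrMr// mul1r.
Qed.

(** Replacing [E] by the cylinder over its trace costs 4 times the measure of the mixed columns, the
    bound 4 (j+1) of the layer cancelling the height 1/(j+1). Replacing f by its boundary values
    costs 4 M times the measure of the trace over j+1. On the cylinder the integral is then
    exact. *)
Lemma boundary_layer_cvg E (f : 'rV[R]_n.+1 -> R) (M : R) : finite_perimeter Om E ->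
  continuous f -> (forall x, `|f x| <= 1) -> 0 <= M ->
  (forall x, 0 < height x -> `|f x - f (boundary_point (horizontal x))| <= M * height x) ->
  \int[mu]_(x in E) (boundary_layer j x * f x) @[j --> \oo] -->
  \int[l]_(y in tr_set E) f (boundary_point y).
Proof.
move=> fE fc fb M0 Hlip; have [mE EOm Eoo _] := fE.
have mA := measurable_tr_set mE; have Aoo := tr_set_lty fE.
set A := tr_set E in mA Aoo *; set I := Rintegral l _ _.
have mf := continuous_measurable_rV fc.
have mg : measurable_fun setT (fun y => f (boundary_point y)).
  by apply: continuous_measurable_rV; exact: continuous_on_boundary.
have mgh : measurable_fun setT (fun x => f (boundary_point (@horizontal R n x))).
  exact: measurableT_comp mg (@measurable_horizontal R n).
have key j : `|\int[mu]_(x in E) (boundary_layer j x * f x) - I| <=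
    4 * fine (l (mixed_set E j)) + 4 * M * fine (l A) * j.+1%:R^-1.
  set s : R := j.+1%:R^-1; have s0 : 0 < s by rewrite invr_gt0.
  pose h x := boundary_layer j x * f x.
  have mb := measurable_boundary_layer j.
  have mh : measurable_fun setT h by exact: measurable_funM.
  have hb x : `|h x| <= 4 * j.+1%:R.
    by rewrite normrM -[leRHS]mulr1 ler_pM// normr_boundary_layer.
  have mX := measurable_mixed_set j mE.
  have mEb : measurable (E `&` band s) by apply: measurableI => //; exact: measurable_band.
  have Eboo := mu_lty mEb mE (@subIsetl _ E (band s)) Eoo.
  have mc := @measurable_cyl R n _ s mA.
  have muc : mu (cyl A s) = (s%:E * l A)%E by exact: mu_cylinder (ltW s0).
  have coo : (mu (cyl A s) < +oo)%E by rewrite muc lte_mul_pinfty ?lee_fin ?ltW.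
  have E1 : \int[mu]_(x in E) h x = \int[mu]_(x in E `&` band s) h x.
    rewrite (@Rintegral_setD _ _ _ mu E (band s))//; last 2 first.
    - exact: measurable_band.
    - exact: (@bounded_integrable _ _ _ _ _ _ (4 * j.+1%:R)).
    rewrite [X in _ + X](_ : _ = 0) ?addr0//.
    rewrite /Rintegral integral0_eq// => x [Ex nb] /=; congr (_%:E).
    rewrite /h boundary_layer_out ?mul0r// leNgt; apply/negP => H; apply: nb.
    by rewrite /band/=; apply/andP; split => //; exact: EOm.
  pose h' x := boundary_layer j x * f (boundary_point (horizontal x)).
  have E2 : \int[mu]_(x in cyl A s) h' x = I.
    pose hh (t : R) := dstep (2 * j.+1%:R * t - 1) * (2 * j.+1%:R).
    have mhh : measurable_fun setT hh.
      apply: measurable_funM => //.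
      have H : continuous (fun t : R => dstep (2 * j.+1%:R * t - 1)).
        move=> t; have c1 : {for t, continuous (fun t : R => 2 * j.+1%:R * t - 1)}.
          by apply: cvgB; [apply: cvgM; [exact: cvg_cst|exact: cvg_id]|exact: cvg_cst].
        by have := continuous_comp c1 (@continuous_dstep R (2 * j.+1%:R * t - 1)); exact.
      exact: continuous_measurable_fun.
    have hhb t : `|hh t| <= 4 * j.+1%:R.
      by have := normr_boundary_layer j (snoc (0, t)); rewrite /boundary_layer height_snoc.
    rewrite (@integral_cylinder R n A s (fun y => f (boundary_point y)) hh 1 (4 * j.+1%:R))//; last exact: ltW.
    rewrite (_ : s = 2 / (2 * j.+1%:R)); last by rewrite invfM mulVKf.
    by rewrite integral_dstep ?mul1r// mulr_gt0.
  have mh' : measurable_fun setT h' by exact: measurable_funM.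
  have hb' x : `|h' x| <= 4 * j.+1%:R.
    by rewrite normrM -[leRHS]mulr1 ler_pM// normr_boundary_layer.
  rewrite -[in X in X <= _]E2 -/h E1.
  rewrite -(subrKA (\int[mu]_(x in cyl A s) h x)); apply: (le_trans (ler_normD _ _)); apply: lerD.
    apply: (le_trans (Rintegral_setY mEb mc Eboo coo mh hb)).
    have moo : (l (mixed_set E j) < +oo)%E by apply: (le_lt_trans (mixed_set_le j fE)); rewrite ltry.
    have := mu_cyl_diff j fE; rewrite -(finite_muK moo) -EFinM => H.
    have H' : fine (mu (E `&` band s `+` cyl A s)) <= s * fine (l (mixed_set E j)).
      rewrite -lee_fin fineK// ge0_fin_numE//; apply: (le_lt_trans H); exact: ltry.
    apply: (@le_trans _ _ (4 * j.+1%:R * (s * fine (l (mixed_set E j))))).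
      by apply: ler_wpM2l => //; rewrite mulr_ge0.
    by rewrite -mulrA [_ * (s * _)]mulrA mulfV ?mul1r.
  rewrite -RintegralB//; last 2 first.
  - exact: (@bounded_integrable _ _ _ _ _ _ (4 * j.+1%:R)).
  - exact: (@bounded_integrable _ _ _ _ _ _ (4 * j.+1%:R)).
  have := @Rintegral_bound _ _ _ mu (cyl A s) (fun x => h x - h' x) (4 * M) mc coo.
  have -> : fine (mu (cyl A s)) = s * fine (l A) by rewrite muc -(finite_muK Aoo).
  move=> H.
  apply: le_trans (H _ _) _.
  - exact: measurable_funB.
  - move=> x [_ /andP[x0 xs]]; rewrite /h /h' -mulrBr normrM.
    have H1 := Hlip _ x0.
    apply: (@le_trans _ _ (4 * j.+1%:R * (M * s))).
      apply: ler_pM => //; first exact: normr_boundary_layer.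
      by apply: (le_trans H1); apply: ler_wpM2l => //; exact: ltW.
    rewrite [M * s]mulrC mulrA -[4 * _ * s]mulrA mulfV ?mulr1//.
  - by rewrite [s * _]mulrC mulrA.
have mc0 : fine (l (mixed_set E j)) @[j --> \oo] --> (0 : R).
  by apply: fine_cvg; exact: mixed_set_cvg.
have h0 : j.+1%:R^-1 @[j --> \oo] --> (0 : R) by exact: cvg_harmonic.
have H : 4 * fine (l (mixed_set E j)) + 4 * M * fine (l A) * j.+1%:R^-1 @[j --> \oo] --> (0 : R).
  have := cvgD (cvgM (cvg_cst (4 : R^o)) mc0) (cvgM (cvg_cst (4 * M * fine (l A) : R^o)) h0).
  by rewrite !mulr0 addr0; exact.
apply/cvgrPdist_lt => e e0; have /cvgrPdist_lt/(_ e e0) := H.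
apply: filterS => j; rewrite sub0r normrN => Hj.
by rewrite distrC; apply: le_lt_trans (key j) _; apply: le_lt_trans Hj; exact: ler_norm.
Qed.

Lemma dive_lift k F dF (x : 'rV[R]_n.+1) :
  dive (dscale_field (lift_cutoff k) (dlift_cutoff k) F dF) x =
  lift_cutoff k x * dive dF x + F ord_max x * (dstep (k.+1%:R * height x - 1) * k.+1%:R).
Proof.
rewrite dive_scale; congr (_ + _); rewrite (bigD1 ord_max)//= big1 ?addr0.
  by rewrite /dlift_cutoff lin_e mxE !eqxx mulr1.
by move=> i /negbTE im; rewrite /dlift_cutoff mxE im andbF !mulr0.
Qed.

(** Test the perimeter in the half-space with the field times [lift_cutoff]: the term in which the
    cutoff is differentiated becomes the boundary integral. *)
Lemma gauss_green_compact E F dF : finite_perimeter Om E -> test_field setT F dF ->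
  \int[mu]_(x in E) dive dF x + \int[l]_(y in tr_set E) F ord_max (boundary_point y) <= Per Om E.
Proof.
move=> fE tF; have [M M0 dFM] := test_field_bounded tF; have [F1 Fu Fs] := tF.
have [mE EOm Eoo _] := fE.
have dM := dive_bounded dFM; have md := measurable_dive F1.
have Fc : continuous (F ord_max) by case: (F1 ord_max).
have c2 := @boundary_layer_cvg E (F ord_max) M fE Fc (fun x => unit_boundedP ord_max x Fu) M0
  (fun x => boundary_lipschitz (F1 ord_max) (fun x i => dFM x ord_max i)).
(* With this index the transition layer of [lift_cutoff (k j)] is that of [boundary_layer j]. *)
pose k j := (2 * j).+1.
have kE j : (k j).+1%:R = 2 * j.+1%:R :> R by rewrite -natrM /k mulnS.
have mlift j : measurable_fun setT (lift_cutoff (k j) : 'rV[R]_n.+1 -> R).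
  exact: (C1_measurable (@C1_lift_cutoff R n (k j))).
have lift1 j x : `|(lift_cutoff (k j) x : R)| <= 1 by exact: normr_step.
have c1 : \int[mu]_(x in E) (lift_cutoff (k j) x * dive dF x) @[j --> \oo] -->
    \int[mu]_(x in E) dive dF x.
  apply: (@Rintegral_cvg _ _ _ _ _ _ _ (n.+1%:R * M)) => //.
  - by move=> j; exact: measurable_funM.
  - by move=> j x _; rewrite normrM -[leRHS]mul1r ler_pM.
  - move=> x Ex; have H : lift_cutoff (k j) x @[j --> \oo] --> (1 : R).
      move=> U /(lift_cutoff_near1 (EOm _ Ex)) [N _ NU]; exists N => // j /= Nj; apply: NU => /=.
      by rewrite /k; apply: (leq_trans Nj); rewrite -addn1 mul2n -addnn -addnA leq_addr.
    by have := cvgM H (cvg_cst (dive dF x : R^o)); rewrite mul1r; exact.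
have H : \int[mu]_(x in E) (lift_cutoff (k j) x * dive dF x) +
    \int[mu]_(x in E) (boundary_layer j x * F ord_max x) @[j --> \oo] -->
    (\int[mu]_(x in E) dive dF x + \int[l]_(y in tr_set E) F ord_max (boundary_point y) : R).
  exact: cvgD c1 c2.
apply: (cvgr_to_le H); apply: nearW => j.
rewrite -RintegralD//; last 2 first.
- apply: (@bounded_integrable _ _ _ _ _ _ (n.+1%:R * M)) => //; first exact: measurable_funM.
  by move=> x _; rewrite normrM -[leRHS]mul1r ler_pM.
- apply: (@bounded_integrable _ _ _ _ _ _ (4 * j.+1%:R * 1)) => //.
    apply: measurable_funM; [exact: measurable_boundary_layer|exact: C1_measurable (F1 ord_max)].
  by move=> x _; rewrite normrM; apply: ler_pM => //; [exact: normr_boundary_layer|exact: unit_boundedP].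
have tk : test_field Om (scale_field (lift_cutoff (k j)) F)
    (dscale_field (lift_cutoff (k j)) (dlift_cutoff (k j)) F dF).
  split; [by apply: C1field_scale => //; exact: C1_lift_cutoff|exact: unit_bounded_scale|exact: supp_lift].
apply: le_trans (Per_ub fE tk); rewrite le_eqVlt; apply/orP; left; apply/eqP.
by apply: eq_Rintegral => x _; rewrite dive_lift kE /boundary_layer [F _ _ * _]mulrC.
Qed.

(** Compact support is relaxed to bounded divergence, so that constant directions qualify as
    fields. *)
Definition admissible F dF := [/\ C1field F dF, unit_bounded F &
  exists M : R, forall x : 'rV[R]_n.+1, `|dive dF x| <= M].

Lemma cutoff_dive_cvg E F dF : measurable E -> (mu E < +oo)%E -> admissible F dF ->
  \int[mu]_(x in E) dive (dscale_field (cutoff k.+1%:R) (dcutoff k.+1%:R) F dF) x @[k --> \oo] -->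
  \int[mu]_(x in E) dive dF x.
Proof.
move=> mE Eoo [F1 Fu [M dM]]; have md := measurable_dive F1.
pose c k (x : 'rV[R]_n.+1) : R := cutoff k.+1%:R x.
pose dc k i (x : 'rV[R]_n.+1) : R := dcutoff k.+1%:R i x.
have c1 k x : `|c k x| <= 1 by exact: normr_cutoff.
have cc (x : 'rV[R]_n.+1) : c k x @[k --> \oo] --> (1 : R).
  have [_ _ _ +] := exhaustion_setT R n.+1; exact.
have dcb k (i : 'I_n.+1) x : `|dc k i x| <= 8 / k.+1%:R by exact: normr_dcutoff.
have sb k x : `|\sum_i F i x * dc k i x| <= n.+1%:R * 8 / k.+1%:R.
  apply: (le_trans (ler_norm_sum _ _ _)).
  apply: (@le_trans _ _ (\sum_(i < n.+1) 8 / k.+1%:R)); last first.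
    by rewrite sumr_const card_ord -[_ *+ n.+1]mulr_natl mulrA.
  apply: ler_sum => i _; rewrite normrM -[leRHS]mul1r; apply: ler_pM => //; exact: unit_boundedP.
have M0 : 0 <= M by apply: le_trans (dM 0).
apply: (@Rintegral_cvg _ _ _ _ _ _ _ (M + n.+1%:R * 8)) => //.
- by move=> k; apply: measurable_dive; apply: C1field_scale => //; exact: C1_cutoff.
- move=> k x _; rewrite dive_scale; apply: (le_trans (ler_normD _ _)); apply: lerD.
    by rewrite normrM -[leRHS]mul1r; apply: ler_pM => //; exact: c1.
  apply: (le_trans (sb k x)); rewrite ler_pdivrMr// ler_peMr ?mulr_ge0// ler1n//.
- move=> x _; have H2 : \sum_i F i x * dc k i x @[k --> \oo] --> (0 : R).
    apply/norm_cvg0P.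
    have H : n.+1%:R * 8 / k.+1%:R @[k --> \oo] --> (0 : R).
      have h0 : j.+1%:R^-1 @[j --> \oo] --> (0 : R) by exact: cvg_harmonic.
      by have := cvgM (cvg_cst (n.+1%:R * 8 : R^o)) h0; rewrite mulr0; exact.
    apply: (squeeze_cvgr _ (cvg_cst (0 : R)) H); apply: nearW => k.
    by rewrite normr_ge0 sb.
  have := cvgD (cvgM (cc x) (cvg_cst (dive dF x : R^o))) H2; rewrite mul1r addr0.
  suff -> : (fun k => dive (dscale_field (c k) (dc k) F dF) x) =
    (fun k => c k x * dive dF x + \sum_i F i x * dc k i x) by exact.
  by apply/funext => k; rewrite dive_scale.
Qed.

Lemma gauss_green E F dF : finite_perimeter Om E -> admissible F dF ->
  \int[mu]_(x in E) dive dF x + \int[l]_(y in tr_set E) F ord_max (boundary_point y) <= Per Om E.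
Proof.
move=> fE aF; have [F1 Fu _] := aF; have [mE EOm Eoo _] := fE.
have mA := measurable_tr_set mE; have Aoo := tr_set_lty fE.
pose c k (x : 'rV[R]_n.+1) : R := cutoff k.+1%:R x.
pose dc k i (x : 'rV[R]_n.+1) : R := dcutoff k.+1%:R i x.
have c1 k x : `|c k x| <= 1 by exact: normr_cutoff.
have cc (x : 'rV[R]_n.+1) : c k x @[k --> \oo] --> (1 : R).
  have [_ _ _ +] := exhaustion_setT R n.+1; exact.
have i1 : \int[mu]_(x in E) dive (dscale_field (c k) (dc k) F dF) x @[k --> \oo] -->
    \int[mu]_(x in E) dive dF x by exact: cutoff_dive_cvg.
have i2 : \int[l]_(y in tr_set E) (c k (boundary_point y) * F ord_max (boundary_point y)) @[k --> \oo] -->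
    \int[l]_(y in tr_set E) F ord_max (boundary_point y).
  have mb (g : 'rV[R]_n.+1 -> R) dg : C1 g dg -> measurable_fun setT (fun y => g (boundary_point y)).
    by case=> gc _ _; apply: continuous_measurable_rV; exact: continuous_on_boundary.
  apply: (@Rintegral_cvg _ _ _ _ _ _ _ 1) => //.
  - move=> k; apply: measurable_funM; [exact: (mb _ _ (@C1_cutoff R n.+1 _))|exact: (mb _ _ (F1 ord_max))].
  - exact: (mb _ _ (F1 ord_max)).
  - by move=> k y _; rewrite normrM -[leRHS]mul1r; apply: ler_pM => //; exact: unit_boundedP.
  - by move=> y _; have := cvgM (cc (boundary_point y)) (cvg_cst (F ord_max (boundary_point y) : R^o)); rewrite mul1r; exact.
have H : \int[mu]_(x in E) dive (dscale_field (c k) (dc k) F dF) x +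
    \int[l]_(y in tr_set E) (c k (boundary_point y) * F ord_max (boundary_point y)) @[k --> \oo] -->
    (\int[mu]_(x in E) dive dF x + \int[l]_(y in tr_set E) F ord_max (boundary_point y) : R).
  exact: cvgD i1 i2.
apply: (cvgr_to_le H); apply: nearW => k.
apply: (@gauss_green_compact E (scale_field (c k) F) (dscale_field (c k) (dc k) F dF)) => //.
split; [by apply: C1field_scale => //; exact: C1_cutoff|exact: unit_bounded_scale|exact: supp_cutoff].
Qed.

(** Tested with the constant upward unit field: vertical projection onto the boundary does not
    increase area. *)
Lemma tr_set_le E : finite_perimeter Om E -> fine (l (tr_set E)) <= Per Om E.
Proof.
move=> fE; have [mE EOm Eoo _] := fE; have mA := measurable_tr_set mE.
pose F (i : 'I_n.+1) : 'rV[R]_n.+1 -> R := cst (e_v 0 i).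
pose dF (i j : 'I_n.+1) : 'rV[R]_n.+1 -> R := cst 0.
have d0 x : dive dF x = 0 by rewrite /dive /dF/= big1.
have aF : admissible F dF.
  split; first by move=> i; exact: C1_cst.
    move=> x; rewrite (bigD1 ord_max)//= big1 ?addr0; first by rewrite /F/= mxE !eqxx expr1n.
    by move=> i /negbTE im; rewrite /F/= mxE im andbF expr0n.
  by exists 0 => x; rewrite d0 normr0.
have := gauss_green fE aF.
rewrite (_ : Rintegral mu _ _ = 0) ?add0r; last first.
  by rewrite /Rintegral integral0_eq// => x _ /=; rewrite d0.
by rewrite Rintegral_cst// /F/= mxE !eqxx mul1r.
Qed.

(** A test field of the whole space need not vanish on the boundary; its flux through the trace is
    at most the measure of the trace. *)
Lemma finite_perimeter_whole E : finite_perimeter Om E ->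
  finite_perimeter setT E /\ Per setT E <= Per Om E + fine (l (tr_set E)).
Proof.
move=> fE; have [mE EOm Eoo _] := fE; have mA := measurable_tr_set mE.
apply: finite_perimeter_le => // F dF tF.
have [F1 Fu _] := tF.
have := gauss_green_compact fE tF; rewrite -lerBrDr => /le_trans; apply.
rewrite lerD2l lerNl; have := @Rintegral_bound _ _ _ l (tr_set E) (fun y => F ord_max (boundary_point y)) 1 mA (tr_set_lty fE).
rewrite mul1r ler_norml => /(_ _ _)/andP[] //.
- by apply: continuous_measurable_rV; apply: continuous_on_boundary; case: (F1 ord_max).
- by move=> y _; exact: unit_boundedP.
Qed.

End gauss_green.

(** * The capillary energy *)

Section lower_integral.
Context d (T : measurableType d) (R : realType) (mu : {measure set T -> \bar R}).
Implicit Types f g : T -> \bar R.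

(* Monotonicity needs no measurability, the integral being a supremum over simple functions. *)
Lemma ge0_le_lower_integral f g : (forall x, 0 <= f x)%E -> (forall x, f x <= g x)%E ->
  (\int[mu]_x f x <= \int[mu]_x g x)%E.
Proof.
move=> f0 fg; have g0 x : (0 <= g x)%E by exact: le_trans (fg x).
rewrite !ge0_integralE//; apply: le_ereal_sup => _ [h hf <-]; exists h => //= x.
by move: (hf x); rewrite !patch_setT => /le_trans; apply.
Qed.

(** Meant for an [f] involving the pointwise trace, whose measurability is not established. It is
    squeezed between two measurable functions equal to g off the null set and to 0, respectively
    infinity, on it. *)
Lemma ge0_ae_eq_lower_integral f g : (forall x, 0 <= f x)%E -> (forall x, 0 <= g x)%E ->
  measurable_fun setT g -> {ae mu, forall x, f x = g x} ->
  (\int[mu]_x f x = \int[mu]_x g x)%E.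
Proof.
move=> f0 g0 mg [N [mN N0 HN]].
have fg x : ~ N x -> f x = g x by move=> nN; apply: contrapT => /HN.
have mNC := measurableC mN.
pose g1 := g \_ (~` N).
pose g2 x := (g1 x + ((cst +oo%E) \_ N) x)%E.
have mg1 : measurable_fun setT g1.
  by apply: (measurable_restrictT _ mNC).1; exact: measurable_funTS.
have mg2 : measurable_fun setT g2.
  apply: emeasurable_funD => //.
  by apply: (measurable_restrictT _ mN).1; exact: measurable_cst.
have g1N x : ~ N x -> g1 x = g x by move=> nN; rewrite /g1 patchE mem_set.
have g1N0 x : N x -> g1 x = 0%E by move=> Nx; rewrite /g1 patchE memNset.
have g2N x : ~ N x -> g2 x = g x.
  by move=> nN; rewrite /g2 g1N// patchE memNset// adde0.
have g2No x : N x -> g2 x = +oo%E.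
  by move=> Nx; rewrite /g2 g1N0// patchE mem_set// add0e.
have ae1 (h : T -> \bar R) : (forall x, ~ N x -> h x = g x) -> ae_eq mu setT h g.
  move=> H; exists N; split => // x /= nx; apply: contrapT => nN; apply: nx => _; exact: H.
have e1 : (\int[mu]_x g1 x = \int[mu]_x g x)%E.
  by apply: ae_eq_integral => //; exact: ae1.
have e2 : (\int[mu]_x g2 x = \int[mu]_x g x)%E.
  by apply: ae_eq_integral => //; exact: ae1.
apply: le_anti; apply/andP; split; [rewrite -e2|rewrite -e1]; apply: ge0_le_lower_integral => //.
- by move=> x; have [Nx|nN] := pselect (N x); [rewrite g2No// leey|rewrite g2N// fg].
- by move=> x; have [Nx|nN] := pselect (N x); [rewrite g1N0|rewrite g1N].
- by move=> x; have [Nx|nN] := pselect (N x); [rewrite g1N0|rewrite g1N// fg].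
Qed.

Lemma ae_eq_lower_integral f g : measurable_fun setT g -> {ae mu, forall x, f x = g x} ->
  (\int[mu]_x f x = \int[mu]_x g x)%E.
Proof.
move=> mg fg; rewrite integralE [RHS]integralE; congr (_ - _)%E.
  apply: ge0_ae_eq_lower_integral => //; first exact: measurable_funepos.
  by move: fg; apply: filterS => x fgx; rewrite !funeposE fgx.
apply: ge0_ae_eq_lower_integral => //; first exact: measurable_funeneg.
by move: fg; apply: filterS => x fgx; rewrite !funenegE fgx.
Qed.

End lower_integral.

Section smooth_approximation.
Variables (R : realType) (m : nat) (B : set 'rV[R]_m).
Hypothesis mB : measurable B.
Hypothesis Boo : (lebesgue R m B < +oo)%E.
Local Notation mu := (lebesgue R m).

(** Binary digits: [S] is where the first digit of f is 1, and [f'] is the remainder, doubled. Each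
    round halves the inherited error, while the error e of the digits is averaged and does not
    accumulate. *)
Lemma smooth_approx01 (k : nat) (e : R) (f : 'rV[R]_m -> R) : 0 < e -> measurable_fun setT f ->
  (forall x, 0 <= f x <= 1) -> exists g dg, [/\ C1 g dg, forall x, 0 <= g x <= 1 &
    \int[mu]_(x in B) `|f x - g x| <= fine (mu B) / 2 ^+ k + e].
Proof.
move=> e0; elim: k f => [|k IH] f mf f01.
  exists (cst 0), (fun _ => cst 0); split; [exact: C1_cst|by move=> x; rewrite /= lexx ler01|].
  rewrite expr0 divr1; have := @Rintegral_bound _ _ _ mu B (fun x => `|f x - cst 0 x|) 1 mB Boo.
  rewrite mul1r => /(_ _ _)/(le_trans (ler_norm _)) H; apply: (@le_trans _ _ (fine (mu B))).
    apply: H.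
      by apply: measurableT_comp => //; apply: measurable_funB => //; exact: measurable_cst.
    by move=> x _; rewrite subr0 !normr_id ger0_norm; have /andP[] := f01 x.
  by rewrite lerDl ltW.
pose S := [set x | 1 / 2 <= f x].
have mS : measurable S.
  rewrite (_ : S = setT `&` f @^-1` `[1 / 2, +oo[); last first.
    by rewrite setTI; apply/seteqP; split => x; rewrite /S/= in_itv/= andbT.
  by apply: mf => //; exact: measurable_itv.
pose f' x := 2 * f x - \1_S x.
have mi : measurable_fun setT (\1_S : 'rV[R]_m -> R) by exact: measurable_indic.
have mf' : measurable_fun setT f' by apply: measurable_funB => //; exact: measurable_funM.
have f'01 x : 0 <= f' x <= 1.
  rewrite /f' indicE; have /andP[a b] := f01 x.
  have [xS|xS] := pselect (S x); [rewrite mem_set//|rewrite memNset//].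
    by move: xS; rewrite /S/= => ?; lra.
  by move: xS; rewrite /S/= => /negP; rewrite -ltNge => ?; lra.
have [g' [dg' [g'1 g'01 Hg']]] := IH f' mf' f'01.
have [g0 [dg0 [g01 g001 Hg0]]] := measurable_smoothable mB Boo mS e0.
have c1 := C1M (C1_cst m (1 / 2 : R)) (C1D g01 g'1).
exists (fun x => cst (1 / 2) x * (g0 x + g' x)); eexists; split; [exact: c1| |].
  by move=> x /=; have := g'01 x; have := g001 x; move: (g0 x) (g' x) => u v /andP[? ?] /andP[? ?]; lra.
have mg0 := C1_measurable g01; have mg' := C1_measurable g'1.
have mhalf : measurable_fun setT (fun x : 'rV[R]_m => 1 / 2 * (g0 x + g' x)).
  by apply: measurable_funM => //; exact: measurable_funD.
have ab (u v : 'rV[R]_m -> R) : measurable_fun setT u -> measurable_fun setT v ->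
    (forall x, 0 <= u x <= 1) -> (forall x, 0 <= v x <= 1) ->
    mu.-integrable B (EFin \o (fun x => `|u x - v x|)).
  move=> mu' mv u01 v01; apply: (@bounded_integrable _ _ _ _ _ _ 1) => //.
    by apply: measurableT_comp => //; exact: measurable_funB.
  by move=> x _; rewrite normr_id ler_norml; have := u01 x; have := v01 x;
    move: (u x) (v x) => p q /andP[? ?] /andP[? ?]; lra.
have i01 x : 0 <= (\1_S x : R) <= 1 by rewrite indicE; case: (x \in S); rewrite /= ?lexx ?ler01.
have I1 := ab _ _ mi mg0 i01 g001; have I2 := ab _ _ mf' mg' f'01 g'01.
apply: (@le_trans _ _ (\int[mu]_(x in B) (1 / 2 * (`|\1_S x - g0 x| + `|f' x - g' x|)))).
  apply: le_Rintegral => //.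
  - apply: ab => // x; have := g'01 x; have := g001 x; move: (g0 x) (g' x) => u v /andP[? ?] /andP[? ?]; rewrite /=; lra.
  - apply: (@bounded_integrable _ _ _ _ _ _ 1) => //.
      by apply: measurable_funM => //; apply: measurable_funD;
        apply: measurableT_comp => //; exact: measurable_funB.
    move=> x _; have := g'01 x; have := g001 x; have := i01 x; have := f'01 x.
    move: (g0 x) (g' x) (\1_S x) (f' x) => u v w z /andP[? ?] /andP[? ?] /andP[? ?] /andP[? ?].
    have : `|w - u| <= 1 by rewrite ler_norml; lra.
    have : `|z - v| <= 1 by rewrite ler_norml; lra.
    have := normr_ge0 (w - u); have := normr_ge0 (z - v).
    by move: `|w - u| `|z - v| => p q ? ? ? ?; rewrite ger0_norm; lra.
  - move=> x _ /=; rewrite /f'; move: (\1_S x) (f x) (g0 x) (g' x) => w z u v.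
    rewrite (_ : z - _ = 1 / 2 * ((w - u) + (2 * z - w - v))); last by field.
    by rewrite normrM ger0_norm ?divr_ge0//; apply: ler_wpM2l; [rewrite divr_ge0|exact: ler_normD].
rewrite RintegralZl ?RintegralD//; last first.
  apply: (eq_integrable _ _ _ _ (integrableD _ I1 I2)) => // x _ /=; by rewrite EFinD.
rewrite exprS invfM [_ * (2^-1 * _)]mulrCA.
move: Hg0 Hg'; move: (fine _ / _) (\int[_]_(_ in _) _) (\int[_]_(_ in _) _) => L u v ? ?; lra.
Qed.

Lemma smooth_approx (e : R) (b : 'rV[R]_m -> R) : 0 < e -> measurable_fun setT b ->
  (forall x, -1 <= b x <= 1) -> exists g dg, [/\ C1 g dg, forall x, -1 <= g x <= 1 &
    \int[mu]_(x in B) `|b x - g x| <= e].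
Proof.
move=> e0 mb b1; pose f x := (b x + 1) / 2.
have mf : measurable_fun setT f.
  by apply: measurable_funM => //; exact: measurable_funD.
have [k Hk] : exists k : nat, fine (mu B) / 2 ^+ k <= e / 4.
  have H : fine (mu B) / 2 ^+ k @[k --> \oo] --> (0 : R).
    have h2 : (2^-1 : R) ^+ k @[k --> \oo] --> (0 : R).
      by apply: cvg_expr; rewrite ger0_norm ?invr_ge0// invf_lt1// ltr1n.
    have := cvgM (cvg_cst (fine (mu B) : R^o)) h2; rewrite mulr0.
    suff -> : (fun k => fine (mu B) / 2 ^+ k) = (fun k => fine (mu B) * 2^-1 ^+ k) by exact.
    by apply/funext => k; rewrite exprVn.
  have e4 : 0 < e / 4 by rewrite divr_gt0.
  have /cvgrPdist_lt/(_ _ e4)[N _ /(_ N (leqnn N))] := H.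
  rewrite sub0r normrN => /ltW/(le_trans (ler_norm _)) H'; by exists N.
have [||g [dg [g1 g01 Hg]]] := @smooth_approx01 k (e / 4) f _ mf.
- by rewrite divr_gt0.
- by move=> x; rewrite /f; have /andP[? ?] := b1 x; lra.
have c1 := C1D (C1M (C1_cst m (2 : R)) g1) (C1_cst m (-1 : R)).
exists (fun x => cst 2 x * g x + cst (-1) x); eexists; split; [exact: c1| |].
  by move=> x /=; have := g01 x; move: (g x) => u /andP[? ?]; lra.
have mg := C1_measurable g1.
rewrite (_ : Rintegral _ _ _ = \int[mu]_(x in B) (2 * `|f x - g x|)); last first.
  apply: eq_Rintegral => x _ /=; rewrite -[X in X * `|_|]ger0_norm// -normrM /f; congr (`|_|).
  by field.
rewrite RintegralZl//; first lra.
apply: (@bounded_integrable _ _ _ _ _ _ 1) => //.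
  by apply: measurableT_comp => //; exact: measurable_funB.
move=> x _; rewrite normr_id ler_norml /f; have := b1 x; have := g01 x.
by move: (g x) (b x) => p q /andP[? ?] /andP[? ?]; lra.
Qed.

End smooth_approximation.

(** * Passing to the density-one representative *)

Section density_representative.
Variables (R : realType) (n : nat).
Local Notation mu := (lebesgue R n.+1).
Local Notation Om := (@halfspace R n).
Implicit Types (E F : set 'rV[R]_n.+1).

Lemma null_setY E F : measurable E -> measurable F -> mu (E `+` F) = 0%E ->
  mu (E `\` F) = 0%E /\ mu (F `\` E) = 0%E.
Proof.
move=> mE mF H; have mY := measurableY mE mF.
split.
  by apply: null_sub H; [exact: measurableD|exact: mY|move=> x xE; left].
by apply: null_sub H; [exact: measurableD|exact: mY|move=> x xE; right].
Qed.

Lemma finite_perimeter_ae E F : finite_perimeter Om E -> measurable F -> F `<=` Om ->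
  mu (E `+` F) = 0%E -> finite_perimeter Om F /\ Per Om F = Per Om E.
Proof.
move=> fE mF FOm EF; have [mE EOm Eoo _] := fE.
have [H1 H2] := null_setY mE mF EF.
have int0 G dG : test_field Om G dG -> \int[mu]_(x in F) dive dG x = \int[mu]_(x in E) dive dG x.
  by case=> G1 _ _; apply: ae_eq_Rintegral_set => //; exact: measurable_dive G1.
have Foo : (mu F < +oo)%E.
  apply: (@le_lt_trans _ _ (mu (E `|` F `\` E))).
    apply: le_mu => //; first by apply: measurableU => //; exact: measurableD.
    by move=> x Fx; have [Ex|nE] := pselect (E x); [left|right].
  by apply: (le_lt_trans (le_muU mu mE (measurableD mF mE))); rewrite [X in (_ + X)%E]H2 adde0.
have [fF PF] : finite_perimeter Om F /\ Per Om F <= Per Om E.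
  by apply: finite_perimeter_le => // G dG tG; rewrite (int0 G dG tG); exact: (Per_ub fE tG).
split => //; apply: le_anti; rewrite PF/=.
have [_ +] : finite_perimeter Om E /\ Per Om E <= Per Om F.
  by apply: finite_perimeter_le => // G dG tG; rewrite -(int0 G dG tG); exact: (Per_ub fF tG).
by [].
Qed.

(** Equality holds at every point, since the limits defining the trace see the set only through
    integrals. *)
Lemma trace_ae E F y : measurable E -> measurable F -> mu (E `+` F) = 0%E ->
  trace (\1_E) y = trace (\1_F) y.
Proof.
move=> mE mF EF.
rewrite -[LHS]/(xget 0 (trace_values E y)) -[RHS]/(xget 0 (trace_values F y)).
congr xget; apply/funext => t; rewrite /trace_values/=.
suff -> : (fun r : R => ((r ^- n.+1)%:E * \int[mu]_(x in Om `&` eball (boundary_point y) r)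
     `|(\1_E x : R) - t|%:E)%E) = (fun r : R => ((r ^- n.+1)%:E * \int[mu]_(x in Om `&` eball (boundary_point y) r)
     `|(\1_F x : R) - t|%:E)%E) by [].
apply/funext => r; congr (_ * _)%E; apply: ae_eq_integral.
- exact: measurable_halfball.
- by apply: measurable_funTS; exact: measurable_indic_dist.
- by apply: measurable_funTS; exact: measurable_indic_dist.
- exists (E `+` F); split => //; first exact: measurableY.
  move=> x /= nx; apply: contrapT => nY; apply: nx => _; rewrite !indicE.
  have [Ex|nE] := pselect (E x); have [Fx|nF] := pselect (F x).
  + by rewrite !mem_set.
  + by case: nY; left.
  + by case: nY; right.
  + by rewrite !memNset.
Qed.

Lemma capillary_ae (beta : 'rV[R]_n -> R) E F : finite_perimeter Om E -> measurable F ->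
  F `<=` Om -> mu (E `+` F) = 0%E -> capillary beta F = capillary beta E.
Proof.
move=> fE mF FOm EF; have [fF PF] := finite_perimeter_ae fE mF FOm EF.
have PE : perimeter F Om = perimeter E Om by rewrite -(PerK fF) PF (PerK fE).
have mE : measurable E by case: fE.
have IE : (\int[lebesgue R n]_y (beta y * trace (\1_F) y)%:E =
    \int[lebesgue R n]_y (beta y * trace (\1_E) y)%:E)%E.
  by apply: eq_integral => y _; rewrite (trace_ae y mE mF EF).
by rewrite /capillary PE IE.
Qed.

Lemma BV01_finite_perimeter E : BV01 Om E -> finite_perimeter Om E.
Proof.
move=> [mE EOm [/integrableP[_ iE] Eoo] _]; split => //.
move: iE; rewrite (eq_integral (fun x => (\1_E x)%:E)); last first.
  by move=> x _; rewrite /= ger0_norm// indicE; case: (x \in E).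
by rewrite integral_indic//; [rewrite setIidl|exact: measurable_halfspace].
Qed.

(** Truncations and limits are controlled only up to null sets; this brings them back into the class
    [BV01], [density_one_halfspace] keeping them inside the half-space. *)
Lemma finite_perimeter_BV01 F : finite_perimeter Om F ->
  BV01 Om (density_one F) /\ mu (F `+` density_one F) = 0%E.
Proof.
move=> fF; have [mF FOm Foo _] := fF.
have mD := measurable_density_one mF; have [N1 N2] := density_one_null mF.
have DOm : density_one F `<=` Om by exact: density_one_halfspace.
have FD : mu (F `+` density_one F) = 0%E.
  rewrite /setY; apply/eqP; rewrite -measure_le0.
  apply: (le_trans (le_muU mu (measurableD mF mD) (measurableD mD mF))).
  by rewrite [X in (X + _)%E]N2 [X in (_ + X)%E]N1 adde0.
have [[_ _ Doo Poo] _] := finite_perimeter_ae fF mD DOm FD.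
split; last exact: FD.
split; [exact: mD|exact: DOm| |exact: density_one_idem mF].
split; last exact: Poo.
apply/integrableP; split.
  by apply: measurable_funTS; apply/measurable_EFinP; exact: measurable_indic.
rewrite (eq_integral (fun x => (\1_(density_one F) x)%:E)); last first.
  by move=> x _; rewrite /= ger0_norm// indicE; case: (x \in _).
rewrite integral_indic//; last exact: measurable_halfspace.
by rewrite setIidl.
Qed.

End density_representative.

(** * The energy and its calibrating fields *)

Section capillary_energy.
Variables (R : realType) (n : nat).
Local Notation mu := (lebesgue R n.+1).
Local Notation l := (lebesgue R n).
Local Notation Om := (@halfspace R n).
Local Notation e_v := (delta_mx 0 ord_max : 'rV[R]_n.+1).
Variable b : 'rV[R]_n -> R.
Hypothesis mb : measurable_fun setT b.
Hypothesis b1 : forall y, -1 <= b y <= 1.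
Implicit Types (E F : set 'rV[R]_n.+1) (A B : set 'rV[R]_n).

(** [capillary] as a real number, with an everywhere bounded representative [b] of [beta] and with
    [tr_set] in place of the pointwise trace. *)
Definition energy E : R := Per Om E - \int[l]_(y in tr_set E) b y.

Lemma bounded_integrable1 A (f : 'rV[R]_n -> R) : measurable A -> (l A < +oo)%E ->
  measurable_fun setT f -> (forall y, -1 <= f y <= 1) -> l.-integrable A (EFin \o f).
Proof.
move=> mA Aoo mf f1; apply: (@bounded_integrable _ _ _ _ _ _ 1) => // y _.
by rewrite ler_norml.
Qed.

Lemma capillaryE (beta : 'rV[R]_n -> R) E : {ae l, forall y, beta y = b y} ->
  finite_perimeter Om E -> capillary beta E = (energy E)%:E.
Proof.
move=> bb fE; have [mE EOm Eoo _] := fE; have mA := measurable_tr_set mE.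
have Aoo := tr_set_lty fE.
rewrite /capillary -PerK// /energy EFinB; congr (_ - _)%E.
rewrite (@ae_eq_lower_integral _ _ _ l _ (fun y => (\1_(tr_set E) y * b y)%:E)); last 2 first.
- by apply/measurable_EFinP; apply: measurable_funM => //; exact: measurable_indic.
- have FF : Filter (almost_everywhere l) by exact: ae_filter_ringOfSetsType.
  apply: (@filterS2 _ _ FF _ _ _ _ bb (trace_indic fE)) => y -> ->.
  by rewrite mulrC.
rewrite /Rintegral fineK; last by apply: integrable_fin_num => //; exact: bounded_integrable1.
rewrite [RHS]integral_mkcond; apply: eq_integral => y _; rewrite patchE indicE.
by case: ifPn => yA; rewrite ?mul1r ?mul0r.
Qed.

Lemma Rintegral_sub_le A B (u v : 'rV[R]_n -> R) : measurable A -> measurable B -> (l B < +oo)%E ->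
  A `<=` B -> measurable_fun setT u -> measurable_fun setT v ->
  (forall y, -1 <= u y <= 1) -> (forall y, -1 <= v y <= 1) ->
  \int[l]_(y in A) u y <= \int[l]_(y in A) v y + \int[l]_(y in B) `|u y - v y|.
Proof.
move=> mA mB Boo AB mu' mv u1 v1; have Aoo := mu_lty mA mB AB Boo.
have md : measurable_fun setT (fun y => `|u y - v y|).
  by apply: measurableT_comp => //; exact: measurable_funB.
have d2 y : `|u y - v y| <= 2.
  by rewrite ler_norml; have := u1 y; have := v1 y; move: (u y) (v y) => p q /andP[? ?] /andP[? ?]; lra.
have dI C : measurable C -> (l C < +oo)%E -> l.-integrable C (EFin \o (fun y => `|u y - v y|)).
  by move=> mC Coo; apply: (@bounded_integrable _ _ _ _ _ _ 2) => // y _; rewrite normr_id.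
apply: (@le_trans _ _ (\int[l]_(y in A) v y + \int[l]_(y in A) `|u y - v y|)).
  rewrite -RintegralD//; [|exact: bounded_integrable1|exact: dI].
  apply: le_Rintegral => //; first exact: bounded_integrable1.
    apply: (@bounded_integrable _ _ _ _ _ _ 3) => //; first exact: measurable_funD.
    move=> y _; apply: (le_trans (ler_normD _ _)); rewrite normr_id.
    have := d2 y; have : `|v y| <= 1 by rewrite ler_norml.
    by move: `|v y| `|u y - v y| => p q ? ?; lra.
  by move=> y _; rewrite addrC -lerBlDr ler_norm.
rewrite lerD2l (@Rintegral_setD _ _ _ l B A)//; last exact: dI.
by rewrite setIidr// lerDl; apply: Rintegral_ge0.
Qed.

Lemma energy_coercive (kappa : R) E : 0 <= kappa <= 1 -> (forall y, b y <= 1 - 2 * kappa) ->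
  finite_perimeter Om E -> kappa * (Per Om E + fine (l (tr_set E))) <= energy E.
Proof.
move=> /andP[k0 k1] bk fE; have [mE EOm Eoo _] := fE; have mA := measurable_tr_set mE.
have Aoo := tr_set_lty fE; have := tr_set_le fE.
have : \int[l]_(y in tr_set E) b y <= (1 - 2 * kappa) * fine (l (tr_set E)).
  rewrite -Rintegral_cst//; apply: le_Rintegral => //; first exact: bounded_integrable1.
  by apply: (@bounded_integrable _ _ _ _ _ _ `|1 - 2 * kappa|) => //; exact: measurable_cst.
have := Per_ge0 fE; rewrite /energy.
(* The right side minus the left is at least (1 - kappa) (P - L), and L <= P by [tr_set_le]. *)
move: (Per Om E) (\int[l]_(y in _) _) (fine _) => P I L ? ? ?; nra.
Qed.

Lemma C1_horizontal (g : 'rV[R]_n -> R) dg : C1 g dg ->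
  C1 (fun x : 'rV[R]_n.+1 => g (horizontal x))
     (fun i x => if unlift ord_max i is Some j then dg j (horizontal x) else 0).
Proof.
move=> [gc gd dgc].
have hc : continuous (@horizontal R n).
  apply: continuous_rV => i.
  rewrite (_ : (fun _ => _) = (fun x : 'rV[R]_n.+1 => x 0 (lift ord_max i))).
    by case: (C1_coord R (lift ord_max i)).
  by apply/funext => x; rewrite mxE.
apply: C1_of_partials => [i z|i].
  apply: is_derive_line0.
  case: unliftP => [j ->|->].
    have := gd j (horizontal z); rewrite -[X in is_derive X]addr0 -(scale0r (delta_mx 0 j)) => /is_derive_line.
    suff -> : (fun s : R => g (horizontal z + s *: delta_mx 0 j)) =
      (fun s : R => g (horizontal (z + s *: delta_mx 0 (lift ord_max j)))) by [].
    apply/funext => s; congr (g _); apply/rowP => i'; rewrite !mxE; congr (_ + s * _).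
    by rewrite (inj_eq (@lift_inj _ _)).
  rewrite (_ : (fun _ => _) = cst (g (horizontal z))); first exact: is_derive_cst.
  apply/funext => s; congr (g _); apply/rowP => i'; rewrite !mxE.
  by rewrite lift_eqF ?andbF mulr0 addr0.
case: (unlift ord_max i) => [j|]; last exact: cst_continuous.
move=> x; apply: (@continuous_comp _ _ _ (@horizontal R n) (dg j)); [exact: hc|exact: dgc].
Qed.

Lemma supp_height (G : 'I_n.+1 -> 'rV[R]_n.+1 -> R) : supp_in Om G ->
  exists2 d : R, 0 < d & forall x, height x < d -> forall i, G i x = 0.
Proof.
move=> [K [cK KOm] G0].
have cH : compact (@height R n @` K).
  by apply: continuous_compact => //; apply: continuous_subspaceT; exact: continuous_height.
have oH : open (~` (@height R n @` K)).
  by apply: closed_openC; apply: compact_closed => //; exact: Rhausdorff.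
have /nbhs_ballP[d /= d0 Hd] : nbhs (0 : R) (~` (@height R n @` K)).
  by apply: open_nbhs_nbhs; split => //= -[x /KOm]; rewrite /halfspace/= => /lt_eqF /eqP + /esym.
exists d => // x xd i; apply: G0 => Kx.
apply: (Hd (height x)); last by exists x.
by rewrite /ball/= sub0r normrN gtr0_norm//; exact: KOm.
Qed.

Lemma Per_approx E (e : R) : finite_perimeter Om E -> 0 < e -> exists G dG,
  test_field Om G dG /\ Per Om E - e <= \int[mu]_(x in E) dive dG x.
Proof.
move=> fE e0; have [mE EOm Eoo _] := fE; apply: contrapT => H.
have [] := @finite_perimeter_le R n.+1 Om E (Per Om E - e) mE EOm Eoo.
  move=> G dG tG; rewrite leNgt; apply/negP => lt; apply: H; exists G, dG; split => //; exact: ltW.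
by move=> _; rewrite lerBrDr gerDl leNgt e0.
Qed.

(** Above height d acts a nearly optimal field for the perimeter in the half-space; below it, a
    vertical field equal on the boundary to a C^1 approximation of [b] and faded out in a thin
    layer. They do not overlap, so the unit bound survives, and the divergence in the layer
    contributes about minus the integral of [b] over the trace. The match with [b] holds on all of
    [B], hence serves for the traces of other sets too. *)
Lemma calibrating_field E B (e : R) : finite_perimeter Om E -> measurable B -> (l B < +oo)%E ->
  tr_set E `<=` B -> 0 < e -> exists (phi : 'I_n.+1 -> 'rV[R]_n.+1 -> R) dphi, [/\ admissible phi dphi,
    energy E - e <= \int[mu]_(x in E) dive dphi x &
    \int[l]_(y in B) `|b y - phi ord_max (boundary_point y)| <= e].
Proof.
move=> fE mB Boo AB e0; have [mE EOm Eoo _] := fE; have mA := measurable_tr_set mE.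
have e3 : 0 < e / 3 by rewrite divr_gt0.
have [G [dG [tG HG]]] := Per_approx fE e3.
have [G1 Gu Gs] := tG; have [d d0 Gd] := supp_height Gs.
have [g [dg [g1 g01 Hg]]] := smooth_approx mB Boo e3 mb b1.
pose f (x : 'rV[R]_n.+1) := g (horizontal x).
have f1 := C1_horizontal g1; have fc : continuous f by case: f1.
have fb y : f (boundary_point y) = g y by rewrite /f /boundary_point horizontal_snoc.
have fn x : `|f x| <= 1 by rewrite ler_norml; exact: g01.
have c2 : \int[mu]_(x in E) (boundary_layer j x * f x) @[j --> \oo] --> \int[l]_(y in tr_set E) g y.
  have := @boundary_layer_cvg R n E f 0 fE fc fn (lexx 0).
  rewrite (_ : \int[l]_(y in tr_set E) f (boundary_point y) = \int[l]_(y in tr_set E) g y).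
    by apply=> x _; rewrite mul0r /f /boundary_point horizontal_snoc subrr normr0.
  by apply: eq_Rintegral => y _; rewrite fb.
(* The layer must lie below d, to avoid the support of [G], and be thin enough to reproduce the
   boundary integral. *)
have [j [jd Hj]] : exists j : nat, j.+1%:R^-1 < d /\
    `|\int[l]_(y in tr_set E) g y - \int[mu]_(x in E) (boundary_layer j x * f x)| < e / 3.
  have [N] := ltr_add_invr d0; rewrite add0r => HN.
  have /cvgrPdist_lt/(_ _ e3)[N' _ HN'] := c2.
  exists (maxn N N'); split; last by apply: HN'; rewrite /= leq_maxr.
  by apply: le_lt_trans HN; rewrite lef_pV2 ?posrE// ler_nat ltnS leq_maxl.
pose k := (2 * j).+1.
have kE : k.+1%:R = 2 * j.+1%:R :> R by rewrite -natrM /k mulnS.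
pose a (x : 'rV[R]_n.+1) := 1 - lift_cutoff k x.
pose da i (x : 'rV[R]_n.+1) := - dlift_cutoff k i x.
have a1 : C1 a da by apply: C1_onem; exact: C1_lift_cutoff.
pose H i x := cst (e_v 0 i) x * f x.
pose dH i := fun j x => cst (e_v 0 i) x * (if unlift ord_max j is Some j' then dg j' (horizontal x) else 0) + f x * cst 0 x : R.
have H1 : C1field H dH by move=> i; exact: C1M (C1_cst _ _) f1.
have dH0 x : dive dH x = 0.
  rewrite /dive big1// => i _; rewrite /dH/= mulr0 addr0 mxE eqxx/=.
  by case: unliftP => [i' ->|->]; rewrite ?lift_eqF ?mul0r ?mulr0.
have dLG x : dive (dscale_field a da H dH) x = - (boundary_layer j x * f x).
  rewrite dive_scale dH0 mulr0 add0r (bigD1 ord_max)//= big1 ?addr0.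
    rewrite /H/= /da /dlift_cutoff lin_e mxE !eqxx !mul1r mulr1 /boundary_layer kE mulrN.
    by rewrite [f x * _]mulrC.
  by move=> i im; rewrite /H/= mxE (negbTE im) andbF !mul0r.
pose F := add_field G (scale_field a H).
pose dF := dadd_field dG (dscale_field a da H dH).
have aH (x : 'rV[R]_n.+1) : d <= height x -> a x = 0.
  move=> dx; rewrite /a lift_cutoffE step1 ?subrr// kE.
  have : 1 <= j.+1%:R * height x.
    by rewrite mulrC -ler_pdivrMr// mul1r (le_trans (ltW jd)).
  by move: (j.+1%:R) => u ?; nra.
have a01 x : `|a x| <= 1.
  rewrite /a ler_norml; have := step_ge0 (k.+1%:R * lin e_v x + -1); have := step_le1 (k.+1%:R * lin e_v x + -1).
  by rewrite /lift_cutoff; move: (step _) => u ? ?; lra.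
have Hsum (x : 'rV[R]_n.+1) (c : R) : \sum_i (c * H i x) ^+ 2 = (c * f x) ^+ 2.
  rewrite (bigD1 ord_max)//= big1 ?addr0; first by rewrite /H/= mxE !eqxx mul1r.
  by move=> i im; rewrite /H/= mxE (negbTE im) andbF mul0r mulr0 expr0n.
have [M M0 dGM] := test_field_bounded tG.
have md := measurable_dive G1.
have mbl : measurable_fun setT (fun x => boundary_layer j x * f x).
  by apply: measurable_funM; [exact: measurable_boundary_layer|exact: continuous_measurable_rV].
have blb x : `|boundary_layer j x * f x| <= 4 * j.+1%:R.
  by rewrite normrM -[leRHS]mulr1; apply: ler_pM => //; exact: normr_boundary_layer.
have dGb := dive_bounded dGM.
exists F, dF; split.
- split.
  + by apply: C1field_add => //; exact: C1field_scale.
  + move=> x; rewrite /F /add_field /scale_field.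
    have [dx|dx] := leP d (height x).
      rewrite (eq_bigr (fun i => G i x ^+ 2)); first exact: Gu.
      by move=> i _; rewrite aH// mul0r addr0.
    rewrite (eq_bigr (fun i => (a x * H i x) ^+ 2)) ?Hsum; last by move=> i _; rewrite Gd// add0r.
    by rewrite -real_normK ?num_real// normrM expr_le1// ?mulr_ge0// mulr_ile1.
  + exists (n.+1%:R * M + 4 * j.+1%:R) => x; rewrite dive_add dLG.
    by apply: (le_trans (ler_normB _ _)); apply: lerD.
- rewrite (_ : \int[mu]_(x in E) dive dF x =
    \int[mu]_(x in E) dive dG x - \int[mu]_(x in E) (boundary_layer j x * f x)); last first.
    rewrite -RintegralB//; last 2 first.
    - exact: (@bounded_integrable _ _ _ _ _ _ (n.+1%:R * M)).
    - exact: (@bounded_integrable _ _ _ _ _ _ (4 * j.+1%:R)).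
    by apply: eq_Rintegral => x _; rewrite dive_add dLG.
  have mg := C1_measurable g1.
  have := Rintegral_sub_le mA mB Boo AB mg mb g01 b1.
  have -> : \int[l]_(y in B) `|g y - b y| = \int[l]_(y in B) `|b y - g y|.
    by apply: eq_Rintegral => y _; rewrite distrC.
  move: Hj Hg HG; rewrite ltr_norml /energy => /andP[].
  move: (\int[l]_(y in B) _) (\int[l]_(y in _) g y) (\int[l]_(y in _) b y) (\int[mu]_(x in E) dive dG x) (\int[mu]_(x in E) _) => u v w z t.
  lra.
- rewrite (_ : Rintegral _ _ _ = \int[l]_(y in B) `|b y - g y|); first by apply: (le_trans Hg); lra.
  apply: eq_Rintegral => y _; rewrite /F /add_field /scale_field Gd ?height_boundary// add0r.
  rewrite /H/= fb mxE !eqxx mul1r /a lift_cutoff_low ?subr0 ?mul1r//.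
  by rewrite height_boundary invr_gt0.
Qed.

Lemma admissible_boundary (F : 'I_n.+1 -> 'rV[R]_n.+1 -> R) dF : admissible F dF ->
  measurable_fun setT (fun y => F ord_max (@boundary_point R n y)) /\
  forall y, -1 <= F ord_max (@boundary_point R n y) <= 1.
Proof.
move=> [F1 Fu _]; split; last by move=> y; rewrite -ler_norml; exact: unit_boundedP.
by apply: continuous_measurable_rV; apply: continuous_on_boundary; case: (F1 ord_max).
Qed.

(** With the calibrating field fixed, the integral of its divergence varies little with the set, and
    [gauss_green] for [F] bounds it by the energy of [F]. The three thirds of e pay for the
    calibration, the mismatch with [b] on [B], and the symmetric difference. *)
Lemma energy_lsc E B (e : R) : finite_perimeter Om E -> measurable B -> (l B < +oo)%E ->
  tr_set E `<=` B -> 0 < e -> exists2 d : R, 0 < d &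
  forall F, finite_perimeter Om F -> tr_set F `<=` B -> (mu (E `+` F) <= d%:E)%E ->
    energy E <= energy F + e.
Proof.
move=> fE mB Boo AB e0; have e3 : 0 < e / 3 by rewrite divr_gt0.
have [phi [dphi [aphi H1 H2]]] := calibrating_field fE mB Boo AB e3.
have [mphi phi1] := admissible_boundary aphi.
have [p1 pu [M pM]] := aphi.
have M0 : 0 <= M by apply: le_trans (pM 0).
exists (e / 3 / (M + 1)); first by rewrite divr_gt0// ltr_wpDl.
move=> F fF AFB EF; have [mE EOm Eoo _] := fE; have [mF FOm Foo _] := fF.
have mAF := measurable_tr_set mF.
have := Rintegral_setY mE mF Eoo Foo (measurable_dive p1) pM.
have Ed : M * fine (mu (E `+` F)) <= e / 3.
  have Yoo : (mu (E `+` F) < +oo)%E by apply: (le_lt_trans EF); exact: ltry.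
  have : fine (mu (E `+` F)) <= e / 3 / (M + 1) by rewrite -lee_fin finite_muK.
  rewrite ler_pdivlMr ?ltr_wpDl//; have := fine_ge0 (measure_ge0 mu (E `+` F)).
  by move: (fine _) => u ? ?; nra.
have := gauss_green fF aphi.
have := Rintegral_sub_le mAF mB Boo AFB mb mphi b1 phi1.
rewrite ler_norml /energy in H1 * => + + /andP[_ +].
move: H1 H2 Ed; rewrite /energy.
move: (\int[l]_(y in B) _) (\int[l]_(y in tr_set F) _) (\int[l]_(y in tr_set F) _) (\int[mu]_(x in E) _) (\int[mu]_(x in F) _) (M * _) => u v w z t q.
lra.
Qed.

(** The calibrating field, cut off at infinity, is itself a test field for the whole space. Applied
    to [E0], this brings the perimeter of [E0] into the radius. *)
Lemma energy_le_perimeter E : finite_perimeter Om E -> energy E <= Per setT E.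
Proof.
move=> fE; have [mE EOm Eoo _] := fE; have mA := measurable_tr_set mE.
have [fT _] := finite_perimeter_whole fE.
apply/ler_addgt0Pr => e e0.
have [F [dF [aF H1 _]]] := calibrating_field fE mA (tr_set_lty fE) (@subset_refl _ _) e0.
rewrite -lerBlDr; apply: (le_trans H1).
have [F1 Fu _] := aF.
apply: (cvgr_to_le (cutoff_dive_cvg mE Eoo aF)); apply: nearW => k.
apply: (@Per_ub _ _ _ _ (scale_field (cutoff k.+1%:R) F)) => //.
split; [by apply: C1field_scale => //; exact: C1_cutoff| |exact: supp_cutoff].
by apply: unit_bounded_scale => // x; exact: normr_cutoff.
Qed.

End capillary_energy.

(** * Cutting and pasting fields along a hyperplane *)

Section mixed_integral.
Context d (T : measurableType d) (R : realType) (mu : {measure set T -> \bar R}).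
Implicit Types (A K : set T) (f g : T -> R).

Lemma Rintegral_mix A K f g : measurable A -> measurable K ->
  mu.-integrable A (EFin \o (fun x => \1_K x * f x + (1 - \1_K x) * g x)) ->
  \int[mu]_(x in A) (\1_K x * f x + (1 - \1_K x) * g x) =
  \int[mu]_(x in A `&` K) f x + \int[mu]_(x in A `\` K) g x.
Proof.
move=> mA mK iA; rewrite (Rintegral_setD mA mK iA); congr (_ + _).
  apply: eq_Rintegral => x /set_mem[_ Kx].
  by rewrite indicE mem_set//= mul1r subrr mul0r addr0.
apply: eq_Rintegral => x /set_mem[_ Kx].
by rewrite indicE memNset//= mul0r subr0 mul1r add0r.
Qed.

End mixed_integral.

Section cut_and_paste.
Variables (R : realType) (n : nat).
Local Notation mu := (lebesgue R n.+1).
Local Notation l := (lebesgue R n).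
Local Notation Om := (@halfspace R n).
Local Notation vfield := ('I_n.+1 -> 'rV[R]_n.+1 -> R).
Variables (nu : 'rV[R]_n.+1) (s : R).
Hypothesis nu1 : \sum_i nu 0 i ^+ 2 <= 1.
Implicit Types (E : set 'rV[R]_n.+1) (k : nat) (F G : vfield).

Definition side : set 'rV[R]_n.+1 := [set x | lin nu x < s].
Local Notation K := side.
Definition bside : set 'rV[R]_n := [set y | side (boundary_point y)].

Lemma open_side : open K.
Proof.
apply: (@open_comp _ _ (lin nu) [set t | t < s]); last exact: open_lt.
by move=> x _; case: (C1_lin nu) => + _ _; exact.
Qed.

Lemma measurable_side : measurable K.
Proof. by apply: open_measurable_rV; exact: open_side. Qed.

Lemma measurable_bside : measurable bside.
Proof.
apply: open_measurable_rV; apply: (@open_comp _ _ (@boundary_point R n) K); last exact: open_side.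
by move=> y _; exact: continuous_boundary.
Qed.

(** Equal to 1 where [lin nu x] is at most s - 1/(k+1) and to 0 from s on: the transition lies
    inside [side], whose indicator is the limit. *)
Definition cut k (x : 'rV[R]_n.+1) : R := step (- k.+1%:R * lin nu x + k.+1%:R * s).
Definition dcut k (i : 'I_n.+1) (x : 'rV[R]_n.+1) : R :=
  dstep (- k.+1%:R * lin nu x + k.+1%:R * s) * (- k.+1%:R * nu 0 i).

Lemma C1_cut k : C1 (cut k) (dcut k).
Proof. exact: C1_step. Qed.

Lemma cut01 k x : 0 <= cut k x <= 1.
Proof. by rewrite step_ge0 step_le1. Qed.

Lemma cut_cvg x : cut k x @[k --> \oo] --> (\1_K x : R).
Proof.
have [xs|xs] := pselect (K x).
  apply: cvg_near_cst; near=> k; rewrite indicE mem_set//= /cut step1//.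
  have d0 : 0 < s - lin nu x by rewrite subr_gt0.
  rewrite mulNr addrC -mulrBr -ler_pdivrMr// mul1r.
  apply: (@le_trans _ _ k%:R); last by rewrite ler_nat.
  by near: k; exact: nbhs_infty_ger.
apply: cvg_near_cst; apply: nearW => k; rewrite indicE memNset//= /cut step0//.
move: xs; rewrite /side/= => /negP; rewrite -leNgt => xs.
by rewrite mulNr addrC -mulrBr mulr_ge0_le0// subr_le0.
Unshelve. all: by end_near. Qed.

Definition mix k F G : vfield :=
  add_field (scale_field (cut k) F) (scale_field (fun x => 1 - cut k x) G).
Definition dmix k F dF G dG : 'I_n.+1 -> vfield :=
  dadd_field (dscale_field (cut k) (dcut k) F dF)
    (dscale_field (fun x => 1 - cut k x) (fun i x => - dcut k i x) G dG).

Lemma dive_mix k F dF G dG x : dive (dmix k F dF G dG) x =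
  (cut k x * dive dF x + (1 - cut k x) * dive dG x) + \sum_i (F i x - G i x) * dcut k i x.
Proof.
rewrite dive_add !dive_scale addrACA; congr (_ + _); rewrite -big_split/=.
by apply: eq_bigr => i _; ring.
Qed.

Lemma cvg_mix (c : nat -> R) (c0 u v : R) : c k @[k --> \oo] --> c0 ->
  c k * u + (1 - c k) * v @[k --> \oo] --> c0 * u + (1 - c0) * v.
Proof.
move=> H; apply: cvgD; apply: cvgM; [exact: H|exact: cvg_cst| |exact: cvg_cst].
by apply: cvgB; [exact: cvg_cst|exact: H].
Qed.

Lemma mix_bounded (c u v M N : R) : 0 <= c <= 1 -> `|u| <= M -> `|v| <= N ->
  `|c * u + (1 - c) * v| <= M + N.
Proof.
move=> /andP[c0 c1] uM vN; apply: (le_trans (ler_normD _ _)); rewrite !normrM.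
have c1' : 0 <= 1 - c by rewrite subr_ge0.
rewrite (ger0_norm c0) (ger0_norm c1'); have := normr_ge0 u; have := normr_ge0 v.
by move: `|u| `|v| uM vN => p q ? ? ? ?; nra.
Qed.

(** The component of F - G along [nu] is at most 2 and the slope of the spline at most 2, whence
    4. *)
Lemma normr_jump k F G x : unit_bounded F -> unit_bounded G ->
  `|\sum_i (F i x - G i x) * dcut k i x| <= 4 * k.+1%:R.
Proof.
move=> Fu Gu.
rewrite (_ : \sum_i _ = (- (\sum_i F i x * nu 0 i) + \sum_i G i x * nu 0 i) *
    (dstep (- k.+1%:R * lin nu x + k.+1%:R * s) * k.+1%:R)); last first.
  rewrite -sumrN -big_split/= mulr_suml; apply: eq_bigr => i _; rewrite /dcut; ring.
have NF (H : vfield) : unit_bounded H -> unit_bounded (fun i x => - H i x).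
  by move=> Hu y; rewrite (eq_bigr (fun i => H i y ^+ 2))// => i _; rewrite sqrrN.
have CS (H : vfield) : unit_bounded H -> \sum_i H i x * nu 0 i <= 1.
  by move=> Hu; apply: cauchy_schwarz_unit => //; exact: Hu.
have CSn (H : vfield) : unit_bounded H -> - 1 <= \sum_i H i x * nu 0 i.
  move=> Hu; rewrite lerNl -sumrN; have := CS _ (NF _ Hu).
  by congr (_ <= _); apply: eq_bigr => i _; rewrite mulNr.
rewrite normrM (_ : 4 * _ = 2 * (2 * k.+1%:R)); last by ring.
apply: ler_pM => //.
  rewrite ler_norml; have := CS _ Fu; have := CSn _ Fu; have := CS _ Gu; have := CSn _ Gu.
  by move: (\sum_i _) (\sum_i _) => p q ? ? ? ?; lra.
rewrite normrM (ger0_norm (ler0n _ _)); apply: ler_wpM2r => //; exact: normr_dstep.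
Qed.

Lemma admissible_mix k F dF G dG : admissible F dF -> admissible G dG ->
  admissible (mix k F G) (dmix k F dF G dG).
Proof.
move=> [F1 Fu [M FM]] [G1 Gu [N GN]]; split.
- apply: C1field_add; apply: C1field_scale => //; first exact: C1_cut.
  by apply: C1_onem; exact: C1_cut.
- by apply: unit_bounded_convex => // x; exact: cut01.
- exists (M + N + 4 * k.+1%:R) => x; rewrite dive_mix; apply: (le_trans (ler_normD _ _)).
  by apply: lerD; [apply: mix_bounded => //; exact: cut01|exact: normr_jump].
Qed.

(** Gauss-Green for the interpolated field, in the limit of a thin slab. Differentiating the cutoff
    produces the only obstruction to pasting, which enters through its lower bound - q. *)
Lemma cut_and_paste E F dF G dG (q : R) : finite_perimeter Om E ->
  admissible F dF -> admissible G dG ->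
  (\forall k \near \oo, - q <= \int[mu]_(x in E) \sum_i (F i x - G i x) * dcut k i x) ->
  \int[mu]_(x in E `&` K) dive dF x + \int[mu]_(x in E `\` K) dive dG x +
  (\int[l]_(y in tr_set E `&` bside) F ord_max (boundary_point y) +
   \int[l]_(y in tr_set E `\` bside) G ord_max (boundary_point y)) <= Per Om E + q.
Proof.
move=> fE aF aG Hq; have [mE EOm Eoo _] := fE.
have mA := measurable_tr_set mE; have Aoo := tr_set_lty fE.
have [F1 Fu [M FM]] := aF; have [G1 Gu [N GN]] := aG.
have mdF := measurable_dive F1; have mdG := measurable_dive G1.
have [mF bF] := admissible_boundary aF; have [mG bG] := admissible_boundary aG.
have mcut k : measurable_fun setT (cut k) by exact: C1_measurable (C1_cut k).
have mi : measurable_fun setT (\1_K : _ -> R) by apply: measurable_indic; exact: measurable_side.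
have i01 x : 0 <= (\1_K x : R) <= 1 by rewrite indicE; case: (x \in K); rewrite /= ?lexx ?ler01.
have mm (c : 'rV[R]_n.+1 -> R) : measurable_fun setT c ->
    measurable_fun setT (fun x => c x * dive dF x + (1 - c x) * dive dG x).
  by move=> mc; apply: measurable_funD; apply: measurable_funM => //; exact: measurable_funB.
pose u k := \int[mu]_(x in E) (cut k x * dive dF x + (1 - cut k x) * dive dG x).
pose v k := \int[l]_(y in tr_set E) mix k F G ord_max (boundary_point y).
have cu : u k @[k --> \oo] --> \int[mu]_(x in E) (\1_K x * dive dF x + (1 - \1_K x) * dive dG x).
  apply: (@Rintegral_cvg _ _ _ _ _ _ _ (M + N)) => //.
  - by move=> k; exact: mm.
  - exact: mm.
  - by move=> k x _; apply: mix_bounded => //; exact: cut01.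
  - by move=> x _; apply: cvg_mix; exact: cut_cvg.
have mib : measurable_fun setT (\1_bside : _ -> R) by apply: measurable_indic; exact: measurable_bside.
have cv : v k @[k --> \oo] --> \int[l]_(y in tr_set E) (\1_bside y * F ord_max (boundary_point y) +
    (1 - \1_bside y) * G ord_max (boundary_point y)).
  apply: (@Rintegral_cvg _ _ _ _ _ _ _ (1 + 1)) => //.
  - by move=> k; have [] := admissible_boundary (admissible_mix k aF aG).
  - by apply: measurable_funD; apply: measurable_funM => //; exact: measurable_funB.
  - move=> k y _; apply: mix_bounded; first exact: cut01.
      by rewrite ler_norml.
    by rewrite ler_norml.
  - move=> y _; have E1 : (\1_bside y : R) = \1_K (boundary_point y).
      rewrite !indicE; have [H|H] := pselect (bside y); first by rewrite !mem_set.
      by rewrite !memNset.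
    by rewrite E1; apply: cvg_mix; exact: cut_cvg.
have Iu : mu.-integrable E (EFin \o (fun x => \1_K x * dive dF x + (1 - \1_K x) * dive dG x)).
  apply: (@bounded_integrable _ _ _ _ _ _ (M + N)) => //; first exact: mm.
  by move=> x _; exact: mix_bounded.
have Iv : l.-integrable (tr_set E) (EFin \o (fun y => \1_bside y * F ord_max (boundary_point y) +
    (1 - \1_bside y) * G ord_max (boundary_point y))).
  apply: (@bounded_integrable _ _ _ _ _ _ (1 + 1)) => //.
    by apply: measurable_funD; apply: measurable_funM => //; exact: measurable_funB.
  move=> y _; apply: mix_bounded; first by rewrite indicE; case: (y \in bside); rewrite /= ?lexx ?ler01.
    by rewrite ler_norml.
  by rewrite ler_norml.
rewrite -(Rintegral_mix mE measurable_side Iu) -(Rintegral_mix mA measurable_bside Iv).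
have cuv : u k + v k @[k --> \oo] --> (\int[mu]_(x in E) (\1_K x * dive dF x + (1 - \1_K x) * dive dG x) +
    \int[l]_(y in tr_set E) (\1_bside y * F ord_max (boundary_point y) +
    (1 - \1_bside y) * G ord_max (boundary_point y)) : R).
  exact: (cvgD cu cv).
apply: (cvgr_to_le cuv); move: Hq; apply: filterS => k Hk.
have := gauss_green fE (admissible_mix k aF aG).
rewrite (_ : \int[mu]_(x in E) dive _ x = u k + \int[mu]_(x in E) \sum_i (F i x - G i x) * dcut k i x).
  by rewrite -/(v k); move: Hk; move: (u k) (v k) (\int[mu]_(x in E) \sum_i _) => p r w; lra.
rewrite -RintegralD//; first by apply: eq_Rintegral => x _; rewrite dive_mix.
  apply: (@bounded_integrable _ _ _ _ _ _ (M + N)) => //; first exact: mm.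
  by move=> x _; apply: mix_bounded => //; exact: cut01.
apply: (@bounded_integrable _ _ _ _ _ _ (4 * k.+1%:R)) => //.
  apply: measurable_sum => i; apply: measurable_funM.
    by apply: measurable_funB; apply: C1_measurable; [exact: F1|exact: G1].
  by apply: continuous_measurable_rV; case: (C1_cut k).
by move=> x _; exact: normr_jump.
Qed.

Lemma test_field_admissible F dF : test_field Om F dF -> admissible F dF /\
  forall y, F ord_max (boundary_point y) = 0.
Proof.
move=> tF; have [F1 Fu Fs] := tF; split.
  by split => //; have [M _ dM] := test_field_bounded tF; exists (n.+1%:R * M); exact: dive_bounded.
by move=> y; have [d d0 ->//] := supp_height Fs; rewrite height_boundary.
Qed.

Variable b : 'rV[R]_n -> R.
Hypothesis mb : measurable_fun setT b.
Hypothesis b1 : forall y, -1 <= b y <= 1.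

Lemma measurable_trI E : measurable E -> measurable (tr_set E `&` bside) /\ measurable (tr_set E `\` bside).
Proof.
move=> mE; have mA := measurable_tr_set mE; have mB := measurable_bside.
by split; [exact: measurableI|exact: measurableD].
Qed.

(** Where [G] equals [nu], the crossing term is 1 - F . nu times a nonnegative slope, and F . nu <=
    1: pasting costs nothing. The divergence of [G] beyond the hyperplane is a gain, exploited by
    the height bound. *)
Lemma truncation E G dG : finite_perimeter Om E -> admissible G dG ->
  \sum_i nu 0 i ^+ 2 = 1 -> (forall i x, lin nu x <= s -> G i x = nu 0 i) ->
  (forall y, b y <= G ord_max (boundary_point y)) ->
  finite_perimeter Om (E `&` K) /\
  energy b (E `&` K) + \int[mu]_(x in E `\` K) dive dG x <= energy b E.
Proof.
move=> fE aG nuE Gnu bG; have [mE EOm Eoo _] := fE; have mA := measurable_tr_set mE.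
have Aoo := tr_set_lty fE; have [mAK mAD] := measurable_trI mE.
have [G1 Gu [N GN]] := aG.
have mEK : measurable (E `&` K) by apply: measurableI => //; exact: measurable_side.
have pos F dF : admissible F dF ->
    \forall k \near \oo, - 0 <= \int[mu]_(x in E) \sum_i (F i x - G i x) * dcut k i x.
  move=> [F1 Fu _]; apply: nearW => k; rewrite oppr0; apply: Rintegral_ge0 => x _.
  have [xs|xs] := leP (lin nu x) s; last first.
    rewrite big1// => i _; rewrite /dcut dstep_out ?mul0r ?mulr0//; apply/orP; left.
    by rewrite mulNr addrC -mulrBr mulr_ge0_le0// subr_le0 ltW.
  rewrite (_ : \sum_i _ = (1 - \sum_i F i x * nu 0 i) *
      (dstep (- k.+1%:R * lin nu x + k.+1%:R * s) * k.+1%:R)); last first.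
    have -> : 1 - \sum_i F i x * nu 0 i = \sum_i (nu 0 i ^+ 2 - F i x * nu 0 i) by rewrite sumrB nuE.
    by rewrite mulr_suml; apply: eq_bigr => i _; rewrite /dcut Gnu//; ring.
  rewrite mulr_ge0 ?mulr_ge0 ?dstep_ge0// subr_ge0.
  by apply: cauchy_schwarz_unit => //; exact: Fu.
have [mG gb] := admissible_boundary aG.
have fEK : finite_perimeter Om (E `&` K).
  have [] // := @finite_perimeter_le R n.+1 Om (E `&` K) (Per Om E - \int[mu]_(x in E `\` K) dive dG x
      - \int[l]_(y in tr_set E `\` bside) G ord_max (boundary_point y)) mEK _ _ _.
  - by move=> x [/EOm].
  - by apply: (mu_lty mEK mE) => // x [].
  - move=> F dF tF; have [aF F0] := test_field_admissible tF.
    have := cut_and_paste fE aF aG (pos _ _ aF).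
    rewrite (_ : \int[l]_(y in tr_set E `&` bside) _ = 0); last first.
      by rewrite /Rintegral integral0_eq// => y _ /=; rewrite F0.
    move: (\int[mu]_(x in _ `&` _) _) (\int[mu]_(x in _ `\` _) _) (\int[l]_(y in _) _) => p r t; lra.
split => //; apply/ler_addgt0Pr => e e0; have e2 : 0 < e / 2 by rewrite divr_gt0.
(* The trace of the truncated set is not computed: [B] contains it together with the trace of [E],
   and on both the vertical component of the field is close to [b]. *)
pose B := tr_set E `|` tr_set (E `&` K).
have mAEK := measurable_tr_set mEK.
have mB : measurable B by exact: measurableU.
have Boo : (l B < +oo)%E.
  apply: (le_lt_trans (le_muU l mA mAEK)); rewrite lte_add_pinfty//; exact: tr_set_lty.
have [F [dF [aF HF Fb]]] := calibrating_field mb b1 fEK mB Boo (@subsetUr _ _ _) e2.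
have [mF fb] := admissible_boundary aF.
have AKB : tr_set E `&` bside `<=` B by move=> y [Ay _]; left.
have H1 := Rintegral_sub_le mAK mB Boo AKB mb mF b1 fb.
have ADoo := mu_lty mAD mA (@subDsetl _ _ _) Aoo.
have H2 : \int[l]_(y in tr_set E `\` bside) b y <= \int[l]_(y in tr_set E `\` bside) G ord_max (boundary_point y).
  by apply: le_Rintegral => //; exact: bounded_integrable1.
have H3 := cut_and_paste fE aF aG (pos _ _ aF).
have H4 : \int[l]_(y in tr_set E) b y = \int[l]_(y in tr_set E `&` bside) b y + \int[l]_(y in tr_set E `\` bside) b y.
  by apply: Rintegral_setD => //; [exact: measurable_bside|exact: bounded_integrable1].
rewrite {2}/energy H4; move: HF Fb H1 H2 H3.
move: (energy b _) (\int[mu]_(x in _ `&` _) _) (\int[mu]_(x in _ `\` _) _) (\int[l]_(y in B) _).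
move: (\int[l]_(y in _ `&` _) _) (\int[l]_(y in _ `&` _) _) (\int[l]_(y in _ `\` _) _) (\int[l]_(y in _ `\` _) _).
move=> p1 p2 p3 p4 p5 p6 p7 p8; lra.
Qed.

(** Here the fields on the two sides are unrelated and the crossing term has no sign; it is at most
    4 (k+1) times the mass q / (k+1) in the slab. *)
Lemma splitting E (q : R) : finite_perimeter Om E -> 0 <= q ->
  (\forall k \near \oo, fine (mu (E `&` [set x | s - k.+1%:R^-1 < lin nu x < s])) <= q / k.+1%:R) ->
  [/\ finite_perimeter Om (E `&` K), finite_perimeter Om (E `\` K) &
      energy b (E `&` K) + energy b (E `\` K) <= energy b E + 4 * q].
Proof.
move=> fE q0 Hq; have [mE EOm Eoo _] := fE; have mA := measurable_tr_set mE.
have Aoo := tr_set_lty fE; have [mAK mAD] := measurable_trI mE.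
have mK := measurable_side.
have mEK : measurable (E `&` K) by exact: measurableI.
have mED : measurable (E `\` K) by exact: measurableD.
have slab F dF G dG : admissible F dF -> admissible G dG ->
    \forall k \near \oo, - (4 * q) <= \int[mu]_(x in E) \sum_i (F i x - G i x) * dcut k i x.
  move=> [F1 Fu _] [G1 Gu _]; move: Hq; apply: filterS => k Hk.
  pose S := [set x : 'rV[R]_n.+1 | s - k.+1%:R^-1 < lin nu x < s].
  have mS : measurable S.
    rewrite (_ : S = setT `&` lin nu @^-1` `]s - k.+1%:R^-1, s[).
      by apply: continuous_measurable_lin => //; exact: measurable_itv.
    by rewrite setTI; apply/seteqP; split => x; rewrite /S/= in_itv.
  have mh : measurable_fun setT (fun x => \sum_i (F i x - G i x) * dcut k i x).
    apply: measurable_sum => i; apply: measurable_funM.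
      by apply: measurable_funB; apply: C1_measurable; [exact: F1|exact: G1].
    by apply: continuous_measurable_rV; case: (C1_cut k).
  rewrite (@Rintegral_setD _ _ _ mu E S)//; last first.
    by apply: (@bounded_integrable _ _ _ _ _ _ (4 * k.+1%:R)) => // x _; exact: normr_jump.
  rewrite [X in _ + X](_ : _ = 0) ?addr0; last first.
    rewrite /Rintegral integral0_eq// => x [_ nS] /=; congr (_%:E).
    rewrite big1// => i _; rewrite /dcut dstep_out ?mul0r ?mulr0//; apply/orP.
    rewrite mulNr addrC -mulrBr.
    have [xs|xs] := leP s (lin nu x); first by left; rewrite mulr_ge0_le0// subr_le0.
    right; have [xk|xk] := leP (lin nu x) (s - k.+1%:R^-1); last by case: nS; rewrite /S/= xk xs.
    by rewrite mulrC -ler_pdivrMr// div1r; move: xk; move: (_^-1) => w ?; lra.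
  have mES : measurable (E `&` S) by exact: measurableI.
  have ESoo := mu_lty mES mE (@subIsetl _ _ _) Eoo.
  have := @Rintegral_bound _ _ _ mu (E `&` S) _ (4 * k.+1%:R) mES ESoo mh (fun x _ => normr_jump k x Fu Gu).
  rewrite ler_norml => /andP[+ _]; apply: le_trans; rewrite lerN2.
  have k0 : 0 < k.+1%:R :> R by [].
  move: Hk; rewrite -/S ler_pdivlMr//; move: (fine _) k0 => u; move: (k.+1%:R) => w ? ?; lra.
(* The zero field on one side isolates the perimeter of the part on the other side. *)
pose Z : vfield := fun _ => cst 0.
pose dZ : 'I_n.+1 -> vfield := fun _ _ => cst 0.
have tZ : test_field Om Z dZ by exact: test_field0.
have main F dF G dG : test_field Om F dF -> test_field Om G dG ->
    \int[mu]_(x in E `&` K) dive dF x + \int[mu]_(x in E `\` K) dive dG x <= Per Om E + 4 * q.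
  move=> tF tG; have [aF F0] := test_field_admissible tF; have [aG G0] := test_field_admissible tG.
  have := cut_and_paste fE aF aG (slab _ _ _ _ aF aG).
  rewrite (_ : \int[l]_(y in tr_set E `&` bside) _ = 0); last first.
    by rewrite /Rintegral integral0_eq// => y _ /=; rewrite F0.
  rewrite (_ : \int[l]_(y in tr_set E `\` bside) _ = 0) ?addr0//.
  by rewrite /Rintegral integral0_eq// => y _ /=; rewrite G0.
have Z0 (A : set 'rV[R]_n.+1) : \int[mu]_(x in A) dive dZ x = 0.
  by rewrite /Rintegral integral0_eq// => x _ /=; rewrite /dive /dZ/= big1.
have fEK : finite_perimeter Om (E `&` K).
  have [] // := @finite_perimeter_le R n.+1 Om (E `&` K) (Per Om E + 4 * q) mEK _ _ _.
  - by move=> x [/EOm].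
  - by apply: (mu_lty mEK mE) => // x [].
  - by move=> F dF tF; have := main _ _ _ _ tF tZ; rewrite Z0 addr0.
have fED : finite_perimeter Om (E `\` K).
  have [] // := @finite_perimeter_le R n.+1 Om (E `\` K) (Per Om E + 4 * q) mED _ _ _.
  - by move=> x [/EOm].
  - by apply: (mu_lty mED mE) => // x [].
  - by move=> F dF tF; have := main _ _ _ _ tZ tF; rewrite Z0 add0r.
split => //; apply/ler_addgt0Pr => e e0; have e4 : 0 < e / 4 by rewrite divr_gt0.
pose B := tr_set E `|` (tr_set (E `&` K) `|` tr_set (E `\` K)).
have mA1 := measurable_tr_set mEK; have mA2 := measurable_tr_set mED.
have mB : measurable B by apply: measurableU => //; exact: measurableU.
have Boo : (l B < +oo)%E.
  apply: (le_lt_trans (le_muU l mA (measurableU _ _ mA1 mA2))); rewrite lte_add_pinfty//.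
  apply: (le_lt_trans (le_muU l mA1 mA2)); rewrite lte_add_pinfty//; exact: tr_set_lty.
have [|F [dF [aF HF Fb]]] := calibrating_field mb b1 fEK mB Boo _ e4; first by move=> y ?; right; left.
have [|G [dG [aG HG Gb]]] := calibrating_field mb b1 fED mB Boo _ e4; first by move=> y ?; right; right.
have [mF fb] := admissible_boundary aF; have [mG gb] := admissible_boundary aG.
have AKB : tr_set E `&` bside `<=` B by move=> y [Ay _]; left.
have ADB : tr_set E `\` bside `<=` B by move=> y [Ay _]; left.
have H1 := Rintegral_sub_le mAK mB Boo AKB mb mF b1 fb.
have H2 := Rintegral_sub_le mAD mB Boo ADB mb mG b1 gb.
have H3 := cut_and_paste fE aF aG (slab _ _ _ _ aF aG).
have H4 : \int[l]_(y in tr_set E) b y = \int[l]_(y in tr_set E `&` bside) b y + \int[l]_(y in tr_set E `\` bside) b y.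
  by apply: Rintegral_setD => //; [exact: measurable_bside|exact: bounded_integrable1].
rewrite {3}/energy H4; move: HF HG Fb Gb H1 H2 H3.
move: (energy b (E `&` K)) (energy b (E `\` K)) (\int[mu]_(x in _ `&` _) _) (\int[mu]_(x in _ `\` _) _).
move: (\int[l]_(y in B) `|b y - F _ _|) (\int[l]_(y in B) `|b y - G _ _|).
move: (\int[l]_(y in _ `&` _) b y) (\int[l]_(y in _ `&` _) F _ _) (\int[l]_(y in _ `\` _) b y) (\int[l]_(y in _ `\` _) G _ _).
move=> p1 p2 p3 p4 p5 p6 p7 p8 p9 p10; lra.
Qed.

End cut_and_paste.

(** * Existence of minimizers *)

Section tilted_directions.
Variables (R : realType) (n : nat).
Implicit Types (x : 'rV[R]_n.+1).

Lemma linC m (x y : 'rV[R]_m) : lin x y = lin y x.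
Proof. by apply: eq_bigr => i _; rewrite mulrC. Qed.

Lemma sum_sq_lin m (x : 'rV[R]_m) : \sum_i x 0 i ^+ 2 = lin x x.
Proof. by apply: eq_bigr => i _; rewrite expr2. Qed.

Lemma sum_lift (f : 'I_n.+1 -> R) :
  \sum_i f i = \sum_(j < n) f (lift ord_max j) + f ord_max.
Proof.
rewrite big_ord_recr; congr (_ + _); apply: eq_bigr => j _; congr (f _).
by apply: val_inj; rewrite /= /bump leqNgt ltn_ord.
Qed.

Definition tilt (a c : R) (i : 'I_n) : 'rV[R]_n.+1 :=
  a *: delta_mx 0 (lift ord_max i) + c *: delta_mx 0 ord_max.

Lemma lin_tilt a c i x : lin (tilt a c i) x = a * x 0 (lift ord_max i) + c * height x.
Proof. by rewrite linC linD !linZ !lin_delta. Qed.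

Lemma tilt_max a c i : tilt a c i 0 ord_max = c.
Proof. by rewrite !mxE !eqxx /= eq_liftF mulr0 add0r mulr1. Qed.

Lemma tilt_unit a c i : \sum_j tilt a c i 0 j ^+ 2 = a ^+ 2 + c ^+ 2.
Proof.
rewrite sum_sq_lin lin_tilt /height tilt_max !mxE !eqxx/= lift_eqF mulr0 addr0 mulr1.
by rewrite !expr2.
Qed.

Lemma e_v_unit : \sum_j (delta_mx 0 ord_max : 'rV[R]_n.+1) 0 j ^+ 2 = 1.
Proof. by rewrite sum_sq_lin lin_e mxE !eqxx. Qed.

End tilted_directions.

Section existence.
Variables (R : realType) (n : nat).
Local Notation mu := (lebesgue R n.+1).
Local Notation l := (lebesgue R n).
Local Notation Om := (@halfspace R n).
Variables (b : 'rV[R]_n -> R) (kappa : R).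
Hypothesis mb : measurable_fun setT b.
Hypothesis kappa0 : 0 < kappa.
Hypothesis kappa1 : kappa <= 1 / 2.
Hypothesis bk : forall y, -1 <= b y <= 1 - 2 * kappa.
Implicit Types (E F : set 'rV[R]_n.+1).

Lemma bk1 y : -1 <= b y <= 1.
Proof. by have /andP[-> /=] := bk y; move: (b y) kappa0 => u ? ?; lra. Qed.

Lemma coercive E : finite_perimeter Om E ->
  kappa * (Per Om E + fine (l (tr_set E))) <= energy b E.
Proof.
move=> fE; apply: energy_coercive => //; [exact: bk1| |by move=> y; have /andP[] := bk y].
by move: kappa0 kappa1 => ? ?; lra.
Qed.

Lemma whole_perimeter_le E : finite_perimeter Om E ->
  finite_perimeter setT E /\ kappa * Per setT E <= energy b E.
Proof.
move=> fE; have [fT PT] := finite_perimeter_whole fE; split => //.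
by apply: le_trans (coercive fE); apply: ler_wpM2l => //; exact: ltW.
Qed.

(** A constant direction has no divergence, and the condition on its vertical component makes it
    dominate [b] on the boundary. *)
Lemma truncation_constant (nu : 'rV[R]_n.+1) s E : \sum_i nu 0 i ^+ 2 = 1 ->
  1 - 2 * kappa <= nu 0 ord_max -> finite_perimeter Om E ->
  finite_perimeter Om (E `&` side nu s) /\ energy b (E `&` side nu s) <= energy b E.
Proof.
move=> nu1 nub fE.
pose G (i : 'I_n.+1) : 'rV[R]_n.+1 -> R := cst (nu 0 i).
pose dG (i j : 'I_n.+1) : 'rV[R]_n.+1 -> R := cst 0.
have d0 x : dive dG x = 0 by rewrite /dive /dG/= big1.
have aG : admissible G dG.
  split; [by move=> i; exact: C1_cst|by move=> x; rewrite /G/= nu1|].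
  by exists 0 => x; rewrite d0 normr0.
have nu1' : \sum_i nu 0 i ^+ 2 <= 1 by rewrite nu1.
have bG y : b y <= G ord_max (boundary_point y).
  by apply: le_trans nub; have /andP[] := bk y.
have [fK] := @truncation R n nu s nu1' b mb bk1 E G dG fE aG nu1 (fun i x _ => erefl) bG.
by rewrite [X in _ + X](_ : _ = 0) ?addr0// /Rintegral integral0_eq// => x _ /=; rewrite d0.
Qed.

Lemma truncation_seq (L : seq ('rV[R]_n.+1 * R)) E0 E :
  (forall p, p \in L -> [/\ \sum_i p.1 0 i ^+ 2 = 1, 1 - 2 * kappa <= p.1 0 ord_max &
     E0 `<=` side p.1 p.2]) ->
  finite_perimeter Om E -> E0 `<=` E -> exists E', [/\ finite_perimeter Om E', E0 `<=` E',
    forall p, p \in L -> E' `<=` side p.1 p.2 & energy b E' <= energy b E].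
Proof.
elim: L E => [|p L IH] E HL fE E0E; first by exists E.
have [nu1 nub E0p] := HL p (mem_head _ _).
have [fK eK] := truncation_constant p.2 nu1 nub fE.
have [||E' [fE' E0E' HE' eE']] := IH (E `&` side p.1 p.2) _ fK.
- by move=> p' p'L; apply: HL; rewrite inE p'L orbT.
- by move=> x E0x; split; [exact: E0E|exact: E0p].
(* The cut by [p] is made once more, as the induction does not record that [E'] stays inside the set
   it started from. *)
have [fK' eK'] := truncation_constant p.2 nu1 nub fE'.
exists (E' `&` side p.1 p.2); split; first exact: fK'.
- by move=> x E0x; split; [exact: E0E'|exact: E0p].
- by move=> p'; rewrite inE => /orP[/eqP ->|p'L] x [E'x px] //; exact: HE' p'L _ E'x.
- by apply: (le_trans eK'); exact: le_trans eK.
Qed.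

(** The directions are the vertical one and, for each horizontal axis and both senses, its tilt with
    vertical component 1 - 2 kappa, the least allowed. This is below 1, so the horizontal component
    a is positive; as heights are positive, each tilted cut bounds a horizontal coordinate by (D +
    H) / a. *)
Lemma truncation_box (E0 : set 'rV[R]_n.+1) (D H : R) : 0 < D -> 0 < H -> E0 `<=` cylinder D H ->
  exists2 M : R, 0 < M & forall E, finite_perimeter Om E -> E0 `<=` E ->
  exists E', [/\ finite_perimeter Om E', E0 `<=` E', E' `<=` half_open_box M & energy b E' <= energy b E].
Proof.
move=> D0 H0 E0C; pose c := 1 - 2 * kappa; pose a := Num.sqrt (1 - c ^+ 2).
have c01 : 0 <= c < 1 by rewrite /c; move: kappa0 kappa1 => ? ?; apply/andP; split; lra.
have /andP[c0 c1] := c01.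
have a20 : 0 < 1 - c ^+ 2 by nra.
have a0 : 0 < a by rewrite sqrtr_gt0.
have a2 : a ^+ 2 = 1 - c ^+ 2 by rewrite sqr_sqrtr// ltW.
have a1 : a <= 1 by nra.
pose M := (D + H) / a + H + 1.
have DHa : 0 < (D + H) / a by rewrite divr_gt0// addr_gt0.
exists M; first by rewrite /M; lra.
move=> E fE E0E.
pose L := (delta_mx 0 ord_max, H) ::
  [seq (tilt a c i, D + H) | i <- enum 'I_n] ++ [seq (tilt (- a) c i, D + H) | i <- enum 'I_n].
have coord x i : E0 x -> `|x 0 (lift ord_max i)| < D /\ 0 < height x < H.
  move=> /E0C [+ hx]; rewrite /eball/= subr0 => xD; split => //.
  by apply: le_lt_trans xD; have := enorm_coord (horizontal x) i; rewrite mxE.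
have [|E' [fE' E0E' HE' eE']] := @truncation_seq L E0 E _ fE E0E.
  move=> p; rewrite inE mem_cat => /orP[/eqP ->|/orP[/mapP[i _ ->]|/mapP[i _ ->]]] /=.
  - split; [exact: e_v_unit|by rewrite mxE !eqxx/= -/c ltW|].
    by move=> x /E0C [_ /andP[_ xH]]; rewrite /side/= lin_e.
  - split; [by rewrite tilt_unit a2 subrK|by rewrite tilt_max|].
    move=> x E0x; have [] := coord x i E0x; rewrite ltr_norml => H1 H2.
    rewrite /side/= lin_tilt; move: (x 0 _) (height x) H1 H2 => u v /andP[? ?] /andP[? ?]; nra.
  - split; [by rewrite tilt_unit sqrrN a2 subrK|by rewrite tilt_max|].
    move=> x E0x; have [] := coord x i E0x; rewrite ltr_norml => H1 H2.
    rewrite /side/= lin_tilt; move: (x 0 _) (height x) H1 H2 => u v /andP[? ?] /andP[? ?]; nra.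
exists E'; split => // x E'x.
have hx0 : 0 < height x by case: fE' => _ /(_ _ E'x).
have hxH : height x < H.
  by have := HE' (delta_mx 0 ord_max, H) (mem_head _ _) _ E'x; rewrite /side/= lin_e.
move=> i; rewrite in_itv/=; case: (unliftP ord_max i) => [j ->|->].
  have /(_ _ _ E'x) := HE' (tilt a c j, D + H); rewrite /side/= lin_tilt inE mem_cat.
  rewrite (_ : (_, _) \in [seq (tilt a c i0, D + H) | i0 <- enum 'I_n]) ?orbT; last first.
    by apply/mapP; exists j => //; rewrite mem_enum.
  move=> /(_ isT) H1.
  have /(_ _ _ E'x) := HE' (tilt (- a) c j, D + H); rewrite /side/= lin_tilt inE !mem_cat.
  rewrite (_ : (_, _) \in [seq (tilt (- a) c i0, D + H) | i0 <- enum 'I_n]) ?orbT; last first.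
    by apply/mapP; exists j => //; rewrite mem_enum.
  move=> /(_ isT) H2.
  have e1 : (D + H) / a * a = D + H by rewrite divfK ?gt_eqF.
  have ch : 0 <= c * height x by rewrite mulr_ge0// ltW.
  rewrite /M; move: (x 0 _) ((D + H) / a) (c * height x) e1 ch H1 H2 => u v w e1 ch H1 H2.
  by apply/andP; split; nra.
rewrite -/(height x) /M; apply/andP; split; lra.
Qed.

(** Minimality among all sets of finite perimeter, density-normalized or not, so that intersections
    and limits are competitors. *)
Definition energy_minimal E0 E := [/\ finite_perimeter Om E, E0 `<=` E &
  forall F, finite_perimeter Om F -> E0 `<=` F -> energy b E <= energy b F].

Lemma existence E0 (D H : R) : 0 < D -> 0 < H -> E0 `<=` cylinder D H -> finite_perimeter Om E0 ->
  exists E, energy_minimal E0 E.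
Proof.
move=> D0 H0 E0C fE0; have [M M0 HM] := truncation_box D0 H0 E0C.
pose S := [set e : R | exists2 F, finite_perimeter Om F /\ E0 `<=` F & energy b F = e].
have S0 e : S e -> 0 <= e.
  move=> [F [fF _] <-]; apply: le_trans (coercive fF).
  by apply: mulr_ge0; [exact: ltW|apply: addr_ge0; [exact: Per_ge0|exact: fine_ge0]].
have infS : has_inf S.
  split; first by exists (energy b E0); exists E0 => //; split.
  by exists 0 => e; exact: S0.
have /choice[E_ HE] : forall k : nat, exists E, [/\ finite_perimeter Om E, E0 `<=` E,
    E `<=` half_open_box M & energy b E <= inf S + k.+1%:R^-1].
  move=> k; have k0 : 0 < k.+1%:R^-1 :> R by rewrite invr_gt0.
  have [_ [F [fF E0F] <-] lt] := inf_adherent k0 infS.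
  have [E' [fE' E0E' boxE' eE']] := HM F fF E0F.
  by exists E'; split => //; apply: (le_trans eE'); exact: ltW.
have invk1 k : k.+1%:R^-1 <= 1 :> R by rewrite invf_le1// ler1n.
have fE_ k : finite_perimeter Om (E_ k) by case: (HE k).
have PT k : Per setT (E_ k) <= (inf S + 1) / kappa.
  have [_ _ _ ek] := HE k; have [_ +] := whole_perimeter_le (fE_ k).
  rewrite ler_pdivlMr// mulrC => /le_trans; apply; apply: (le_trans ek).
  by rewrite lerD2l.
have [||E [mE EU EI Econv]] := perimeter_compactness M0 (_ : forall k, E_ k `<=` half_open_box M) _ PT.
- by move=> k; case: (HE k).
- by move=> k; have [] := whole_perimeter_le (fE_ k).
have EOm : E `<=` Om by move=> x /EU[k _]; have [_ + _ _] := fE_ k; exact.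
have E0E : E0 `<=` E by move=> x E0x; apply: EI => k _; have [_ + _ _] := HE k; exact.
have Ebox : E `<=` half_open_box M by move=> x /EU[k _]; have [_ _ + _] := HE k; exact.
have mbox : measurable (half_open_box M : set 'rV[R]_n.+1).
  by apply: (measurable_box (A := fun _ => [set` `[- M, M[])) => i; exact: measurable_itv.
have boxoo : (mu (half_open_box M) < +oo)%E.
  have := @lebesgue_itv_box R n.+1 (fun _ => - M) (2 * M) _ true true.
  rewrite mulr_ge0 ?ltW// => /(_ isT); rewrite (_ : [set _ | _] = half_open_box M).
    by move=> ->; rewrite ltry.
  by apply/seteqP; split => x Hx i; have := Hx i; rewrite !in_itv/= (_ : - M + 2 * M = M)//; lra.
have Eoo : (mu E < +oo)%E by exact: mu_lty mE mbox Ebox boxoo.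
(* Test fields have bounded divergence, so the bound on the perimeters passes to the limit; the
   extra 1 pays for one sufficiently close index. *)
have fE : finite_perimeter Om E.
  have [] // := @finite_perimeter_le R n.+1 Om E ((inf S + 1) / kappa + 1) mE EOm Eoo.
  move=> F dF tF; have [N N0 dFN] := test_field_bounded tF; have [F1 _ _] := tF.
  have e0 : 0 < (n.+1%:R * N + 1)^-1 by rewrite invr_gt0 ltr_wpDl// mulr_ge0.
  have [k _ Hk] := Econv _ 0%N e0; have [mEk _ Ekoo _] := fE_ k.
  have := Rintegral_setY mE mEk Eoo Ekoo (measurable_dive F1) (dive_bounded dFN).
  have Ed : n.+1%:R * N * fine (mu (E `+` E_ k)) <= 1.
    have Yoo : (mu (E `+` E_ k) < +oo)%E by apply: (le_lt_trans Hk); exact: ltry.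
    have : fine (mu (E `+` E_ k)) <= (n.+1%:R * N + 1)^-1 by rewrite -lee_fin finite_muK.
    rewrite -[leRHS]mul1r ler_pdivlMr; last by rewrite ltr_wpDl// mulr_ge0.
    have := fine_ge0 (measure_ge0 mu (E `+` E_ k)).
    by move: (fine _) (n.+1%:R * N) => u w ? ?; nra.
  have := Per_ub (fE_ k) tF.
  have P1 : Per Om (E_ k) <= (inf S + 1) / kappa.
    have [_ _ _ ek] := HE k; have := coercive (fE_ k).
    have := invk1 k; have L0 : 0 <= fine (l (tr_set (E_ k))) by exact: fine_ge0.
    rewrite ler_pdivlMr//; move: (fine _) (k.+1%:R^-1) (Per _ _) (energy _ _) L0 ek => u v p e L0 ek ? ?.
    by move: kappa0 => ?; nra.
  rewrite ler_norml => Pk /andP[_].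
  move: Ed P1 Pk; move: (_ * fine _) (\int[mu]_(x in E) _) (\int[mu]_(x in E_ k) _) (Per _ _) (_ / kappa) => q u v p w.
  lra.
pose B := [set y : 'rV[R]_n | forall i, y 0 i \in `[- M, (- M + 2 * M)] ].
have mB : measurable B.
  by apply: (measurable_box (A := fun _ => [set` `[- M, (- M + 2 * M)]])) => i; exact: measurable_itv.
have Boo : (l B < +oo)%E.
  have M20 : 0 <= 2 * M by rewrite mulr_ge0 ?ltW.
  by have -> := @lebesgue_itv_box R n (fun _ => - M) (2 * M) M20 true false; rewrite ltry.
(* Above a point of the trace there is some point of [F], so traces of subsets of the box lie over
   its base. This gives one finite-measure [B] for the whole sequence. *)
have trB F : measurable F -> F `<=` half_open_box M -> tr_set F `<=` B.
  move=> mF Fbox y [k yk].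
  have [t Ft] : exists t, F (snoc (y, t)).
    apply: contrapT => nF.
    have := @itv0_pos R k.+1%:R^-1; rewrite invr_gt0 => /(_ (ltr0Sn _ _)).
    rewrite -yk (_ : _ `\` _ = `]0, k.+1%:R^-1[%classic) ?ltxx//.
    by apply/seteqP; split => [t []//|t tk]; split => // Ft; apply: nF; exists t.
  move=> i; have := Fbox _ Ft (lift ord_max i); rewrite mxE liftK/= !in_itv/=.
  by move=> /andP[-> /ltW yM]/=; lra.
exists E; split => // F fF E0F; apply: (@le_trans _ _ (inf S)); last first.
  by apply: ge_inf; [exists 0 => e; exact: S0|exists F].
apply/ler_addgt0Pr => e e0; have e2 : 0 < e / 2 by rewrite divr_gt0.
have [d d0 Hd] := energy_lsc mb bk1 fE mB Boo (trB _ mE Ebox) e2.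
have [K HK] := ltr_add_invr e2; rewrite add0r in HK.
have [k Kk Hk] := Econv d K d0; have [_ _ boxk ek] := HE k.
have [mEk _ _ _] := fE_ k.
have := Hd _ (fE_ k) (trB _ mEk boxk) Hk.
have kK : k.+1%:R^-1 <= K.+1%:R^-1 :> R by rewrite lef_pV2 ?posrE// ler_nat ltnS.
move: HK kK ek; move: (K.+1%:R^-1) (k.+1%:R^-1) (energy b E) (energy b (E_ k)) (inf S) => p q r s t.
lra.
Qed.

End existence.

(** * Bounds on minimizers *)

Section radius_bound.
Variables (R : realType) (n : nat).
Local Notation mu := (lebesgue R n.+1).
Local Notation l := (lebesgue R n).
Local Notation Om := (@halfspace R n).
Local Notation m := n.+1.

Lemma expr_sub_le (W x : R) : 0 <= W -> 0 <= x ->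
  (W + x) ^+ m <= W ^+ m + m%:R * x * (W + x) ^+ n.
Proof.
move=> W0 x0; elim: n => [|k IH]; first by rewrite !expr1 expr0 mulr1 mul1r.
have Wx : 0 <= W + x by rewrite addr_ge0.
rewrite exprS (@le_trans _ _ ((W + x) * (W ^+ k.+1 + k.+1%:R * x * (W + x) ^+ k)))//.
  exact: ler_wpM2l.
rewrite [(W + x) ^+ k.+1]exprS [W ^+ k.+2]exprS -[k.+2]addn1 natrD.
have H : W ^+ k.+1 <= (W + x) ^+ k.+1 by apply: lerXn2r; rewrite ?nnegrE// lerDl.
have Hx : x * W ^+ k.+1 <= x * ((W + x) * (W + x) ^+ k) by apply: ler_wpM2l => //; rewrite -exprS.
move: Hx; move: (W ^+ k.+1) ((W + x) ^+ k) (k.+1%:R) => p q r Hx.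
rewrite (_ : (W + x) * (p + r * x * q) = W * p + (x * p + r * x * ((W + x) * q))); last by ring.
rewrite lerD2l (_ : (r + 1) * x * ((W + x) * q) = x * ((W + x) * q) + r * x * ((W + x) * q)); last by ring.
by rewrite lerD2r.
Qed.

Lemma shift_le (p1 p2 p3 p4 : R) : p1 + p3 < p2 -> p1 + p4 <= p2 + (p4 - p3).
Proof. by move=> ?; lra. Qed.

Lemma cvg_exprn (u : nat -> R) (c : R) p : u k @[k --> \oo] --> c ->
  u k ^+ p @[k --> \oo] --> c ^+ p.
Proof.
move=> H; elim: p => [|p IH]; first exact: cvg_cst.
rewrite exprS (_ : (fun k => u k ^+ p.+1) = (fun k => u k * u k ^+ p)).
  by apply: cvgM; [exact: H|exact: IH].
by apply/funext => k; rewrite exprS.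
Qed.

Variables (b : 'rV[R]_n -> R) (kappa : R).
Hypothesis mb : measurable_fun setT b.
Hypothesis kappa0 : 0 < kappa.
Hypothesis kappa1 : kappa <= 1 / 2.
Hypothesis bk : forall y, -1 <= b y <= 1 - 2 * kappa.
Variables (E0 E : set 'rV[R]_n.+1).
Hypothesis minE : energy_minimal b E0 E.
Variable w : 'rV[R]_n.+1.
Hypothesis w1 : \sum_i w 0 i ^+ 2 = 1.
Implicit Types (r a c : R) (k : nat).

Let fE : finite_perimeter Om E. Proof. by case: minE. Qed.
Let mE : measurable E. Proof. by case: fE. Qed.
Let Eoo : (mu E < +oo)%E. Proof. by case: fE. Qed.
Let b1 := bk1 kappa0 bk.
Let w1' : \sum_i w 0 i ^+ 2 <= 1. Proof. by rewrite w1. Qed.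

Definition tail r : R := fine (mu (E `\` side w r)).
(** The side of the cube with the volume of the tail. In this variable the isoperimetric
    differential inequality becomes linear decay. *)
Definition tail_radius r : R := tail r `^ (m%:R^-1).

Lemma measurable_tail r : measurable (E `\` side w r).
Proof. by apply: measurableD => //; exact: measurable_side. Qed.

Lemma tail_lty r : (mu (E `\` side w r) < +oo)%E.
Proof. exact: mu_lty (measurable_tail r) mE (@subDsetl _ _ _) Eoo. Qed.

Lemma tailE r : (tail r)%:E = mu (E `\` side w r).
Proof. by rewrite /tail (finite_muK (tail_lty r)). Qed.

Lemma tail_ge0 r : 0 <= tail r. Proof. exact: fine_ge0. Qed.

Lemma tail_radius_ge0 r : 0 <= tail_radius r. Proof. exact: powR_ge0. Qed.

Lemma root_pow (x : R) : 0 <= x -> (x `^ (m%:R^-1)) ^+ m = x.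
Proof. by move=> x0; rewrite -powR_mulrn ?powR_ge0// -powRrM mulVf// powRr1. Qed.

Lemma tail_radiusX r : tail_radius r ^+ m = tail r.
Proof. exact: root_pow (tail_ge0 r). Qed.

Lemma tail_mono r r' : r <= r' -> tail_radius r' <= tail_radius r.
Proof.
move=> rr'; apply: ge0_ler_powR; [by rewrite invr_ge0|by rewrite nnegrE tail_ge0|by rewrite nnegrE tail_ge0|].
rewrite -lee_fin !tailE.
apply: le_mu; [exact: measurable_tail|exact: measurable_tail|].
by move=> x [Ex xr']; split => // xr; apply: xr'; exact: lt_le_trans rr'.
Qed.

(** Chosen so that 4 m (m [decay_rate]) (6 / 5) is 24 / 25 of [kappa]: one m from the isoperimetric
    inequality, one from differentiating a power m, 4 from [splitting], and 6 / 5 as a margin for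
    slabs of positive thickness. *)
Definition decay_rate : R := kappa / (5 * m%:R ^+ 2).

Lemma decay_rate_gt0 : 0 < decay_rate.
Proof. by rewrite divr_gt0// mulr_gt0// exprn_gt0. Qed.

(** Otherwise the slabs just before r are so light that, the inner part being a competitor, the part
    beyond r has energy at most 4 q and perimeter at most 4 q / kappa, too little for its volume. *)
Lemma tail_decrease r (N : nat) : E0 `<=` side w r -> 0 < tail_radius r ->
  exists2 k, (N <= k)%N &
    tail_radius r + decay_rate * k.+1%:R^-1 < tail_radius (r - k.+1%:R^-1).
Proof.
move=> E0r W0; apply: contrapT => nH.
have H k : (N <= k)%N -> tail_radius (r - k.+1%:R^-1) <= tail_radius r + decay_rate * k.+1%:R^-1.
  by move=> Nk; rewrite leNgt; apply/negP => lt; apply: nH; exists k.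
have d0 := decay_rate_gt0.
set W := tail_radius r in W0 H *; pose q := m%:R * decay_rate * (6 / 5 * W ^+ n).
have q0 : 0 <= q by rewrite !mulr_ge0// ?exprn_ge0// ltW.
have cW : (W + decay_rate * k.+1%:R^-1) ^+ n @[k --> \oo] --> (W ^+ n : R).
  have h0 : j.+1%:R^-1 @[j --> \oo] --> (0 : R) by exact: cvg_harmonic.
  have h1 : W + decay_rate * j.+1%:R^-1 @[j --> \oo] --> (W : R).
    have := cvgD (cvg_cst (W : R^o)) (cvgM (cvg_cst (decay_rate : R^o)) h0).
    by rewrite mulr0 addr0; exact.
  exact: (@cvg_exprn (fun k => W + decay_rate * k.+1%:R^-1)).
have near_q : \forall k \near \oo, fine (mu (E `&` [set x | r - k.+1%:R^-1 < lin w x < r])) <= q / k.+1%:R.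
  have Wn0 : 0 < 1 / 5 * W ^+ n by rewrite mulr_gt0// exprn_gt0.
  have /cvgrPdist_lt/(_ _ Wn0) := cW.
  move=> [N' _ HN']; exists (maxn N N') => // k /=; rewrite geq_max => /andP[Nk N'k].
  have := HN' k N'k; rewrite /= distrC => /(le_lt_trans (ler_norm _)) HW.
  set x := k.+1%:R^-1 in HW *; have x0 : 0 < x by rewrite invr_gt0.
  pose S := [set z : 'rV[R]_n.+1 | r - x < lin w z < r].
  have mS : measurable (E `&` S).
    apply: measurableI => //; rewrite (_ : S = setT `&` lin w @^-1` `]r - x, r[).
      by apply: continuous_measurable_lin => //; exact: measurable_itv.
    by rewrite setTI; apply/seteqP; split => z; rewrite /S/= in_itv.
  have Soo := mu_lty mS mE (@subIsetl _ _ _) Eoo.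
  have sumle : fine (mu (E `&` S)) + tail r <= tail (r - x).
    rewrite -lee_fin EFinD (finite_muK Soo) (tailE r) (tailE (r - x)).
    have disj : (E `&` S) `&` (E `\` side w r) = set0.
      by apply/seteqP; split => // z [[Ez /andP[z1 z2]] [_]]; rewrite /side/= z2.
    have U : mu ((E `&` S) `|` (E `\` side w r)) = (mu (E `&` S) + mu (E `\` side w r))%E.
      by apply: measureU => //; exact: measurable_tail.
    rewrite -U; apply: le_mu.
    - by apply: measurableU => //; exact: measurable_tail.
    - exact: measurable_tail.
    - move=> z [[Ez /andP[z1 z2]]|[Ez zr]]; split => //; rewrite /side/=.
        by move=> z3; have := lt_trans z1 z3; rewrite ltxx.
      by move=> z3; apply: zr; apply: (lt_trans z3); rewrite gtrBl.
  have H1 : tail (r - x) <= (W + decay_rate * x) ^+ m.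
    rewrite -tail_radiusX; apply: lerXn2r; rewrite ?nnegrE ?tail_radius_ge0 ?H//.
    by rewrite addr_ge0 ?mulr_ge0 ?ltW.
  have dx0 : 0 <= decay_rate * x by rewrite mulr_ge0 ?ltW.
  have := expr_sub_le (ltW W0) dx0.
  rewrite -{1}/W tail_radiusX => H2.
  have H3 : m%:R * (decay_rate * x) * (W + decay_rate * x) ^+ n <= m%:R * (decay_rate * x) * (6 / 5 * W ^+ n).
    apply: ler_wpM2l; first by rewrite mulr_ge0.
    by move: HW; move: ((W + _) ^+ n) (W ^+ n) => u v ?; lra.
  rewrite /q (_ : _ / k.+1%:R = m%:R * (decay_rate * x) * (6 / 5 * W ^+ n)); last by rewrite -/x; ring.
  rewrite -(lerD2r (tail r)); apply: (le_trans sumle); apply: (le_trans H1); apply: (le_trans H2).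
  by rewrite addrC lerD2r.
have [fEK fED eKD] := splitting w1' mb b1 fE q0 near_q.
have [_ E0E Emin] := minE.
have eE : energy b E <= energy b (E `&` side w r).
  by apply: Emin => // x E0x; split; [exact: E0E|exact: E0r].
have eD : energy b (E `\` side w r) <= 4 * q.
  by move: eKD eE; move: (energy b _) (energy b _) (energy b _) => p1 p2 p3; lra.
have [fT PT] := whole_perimeter_le mb kappa0 kappa1 bk fED.
have muW : mu (E `\` side w r) = (W ^+ m)%:E by rewrite tail_radiusX /tail fineK// ge0_fin_numE ?tail_lty.
have := isoperimetric (ltn0Sn n) fT W0 muW; rewrite /=.
have Wn0 : 0 < W ^+ n by rewrite exprn_gt0.
have qE : kappa * (24 / 25 * W ^+ n) = m%:R * (4 * q).
  by rewrite /q /decay_rate; field; rewrite gt_eqF.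
have m0 : 0 < m%:R :> R by [].
apply/negP; rewrite -ltNge -(ltr_pM2l kappa0).
apply: (@le_lt_trans _ _ (kappa * (24 / 25 * W ^+ n))); last by rewrite ltr_pM2l//; lra.
rewrite qE mulrCA; apply: ler_wpM2l; first exact: ltW.
exact: le_trans eD.
Qed.

(** [tail_decrease] gives only discrete steps back from each r. So take the leftmost r where [g],
    the tail radius plus [decay_rate] times r, is at least its value at a + c: it must be a, since a
    step back would lead further left. Comparing a with a + c then shows a loss of at least
    [decay_rate] times c. *)
Lemma tail_vanishes a c : E0 `<=` side w a -> 0 <= c -> tail_radius a <= decay_rate * c ->
  tail_radius (a + c) = 0.
Proof.
move=> E0a c0 Wa; apply/eqP; rewrite eq_le tail_radius_ge0 andbT leNgt; apply/negP => Wc.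
have d0 := decay_rate_gt0.
pose g r := tail_radius r + decay_rate * r.
pose S := [set r | a <= r <= a + c /\ g (a + c) <= g r].
have Sac : S (a + c) by rewrite /S/= lexx lerDl c0.
have infS : has_inf S by split; [exists (a + c)|exists a => r [/andP[]]].
have lbS : has_lbound S by case: infS.
pose sg := inf S.
have asg : a <= sg by apply: lb_le_inf => //; [exists (a + c)|move=> r [/andP[]]].
have sgac : sg <= a + c by exact: ge_inf.
(* The infimum belongs to [S] because [tail_radius] is nonincreasing. *)
have gsg : g (a + c) <= g sg.
  apply/ler_addgt0Pr => e e0; have ed : 0 < e / decay_rate by rewrite divr_gt0.
  have [r Sr rlt] := inf_adherent ed infS; have [_ gr] := Sr.
  have sgr : sg <= r by exact: ge_inf.
  apply: (le_trans gr); rewrite /g -addrA; apply: lerD; first exact: tail_mono.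
  have -> : decay_rate * sg + e = decay_rate * (sg + e / decay_rate).
    by rewrite mulrDr [_ * (e / _)]mulrC divfK ?gt_eqF.
  by apply: ler_wpM2l; [exact: ltW|exact: ltW].
have [sga|] := ltP a sg.
  have ds : 0 < sg - a by rewrite subr_gt0.
  have [N HN] := ltr_add_invr ds; rewrite add0r in HN.
  have E0sg : E0 `<=` side w sg by move=> x /E0a /lt_le_trans; apply.
  have Wsg : 0 < tail_radius sg by apply: (lt_le_trans Wc); exact: tail_mono.
  have [k Nk Hk] := tail_decrease N E0sg Wsg.
  set x := k.+1%:R^-1 in Hk; have x0 : 0 < x by rewrite invr_gt0.
  have xN : x <= N.+1%:R^-1 by rewrite lef_pV2 ?posrE// ler_nat ltnS.
  have : S (sg - x).
    split; first by apply/andP; split; [rewrite lerBrDr addrC -lerBrDr ltW// (le_lt_trans xN)|apply: le_trans sgac; rewrite gerBl ltW].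
    by apply: (le_trans gsg); rewrite /g mulrBr; exact: (shift_le _ Hk).
  by move/(ge_inf lbS); rewrite -/sg lerBrDr gerDl leNgt x0.
move=> sga; have sgE : sg = a by apply: le_anti; rewrite sga.
move: gsg; rewrite sgE /g mulrDr; move: Wa Wc.
move: (tail_radius _) (tail_radius _) (decay_rate * a) (decay_rate * c) => p1 p2 p3 p4; lra.
Qed.

(** Coercivity, minimality and [energy_le_perimeter] bound [kappa] times the perimeter of [E] by the
    perimeter of [E0]; the isoperimetric inequality for the whole of [E] does the rest. *)
Lemma tail_radius_le a : (0 < n)%N -> finite_perimeter Om E0 ->
  tail_radius a ^+ n <= m%:R * (Per setT E0 / kappa).
Proof.
move=> n0 fE0; have [_ E0E Emin] := minE.
have [fT PT] := whole_perimeter_le mb kappa0 kappa1 bk fE.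
have P0 := Per_ge0 (finite_perimeter_whole fE0).1.
have e0 : energy b E <= Per setT E0.
  by apply: le_trans (Emin _ fE0 (@subset_refl _ _)) _; exact: energy_le_perimeter mb b1 _ fE0.
pose We := fine (mu E) `^ (m%:R^-1).
have WeX : We ^+ m = fine (mu E) by apply: root_pow; exact: fine_ge0.
have WWe : tail_radius a <= We.
  apply: ge0_ler_powR; [by rewrite invr_ge0|by rewrite nnegrE tail_ge0|by rewrite nnegrE fine_ge0|].
  rewrite -lee_fin tailE (finite_muK Eoo).
  by apply: le_mu; [exact: measurable_tail|exact: mE|exact: subDsetl].
apply: (@le_trans _ _ (We ^+ n)); first by apply: lerXn2r; [rewrite nnegrE tail_radius_ge0|rewrite nnegrE powR_ge0|exact: WWe].
have [We0|We0] := ltP 0 We.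
  have muE : mu E = (We ^+ m)%:E by rewrite WeX fineK// ge0_fin_numE.
  apply: (le_trans (isoperimetric (ltn0Sn n) fT We0 muE)); apply: ler_wpM2l => //.
  by rewrite ler_pdivlMr// mulrC; exact: le_trans e0.
have -> : We = 0 by apply: le_anti; rewrite We0 powR_ge0.
by rewrite expr0n eqn0Ngt n0 mulr_ge0// divr_ge0// ltW.
Qed.

End radius_bound.

(** * Arithmetic of the radius *)

Section radius_arithmetic.
Variable R : realType.

Lemma cube_le_expn (n : nat) : (2 <= n)%N -> (5 * n.+1 ^ 3 <= 4 * 8 ^ n)%N.
Proof.
elim: n => // n IH; rewrite leq_eqVlt => /orP[/eqP <-//|n2].
apply: (@leq_trans (8 * (5 * n.+1 ^ 3))%N); last first.
  by rewrite (expnS 8 n) [X in (_ <= X)%N]mulnCA leq_mul2l/=; exact: IH.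
rewrite mulnCA leq_mul2l/= (_ : (8 * n.+1 ^ 3 = (2 * n.+1) ^ 3)%N); last by rewrite expnMn.
by rewrite leq_exp2r// mul2n -addnn addSn addnS !ltnS leq_addr.
Qed.

(** For n >= 2 the factors are compared separately through 5 (n+1)^3 <= 4 8^n. That inequality fails
    for n = 1, where the claim reads 400 <= 512. *)
Lemma radius_constant (n : nat) : (0 < n)%N ->
  5 * n.+1%:R ^+ 3 * (5 * n.+1%:R ^+ 3 / 4) ^+ n <= 8 ^+ (n ^ 2 + n + 1) :> R.
Proof.
case: n => // -[_|n _].
  by rewrite expr1 /= (_ : (1 ^ 2 + 1 + 1 = 3)%N)//; lra.
set k := n.+2; have H : 5 * k.+1%:R ^+ 3 <= 4 * 8 ^+ k :> R.
  by rewrite -!natrX -!natrM ler_nat; exact: cube_le_expn.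
have p0 : 0 <= 5 * k.+1%:R ^+ 3 :> R by rewrite mulr_ge0// exprn_ge0.
have e0 : 0 <= 8 ^+ k :> R by rewrite exprn_ge0.
rewrite !exprD expr1 -[leRHS]mulrA [leRHS]mulrC; apply: ler_pM => //.
- by move: H e0; move: (8 ^+ k) (5 * _) => u v ? ?; lra.
- rewrite (_ : (k ^ 2 = k * k)%N)// exprM; apply: lerXn2r; rewrite ?nnegrE ?divr_ge0//.
  by rewrite ler_pdivrMr//; move: H; move: (8 ^+ k) (5 * _) => u v ?; lra.
Qed.

(** With t^n = X and y^n = 1/kappa + 2 one has W <= (n+1) t and kappa y^n >= 1, so it remains to
    bound 5 (n+1)^3 t by kappa times the maximum. If y <= (5 (n+1)^3 / 4) t, multiplying by kappa
    y^n >= 1 leads to the first term; otherwise 5 (n+1)^3 t < 4 y <= 4 kappa y^(n+1), the second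
    term. *)
Lemma radius_le (n : nat) (W X kappa : R) : (0 < n)%N -> 0 < kappa -> 0 <= W -> 0 <= X ->
  W ^+ n <= n.+1%:R * X ->
  W <= kappa / (5 * n.+1%:R ^+ 2) * Num.max (8 ^+ (n ^ 2 + n + 1) * X `^ (n.+1%:R / n%:R))
    (4 * mu_const n kappa).
Proof.
move=> n0 k0 W0 X0 HW.
have nn0 : n%:R != 0 :> R by rewrite pnatr_eq0 -lt0n.
have root (Z : R) : 0 <= Z -> exists t, [/\ 0 <= t, t ^+ n = Z & Z `^ (n.+1%:R / n%:R) = t ^+ n.+1].
  move=> Z0; exists (Z `^ n%:R^-1); split; first exact: powR_ge0.
    by rewrite -powR_mulrn ?powR_ge0// -powRrM mulVf// powRr1.
  by rewrite -powR_mulrn ?powR_ge0// -powRrM mulrC.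
have [t [t0 tX ->]] := root X X0.
have Z0 : 0 <= kappa^-1 + 2 by rewrite addr_ge0// invr_ge0 ltW.
have [y [y0 yX yE]] := root _ Z0; rewrite /mu_const yE.
have ky : 1 <= kappa * y ^+ n.
  by rewrite yX mulrDr mulfV ?gt_eqF// lerDl mulr_ge0// ltW.
pose m : R := n.+1%:R; have m1 : 1 <= m by rewrite ler1n.
have Wt : W <= m * t.
  have m0 : 0 <= m by exact: le_trans ler01 m1.
  have mt0 : 0 <= m * t by exact: mulr_ge0.
  rewrite -(@ler_pXn2r _ n n0) ?nnegrE//.
  apply: (le_trans HW); rewrite -tX exprMn; apply: ler_wpM2r; first exact: exprn_ge0.
  exact: ler_eXnr.
set Mx := Num.max _ _; rewrite mulrAC ler_pdivlMr; last by rewrite mulr_gt0// exprn_gt0.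
apply: (@le_trans _ _ (5 * m ^+ 3 * t)).
  rewrite (_ : 5 * m ^+ 3 * t = m * t * (5 * m ^+ 2)); last by ring.
  by apply: ler_wpM2r => //; rewrite mulr_ge0// exprn_ge0.
have c0 : 0 <= 5 * m ^+ 3 by rewrite mulr_ge0// exprn_ge0// (le_trans ler01).
have [yt|ty] := leP y (5 * m ^+ 3 / 4 * t).
  apply: (@le_trans _ _ (kappa * (8 ^+ (n ^ 2 + n + 1) * t ^+ n.+1))); last first.
    by apply: ler_wpM2l; [exact: ltW|rewrite le_max lexx].
  apply: (@le_trans _ _ (kappa * (5 * m ^+ 3 * (5 * m ^+ 3 / 4) ^+ n * t ^+ n.+1))); last first.
    apply: ler_wpM2l; first exact: ltW.
    by apply: ler_wpM2r; [exact: exprn_ge0|exact: radius_constant].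
  have H : y ^+ n <= (5 * m ^+ 3 / 4) ^+ n * t ^+ n.
    rewrite -exprMn; apply: lerXn2r => //; rewrite nnegrE; exact: le_trans yt.
  have H2 : 1 <= kappa * ((5 * m ^+ 3 / 4) ^+ n * t ^+ n).
    by apply: (le_trans ky); apply: ler_wpM2l => //; exact: ltW.
  rewrite [t ^+ n.+1]exprS; have ct : 0 <= 5 * m ^+ 3 * t by rewrite mulr_ge0.
  rewrite [leRHS](_ : _ = 5 * m ^+ 3 * t * (kappa * ((5 * m ^+ 3 / 4) ^+ n * t ^+ n))); last by ring.
  by rewrite ler_peMr.
apply: (@le_trans _ _ (kappa * (4 * y ^+ n.+1))); last first.
  by apply: ler_wpM2l; [exact: ltW|rewrite le_max lexx orbT].
rewrite [y ^+ n.+1]exprS (_ : kappa * _ = 4 * y * (kappa * y ^+ n)); last by ring.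
apply: (@le_trans _ _ (4 * y)); last by rewrite ler_peMr// mulr_ge0.
by move: ty; move: (5 * m ^+ 3) => u; lra.
Qed.

End radius_arithmetic.

(** * Height of a minimizer *)

Section height_bound.
Variables (R : realType) (n : nat).
Local Notation mu := (lebesgue R n.+1).
Local Notation Om := (@halfspace R n).
Local Notation e_v := (delta_mx 0 ord_max : 'rV[R]_n.+1).
Local Notation e_h j := (delta_mx 0 (lift ord_max j) : 'rV[R]_n.+1).
Variables (b : 'rV[R]_n -> R) (kappa : R).
Hypothesis mb : measurable_fun setT b.
Hypothesis kappa0 : 0 < kappa.
Hypothesis kappa1 : kappa <= 1 / 2.
Hypothesis bk : forall y, -1 <= b y <= 1 - 2 * kappa.
Variables (E0 E : set 'rV[R]_n.+1).
Hypothesis minE : energy_minimal b E0 E.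
Variables (h rho : R).
Hypothesis n0 : (0 < n)%N.
Hypothesis h0 : 0 <= h.
Hypothesis rho0 : 0 < rho.
Hypothesis E0h : E0 `<=` side e_v h.
Hypothesis Erho : forall x, E x -> forall j : 'I_n, `|x 0 (lift ord_max j)| <= rho.

(** Small enough that, after the common factor eps zeta, the loss 2 eps n times the slope 2 from the
    vertical component is at most half of the horizontal gain n / (4 rho). *)
Let eps : R := (32 * (rho + 1) * n%:R)^-1.
Let zeta (x : 'rV[R]_n.+1) : R := step (1 * lin e_v x + - h).
Let dzeta (i : 'I_n.+1) (x : 'rV[R]_n.+1) : R := dstep (1 * lin e_v x + - h) * (1 * e_v 0 i).
(** On [E] the argument of the spline stays in [1/4, 3/4], where its slope is at least 1; this is
    why a horizontal bound on [E] must come first. *)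
Let tau (j : 'I_n) (x : 'rV[R]_n.+1) : R := step ((4 * rho)^-1 * lin (e_h j) x + 2^-1).
Let dtau (j : 'I_n) (i : 'I_n.+1) (x : 'rV[R]_n.+1) : R :=
  dstep ((4 * rho)^-1 * lin (e_h j) x + 2^-1) * ((4 * rho)^-1 * e_h j 0 i).
(** The squares of the horizontal components sum to at most [A] zeta^2; the vertical component is
    lowered by this amount to restore the unit bound. *)
Let A : R := eps ^+ 2 * n%:R.

(* Equals the vertical unit vector up to height [h], and has positive divergence
   above [h] on [E]. *)
Let G (i : 'I_n.+1) (x : 'rV[R]_n.+1) : R := match unlift ord_max i with
  | Some j => cst eps x * (zeta x * tau j x)
  | None => cst 1 x + cst (- A) x * (zeta x * zeta x) end.
Let dG (i k : 'I_n.+1) (x : 'rV[R]_n.+1) : R := match unlift ord_max i with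
  | Some j => cst eps x * (zeta x * dtau j k x + tau j x * dzeta k x) + zeta x * tau j x * cst 0 x
  | None => cst 0 x + (cst (- A) x * (zeta x * dzeta k x + zeta x * dzeta k x) + zeta x * zeta x * cst 0 x)
  end.

Let eps_gt0 : 0 < eps.
Proof. by rewrite invr_gt0 !mulr_gt0 ?ltr0n// ltr_wpDl// ltW. Qed.

Let eps_n : eps * n%:R * (32 * (rho + 1)) = 1.
Proof.
rewrite /eps; have n1 : n%:R != 0 :> R by rewrite pnatr_eq0 -lt0n.
by field; rewrite n1 gt_eqF// ltr_wpDl// ltW.
Qed.

Let A01 : 0 <= A <= 1.
Proof.
rewrite /A; have n1 : 1 <= n%:R :> R by rewrite ler1n.
have := eps_n; have := eps_gt0; move: rho0 n1; move: eps (n%:R) => e N r0 N1 e0 H.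
have eN0 : 0 <= e * N by nra.
have eN : e * N <= 1 by nra.
have e1 : e <= 1 by nra.
by apply/andP; split; nra.
Qed.

Let zeta01 x : 0 <= zeta x <= 1. Proof. by rewrite step_ge0 step_le1. Qed.
Let tau01 j x : 0 <= tau j x <= 1. Proof. by rewrite step_ge0 step_le1. Qed.

Let C1G : C1field G dG.
Proof.
have zc : C1 zeta dzeta by exact: C1_step.
have tc j : C1 (tau j) (dtau j) by exact: C1_step.
move=> i; rewrite /G /dG; case: (unlift ord_max i) => [j|].
  exact: C1M (C1_cst _ eps) (C1M zc (tc j)).
exact: C1D (C1_cst _ 1) (C1M (C1_cst _ (- A)) (C1M zc zc)).
Qed.

Let G_lift j x : G (lift ord_max j) x = eps * (zeta x * tau j x).
Proof. by rewrite /G liftK. Qed.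

Let G_max x : G ord_max x = 1 - A * (zeta x * zeta x).
Proof. by rewrite /G unlift_none/= mulNr. Qed.

Let unitG : unit_bounded G.
Proof.
move=> x; rewrite sum_lift G_max.
have H : \sum_(j < n) G (lift ord_max j) x ^+ 2 <= A * (zeta x * zeta x).
  apply: (@le_trans _ _ (\sum_(j < n) eps ^+ 2 * (zeta x * zeta x))).
    apply: ler_sum => j _; rewrite G_lift exprMn; apply: ler_wpM2l; first exact: sqr_ge0.
    have := tau01 j x; have := zeta01 x; move: (zeta x) (tau j x) => z t /andP[? ?] /andP[? ?].
    by rewrite exprMn expr2 -[leRHS]mulr1; apply: ler_wpM2l; [exact: mulr_ge0|nra].
  by rewrite sumr_const card_ord -[_ *+ n]mulr_natr /A mulrAC.
have := zeta01 x; have := A01; move: H; move: (\sum_(j < n) _) (zeta x) A => s z a H /andP[a0 a1] /andP[z0 z1].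
have zz : 0 <= z * z <= 1 by apply/andP; split; nra.
move: zz H; move: (z * z) => q /andP[q0 q1] H.
(* With v = A zeta^2 in [0, 1], the squared norm is at most v + (1 - v)^2 <= 1. *)
have : 0 <= a * q <= 1 by apply/andP; split; nra.
by move: H; move: (a * q) => v H /andP[v0 v1]; nra.
Qed.

Let diveG x : dive dG x = eps * zeta x *
  ((4 * rho)^-1 * (\sum_(j < n) dstep ((4 * rho)^-1 * x 0 (lift ord_max j) + 2^-1))
    - 2 * eps * n%:R * dstep (height x - h)).
Proof.
rewrite /dive sum_lift mulrBr; congr (_ + _).
  rewrite !mulr_sumr; apply: eq_bigr => j _; rewrite /dG liftK /dtau /dzeta !lin_e !mxE !eqxx/= lift_eqF.
  by rewrite /= !mulr0 !addr0 mulr1; ring.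
rewrite /dG unlift_none/= /dzeta lin_e !mxE !eqxx/= /A !mul1r mulr1 mulr0 addr0 add0r.
by rewrite -/(height x); ring.
Qed.

Let diveG_bounded : exists M : R, forall x, `|dive dG x| <= M.
Proof.
exists (eps * 1 * ((4 * rho)^-1 * (n%:R * 2) + 2 * eps * n%:R * 2)) => x; rewrite diveG.
have e0 := ltW eps_gt0; have r0 : 0 <= (4 * rho)^-1 by rewrite invr_ge0 mulr_ge0// ltW.
rewrite normrM; apply: ler_pM => //.
  rewrite normrM (ger0_norm e0); apply: ler_wpM2l => //.
  by have /andP[z0 z1] := zeta01 x; rewrite ger0_norm.
apply: (le_trans (ler_normB _ _)); apply: lerD.
  rewrite normrM (ger0_norm r0); apply: ler_wpM2l => //; apply: (le_trans (ler_norm_sum _ _ _)).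
  apply: (@le_trans _ _ (\sum_(j < n) 2)); first by apply: ler_sum => j _; exact: normr_dstep.
  by rewrite sumr_const card_ord -[_ *+ n]mulr_natl.
have c0 : 0 <= 2 * eps * n%:R by rewrite !mulr_ge0.
by rewrite normrM (ger0_norm c0); apply: ler_wpM2l => //; exact: normr_dstep.
Qed.

Let diveG_ge x : E x -> eps * zeta x * (n%:R * (8 * rho)^-1) <= dive dG x.
Proof.
move=> Ex; rewrite diveG; have e0 := ltW eps_gt0; have /andP[z0 _] := zeta01 x.
apply: ler_wpM2l; first exact: mulr_ge0.
have r0 : 0 < 4 * rho by rewrite mulr_gt0.
have H : n%:R <= \sum_(j < n) dstep ((4 * rho)^-1 * x 0 (lift ord_max j) + 2^-1).
  apply: (@le_trans _ _ (\sum_(j < n) 1)); first by rewrite sumr_const card_ord.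
  apply: ler_sum => j _; apply: dstep_mid.
  have := Erho Ex j; rewrite ler_norml => /andP[x1 x2].
  have : - (1 / 4) <= (4 * rho)^-1 * x 0 (lift ord_max j) <= 1 / 4.
    rewrite [_^-1 * _]mulrC ler_pdivlMr// ler_pdivrMr//; apply/andP; split; lra.
  by move: (_^-1 * _) => u /andP[? ?]; apply/andP; split; lra.
have d2 := dstep_le2 (height x - h).
have eN : 2 * eps * n%:R * dstep (height x - h) <= n%:R * (8 * rho)^-1.
  have e2 : 0 <= 2 * eps * n%:R by rewrite !mulr_ge0.
  apply: (@le_trans _ _ (2 * eps * n%:R * 2)); first exact: ler_wpM2l.
  rewrite ler_pdivlMr ?mulr_gt0//; apply: (@le_trans _ _ 1); last by rewrite ler1n.
  have u0 : 0 <= eps * n%:R by exact: mulr_ge0.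
  have := eps_n; rewrite -[2 * eps * n%:R]mulrA; move: (eps * n%:R) u0 => u u0 Hu.
  by move: rho0 => ?; nra.
apply: (@le_trans _ _ ((4 * rho)^-1 * n%:R - n%:R * (8 * rho)^-1)).
  rewrite le_eqVlt; apply/orP; left; apply/eqP; field; rewrite gt_eqF//.
by apply: lerB => //; apply: ler_wpM2l => //; rewrite invr_ge0 ltW.
Qed.

Lemma height_null : mu (E `&` [set x | h < height x]) = 0%E.
Proof.
have [fE E0E Emin] := minE; have [mE EOm Eoo _] := fE.
have ev1 := @e_v_unit R n.
have ev1' : \sum_i e_v 0 i ^+ 2 <= 1 by rewrite ev1.
have aG : admissible G dG by split; [exact: C1G|exact: unitG|exact: diveG_bounded].
have zeta0 x : lin e_v x <= h -> zeta x = 0 by move=> H; rewrite /zeta step0// mul1r subr_le0.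
have Gnu i x : lin e_v x <= h -> G i x = e_v 0 i.
  move=> /zeta0 z0; case: (unliftP ord_max i) => [j ->|->].
    by rewrite G_lift z0 mul0r mulr0 mxE lift_eqF.
  by rewrite G_max z0 mulr0 mulr0 subr0 mxE !eqxx.
have bG y : b y <= G ord_max (boundary_point y).
  rewrite Gnu; last by rewrite lin_e -/(height _) height_boundary.
  by rewrite mxE !eqxx/=; have /andP[] := bk1 kappa0 bk y.
have [fK eK] := truncation ev1' mb (bk1 kappa0 bk) fE aG ev1 Gnu bG.
have E0K : E0 `<=` E `&` side e_v h by move=> x E0x; split; [exact: E0E|exact: E0h].
(* Minimality turns the gain in [truncation] into the upper bound 0, while the integrand is
   nonnegative on [E], so it vanishes almost everywhere beyond the hyperplane. *)
have I0 : \int[mu]_(x in E `\` side e_v h) dive dG x <= 0.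
  by have := Emin _ fK E0K; move: eK; move: (energy _ _) (energy _ _) => u v; lra.
have mS := measurable_side e_v h; have mD := measurableD mE mS.
have Doo := mu_lty mD mE (@subDsetl _ E (side e_v h)) Eoo.
have f0 x : (E `\` side e_v h) x -> 0 <= dive dG x.
  move=> [Ex _]; apply: le_trans (diveG_ge Ex); have /andP[z0 _] := zeta01 x.
  apply: mulr_ge0; first exact: mulr_ge0 (ltW eps_gt0) z0.
  by rewrite divr_ge0// mulr_ge0// ltW.
have md := measurable_dive C1G.
have [M HM] := diveG_bounded.
have iD : mu.-integrable (E `\` side e_v h) (EFin \o dive dG).
  by apply: (@bounded_integrable _ _ _ _ _ _ M).
have I00 : \int[mu]_(x in E `\` side e_v h) dive dG x = 0.
  by apply: le_anti; rewrite I0 Rintegral_ge0.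
have Iabs : (\int[mu]_(x in E `\` side e_v h) `|(EFin \o dive dG) x| = 0)%E.
  transitivity (\int[mu]_(x in E `\` side e_v h) (dive dG x)%:E)%E.
    by apply: eq_integral => x /set_mem Dx; rewrite /= ger0_norm// f0.
  rewrite -[LHS]fineK; last exact: integrable_fin_num.
  by congr (_%:E); exact: I00.
have mf : measurable_fun (E `\` side e_v h) (EFin \o dive dG).
  by apply: measurable_funTS; exact/measurable_EFinP.
have [N [mN N0 HN]] := (ae_eq_integral_abs mu mD mf).1 Iabs.
have mU : measurable [set x : 'rV[R]_n.+1 | h < height x].
  rewrite (_ : [set _ | _] = setT `&` @height R n @^-1` `]h, +oo[).
    by apply: measurable_height => //; exact: measurable_itv.
  by rewrite setTI; apply/seteqP; split => x; rewrite /= in_itv/= andbT.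
apply: null_sub N0 => //; first exact: measurableI.
move=> x [Ex hx]; apply: HN => /= H.
have /H : (E `\` side e_v h) x by split => //; rewrite /side/= lin_e -/(height x) => /lt_trans/(_ hx); rewrite ltxx.
move=> dE; have d0 : dive dG x = 0 by apply: EFin_inj.
have := diveG_ge Ex; rewrite d0 leNgt => /negP; apply.
have z0 : 0 < zeta x by rewrite step_gt0// mul1r lin_e subr_gt0.
by rewrite !mulr_gt0// ?invr_gt0 ?mulr_gt0// ltr0n.
Qed.

End height_bound.

(** * From minimal energy to the theorem *)

Section minimizers.
Variables (R : realType) (n : nat).
Local Notation mu := (lebesgue R n.+1).
Local Notation l := (lebesgue R n).
Local Notation Om := (@halfspace R n).
Variables (beta b : 'rV[R]_n -> R).
Hypothesis mb : measurable_fun setT b.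
Hypothesis b1 : forall y, -1 <= b y <= 1.
Hypothesis beta_b : {ae l, forall y, beta y = b y}.
Variable E0 : set 'rV[R]_n.+1.
Hypothesis E0_BV : BV01 Om E0.
Implicit Types E F : set 'rV[R]_n.+1.

Lemma supersets_density_one F : finite_perimeter Om F -> E0 `<=` F ->
  supersets E0 (density_one F) /\ capillary beta (density_one F) = (energy b F)%:E.
Proof.
move=> fF E0F; have [mF FOm _ _] := fF; have [bv FD] := finite_perimeter_BV01 fF.
have [mE0 _ _ E0d] := E0_BV; have [mD DOm _ _] := bv.
split.
  split => //; rewrite -E0d; apply: density_one_mono => //.
  by rewrite (_ : E0 `\` F = set0) ?measure0//; apply/seteqP; split => // x [/E0F].
by rewrite (capillary_ae beta fF mD DOm FD) (capillaryE mb b1 beta_b fF).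
Qed.

Lemma minimizer_energy E : minimizer beta E0 E -> energy_minimal b E0 E.
Proof.
move=> [[bvE E0E] Emin]; have fE := BV01_finite_perimeter bvE; split => // F fF E0F.
have [sF cF] := supersets_density_one fF E0F.
by have := Emin _ sF; rewrite cF (capillaryE mb b1 beta_b fE) lee_fin.
Qed.

Lemma energy_minimizer E : energy_minimal b E0 E -> minimizer beta E0 (density_one E).
Proof.
move=> [fE E0E Emin]; have [sE cE] := supersets_density_one fE E0E.
split; first exact: sE.
move=> F [bvF E0F]; have fF := BV01_finite_perimeter bvF.
by rewrite cE (capillaryE mb b1 beta_b fF) lee_fin; exact: Emin.
Qed.

End minimizers.

Lemma enorm_sq (R : realType) m (x : 'rV[R]_m) : enorm x ^+ 2 = lin x x.
Proof.
rewrite sqr_sqrtr; last by apply: sumr_ge0 => i _; exact: sqr_ge0.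
exact: sum_sq_lin.
Qed.

Lemma lin_le_enorm (R : realType) m (x y : 'rV[R]_m) : \sum_i y 0 i ^+ 2 <= 1 ->
  lin y x <= enorm x.
Proof.
move=> y1; have [x0|x0] := ltP 0 (enorm x); last first.
  rewrite /lin big1 ?enorm_ge0// => i _.
  have := le_trans (enorm_coord x i) x0; rewrite normr_le0 => /eqP ->.
  by rewrite mulr0.
have H : \sum_i y 0 i * ((enorm x)^-1 * x 0 i) <= 1.
  apply: cauchy_schwarz_unit => //.
  rewrite (eq_bigr (fun i => (enorm x) ^- 2 * x 0 i ^+ 2)); last first.
    by move=> i _; rewrite exprMn exprVn.
  by rewrite -mulr_sumr sum_sq_lin -enorm_sq mulVf// expf_neq0// gt_eqF.
move: H; rewrite (eq_bigr (fun i => (enorm x)^-1 * (y 0 i * x 0 i))); last first.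
  by move=> i _; rewrite mulrCA.
by rewrite -mulr_sumr mulrC ler_pdivrMr// mul1r.
Qed.

(** The hyperplanes are orthogonal to the horizontal direction of the point x itself. Beyond
    distance D + 1/2 + Mx the set is null, and since the points of [E] are its density points, x
    does not lie there. Starting at D + 1/2 instead of D + 1 makes the final inequality strict. *)
Lemma horizontal_radius (R : realType) n (b : 'rV[R]_n -> R) (kappa D : R)
    (E0 E : set 'rV[R]_n.+1) (H : R) :
  (0 < n)%N -> measurable_fun setT b -> 0 < kappa -> kappa <= 1 / 2 ->
  (forall y, -1 <= b y <= 1 - 2 * kappa) -> finite_perimeter halfspace E0 ->
  energy_minimal b E0 E -> density_one E = E -> 0 < D -> E0 `<=` cylinder D H ->
  forall x, E x -> enorm (horizontal x) < R0 kappa D E0.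
Proof.
move=> n0 mb k0 k1 bk fE0 minE Ed D0 E0C x Ex.
have [fE _ _] := minE; have [mE _ Eoo _] := fE.
have P0 := Per_ge0 (finite_perimeter_whole fE0).1.
have X0 : 0 <= Per setT E0 / kappa by rewrite divr_ge0// ltW.
set Mx := Num.max (8 ^+ (n ^ 2 + n + 1) * (Per setT E0 / kappa) `^ (n.+1%:R / n%:R)) (4 * mu_const n kappa).
have RE : R0 kappa D E0 = D + 1 + Mx by [].
have Mx0 : 0 <= Mx by rewrite le_max mulr_ge0 ?exprn_ge0 ?powR_ge0.
have [xz|xnz] := leP (enorm (horizontal x)) 0.
  by rewrite RE; apply: (le_lt_trans xz); rewrite ltr_wpDr// ltr_wpDr.
pose w' := (enorm (horizontal x))^-1 *: horizontal x.
pose w : 'rV[R]_n.+1 := snoc (w', 0).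
have linw z : lin w z = lin w' (horizontal z).
  by rewrite linC /w lin_snoc mulr0 addr0 linC.
have w'1 : \sum_i w' 0 i ^+ 2 = 1.
  rewrite sum_sq_lin /w' linZ linC linZ -enorm_sq mulrA -expr2 -exprMn mulVf ?expr1n//.
  by rewrite gt_eqF.
have w1 : \sum_i w 0 i ^+ 2 = 1.
  by rewrite sum_sq_lin linw /w horizontal_snoc -sum_sq_lin w'1.
have lwx : lin w x = enorm (horizontal x).
  rewrite linw /w' linC linZ -enorm_sq expr2 mulrA mulVf ?mul1r// gt_eqF//.
have E0a : E0 `<=` side w (D + 1 / 2).
  move=> z /E0C [+ _]; rewrite /eball/= subr0 => zD; rewrite /side/= linw.
  have w'1' : \sum_i w' 0 i ^+ 2 <= 1 by rewrite w'1.
  by apply: (le_lt_trans (lin_le_enorm _ w'1')); apply: (lt_trans zD); rewrite ltrDl divr_gt0.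
have Wa : tail_radius E w (D + 1 / 2) <= decay_rate n kappa * Mx.
  apply: (radius_le n0 k0 (tail_radius_ge0 _ _ _) X0).
  exact: (tail_radius_le mb k0 k1 bk minE w _ n0 fE0).
have T0 := tail_vanishes mb k0 k1 bk minE w1 E0a Mx0 Wa.
have oU : open [set z : 'rV[R]_n.+1 | D + 1 / 2 + Mx < lin w z].
  apply: (@open_comp _ _ (lin w) [set t | D + 1 / 2 + Mx < t]); last exact: open_gt.
  by move=> z _; case: (C1_lin w) => + _ _; exact.
have U0 : lebesgue R n.+1 (E `&` [set z | D + 1 / 2 + Mx < lin w z]) = 0%E.
  have oT : lebesgue R n.+1 (E `\` side w (D + 1 / 2 + Mx)) = 0%E.
    by rewrite -(tailE minE) -tail_radiusX T0 expr0n.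
  apply: (null_sub _ (measurableD mE (measurable_side w (D + 1 / 2 + Mx))) _ oT).
    by apply: measurableI => //; exact: open_measurable_rV.
  by move=> z [Ez zU]; split => //; rewrite /side/= => /lt_trans/(_ zU); rewrite ltxx.
have := density_one_open mE oU U0; rewrite Ed => /(_ x Ex) /= /negP; rewrite -leNgt lwx => /le_lt_trans; apply.
by rewrite RE ltrD2r ltrD2l ltr_pdivrMr// mul1r ltr1n.
Qed.

Theorem proposition4p4 (R : realType) (n : nat) (n_ge1 : (1 <= n)%N)
    (E0 : set 'rV[R]_n.+1) (E0_BV : BV01 halfspace E0)
    (E0_neq0 : E0 !=set0) (E0_bounded : bounded_set E0)
    (beta : 'rV[R]_n -> R) (beta_Loo : beta \in Lfun (lebesgue R n) +oo%E)
    (kappa : R) (kappa_gt0 : 0 < kappa) (kappa_le : kappa <= 1 / 2)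
    (beta_bounds : {ae lebesgue R n, forall y, -1 <= beta y <= 1 - 2 * kappa})
    (D : R) (D_gt0 : 0 < D) (E0_cyl : E0 `<=` cylinder D (top_height E0)) :
  (exists E, minimizer beta E0 E) /\
  (forall Ep, minimizer beta E0 Ep ->
     Ep `<=` cylinder (R0 kappa D E0) (top_height E0) /\
     minimizer beta Ep Ep).
Proof.
have mbeta : measurable_fun setT beta.
  by move: beta_Loo; rewrite inE => /andP[+ _]; rewrite inE.
(* [beta] clamped to its prescribed range: the bounds then hold everywhere, and energies are
   unchanged because [b] equals [beta] almost everywhere. *)
pose b y := Num.max (-1) (Num.min (beta y) (1 - 2 * kappa)).
have mb : measurable_fun setT b.
  apply: measurable_maxr; first exact: measurable_cst.
  by apply: measurable_minr => //; exact: measurable_cst.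
have k2 : -1 <= 1 - 2 * kappa by move: kappa_le => ?; lra.
have bk y : -1 <= b y <= 1 - 2 * kappa.
  by rewrite /b le_max lexx/= ge_max k2 ge_min lexx orbT.
have b1 := bk1 kappa_gt0 bk.
have beta_b : {ae lebesgue R n, forall y, beta y = b y}.
  move: beta_bounds; apply: filterS => y /andP[y1 y2].
  by rewrite /b min_l// max_r.
have fE0 := BV01_finite_perimeter E0_BV.
set H := top_height E0 in E0_cyl *.
have [x0 E0x0] := E0_neq0; have [_ /andP[hx0 hx0H]] := E0_cyl _ E0x0.
have H0 : 0 < H by exact: lt_trans hx0H.
(* The 1 added in [top_height] leaves [E0] a full unit below H. *)
have E0H x : E0 x -> height x <= H - 1.
  move=> E0x; rewrite /H /top_height [1 + _]addrC addrK; apply: ub_le_sup; last first.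
    by exists x => //; exact: subset_closure.
  exists H => _ [z cz <-].
  have cH : closed [set z : 'rV[R]_n.+1 | height z <= H].
    apply: (@closed_comp _ _ (@height R n) [set t | t <= H]); last exact: closed_le.
    by move=> z' _; exact: continuous_height.
  have : closure E0 `<=` [set z : 'rV[R]_n.+1 | height z <= H].
    rewrite [X in _ `<=` X]((closure_id _).1 cH); apply: closure_subset => z' /E0_cyl [_ /andP[_ ?]].
    exact: ltW.
  exact.
split.
  have [E minE] := existence mb kappa_gt0 kappa_le bk D_gt0 H0 E0_cyl fE0.
  by exists (density_one E); exact: (energy_minimizer mb b1 beta_b E0_BV).
move=> Ep minEp; have [[bvEp E0Ep] Epmin] := minEp.
have eminEp := minimizer_energy mb b1 beta_b E0_BV minEp.
have [mEp EpOm _ Epd] := bvEp.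
have hor x := horizontal_radius n_ge1 mb kappa_gt0 kappa_le bk fE0 eminEp Epd D_gt0 E0_cyl (x := x).
(* A set containing [Ep] also contains [E0], so the last claim is minimality over a smaller
   class. *)
split; last first.
  split; first by split.
  by move=> F [bvF EpF]; apply: Epmin; split => //; exact: subset_trans EpF.
have R00 : 0 < R0 kappa D E0 by apply: (le_lt_trans (enorm_ge0 _)); exact: hor (E0Ep _ E0x0).
have coordle x (j : 'I_n) : Ep x -> `|x 0 (lift ord_max j)| <= R0 kappa D E0.
  move=> Epx; apply: le_trans (ltW (hor _ Epx)).
  by have := enorm_coord (horizontal x) j; rewrite mxE.
(* H - 1/2 is strictly above [E0], so the cut spares [E0], and strictly below H, so the resulting
   height bound is strict. *)
have h0 : 0 <= H - 1 / 2 by have := E0H _ E0x0; move: hx0 => ? ?; lra.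
have E0h : E0 `<=` side (delta_mx 0 ord_max) (H - 1 / 2).
  move=> x /E0H; rewrite /side/= lin_e -/(height x) => ?; lra.
have nul := height_null mb kappa_gt0 bk eminEp n_ge1 h0 R00 E0h (fun x Epx j => coordle x j Epx).
have oU : open [set x : 'rV[R]_n.+1 | H - 1 / 2 < height x].
  apply: (@open_comp _ _ (@height R n) [set t | H - 1 / 2 < t]); last exact: open_gt.
  by move=> x _; exact: continuous_height.
have top := density_one_open mEp oU nul.
move=> x Epx; split; first by rewrite /eball/= subr0; exact: hor.
apply/andP; split; first exact: EpOm.
have := top x; rewrite Epd => /(_ Epx) /= /negP; rewrite -leNgt => ?; lra.
Qed.
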